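(* Let $a\ge 0$ and let $u$ be a minimizer of $J_a$ in $D^+$. Then $\Gamma^+\cap\Gamma^-=\emptyset$.
   Context: $D\subset\mathbb{R}^n$ is a bounded domain, $D^+=D\cap\{x_n>0\}$, $D'=D\cap\{x_n=0\}$, $(\partial D)^+=\partial D\cap\{x_n>0\}$. Here $a\in(-1,1)$, $\lambda_+,\lambda_->0$; $u^\pm=\max\{\pm u,0\}$. $W^{1,2}(D^+,x_n^a)$ is the weighted Sobolev space of functions that, together with their first distributional derivatives, are square integrable on $D^+$ with respect to $x_n^a\,dx$. The energy is $$J_a(u)=\int_{D^+}|\nabla u|^2x_n^a\,dx+2\int_{D'}(\lambda_+u^++\lambda_-u^-)\,dx',$$ with $u$ on $D'$ understood as a trace. A minimizer is a function $u\in W^{1,2}(D^+,x_n^a)$ with $J_a(u)\le J_a(w)$ for all $w\in W^{1,2}(D^+,x_n^a)$ with $w=u$ on $(\partial D)^+$ in the sense of traces ($D$ is assumed regular enough for the traces to exist, e.g. there is a bi-Lipschitz map taking $(D,D')$ to $(B_1,B_1')$). Minimizers are identified with their representatives continuous on $D^+\cup D'$. The free boundaries are $\Gamma^+=\partial'\{x'\in D':u(x',0)>0\}\cap D'$ and $\Gamma^-=\partial'\{x'\in D':u(x',0)<0\}\cap D'$, where $\partial'$ is the topological boundary in $\mathbb{R}^{n-1}\cong\mathbb{R}^{n-1}\times\{0\}$. *)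

(* Defs.v *)
From HB Require Import structures.
From mathcomp Require Import all_boot all_order all_algebra.
From mathcomp Require Import all_classical all_reals all_analysis.

Set Implicit Arguments.
Unset Strict Implicit.
Unset Printing Implicit Defensive.

Import Order.TTheory GRing.Theory Num.Theory.
Import numFieldNormedType.Exports.

Local Open Scope classical_set_scope.
Local Open Scope ring_scope.

(* Borel sigma-algebra of R^n, generated by the coordinates
   (as the library does for n.-tuple). *)
Definition rV_display : measure_display.
Proof. exact: default_measure_display. Qed.

Section measurable_rV.
Context {R : realType}.
Variable n : nat.

Let coors : 'I_n -> 'rV[R]_n -> R := fun i x => x ord0 i.

Let rV_set0 : g_sigma_preimage coors set0.
Proof. exact: sigma_algebra0. Qed.

Let rV_setC A : g_sigma_preimage coors A -> g_sigma_preimage coors (~` A).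
Proof. exact: sigma_algebraC. Qed.

Let rV_bigcup (F : (set 'rV[R]_n)^nat) :
  (forall i, g_sigma_preimage coors (F i)) ->
  g_sigma_preimage coors (\bigcup_i (F i)).
Proof. exact: sigma_algebra_bigcup. Qed.

HB.instance Definition _ := @isMeasurable.Build rV_display
  'rV[R]_n (g_sigma_preimage coors) rV_set0 rV_setC rV_bigcup.

Lemma measurable_coord (i : 'I_n) :
  measurable_fun [set: 'rV[R]_n] (fun x : 'rV[R]_n => x ord0 i).
Proof.
move=> _ Y mY; rewrite setTI; apply: sub_sigma_algebra => /=.
rewrite -bigcup_seq/=; exists i => /=; first by rewrite mem_index_enum.
by exists Y => //; rewrite setTI.
Qed.

Lemma measurable_fun_coordP d (T : measurableType d) (f : T -> 'rV[R]_n) :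
  (forall i, measurable_fun [set: T] (fun t => f t ord0 i)) ->
  measurable_fun [set: T] f.
Proof.
move=> mf; suff H : g_sigma_preimage (fun i t => coors i (f t)) `<=` measurable.
  move=> _ A mA; apply: H.
  by rewrite (g_sigma_preimage_comp coors f); exists A.
apply: smallest_sub; first exact: sigma_algebra_measurable.
rewrite -bigcup_seq => A [i _ [B mB <-]].
by apply: mf.
Qed.

End measurable_rV.

Definition rV_cons (R : realType) (n : nat) (p : R * 'rV[R]_n) : 'rV[R]_n.+1 :=
  row_mx (p.1)%:M p.2.

(* Lebesgue measure on R^n; it is the Dirac mass on the one-point space R^0. *)
Fixpoint leb (R : realType) (n : nat) : set 'rV[R]_n -> \bar R :=
  match n with
  | 0 => dirac (0 : 'rV[R]_0)
  | n'.+1 => pushforward (product_measure1 (@lebesgue_measure R) (@leb R n'))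
                         (@rV_cons R n')
  end.
Arguments leb {R}.

Section leb_measure.
Context {R : realType}.

Lemma measurable_rV_cons n : measurable_fun [set: R * 'rV[R]_n] (@rV_cons R n).
Proof.
apply: measurable_fun_coordP => i; rewrite /rV_cons.
have [j ->|j ->] := @split_ordP 1 n i.
  rewrite (_ : (fun _ => _) = fst); first exact: measurable_fst.
  by apply/funext => -[t x] /=; rewrite (@row_mxEl R 1 1 n) [j]ord1 mxE.
rewrite (_ : (fun _ => _) = (fun x : 'rV[R]_n => x ord0 j) \o snd).
  exact: measurableT_comp (@measurable_coord R n j) measurable_snd.
by apply/funext => -[t x] /=; exact: row_mxEr.
Qed.

Lemma measurable_rV_cons_inv n :
  measurable_fun [set: 'rV[R]_n.+1]
    (fun x : 'rV[R]_(1 + n) => (x ord0 ord0, rsubmx x)).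
Proof.
apply: measurable_fun_pair; first exact: (@measurable_coord R n.+1 ord0).
apply: measurable_fun_coordP => i /=.
rewrite (_ : (fun _ => _) = fun x : 'rV[R]_n.+1 => x ord0 (rshift 1 i)).
  exact: measurable_coord.
by apply/funext => x; rewrite mxE.
Qed.

Lemma rV_consK n : cancel (@rV_cons R n)
  (fun x : 'rV[R]_(1 + n) => (x ord0 ord0, rsubmx x)).
Proof.
move=> [t x]; rewrite /rV_cons /= row_mxKr; congr (_, _).
by rewrite (_ : ord0 = lshift n ord0 :> 'I_(1 + n)) ?(@row_mxEl R 1 1 n) ?mxE//; apply: val_inj.
Qed.

Lemma sigma_finite_measure_pack d (T : measurableType d)
    (mu : {measure set T -> \bar R}) : sigma_finite setT mu ->
  exists nu : {sigma_finite_measure set T -> \bar R},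
    (mu : set T -> \bar R) = nu.
Proof.
move=> sf; pose f : set T -> \bar R := mu.
pose H0 := isMeasure.Build _ T R f (measure0 mu) (measure_ge0 mu)
  (@measure_semi_sigma_additive _ _ _ mu).
pose m : {measure set T -> \bar R} := HB.pack_for {measure set T -> \bar R} f H0.
pose H1 := Measure_isSigmaFinite.Build _ T R m sf.
by exists (HB.pack_for {sigma_finite_measure set T -> \bar R} f H0 H1).
Qed.

Lemma product_sigma_finite d1 d2 (T1 : measurableType d1) (T2 : measurableType d2)
    (m1 : {sigma_finite_measure set T1 -> \bar R})
    (m2 : {sigma_finite_measure set T2 -> \bar R}) :
  sigma_finite setT (product_measure1 m1 m2).
Proof.
have /sigma_finiteP[F [TF ndF Foo]] := sigma_finiteT m1.
have /sigma_finiteP[G [TG ndG Goo]] := sigma_finiteT m2.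
exists (fun n => F n `*` G n).
  rewrite -setXTT TF TG predeqE => -[x y]; split.
    move=> [/= [n _ Fnx] [k _ Gky]]; exists (maxn n k) => //; split.
      by move: x Fnx; exact/subsetPset/ndF/leq_maxl.
    by move: y Gky; exact/subsetPset/ndG/leq_maxr.
  by move=> [n _ []/= ? ?]; split; exists n.
move=> k; have [? ?] := Foo k; have [? ?] := Goo k.
split; first exact: measurableX.
by rewrite product_measure1E// lte_mul_pinfty// ge0_fin_numE.
Qed.

Lemma leb_sigma_finite n : exists mu : {sigma_finite_measure set 'rV[R]_n -> \bar R},
  @leb R n = mu :> (set 'rV[R]_n -> \bar R).
Proof.
elim: n => [|n [mu IH]].
  pose d0 : {measure set 'rV[R]_0 -> \bar R} := dirac (0 : 'rV[R]_0).
  have sf : sigma_finite setT d0.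
    exists (fun=> setT); first by rewrite bigcup_const.
    by move=> _; split => //; rewrite /d0 /= diracT ltry.
  exact: sigma_finite_measure_pack sf.
pose nu : {measure set (measurableTypeR R * 'rV[R]_n)%type -> \bar R} :=
  product_measure1 (@lebesgue_measure R) mu.
pose p : {measure set 'rV[R]_n.+1 -> \bar R} :=
  measure_function_pushforward__canonical__measure_function_Measure nu (@measurable_rV_cons n).
have sf : sigma_finite setT p.
  have [F TF Foo] := product_sigma_finite (@lebesgue_measure R) mu.
  exists (fun k => (fun x : 'rV[R]_(1 + n) => (x ord0 ord0, rsubmx x)) @^-1` F k).
    by rewrite -preimage_bigcup -TF preimage_setT.
  move=> k; have [mF oo] := Foo k; split.
    by rewrite -[X in measurable X]setTI; exact: measurable_rV_cons_inv.
  rewrite /p /= /pushforward -comp_preimage.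
  rewrite (_ : _ \o _ = id) ?preimage_id//.
  by apply/funext => x; exact: rV_consK.
have [la laE] := sigma_finite_measure_pack sf.
exists la; rewrite -laE /= IH //.
Qed.

Variable n : nat.

Let leb0 : @leb R n set0 = 0%E.
Proof. by have [mu ->] := leb_sigma_finite n; exact: measure0. Qed.

Let leb_ge0 A : (0 <= @leb R n A)%E.
Proof. by have [mu ->] := leb_sigma_finite n; exact: measure_ge0. Qed.

Let leb_sigma_additive : semi_sigma_additive (@leb R n).
Proof.
by have [mu ->] := leb_sigma_finite n; exact: measure_semi_sigma_additive.
Qed.

HB.instance Definition _ := isMeasure.Build _ _ _ (@leb R n)
  leb0 leb_ge0 leb_sigma_additive.

Let leb_sigma_finiteT : sigma_finite setT (@leb R n).
Proof. by have [mu ->] := leb_sigma_finite n; exact: sigma_finiteT. Qed.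

HB.instance Definition _ := Measure_isSigmaFinite.Build _ _ _ (@leb R n)
  leb_sigma_finiteT.

End leb_measure.

Definition enorm (R : realType) (n : nat) (x : 'rV[R]_n) : R :=
  Num.sqrt (\sum_i x ord0 i ^+ 2).

(* The library norm on 'rV[R]_n is the sup norm, hence this Euclidean ball. *)
Definition eball (R : realType) (n : nat) (x : 'rV[R]_n) (r : R) :
    set 'rV[R]_n :=
  [set y | enorm (y - x) < r].

Section hausdorff.
Context {R : realType} {n : nat}.
Implicit Types (A : set 'rV[R]_n).

(* Countable covers are indexed by a set K of naturals rather than padded with
   empty sets, so that the case s = 0 (where r ^+ 0 = 1) is right. *)
Definition hausdorff_cover (delta : R) A (K : set nat)
    (C : nat -> set 'rV[R]_n) (r : nat -> R) : Prop :=
  A `<=` \bigcup_(k in K) C k /\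
  forall k, K k -> 0 <= r k <= delta /\
    forall x y, C k x -> C k y -> enorm (x - y) <= r k.

(* s-dimensional Hausdorff (outer) measure, without normalizing constant. *)
Definition hausdorff (s : nat) A : \bar R :=
  ereal_sup [set ereal_inf [set e | exists K C r,
      hausdorff_cover delta A K C r /\ e = \esum_(k in K) (r k ^+ s)%:E]
    | delta in [set delta : R | 0 < delta]].

End hausdorff.

Section weak_derivatives.
Context {R : realType} {n : nat}.
Implicit Types (U : set 'rV[R]_n) (f g : 'rV[R]_n -> R).

Definition partial (i : 'I_n) f : 'rV[R]_n -> R :=
  fun x => 'D_(delta_mx ord0 i) f x.

Definition smooth f : Prop :=
  forall (s : seq 'I_n) x, differentiable (foldr partial f s) x.

Definition test_function U f : Prop :=
  smooth f /\
  exists K, [/\ compact K, K `<=` U & forall x, ~ K x -> f x = 0].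

Definition loc_integrable U f : Prop :=
  measurable_fun U f /\
  forall K, compact K -> K `<=` U -> (leb n).-integrable K (EFin \o f).

Definition is_weak_deriv U (i : 'I_n) f g : Prop :=
  [/\ loc_integrable U f, loc_integrable U g &
    forall phi, test_function U phi ->
      (\int[leb n]_(x in U) (f x * partial i phi x)%:E =
       - \int[leb n]_(x in U) (g x * phi x)%:E)%E].

(* A chosen representative (unique a.e. in U when it exists). *)
Definition weak_deriv U (i : 'I_n) f : 'rV[R]_n -> R :=
  xget (cst 0) [set g | is_weak_deriv U i f g].

End weak_derivatives.

(* Traces are defined through the limit of the means over U near the boundary
   (or hyperplane) point; for functions of class W^{1,1} up to a Lipschitz
   boundary this is a.e. the value of the trace operator. *)
Section traces.
Context {R : realType} {n : nat}.
Implicit Types (U : set 'rV[R]_n) (f : 'rV[R]_n -> R) (y : 'rV[R]_n).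

Definition mean_near U f y (r : R) : R :=
  (fine (leb n (U `&` eball y r)))^-1 *
  \int[leb n]_(x in U `&` eball y r) f x.

Definition has_trace_at U f y : Prop :=
  cvg (mean_near U f y r @[r --> 0^'+]).

Definition trace U f y : R := lim (mean_near U f y r @[r --> 0^'+]).

End traces.

(* Points of R^n with n = m + 1 are row vectors x = (x', x_n), and R^(n-1) is
   identified with {x_n = 0} through emb. *)
Section two_phase_problem.
Context {R : realType} {m : nat}.
Local Notation E := 'rV[R]_(m + 1).
Local Notation E' := 'rV[R]_m.
Implicit Types (D U : set E) (u w : E -> R) (a : R).

Definition xn (x : E) : R := x ord0 (rshift m ord0).

Definition emb (x' : E') : E := row_mx x' 0.

Definition upper D : set E := D `&` [set x | 0 < xn x].

Definition flat D : set E := D `&` [set x | xn x = 0].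

Definition flat' D : set E' := emb @^-1` D.

Definition boundary (T : topologicalType) (A : set T) : set T :=
  closure A `\` A°.

Definition bd_upper D : set E := boundary D `&` [set x | 0 < xn x].

Definition W12 a U u : Prop :=
  [/\ measurable_fun U u,
      (\int[leb (m + 1)]_(x in U) (u x ^+ 2 * xn x `^ a)%:E < +oo)%E &
      forall i, is_weak_deriv U i u (weak_deriv U i u) /\
        (\int[leb (m + 1)]_(x in U)
           (weak_deriv U i u x ^+ 2 * xn x `^ a)%:E < +oo)%E].

Definition grad_sq U u (x : E) : R := \sum_i weak_deriv U i u x ^+ 2.

Definition energy (a lp lm : R) D u : \bar R :=
  (\int[leb (m + 1)]_(x in upper D) (grad_sq (upper D) u x * xn x `^ a)%:E +
   2%:E * \int[leb m]_(x' in flat' D)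
     (lp * Num.max (trace (upper D) u (emb x')) 0 +
      lm * Num.max (- trace (upper D) u (emb x')) 0)%:E)%E.

Definition same_boundary_values D u w : Prop :=
  hausdorff m (bd_upper D `&`
    [set y | trace (upper D) u y <> trace (upper D) w y]) = 0%E.

Definition minimizer (a lp lm : R) D u : Prop :=
  W12 a (upper D) u /\
  forall w, W12 a (upper D) w -> same_boundary_values D w u ->
    (energy a lp lm D u <= energy a lp lm D w)%E.

Definition traces_exist a D : Prop :=
  forall w, W12 a (upper D) w ->
    [/\ {ae leb m, forall x', flat' D x' ->
           has_trace_at (upper D) w (emb x')},
        (leb m).-integrable (flat' D)
           (fun x' => (trace (upper D) w (emb x'))%:E) &
        hausdorff m (bd_upper D `&`
          [set y | ~ has_trace_at (upper D) w y]) = 0%E].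

Definition bilipschitz_to_ball D : Prop :=
  exists (Phi : E -> E) (L : R),
    [/\ 0 < L,
        {in D &, forall x y,
           L^-1 * enorm (x - y) <= enorm (Phi x - Phi y) <= L * enorm (x - y)},
        Phi @` D = eball 0 1 &
        Phi @` flat D = flat (eball 0 1)].

(* Standing assumption that D is regular enough for the traces to exist. The
   bi-Lipschitz condition is the usual sufficient one; it is listed separately
   so that no trace theorem has to be assumed for it. *)
Definition regular a D : Prop := traces_exist a D \/ bilipschitz_to_ball D.

Definition bounded_domain D : Prop :=
  [/\ open D, connected D, D !=set0 & bounded_set D].

Definition Gamma_pos D u : set E' :=
  boundary [set x' | flat' D x' /\ 0 < u (emb x')] `&` flat' D.

Definition Gamma_neg D u : set E' :=
  boundary [set x' | flat' D x' /\ u (emb x') < 0] `&` flat' D.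

End two_phase_problem.

(* Main.v *)
(** At a common point z of the two free boundaries, minimality leaves a local first-order
    condition in which the convex penalty is not linearized.  Testing it with tangential difference
    quotients gives a Caccioppoli inequality; a weighted mean of their squares over concentric
    half balls is then monotone in the radius, and u is Lipschitz in the tangential directions.
    Let F(s) be the flux through the flat part, averaged with a bump of radius s at z.  The sign
    conditions force F(s) near -lp (seen from the positive phase) and near lm (seen from the
    negative one).  If a > 0, the dilation identity gives |F'(s)| <= C s^(a-1), so both values
    are limits of F at 0, which is absurd.  If a = 0, F is only almost constant, at suitable
    good scales; there one phase, say the positive one, has mean flux bounded away from its jump,
    so u stays below a linear function of slope less than lp, and a strictly superharmonic
    barrier touching u from above excludes positive values on the flat part. *)
Require Import Defs.
From HB Require Import structures.
From mathcomp Require Import all_boot all_order all_algebra.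
From mathcomp Require Import all_classical all_reals all_analysis.
From mathcomp Require Import measurable_realfun ring lra zify.

Set Implicit Arguments.
Unset Strict Implicit.
Unset Printing Implicit Defensive.
Generalizable Variables a lp lm r z u G.

Import Order.TTheory GRing.Theory Num.Theory.
Import numFieldNormedType.Exports.

Local Open Scope classical_set_scope.
Local Open Scope ring_scope.

(** Only tangential translations preserve both the weight and the flat part, so the normal behavior
    of [u] has to be read off the functional [ell], which formally pairs minus the limit of x_n^a
    d_n u with the trace of a test function. All means use one profile, exp(-1/s) at s = 1 - |x -
    p|^2 / r^2, because the r-derivative of the resulting mean is exactly a weighted Laplacian of
    that profile; no spherical integrals are needed. The split of cases is forced by s^(a-1), which
    is integrable at 0 only for a > 0. In the borderline case a = 0, bounded monotone means can grow
    substantially at boundedly many dyadic scales only, and at the others the flux hardly varies.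
    The phases ask for mean fluxes lp and -lm; the side of the midpoint (lp - lm) / 2 on which the
    flux lies decides which phase the barrier excludes. A separate obstacle: the penalty energies of
    [u] and a competitor can be subtracted only if the trace of [u] is integrable on the flat part.
    Under the bi-Lipschitz alternative this has to be derived from the energy, by chains of balls
    descending to the flat part. *)

Ltac pos_leaf := first [assumption | refine (ltW _); assumption | solve [trivial with positivity nocore]].

Ltac pos := lazymatch goal with
  | |- is_true (negb (@eq_op _ _ _)) => first [assumption | refine (lt0r_neq0 _); pos]
  | |- is_true (@Order.lt _ _ (@GRing.zero _) ?x) => lazymatch x with
    | @GRing.one _ => exact: ltr01
    | @GRing.mul _ _ _ => first [assumption | refine (mulr_gt0 _ _); pos]
    | @GRing.inv _ _ => rewrite invr_gt0; pos
    | @GRing.exp _ _ _ => refine (exprn_gt0 _ _); pos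
    | @GRing.natmul _ _ _ => first [rewrite ltr0n ?addn1; exact: isT | apply: mulrn_wgt0; pos]
    | @powR _ _ _ => refine (powR_gt0 _ _); pos
    | @Order.min _ _ _ _ => rewrite lt_min; apply/andP; split; pos
    | @GRing.add _ _ _ => first [assumption | rewrite subr_gt0; assumption
        | refine (addr_gt0 _ _); pos | refine (ltr_wpDl _ _); pos | refine (ltr_wpDr _ _); pos]
    | _ => pos_leaf
    end
  | |- is_true (@Order.le _ _ (@GRing.zero _) ?x) => lazymatch x with
    | @GRing.one _ => exact: ler01
    | @GRing.zero _ => exact: lexx
    | @GRing.mul _ _ _ => first [assumption | refine (mulr_ge0 _ _); pos]
    | @GRing.inv _ _ => rewrite invr_ge0; pos
    | @GRing.exp _ _ 2 => refine (sqr_ge0 _)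
    | @GRing.exp _ _ _ => refine (exprn_ge0 _ _); pos
    | @GRing.natmul _ _ _ => first [exact: ler0n | apply: mulrn_wge0; pos]
    | @powR _ _ _ => refine (powR_ge0 _ _)
    | @GRing.add _ _ _ => first [assumption | rewrite subr_ge0; pos_leaf | refine (addr_ge0 _ _); pos]
    | @bigop _ _ _ _ _ => first [apply: sumr_ge0 => ? _; pos | apply: prodr_ge0 => ? _; pos]
    | _ => pos_leaf
    end
  end.

Create HintDb positivity.
#[export] Hint Resolve normr_ge0 expR_gt0 expR_ge0 sqrtr_ge0 : positivity.
#[export] Hint Extern 0 (is_true (negb _)) => pos : core.
#[export] Hint Extern 0 (is_true (@Order.lt _ _ _ _)) => pos : core.
#[export] Hint Extern 0 (is_true (@Order.le _ _ _ _)) => pos : core.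

Lemma eqW d (T : porderType d) (x y : T) : x = y -> (x <= y)%O.
Proof. by move->. Qed.

Section metric_balls.
Context {R : numFieldType} {V : normedModType R}.
Implicit Types (x y : V) (r : R).

Lemma ballE x y r : ball x r y = (`|x - y| < r) :> Prop.
Proof. by rewrite -ball_normE. Qed.

Lemma ballEC x y r : ball x r y = (`|y - x| < r) :> Prop.
Proof. by rewrite ballE distrC. Qed.

End metric_balls.

(** * Lebesgue measure on R^n: translations and splitting off a coordinate *)

Section lebesgue_rV.
Context {R : realType}.
Local Notation mu := (@lebesgue_measure R).
Local Open Scope ereal_scope.

Lemma lebesgue_translate (c : R) (A : set (measurableTypeR R)) : measurable A ->
  mu A = mu ((fun x : R => (x + c)%R) @^-1` A).
Proof.
have mc : measurable_fun [set: measurableTypeR R] (fun x : measurableTypeR R => (x + c)%R : measurableTypeR R) by apply: measurable_funD => //; exact: measurable_cst.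
pose nu : {measure set (measurableTypeR R) -> \bar R} :=
  measure_function_pushforward__canonical__measure_function_Measure mu mc.
move=> mA; rewrite (_ : mu (_ @^-1` A) = nu A)//.
apply: lebesgue_measure_unique => // X [[a b] _ <-] /=.
rewrite /nu /= /pushforward /=.
rewrite (_ : _ @^-1` _ = `]a - c, b - c]%classic)%R; last first.
  by apply/seteqP; split => x /=; rewrite !in_itv/= ltrBlDr lerBrDr.
rewrite !lebesgue_measure_itv/= !lte_fin ltrD2r.
by case: ifPn => // _; rewrite -!EFinB; congr EFin; ring.
Qed.

Lemma ge0_integral_lebesgue_translate (c : R) (f : R -> \bar R) : measurable_fun setT f ->
  (forall x, 0 <= f x) -> \int[mu]_x f (x + c)%R = \int[mu]_x f x.
Proof.
move=> mf f0.
have mc : measurable_fun [set: measurableTypeR R] (fun x : measurableTypeR R => (x + c)%R : measurableTypeR R) by apply: measurable_funD => //; exact: measurable_cst.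
pose nu : {measure set (measurableTypeR R) -> \bar R} :=
  measure_function_pushforward__canonical__measure_function_Measure mu mc.
transitivity (\int[nu]_x f x).
  rewrite /nu /= ge0_integral_pushforward//=.
apply: eq_measure_integral => A mA _ /=.
by rewrite /nu /= /pushforward -lebesgue_translate.
Qed.

Lemma rV_consE n (x : 'rV[R]_n.+1) : exists t y, x = rV_cons (t, y).
Proof.
exists (x ord0 ord0), (rsubmx (x : 'rV[R]_(1 + n))); rewrite /rV_cons /=.
rewrite -[LHS](@hsubmxK _ 1 1); congr (@row_mx R 1 1).
apply/rowP => i; rewrite ord1 !mxE; congr (_ _).
exact: val_inj.
Qed.

Lemma ge0_integral_cons n (f : 'rV[R]_n.+1 -> \bar R) : measurable_fun setT f ->
  (forall x, 0 <= f x) ->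
  \int[leb n.+1]_x f x = \int[mu]_t \int[leb n]_y f (rV_cons (t, y)).
Proof.
move=> mf f0.
pose m2 : {sigma_finite_measure set 'rV[R]_n -> \bar R} := @leb R n.
pose nu : {measure set (measurableTypeR R * 'rV[R]_n)%type -> \bar R} := product_measure1 mu m2.
pose p : {measure set 'rV[R]_n.+1 -> \bar R} :=
  measure_function_pushforward__canonical__measure_function_Measure nu (@measurable_rV_cons R n).
transitivity (\int[p]_x f x); first exact: eq_measure_integral.
rewrite /p /= ge0_integral_pushforward//=.
by rewrite fubini_tonelli1//=; exact: (measurableT_comp mf (@measurable_rV_cons R n)).
exact: measurable_rV_cons.
Qed.

Lemma ge0_measurable_integral_cons n (f : 'rV[R]_n.+1 -> \bar R) : measurable_fun setT f ->
  (forall x, 0 <= f x) ->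
  measurable_fun [set: measurableTypeR R] (fun t : R => \int[leb n]_y f (rV_cons (t, y))).
Proof.
move=> mf f0.
pose m2 : {sigma_finite_measure set 'rV[R]_n -> \bar R} := @leb R n.
apply: (@measurable_fun_fubini_tonelli_F _ _ _ _ R m2 (fun p : measurableTypeR R * 'rV[R]_n => _)) => //.
exact: (measurableT_comp mf (@measurable_rV_cons R n)).
Qed.

Lemma measurable_addv n (v : 'rV[R]_n) : measurable_fun setT (fun x : 'rV[R]_n => (x + v)%R).
Proof.
apply: measurable_fun_coordP => i.
rewrite (_ : (fun _ => _) = (fun x : 'rV[R]_n => x ord0 i + v ord0 i)%R); last first.
  by apply/funext => x; rewrite mxE.
by apply: measurable_funD => //; exact: measurable_coord.
Qed.

Lemma rV_consD n (t s : R) (x y : 'rV[R]_n) :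
  (rV_cons (t, x) + rV_cons (s, y))%R = rV_cons ((t + s)%R, (x + y)%R).
Proof.
apply/rowP => i; rewrite !mxE /=.
by case: (fintype.split _) => j; rewrite !mxE// ord1 !mulr1n.
Qed.

Lemma ge0_integral_translate n (v : 'rV[R]_n) (f : 'rV[R]_n -> \bar R) :
  measurable_fun setT f -> (forall x, 0 <= f x) ->
  \int[leb n]_x f (x + v)%R = \int[leb n]_x f x.
Proof.
elim: n v f => [|n IH] v f mf f0.
  by apply: eq_integral => x _; congr f; rewrite !thinmx0.
have mfv : measurable_fun setT (fun x : 'rV[R]_n.+1 => f (x + v)%R) by exact: (measurableT_comp mf (measurable_addv v)).
rewrite (ge0_integral_cons mfv (fun=> f0 _)) (ge0_integral_cons mf f0).
have [t [y ->]] := rV_consE v.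
under eq_integral => s _.
  under eq_integral do rewrite rV_consD.
  rewrite (IH _ (fun z => f (rV_cons (_%R, z)))); last 2 first.
  - apply: (measurableT_comp mf).
    apply: (measurableT_comp (@measurable_rV_cons R n)).
    exact: measurable_pair1.
  - by move=> ?; exact: f0.
  over.
rewrite (ge0_integral_lebesgue_translate t (f := fun s => \int[leb n]_x f (rV_cons (s, x))))//.
- exact: ge0_measurable_integral_cons.
- by move=> s; exact: integral_ge0.
Qed.

Definition rV_rcons n (y : 'rV[R]_n) (s : R) : 'rV[R]_(n + 1) := row_mx y s%:M.

Lemma measurable_rV_rcons n : measurable_fun setT (fun p : 'rV[R]_n * measurableTypeR R => rV_rcons p.1 p.2).
Proof.
apply: measurable_fun_coordP => i; rewrite /rV_rcons.
case: (split_ordP i) => j ->.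
  rewrite (_ : (fun _ => _) = (fun x : 'rV[R]_n => x ord0 j) \o fst).
    exact: measurableT_comp (@measurable_coord R n j) measurable_fst.
  by apply/funext => -[x t] /=; rewrite row_mxEl.
rewrite (_ : (fun _ => _) = snd); first exact: measurable_snd.
by apply/funext => -[x t] /=; rewrite row_mxEr [j]ord1 mxE.
Qed.

Lemma rV_cons0 n (t : R) (y : 'rV[R]_n) : rV_cons (t, y) ord0 ord0 = t.
Proof.
rewrite /rV_cons /= (_ : ord0 = lshift n (ord0 : 'I_1)); last exact: val_inj.
by rewrite (@row_mxEl R 1 1 n) mxE.
Qed.

Lemma rV_consS n (t : R) (y : 'rV[R]_n) (j : 'I_n) : rV_cons (t, y) ord0 (lift ord0 j) = y ord0 j.
Proof.
rewrite /rV_cons /= (_ : lift ord0 j = rshift 1 j); last exact: val_inj.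
by rewrite (@row_mxEr R 1 1 n).
Qed.

Lemma rV_rconsl n (y : 'rV[R]_n) (s : R) j : rV_rcons y s ord0 (lshift 1 j) = y ord0 j.
Proof. by rewrite /rV_rcons row_mxEl. Qed.

Lemma rV_rconsr n (y : 'rV[R]_n) (s : R) : rV_rcons y s ord0 (rshift n ord0) = s.
Proof. by rewrite /rV_rcons row_mxEr mxE. Qed.

Lemma rV_cons_rcons n (t s : R) (y : 'rV[R]_n) :
  rV_rcons (rV_cons (t, y)) s = rV_cons (t, rV_rcons y s) :> 'rV[R]_(n.+1 + 1).
Proof.
apply/rowP => i; case: (split_ordP i) => j ->.
  rewrite rV_rconsl; case: (unliftP ord0 j) => [k|] ->.
    rewrite rV_consS (_ : lshift 1 (lift ord0 k) = lift ord0 (lshift 1 k)); last exact: val_inj.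
    by rewrite rV_consS rV_rconsl.
  by rewrite rV_cons0 (_ : lshift 1 ord0 = ord0) ?rV_cons0//; exact: val_inj.
rewrite ord1 rV_rconsr (_ : rshift n.+1 ord0 = lift ord0 (rshift n ord0)); last exact: val_inj.
by rewrite rV_consS rV_rconsr.
Qed.

Lemma measurable_fun_rV0 d (T : measurableType d) (f : 'rV[R]_0 -> T) : measurable_fun setT f.
Proof.
move=> _ Y mY; rewrite setTI.
have [C0|C0] := pselect (Y (f 0%R)).
  rewrite (_ : _ @^-1` _ = setT); first exact: measurableT.
  by apply/seteqP; split => // x _ /=; rewrite (thinmx0 x).
rewrite (_ : _ @^-1` _ = set0); first exact: measurable0.
by apply/seteqP; split => // x /=; rewrite (thinmx0 x).
Qed.

(** The measure is built by adding a first coordinate, whereas the normal coordinate is the last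
    one; the induction passes from one end to the other. *)
Lemma ge0_integral_rcons n (f : 'rV[R]_(n + 1) -> \bar R) : measurable_fun setT f ->
  (forall x, 0 <= f x) ->
  \int[leb (n + 1)]_x f x = \int[leb n]_y \int[mu]_s f (rV_rcons y s).
Proof.
elim: n f => [|n IH] f mf f0.
  rewrite ge0_integral_cons// integral_dirac//=; last exact: measurable_fun_rV0.
  rewrite diracT mul1e.
  apply: eq_integral => t _; rewrite integral_dirac ?diracT ?mul1e//; last exact: measurable_fun_rV0.
  congr f; apply/rowP => i; rewrite (_ : i = rshift 0 ord0) ?rV_rconsr; last first.
    by apply/val_inj/eqP; rewrite /= -leqn0 -ltnS.
  by rewrite (_ : rshift 0 ord0 = ord0) ?rV_cons0//; exact: val_inj.
pose g := fun y : 'rV[R]_n.+1 => \int[mu]_s f (rV_rcons y s).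
have mg : measurable_fun setT g.
  apply: (@measurable_fun_fubini_tonelli_F _ _ _ _ R mu (fun p : 'rV[R]_n.+1 * measurableTypeR R => f (rV_rcons p.1 p.2))) => //.
  exact: (measurableT_comp mf (@measurable_rV_rcons n.+1)).
rewrite (ge0_integral_cons mg); last by move=> y; exact: integral_ge0.
rewrite (@ge0_integral_cons (n + 1))//.
apply: eq_integral => t _.
rewrite IH; [| |by move=> y; exact: f0]; last first.
  apply: (measurableT_comp mf).
  apply: (measurableT_comp (@measurable_rV_cons R _)).
  exact: measurable_pair1.
by apply: eq_integral => y _; apply: eq_integral => s _; rewrite rV_cons_rcons.
Qed.

End lebesgue_rV.

Lemma amgm (R : realFieldType) (p q l : R) : 0 < l -> p * q <= (l * p ^+ 2 + l^-1 * q ^+ 2) / 2.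
Proof.
move=> l0; have lk : l * l^-1 = 1 by rewrite divff// gt_eqF.
have : l * p ^+ 2 + l^-1 * q ^+ 2 = l * (p - l^-1 * q) ^+ 2 + 2 * (l * l^-1) * p * q + (1 - l * l^-1) * l^-1 * q ^+ 2 by ring.
have := mulr_ge0 (ltW l0) (sqr_ge0 (p - l^-1 * q)).
by rewrite lk => h1 ->; lra.
Qed.

Lemma sqr_normr (R : realDomainType) (x : R) : `|x| ^+ 2 = x ^+ 2.
Proof. by rewrite real_normK ?num_real. Qed.

Lemma MVT_is_derive (R : realType) (F dF : R -> R) (s t : R) : s <= t ->
  (forall v, s <= v <= t -> is_derive v 1 F (dF v)) -> exists2 c, s <= c <= t & F t - F s = dF c * (t - s).
Proof.
move=> st D; have [||c] := @MVT_segment R F dF s t st; last by rewrite in_itv; exists c.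
- by move=> v; rewrite in_itv => /andP[v0 v1]; apply: D; rewrite !ltW.
- apply/continuous_in_subspaceT => v; rewrite inE/= in_itv/= => /D[d _].
  by apply/differentiable_continuous; rewrite -derivable1_diffP.
Qed.

Lemma is_derive_mulr (R : realType) (f : R -> R) (c t df : R) :
  is_derive t 1 f df -> is_derive t 1 (fun s => f s * c) (df * c).
Proof.
move=> h; have H : is_derive t 1 (f * cst c) (f t *: 0 + c *: df) by apply: is_deriveM.
by rewrite scaler0 add0r in H; rewrite mulrC.
Qed.

(** * Borel sets of R^n, balls, and translation of signed integrals *)

Section borel_rV.
Context {R : realType}.
Local Notation mu := (@lebesgue_measure R).

Lemma ball_rVP n (x y : 'rV[R]_n) (r : R) :
  ball x r y <-> 0 < r /\ forall i, `|x ord0 i - y ord0 i| < r.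
Proof.
split=> [[r0 H]|[r0 H]]; split => // i; first exact: H.
by move=> j; rewrite [i]ord1; exact: H.
Qed.

Lemma measurable_ball_rV n (x : 'rV[R]_n) (r : R) : measurable (ball x r).
Proof.
have [r0|r0] := ltP 0 r; last first.
  rewrite (_ : ball x r = set0); first exact: measurable0.
  by apply/seteqP; split => // y /ball_rVP[]; rewrite ltNge r0.
rewrite (_ : ball x r = \bigcap_(i in [set: 'I_n]) [set y : 'rV[R]_n | `|x ord0 i - y ord0 i| < r]).
  apply: fin_bigcap_measurable => // i _.
  rewrite (_ : [set y | _] = (fun y : 'rV[R]_n => y ord0 i) @^-1` (ball (x ord0 i) r))//.
  rewrite -[X in measurable X]setTI; apply: measurable_coord => //; exact: measurable_ball.
apply/seteqP; split => y.
  by move=> /ball_rVP[_ H] i _; exact: H.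
by move=> H; apply/ball_rVP; split => // i; exact: H.
Qed.

Definition qvec n (q : 'rV[rat]_n) : 'rV[R]_n := map_mx ratr q.

(** The doubled ball is kept inside [U] so that the closure of the small one is a compact subset of
    [U], on which a locally integrable function is integrable. The radius is chosen with 3/(k+1)
    below the distance available at [x]: a point of the doubled ball is that close to [x]. *)
Lemma open_qball n (U : set 'rV[R]_n) x : open U -> U x ->
  exists q k, ball (qvec q) (k.+1%:R^-1) x /\ ball (qvec q) (k.+1%:R^-1 *+ 2) `<=` U.
Proof.
move=> oU Ux; have /nbhs_ballP[e /= e0 eU] := open_nbhs_nbhs (conj oU Ux).
have [k ke] : exists k : nat, k.+1%:R^-1 *+ 3 < e.
  have := @cvg_harmonic R => /cvgrPdist_lt/(_ (e / 3)) [|N _ /(_ N (leqnn _))]//.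
  rewrite sub0r normrN ger0_norm ?invr_ge0//= => H.
  by exists N; rewrite -[_ *+ 3]mulr_natr -ltr_pdivlMr.
have k0 : 0 < (k.+1%:R^-1 : R) by rewrite invr_gt0.
have /choice[q qP] : forall i, exists q : rat, `|x ord0 i - ratr q| < k.+1%:R^-1.
  move=> i; have : x ord0 i - k.+1%:R^-1 < x ord0 i by rewrite gtrBl.
  case/rat_in_itvoo => q; rewrite in_itv/= => /andP[q1 q2]; exists q.
  by rewrite gtr0_norm ?subr_gt0// ltrBlDr -ltrBlDl.
exists (\row_i q i), k; split.
  by apply/ball_rVP; split => // i; rewrite !mxE distrC; exact: qP.
move=> y /ball_rVP[_ H]; apply: eU; apply/ball_rVP; split => // i.
have := H i; have := qP i; rewrite !mxE.
move: (k.+1%:R^-1) ke k0 => d ke k0.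
have := ler_distD (ratr (q i)) (x ord0 i) (y ord0 i); lra.
Qed.

Lemma open_bigcup_qball n (U : set 'rV[R]_n) : open U ->
  U = \bigcup_(p in [set p : 'rV[rat]_n * nat | ball (qvec p.1) (p.2.+1%:R^-1 *+ 2) `<=` U]) ball (qvec p.1) (p.2.+1%:R^-1).
Proof.
move=> oU; apply/seteqP; split => [x Ux|x [p pU px]].
  by have [q [k [h1 h2]]] := open_qball oU Ux; exists (q, k).
apply: pU; move: px; apply: le_ball; rewrite mulr2n lerDl.
by rewrite invr_ge0.
Qed.

Lemma measurable_open n (U : set 'rV[R]_n) : open U -> measurable U.
Proof.
move=> oU; rewrite (open_bigcup_qball oU) bigcup_mkcond.
apply: countable_bigcupT_measurable => [|p]//.
by case: ifPn => // _; exact: measurable_ball_rV.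
Qed.

Lemma measurable_closed n (U : set 'rV[R]_n) : closed U -> measurable U.
Proof. by move=> cU; rewrite -(setCK U); apply: measurableC; apply: measurable_open; exact: closed_openC. Qed.

Lemma measurable_fun_continuous n (U : set 'rV[R]_n) (f : 'rV[R]_n -> R) : open U ->
  (forall x, U x -> {for x, continuous f}) -> measurable_fun U f.
Proof.
move=> oU cf mU; apply: (measurability _ (RGenOInfty.measurableE R)) => //.
move=> _ [_ [a ->] <-]; apply: measurable_open.
rewrite openE => x [Ux]; rewrite /= in_itv/= andbT => fax.
have h1 : nbhs x U by exact: open_nbhs_nbhs.
have h2 := cvgr_gt _ (cf x Ux) _ fax.
have {}h2 := h2 (nbhs_filter x); rewrite /interior.
by apply: filterS2 h1 h2 => y Uy ay; split => //=; rewrite in_itv/= andbT.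
Qed.

Lemma leb_ball n (x : 'rV[R]_n) (r : R) : 0 < r -> leb n (ball x r) = ((r *+ 2) ^+ n)%:E.
Proof.
move=> r0; elim: n x => [|n IH] x.
  rewrite expr0 /= /dirac indicE mem_set//=.
  by rewrite (thinmx0 x); exact: ballxx.
have mb := @measurable_ball_rV n.+1 x r.
rewrite -[ball x r]setIT -integral_indic//.
rewrite (@ge0_integral_cons _ n (fun x0 => (\1_(ball x r) x0)%:E)); last 2 first.
- by apply/measurable_EFinP; exact: measurable_indic.
- by move=> y; rewrite lee_fin.
have [t [y ->]] := rV_consE x.
transitivity (\int[mu]_s (((r *+ 2) ^+ n)%:E * (\1_(ball t r) s)%:E))%E.
  apply: eq_integral => s _.
  have [st|st] := boolP (s \in (ball t r : set R)).
    rewrite indicE st mule1 -(IH y).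
    rewrite -[ball y r]setIT -integral_indic//; last exact: measurable_ball_rV.
    apply: eq_integral => z _; rewrite !indicE.
    rewrite (_ : (_ \in _) = (z \in (ball y r : set 'rV[R]_n)))//.
    apply/idP/idP => /set_mem/ball_rVP[_ H]; apply/mem_set/ball_rVP; split => // i.
      by have := H (lift ord0 i); rewrite !rV_consS.
    case: (unliftP ord0 i) => [j|] ->; rewrite ?rV_consS ?rV_cons0//.
    by move/set_mem : st.
  rewrite indicE (negbTE st) mule0; apply: integral0_eq => z _; rewrite indicE.
  case: (boolP (_ \in _)) => // /set_mem/ball_rVP[_ /(_ ord0)]; rewrite !rV_cons0 => H.
  by rewrite mem_set in st.
rewrite ge0_integralZl//=; last 2 first.
- by apply/measurable_EFinP; apply: measurable_indic; exact: measurable_ball.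
- by rewrite lee_fin exprn_ge0// mulrn_wge0// ltW.
rewrite integral_indic//=; last exact: measurable_ball.
rewrite setIT.
rewrite (_ : ball t r = `]t - r, t + r[%classic); last first.
  by apply/seteqP; split => s; rewrite /ball/= in_itv/= ltr_distlC.
rewrite lebesgue_measure_itv/= lte_fin ltrBlDr -addrA ltrDl addr_gt0//.
rewrite -EFinB -EFinM exprS; congr EFin; rewrite mulr2n; ring.
Qed.

Lemma integral_translate n (v : 'rV[R]_n) (f : 'rV[R]_n -> \bar R) : measurable_fun setT f ->
  (\int[leb n]_x f (x + v)%R = \int[leb n]_x f x)%E.
Proof.
move=> mf; rewrite integralE [RHS]integralE; congr (_ - _)%E.
  have H := @ge0_integral_translate _ _ v f^\+%E (measurable_funepos mf) (funepos_ge0 f).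
  by rewrite -[RHS]H; apply: eq_integral => x _; rewrite !funeposE.
have H := @ge0_integral_translate _ _ v f^\-%E (measurable_funeneg mf) (funeneg_ge0 f).
by rewrite -[RHS]H; apply: eq_integral => x _; rewrite !funenegE.
Qed.

End borel_rV.

(* Integrals against a weight are taken over the whole space; sets are encoded
   by integrands vanishing outside of them. *)

#[export] Hint Resolve measurable_ball_rV : core.

(** * Integrability, L^2 spaces and limit theorems with respect to a weight *)

Section weighted_integral.
Context {R : realType} {n : nat}.
Local Notation E := 'rV[R]_n.
Implicit Types f g w : E -> R.

Definition mbfun f := measurable_fun [set: E] f.

Definition weight w := [/\ mbfun w, forall x, 0 <= w x &
  forall r, 0 < r -> (leb n).-integrable (ball 0 r) (EFin \o w)].

Definition wint w f := (leb n).-integrable setT (fun x => (f x * w x)%:E).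

Definition wI w f : R := \int[leb n]_x (f x * w x).

Lemma mbfun_cst c : mbfun (fun=> c). Proof. exact: measurable_cst. Qed.
Lemma mbfunD f g : mbfun f -> mbfun g -> mbfun (fun x => f x + g x).
Proof. exact: measurable_funD. Qed.
Lemma mbfunB f g : mbfun f -> mbfun g -> mbfun (fun x => f x - g x).
Proof. exact: measurable_funB. Qed.
Lemma mbfunM f g : mbfun f -> mbfun g -> mbfun (fun x => f x * g x).
Proof. exact: measurable_funM. Qed.
Lemma mbfunZ c f : mbfun f -> mbfun (fun x => c * f x).
Proof. by move=> mf; apply: mbfunM => //; exact: mbfun_cst. Qed.
Lemma mbfunN f : mbfun f -> mbfun (fun x => - f x).
Proof. exact: measurable_funN. Qed.
Lemma mbfunX k f : mbfun f -> mbfun (fun x => f x ^+ k).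
Proof. exact: measurable_funX. Qed.
Lemma mbfun_norm f : mbfun f -> mbfun (fun x => `|f x|).
Proof. by move=> mf; exact: measurableT_comp. Qed.
Lemma mbfun_sum (I : Type) (s : seq I) (F : I -> E -> R) :
  (forall i, mbfun (F i)) -> mbfun (fun x => \sum_(i <- s) F i x).
Proof. by move=> mF; exact: measurable_sum. Qed.
Lemma mbfun_translate v f : mbfun f -> mbfun (fun x => f (x + v)).
Proof. by move=> mf; exact: (measurableT_comp mf (measurable_addv v)). Qed.
Lemma mbfun_continuous f : continuous f -> mbfun f.
Proof. by move=> cf; apply: measurable_fun_continuous => [|x _]; [exact: openT|exact: cf]. Qed.
Lemma mbfun_if (A : set E) f : measurable A -> mbfun f -> mbfun (fun x => if x \in A then f x else 0).
Proof.
move=> mA mf; have := (@measurable_restrictT _ _ E R A f mA).1.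
by move/(_ (measurable_funS measurableT (@subsetT _ _) mf)).
Qed.

Section fixed_weight.
Variable w : E -> R.
Hypothesis hw : weight w.
Local Notation I := (wI w).
Local Notation wint := (wint w).

Lemma weight_mfun : mbfun w. Proof. by case: hw. Qed.
Lemma weight_ge0 x : 0 <= w x. Proof. by case: hw. Qed.

Lemma wint_le f g : mbfun f -> (forall x, `|f x| <= g x) -> wint g -> wint f.
Proof.
move=> mf fg; apply: le_integrable => //.
  by apply/measurable_EFinP; apply: mbfunM => //; exact: weight_mfun.
move=> x _ /=; rewrite lee_fin !normrM ler_wpM2r//.
by rewrite (le_trans (fg x))// ler_norm.
Qed.

Lemma wint_ext f g : (forall x, f x = g x) -> wint f -> wint g.
Proof. by move=> /funext->. Qed.
Lemma wintD f g : wint f -> wint g -> wint (fun x => f x + g x).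
Proof.
move=> hf hg; have := integrableD measurableT hf hg.
by apply: eq_integrable => // x _ /=; rewrite -EFinD mulrDl.
Qed.
Lemma wintZ c f : wint f -> wint (fun x => c * f x).
Proof.
move=> hf; have := integrableZl measurableT c hf.
by apply: eq_integrable => // x _ /=; rewrite -EFinM mulrA.
Qed.
Lemma wintN f : wint f -> wint (fun x => - f x).
Proof. by move=> /(wintZ (-1)); apply: wint_ext => x; rewrite mulN1r. Qed.
Lemma wintB f g : wint f -> wint g -> wint (fun x => f x - g x).
Proof. by move=> hf /wintN; exact: wintD. Qed.
Lemma wint0 : wint (fun=> 0).
Proof.
apply: (@eq_integrable _ _ _ _ _ _ (cst 0%E)); first exact: measurableT.
  by move=> x _ /=; rewrite mul0r.
exact: integrable0.
Qed.
Lemma wint_sum (J : Type) (s : seq J) (F : J -> E -> R) :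
  (forall i, wint (F i)) -> wint (fun x => \sum_(i <- s) F i x).
Proof.
move=> hF; elim: s => [|i s IH].
  by apply: wint_ext wint0 => x; rewrite big_nil.
by apply: wint_ext (wintD (hF i) IH) => x; rewrite big_cons.
Qed.
Lemma wint_abs f : wint f -> wint (fun x => `|f x|).
Proof.
move=> /integrable_norm; apply: eq_integrable => // x _ /=.
by rewrite normrM (ger0_norm (weight_ge0 x)).
Qed.

Lemma wI_ext f g : (forall x, f x = g x) -> I f = I g.
Proof. by move=> /funext->. Qed.
Lemma wID f g : wint f -> wint g -> I (fun x => f x + g x) = I f + I g.
Proof.
move=> hf hg; rewrite /wI -RintegralD//.
by apply: eq_Rintegral => x _; rewrite mulrDl.
Qed.
Lemma wIZ c f : wint f -> I (fun x => c * f x) = c * I f.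
Proof.
move=> hf; rewrite /wI -RintegralZl//.
by apply: eq_Rintegral => x _; rewrite mulrA.
Qed.
(** Integrability is not assumed: [fine] sends both infinities to 0, which is its own opposite. *)
Lemma wIN f : I (fun x => - f x) = - I f.
Proof.
rewrite /wI /Rintegral; set F := fun x => (f x * w x)%:E.
rewrite (_ : (fun x => (- f x * w x)%:E) = (\- F)%E); last by apply/funext => x; rewrite mulNr EFinN.
rewrite (integralE _ _ F) (integralE _ _ (\- F)%E) funeposN funenegN.
by case: (integral _ _ _) (integral _ _ _) => [p| |] [q| |] //=; rewrite ?opprB ?oppr0.
Qed.
Lemma wIB f g : wint f -> wint g -> I (fun x => f x - g x) = I f - I g.
Proof. by move=> hf hg; rewrite wID ?wIN//; exact: wintN. Qed.
Lemma wI0 : I (fun=> 0) = 0.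
Proof.
rewrite /wI (@eq_Rintegral _ _ _ _ _ (cst 0)) => [|x _]; last by rewrite mul0r.
by rewrite Rintegral_cst// mul0r.
Qed.
Lemma wI_sum (J : Type) (s : seq J) (F : J -> E -> R) : (forall i, wint (F i)) ->
  I (fun x => \sum_(i <- s) F i x) = \sum_(i <- s) I (F i).
Proof.
move=> hF; elim: s => [|i s IH].
  by rewrite big_nil -[RHS]wI0; apply: wI_ext => x; rewrite big_nil.
rewrite big_cons -IH -wID//; last exact: wint_sum.
by apply: wI_ext => x; rewrite big_cons.
Qed.
Lemma wI_le f g : wint f -> wint g -> (forall x, f x <= g x) -> I f <= I g.
Proof.
move=> hf hg fg; apply: le_Rintegral => // x _.
by rewrite ler_wpM2r// weight_ge0.
Qed.
Lemma wI_ge0 f : (forall x, 0 <= f x) -> 0 <= I f.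
Proof. by move=> f0; apply: Rintegral_ge0 => x _; rewrite mulr_ge0// weight_ge0. Qed.
Lemma wI_abs f : wint f -> `|I f| <= I (fun x => `|f x|).
Proof.
move=> hf; rewrite (le_trans (le_normr_Rintegral _ hf))//.
apply: eqW; apply: eq_Rintegral => x _.
by rewrite normrM (ger0_norm (weight_ge0 x)).
Qed.

Lemma wI_translate v f : wint f -> (forall x, w (x + v) = w x) ->
  wint (fun x => f (x + v)) /\ I (fun x => f (x + v)) = I f.
Proof.
move=> /integrableP[mf oo] wv.
pose g x := (f x * w x)%:E.
have mgv : measurable_fun [set: E] (fun x : E => g (x + v)) by exact: (measurableT_comp mf (measurable_addv v)).
have gv x : (f (x + v) * w x)%:E = g (x + v) by rewrite /g wv.
split.
  apply/integrableP; split; first by under eq_fun do rewrite gv.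
  under eq_integral do rewrite gv.
  rewrite (@ge0_integral_translate _ _ v (fun x => `|g x|%E))//.
  exact: measurableT_comp.
rewrite /wI /Rintegral; congr fine.
under eq_integral do rewrite gv.
exact: (integral_translate v mf).
Qed.

Definition bmfun f := mbfun f /\ exists C r, [/\ 0 < r, forall x, `|f x| <= C &
  forall x, ~ ball 0 r x -> f x = 0].

Lemma wint_bmfun f : bmfun f -> wint f.
Proof.
move=> [mf [C [r [r0 fC fr]]]].
have C0 : 0 <= C by rewrite (le_trans _ (fC 0)).
apply: (@wint_le _ (fun x => if x \in (ball 0 r : set E) then C else 0)) => //.
  move=> x; case: ifPn => [_//|/negP xr]; rewrite fr ?normr0//.
  by move=> /mem_set.
have mb := @measurable_ball_rV R n 0 r.
case: hw => _ _ /(_ r r0) /(integrableZl mb C) /(integrable_mkcond _ mb).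
apply: eq_integrable => // x _ /=; rewrite /patch; case: ifPn => // _; by rewrite mul0r.
Qed.

Definition l2 f := mbfun f /\ wint (fun x => f x ^+ 2).

Lemma l2_mfun f : l2 f -> mbfun f. Proof. by case. Qed.

Lemma wint_mul f g : l2 f -> l2 g -> wint (fun x => f x * g x).
Proof.
move=> [mf hf] [mg hg]; apply: wint_le (wintD hf hg); first exact: mbfunM.
move=> x; rewrite normrM -(normr_id (f x)) -(real_normK (num_real (f x))) -(real_normK (num_real (g x))).
by rewrite normr_id; have := sqr_ge0 (`|f x| - `|g x|); have := sqr_ge0 (`|f x|); have := sqr_ge0 (`|g x|); rewrite sqrrB; nra.
Qed.

Lemma l2D f g : l2 f -> l2 g -> l2 (fun x => f x + g x).
Proof.
move=> lf lg; split; first by apply: mbfunD; exact: l2_mfun.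
have := wintD (wintD (proj2 lf) (wintZ 2 (wint_mul lf lg))) (proj2 lg).
by apply: wint_ext => x; rewrite sqrrD; ring.
Qed.
Lemma l2Z c f : l2 f -> l2 (fun x => c * f x).
Proof.
move=> [mf hf]; split; first exact: mbfunZ.
by apply: wint_ext (wintZ (c ^+ 2) hf) => x; rewrite exprMn.
Qed.
Lemma l2_ext f g : (forall x, f x = g x) -> l2 f -> l2 g.
Proof. by move=> /funext->. Qed.
Lemma l2N f : l2 f -> l2 (fun x => - f x).
Proof. by move=> /(l2Z (-1)); apply: l2_ext => x; rewrite mulN1r. Qed.
Lemma l2B f g : l2 f -> l2 g -> l2 (fun x => f x - g x).
Proof. by move=> hf /l2N; exact: l2D. Qed.
Lemma l2_0 : l2 (fun=> 0).
Proof. by split; [exact: mbfun_cst|apply: wint_ext wint0 => x; rewrite expr0n]. Qed.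
Lemma l2_sum (J : Type) (s : seq J) (F : J -> E -> R) :
  (forall i, l2 (F i)) -> l2 (fun x => \sum_(i <- s) F i x).
Proof.
move=> hF; elim: s => [|i s IH].
  by apply: l2_ext l2_0 => x; rewrite big_nil.
by apply: l2_ext (l2D (hF i) IH) => x; rewrite big_cons.
Qed.
Lemma l2_le f g : mbfun f -> (forall x, `|f x| <= `|g x|) -> l2 g -> l2 f.
Proof.
move=> mf fg [mg hg]; split => //; apply: wint_le hg; first exact: mbfunX.
move=> x; rewrite normrX -[leRHS]sqr_normr.
by rewrite ler_sqr ?nnegrE.
Qed.
Lemma l2_bounded f g C : mbfun f -> (forall x, `|f x| <= C) -> l2 g -> l2 (fun x => f x * g x).
Proof.
move=> mf fC lg; have C0 : 0 <= C by rewrite (le_trans _ (fC 0)).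
apply: l2_le (l2Z C lg); first by apply: mbfunM => //; exact: l2_mfun.
by move=> x; rewrite !normrM (ger0_norm C0) ler_wpM2r.
Qed.
Lemma bmfunM f g C : mbfun g -> (forall x, `|g x| <= C) -> bmfun f -> bmfun (fun x => g x * f x).
Proof.
move=> mg gC [mf [D [r [r0 fD fr]]]]; split; first exact: mbfunM.
exists (C * D), r; split => // x; first by rewrite normrM ler_pM.
by move=> /fr->; rewrite mulr0.
Qed.
Lemma l2_bmfun f : bmfun f -> l2 f.
Proof.
move=> bf; have [mf [C [r [r0 fC fr]]]] := bf; split => //.
by apply: wint_bmfun; exact: bmfunM mf fC bf.
Qed.
Lemma l2_translate v f : (forall x, w (x + v) = w x) -> l2 f -> l2 (fun x => f (x + v)).
Proof.
move=> wv [mf hf]; split; first exact: mbfun_translate.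
by have [] := wI_translate hf wv.
Qed.

Lemma wI_cvg (F : nat -> E -> R) f g : (forall k, mbfun (F k)) -> mbfun f -> wint g ->
  (forall k x, `|F k x| <= g x) ->
  (forall x, w x != 0 -> F ^~ x @ \oo --> f x) -> wint f /\ (fun k => I (F k)) @ \oo --> I f.
Proof.
move=> mF mf hg Fg Ff.
have mw := weight_mfun.
have cF : {ae leb n, forall x : E, setT x -> (fun k => (F k x * w x)%:E) @ \oo --> (f x * w x)%:E}.
  apply: aeW => x _; apply: cvg_EFin; first exact: nearW.
  have [->|wx] := eqVneq (w x) 0.
    by rewrite mulr0; under eq_fun do rewrite /= mulr0; exact: cvg_cst.
  by apply: cvgM; [exact: Ff|exact: cvg_cst].
have bF : {ae leb n, forall (x : E) k, setT x -> (`|(F k x * w x)%:E| <= (g x * w x)%:E)%E} by apply: aeW => x k _ /=; rewrite lee_fin normrM (ger0_norm (weight_ge0 x)) ler_wpM2r// weight_ge0.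
have [h1 _ h2] := @dominated_convergence _ _ _ (leb n) setT measurableT
  (fun k x => (F k x * w x)%:E) (fun x => (f x * w x)%:E) (fun x => (g x * w x)%:E)
  (fun k => (measurable_EFinP _ _).2 (mbfunM (mF k) mw)) ((measurable_EFinP _ _).2 (mbfunM mf mw)) cF hg bF.
split => //; rewrite /wI /Rintegral.
apply: fine_cvg; rewrite fineK; last exact: (integrable_fin_num measurableT h1).
exact: h2.
Qed.

Lemma wI_derive (F dF : R -> E -> R) (g : E -> R) (t0 d : R) : 0 < d -> wint g ->
  (forall t, `|t - t0| < d -> wint (F t)) ->
  (forall t x, `|t - t0| < d -> is_derive t 1 (F ^~ x) (dF t x)) ->
  (forall t x, `|t - t0| < d -> `|dF t x| <= g x) ->
  is_derive t0 1 (fun t => I (F t)) (I (dF t0)).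
Proof.
move=> d0 hg hF hD hdF.
have d00 : `|t0 - t0| < d by rewrite subrr normr0.
have dE t : t \in `]t0 - d, t0 + d[ -> `|t - t0| < d by rewrite in_itv/= distrC ltr_distlC.
have It0 : `]t0 - d, t0 + d[%classic t0 by rewrite /= in_itv/= ltrBlDr !ltrDl d0.
have w0 := weight_ge0.
have D t x : `|t - t0| < d -> is_derive t 1 (fun s => F s x * w x) (dF t x * w x) by move=> td; apply: is_derive_mulr; exact: hD.
have DF := @derivable_under_integral _ _ _ (leb n) (fun t x => F t x * w x) setT measurableT
  t0 (t0 - d) (t0 + d) It0 _ _ (fun x => g x * w x) _ hg _.
have CF := @differentiation_under_integral _ _ _ (leb n) (fun t x => F t x * w x) setT measurableT
  t0 (t0 - d) (t0 + d) It0 _ _ (fun x => g x * w x) _ hg _.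
have h1 : forall x : R, `]t0 - d, t0 + d[%classic x ->
  (leb n).-integrable setT (EFin \o (fun x0 => F x x0 * w x0)) by move=> t /dE; exact: hF.
have h2 : forall (x : R) (y : E), `]t0 - d, t0 + d[%classic x -> setT y ->
  derivable (fun t => F t y * w y) x 1 by move=> t y /dE/(D t y)[].
have h3 : forall y : E, 0 <= g y * w y by move=> y; rewrite mulr_ge0// (le_trans _ (hdF t0 y d00)).
have h4 : forall (x : R) (y : E), `]t0 - d, t0 + d[%classic x -> setT y ->
  `|partial1of2 (fun t x => F t x * w x) x y| <= g y * w y.
  move=> t y /dE td _; rewrite partial1of2E (@derive_val _ _ _ _ _ _ _ (D t y td)).
  by rewrite normrM (ger0_norm (w0 y)) ler_wpM2r// hdF.
apply: DeriveDef; first exact: DF.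
rewrite -derive1E CF//; apply: eq_Rintegral => y _.
by rewrite partial1of2E (@derive_val _ _ _ _ _ _ _ (D t0 y d00)).
Qed.

End fixed_weight.
End weighted_integral.

#[export] Hint Resolve mbfun_cst mbfunD mbfunB mbfunM mbfunZ mbfunN mbfunX mbfun_norm mbfun_sum mbfun_translate : regularity.
#[export] Hint Extern 0 (mbfun _) => solve [auto with regularity nocore] : core.

(** * Smooth functions on the line built from exp(-1/s) *)

Section smooth_line.
Context {R : realType}.
Implicit Types (g h : R -> R) (p : {poly R}).

Lemma near_lt (s z : R) : s < z -> \forall t \near s, t < z.
Proof. by move=> h; apply: (open_nbhs_nbhs (conj (@open_lt _ z) h)). Qed.

Lemma is_derive_mul g h (x dg dh d : R) : is_derive x 1 g dg -> is_derive x 1 h dh ->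
  d = dg * h x + g x * dh -> is_derive x 1 (fun s => g s * h s) d.
Proof.
move=> Dg Dh ->; have H : is_derive x 1 (g * h) (g x *: dh + h x *: dg) by apply: is_deriveM.
by rewrite addrC [dg * _]mulrC.
Qed.

Definition smooth1 g : Prop := forall k x, derivable (derive1n k g) x 1.

Lemma smooth1_derivable g x : smooth1 g -> derivable g x 1.
Proof. by move=> /(_ 0%N); rewrite derive1n0. Qed.

Lemma smooth1_derive g : smooth1 g -> smooth1 (derive1 g).
Proof. by move=> sg k x; rewrite -derive1Sn; exact: sg. Qed.

Lemma smooth1_is_derive g (x : R) : smooth1 g -> is_derive x 1 g ((derive1 g) x).
Proof. by move=> sg; rewrite derive1E; apply: derivableP; exact: smooth1_derivable. Qed.

Lemma smooth1_closed (P : (R -> R) -> Prop) :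
  (forall g, P g -> exists2 g', P g' & forall x : R, is_derive x 1 g (g' x)) ->
  forall g, P g -> smooth1 g.
Proof.
move=> H g Pg k; suff [gk Pk ->] : exists2 gk, P gk & derive1n k g = gk.
  by have [g' _ D] := H _ Pk => x; have [] := D x.
elim: k => [|k [gk Pk E]]; first by exists g => //; derive1n0.
have [g' Pg' D] := H _ Pk; exists g' => //.
rewrite derive1nS E; apply/funext => x; rewrite derive1E.
exact: derive_val.
Qed.

Lemma is_derive_ext g h (x d : R) : (forall y, g y = h y) -> is_derive x 1 g d -> is_derive x 1 h d.
Proof. by move=> /funext->. Qed.

Lemma is_derive_near g h (x d : R) : (\forall y \near x, g y = h y) -> is_derive x 1 g d -> is_derive x 1 h d.
Proof.
move=> gh [dg Dg]; apply: DeriveDef; first exact: near_eq_derivable dg.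
by rewrite -(near_eq_derive (1 : R) gh).
Qed.

Lemma is_derive_sqbound g x C : g x = 0 -> (forall y, `|g y| <= C * (y - x) ^+ 2) ->
  is_derive x 1 g 0.
Proof.
move=> g0 gC.
have C1 : 0 < `|C| + 1 by [].
have H : (fun t => t^-1 *: ((g \o shift x) (t *: 1) - g x)) @ 0^' --> (0 : R).
  apply/cvgrPdist_le => e e0; near=> t.
  have t0 : t != 0 by near: t; exact: nbhs_dnbhs_neq.
  have te : `|t| < e / (`|C| + 1) by near: t; apply: dnbhs0_lt; pos.
  rewrite sub0r normrN /= g0 subr0 normrM normrV ?unitfE// ler_pdivrMl ?normr_gt0//.
  rewrite (le_trans (gC _))// addrK [_ *: _]mulr1 -(real_normK (num_real t)).
  rewrite ltr_pdivlMr// in te.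
  have := ler_norm C; have : 0 < `|t| by rewrite normr_gt0.
  by move: te; nra.
apply: DeriveDef; first by apply/cvg_ex; exists 0.
exact/cvg_lim.
Unshelve. all: by end_near. Qed.

(** The functions p(1/s) exp(-1/s), extended by 0, form a class closed under differentiation.
    Working with the whole class proves the smoothness of exp(-1/s) without computing higher
    derivatives. *)
Definition flatfun p (s : R) : R := if 0 < s then p.[s^-1] * expR (- s^-1) else 0.

(** A quadratic bound is what differentiability at 0 with derivative 0 asks for. With y = 1/s it
    comes term by term from exp y >= y^(i+2) / (i+2)!. *)
Lemma poly_expR_bound p : exists C, forall s, `|flatfun p s| <= C * s ^+ 2.
Proof.
exists (\sum_(i < size p) `|p`_i| * i.+2`!%:R) => s; rewrite /flatfun.
case: ifPn => s0; last first.
  by rewrite normr0 mulr_ge0 ?sqr_ge0// sumr_ge0// => i _; rewrite mulr_ge0.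
have y0 : 0 < s^-1 by rewrite invr_gt0.
have yn k : 0 <= s^-1 ^+ k by rewrite exprn_ge0// ltW.
rewrite normrM (gtr0_norm (expR_gt0 _)) horner_coef mulr_suml.
apply: le_trans (_ : (\sum_(i < size p) `|p`_i * s^-1 ^+ i|) * expR (- s^-1) <= _).
  by rewrite ler_wpM2r ?expR_ge0// ler_norm_sum.
rewrite mulr_suml; apply: ler_sum => i _.
rewrite normrM -!mulrA ler_wpM2l// (ger0_norm (yn _)).
have := expR_ge1Dxn i.+1 (ltW y0); move: (expR_gt0 (s^-1)) => e0.
rewrite expRN ler_pdivrMr// => H.
rewrite -[s ^+ 2]invrK -exprVn mulrAC ler_pdivlMr ?exprn_gt0// -exprD addn2.
rewrite -ler_pdivrMl ?fact_gt0// mulrC.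
by apply: le_trans H; rewrite lerDr.
Qed.

(** With y = 1/s, the derivative in s of p(y) exp(-y) is y^2 (p(y) - p'(y)) exp(-y). *)
Definition flat_deriv p : {poly R} := 'X^2 * p - 'X^2 * p^`().

Lemma is_derive_flatfun p (s : R) : is_derive s 1 (flatfun p) (flatfun (flat_deriv p) s).
Proof.
have [s0|s0|->] := ltgtP s 0; rewrite {2}/flatfun ?ltxx.
- rewrite ltNge (ltW s0); apply: is_derive_near (is_derive_cst (0 : R) s 1).
  by near=> t; rewrite /flatfun ltNge ltW//; near: t; exact: near_lt.
- rewrite s0; apply: (@is_derive_near (fun s => p.[s^-1] * expR (- s^-1))).
    by near=> t; rewrite /flatfun (_ : 0 < t)//; near: t; exact: lt_nbhsr.
  have sn : s != 0 by [].
  have D1 : is_derive s 1 (fun s : R => s^-1) (- s ^- 2).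
    have := @is_deriveV _ id s 1 1 sn (is_derive_id _ _); by rewrite [_ *: _]mulr1.
  have D2 : is_derive s 1 (fun s : R => p.[s^-1]) (- s ^- 2 * (p^`()).[s^-1]).
    have := @is_derive1_comp _ (horner p) (fun s : R => s^-1) s _ _ _ D1.
    by move=> /(_ _ (is_derive_poly _ _)); rewrite mulrC.
  have D3 : is_derive s 1 (fun s : R => expR (- s^-1)) (expR (- s^-1) * s ^- 2).
    have := @is_derive1_comp _ expR (fun s : R => - s^-1) s _ _ (is_derive_expR _) (is_deriveN D1).
    by rewrite opprK.
  apply: (is_derive_mul D2 D3).
  rewrite /flat_deriv hornerD hornerN !hornerM !hornerX -!expr2 exprVn; move: (s ^- 2) => y; ring.
- have [C HC] := poly_expR_bound p; apply: (@is_derive_sqbound _ _ C).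
    by rewrite /flatfun ltxx.
  by move=> y; rewrite subr0.
Unshelve. all: end_near. Qed.

Lemma smooth1_flatfun p : smooth1 (flatfun p).
Proof.
apply: (@smooth1_closed (fun g => exists p, g = flatfun p)); last by exists p.
move=> _ [q ->]; exists (flatfun (flat_deriv q)); first by exists (flat_deriv q).
exact: is_derive_flatfun.
Qed.

Definition fe : R -> R := flatfun 1.

Lemma feE s : fe s = if 0 < s then expR (- s^-1) else 0.
Proof. by rewrite /fe /flatfun hornerE mul1r. Qed.
Lemma fe_le0 s : s <= 0 -> fe s = 0. Proof. by rewrite feE ltNge => ->. Qed.
Lemma fe_ge0 s : 0 <= fe s.
Proof. by rewrite feE; case: ifP => // _; exact: expR_ge0. Qed.
Lemma fe_le1 s : fe s <= 1.
Proof. by rewrite feE; case: ifPn => // s0; rewrite expR_le1 oppr_le0 invr_ge0 ltW. Qed.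
Lemma fe_homo : {homo fe : x y / x <= y}.
Proof.
move=> x y xy; have [x0|x0] := leP x 0; first by rewrite (fe_le0 x0) fe_ge0.
by rewrite !feE x0 (lt_le_trans x0 xy) ler_expR lerN2 lef_pV2 ?posrE// (lt_le_trans x0).
Qed.
Lemma smooth1_fe : smooth1 fe. Proof. exact: smooth1_flatfun. Qed.

Definition fe' : R -> R := flatfun 'X^2.
Lemma is_derive_fe (s : R) : is_derive s 1 fe (fe' s).
Proof.
have := is_derive_flatfun 1; rewrite (_ : flat_deriv 1 = 'X^2)//.
by rewrite /flat_deriv derivC mulr1 mulr0 subr0.
Qed.
Lemma fe'E s : fe' s = if 0 < s then s ^- 2 * expR (- s^-1) else 0.
Proof. by rewrite /fe' /flatfun hornerXn exprVn. Qed.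
Lemma fe'_le0 s : s <= 0 -> fe' s = 0. Proof. by rewrite fe'E ltNge => ->. Qed.
Lemma fe'_gt0 s : 0 < s -> 0 < fe' s.
Proof. by rewrite fe'E => s0; rewrite s0 mulr_gt0 ?expR_gt0// invr_gt0 exprn_gt0. Qed.
Lemma fe'_ge0 s : 0 <= fe' s.
Proof. by have [/fe'_le0->|/fe'_gt0/ltW] := leP s 0. Qed.
Lemma smooth1_fe' : smooth1 fe'. Proof. exact: smooth1_flatfun. Qed.
Lemma fe_derive1 : (derive1 fe) = fe'.
Proof. by apply/funext => s; rewrite derive1E; exact: (@derive_val _ _ _ _ _ _ _ (is_derive_fe s)). Qed.

(* The weight [s `^ b] is smooth only away from 0, so it enters through
   products with functions vanishing near 0. *)
Inductive gen1 : (R -> R) -> Prop :=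
| gen1_smooth g : smooth1 g -> gen1 g
| gen1_affine c d : gen1 (fun s => c * s + d)
| gen1_add g h : gen1 g -> gen1 h -> gen1 (fun s => g s + h s)
| gen1_mul g h : gen1 g -> gen1 h -> gen1 (fun s => g s * h s)
| gen1_comp g h : smooth1 g -> gen1 h -> gen1 (fun s => g (h s))
| gen1_powR d b g : 0 < d -> gen1 g -> (forall s, s < d -> g s = 0) -> gen1 (fun s => s `^ b * g s).

Lemma gen1_derive g : gen1 g -> exists2 g', gen1 g' & forall x : R, is_derive x 1 g (g' x).
Proof.
elim=> {g} [g sg|c d|g h _ [g' Pg Dg] _ [h' Ph Dh]|g h Pg0 [g' Pg Dg] Ph0 [h' Ph Dh]|g h sg Ph0 [h' Ph Dh]|
 d b g d0 Pg0 [g' Pg Dg] g0].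
- exists (derive1 g); first exact/gen1_smooth/smooth1_derive.
  by move=> x; exact: smooth1_is_derive.
- exists (fun s => 0 * s + c) => [|x]; first exact: gen1_affine.
  have := is_deriveD (is_derive_mulr c (is_derive_id x 1)) (is_derive_cst d x 1).
  by rewrite mul0r add0r mul1r addr0; apply: is_derive_ext => y; rewrite /= mulrC.
- by exists (fun s => g' s + h' s) => [|x]; [exact: gen1_add|exact: is_deriveD].
- exists (fun s => g' s * h s + g s * h' s) => [|x]; first by apply: gen1_add; apply: gen1_mul.
  exact: (is_derive_mul (Dg x) (Dh x)).
- exists (fun s => derive1 g (h s) * h' s) => [|x].
    by apply: gen1_mul => //; apply: gen1_comp => //; exact: smooth1_derive.
  exact: (@is_derive1_comp _ g h x _ _ (smooth1_is_derive _ sg) (Dh x)).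
have near0 x : x < d -> \forall t \near x, g t = cst 0 t by move=> xd; near=> t; apply: g0; near: t; exact: near_lt.
have g'0 x : x < d -> g' x = 0 by move=> xd; rewrite -(@derive_val _ _ _ _ _ _ _ (Dg x)) (near_eq_derive _ (near0 x xd)) derive_cst.
exists (fun s => (0 * s + b) * (s `^ (b - 1) * g s) + s `^ b * g' s) => [|x].
  by apply: gen1_add; [apply: gen1_mul; [exact: gen1_affine|]|]; apply: (gen1_powR _ d0).
have [xd|xd] := ltP x d.
  rewrite g0// g'0// !mulr0 addr0; apply: is_derive_near (is_derive_cst (0 : R) x 1).
  by apply: filterS (near0 x xd) => t ->; rewrite mulr0.
apply: (is_derive_mul (is_derive1_powR b (lt_le_trans d0 xd)) (Dg x)); ring.
Unshelve. all: by end_near. Qed.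

Lemma smooth1_gen g : gen1 g -> smooth1 g.
Proof. by apply: smooth1_closed => h /gen1_derive. Qed.

Lemma smooth1_comp_affine g c d : smooth1 g -> smooth1 (fun s => g (c * s + d)).
Proof. by move=> sg; apply/smooth1_gen/gen1_comp => //; exact: gen1_affine. Qed.

End smooth_line.

#[export] Hint Resolve fe_ge0 : positivity.

Notation "''e_' i" := (delta_mx ord0 i) (at level 8, i at level 2, format "''e_' i").

(** * Smooth functions and test functions on R^n *)

Section smooth_functions.
Context {R : realType} {n : nat}.
Local Notation E := 'rV[R]_n.
Implicit Types (f g : E -> R) (i : 'I_n) (x y v : E) (c : R).

(** An inductive class that consists of differentiable functions and is stable under [partial]. One
    induction on it replaces a separate rule for the iterated partial derivatives of each
    operation. *)
Inductive gen : (E -> R) -> Prop :=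
| gen_smooth f : smooth f -> gen f
| gen_cst c : gen (fun=> c)
| gen_coord i : gen (fun x => x ord0 i)
| gen_add f g : gen f -> gen g -> gen (fun x => f x + g x)
| gen_mul f g : gen f -> gen g -> gen (fun x => f x * g x)
| gen_comp h f : smooth1 h -> gen f -> gen (fun x => h (f x)).

Lemma smooth_differentiable f x : smooth f -> differentiable f x.
Proof. by move=> /(_ [::]). Qed.

Lemma smooth_partial i f : smooth f -> smooth (partial i f).
Proof. by move=> sf s; have := sf (rcons s i); rewrite foldr_rcons. Qed.

Lemma gen_differentiable f x : gen f -> differentiable f x.
Proof.
elim=> {f} [f /smooth_differentiable//|c|i|f g _ df _ dg|f g _ df _ dg|h f sh _ df].
- exact: differentiable_cst.
- exact: differentiable_coord.
- exact: differentiableD.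
- exact: differentiableM.
- apply: differentiable_comp => //; apply/derivable1_diffP; exact: smooth1_derivable.
Qed.

Lemma partialD i f g x : differentiable f x -> differentiable g x ->
  partial i (fun y => f y + g y) x = partial i f x + partial i g x.
Proof. by move=> df dg; rewrite /partial deriveD//; exact: diff_derivable. Qed.

Lemma partialM i f g x : differentiable f x -> differentiable g x ->
  partial i (fun y => f y * g y) x = f x * partial i g x + partial i f x * g x.
Proof.
move=> df dg; rewrite /partial deriveM; [|exact: diff_derivable..].
by rewrite [_ *: 'D__ g x]mulrC mulrC [_ *: _]mulrC.
Qed.

Lemma partial_comp i (h : R -> R) f x : derivable h (f x) 1 -> differentiable f x ->
  partial i (fun y => h (f y)) x = derive1 h (f x) * partial i f x.
Proof.
move=> dh df; have dh' : differentiable h (f x) by apply/derivable1_diffP.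
rewrite /partial !deriveE//; last exact: differentiable_comp.
by rewrite (diff_comp df dh')/= derive1E' // -[X in 'd h _ X]mulr1 [LHS]linearZ mulrC.
Qed.

Lemma line_quotient f (x v : E) (t : R) :
  (fun h : R => h^-1 *: (((fun s : R => f (x + s *: v)) \o shift t) (h *: 1) - f (x + t *: v))) =
  (fun h : R => h^-1 *: ((f \o shift (x + t *: v)) (h *: v) - f (x + t *: v))).
Proof.
apply/funext => h /=; rewrite [h *: (1 : R)]mulr1 scalerDl.
by rewrite addrCA.
Qed.

Lemma derive_line f (x v : E) : 'D_v f x = 'D_1 (fun s : R => f (x + s *: v)) 0.
Proof. by rewrite /derive line_quotient scale0r addr0. Qed.

Lemma partial_coord i (j : 'I_n) x : partial i (fun y : E => y ord0 j) x = (i == j)%:R.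
Proof.
rewrite /partial derive_line (_ : (fun => _) = fun s : R => s * (i == j)%:R + x ord0 j).
  have D : is_derive (0 : R) 1 (fun s : R => s * (i == j)%:R + x ord0 j) (1 * (i == j)%:R + 0) by apply: is_deriveD; apply: is_derive_mulr; exact: is_derive_id.
  by rewrite (@derive_val) mul1r addr0.
by apply/funext => s; rewrite !mxE addrC eq_sym.
Qed.

Lemma gen_partial i f : gen f -> gen (partial i f).
Proof.
elim=> {f} [f sf|c|j|f g gf Gf gg Gg|f g gf Gf gg Gg|h f sh gf Gf].
- exact/gen_smooth/smooth_partial.
- rewrite (_ : partial i _ = fun=> 0); first exact: gen_cst.
  by apply/funext => x; rewrite /partial derive_cst.
- rewrite (_ : partial i _ = fun=> (i == j)%:R); first exact: gen_cst.
  by apply/funext => x; rewrite partial_coord.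
- rewrite (_ : partial i _ = fun x => partial i f x + partial i g x); first exact: gen_add.
  by apply/funext => x; rewrite partialD//; exact: gen_differentiable.
- rewrite (_ : partial i _ = fun x => f x * partial i g x + partial i f x * g x).
    by apply: gen_add; apply: gen_mul.
  by apply/funext => x; rewrite partialM//; exact: gen_differentiable.
- rewrite (_ : partial i _ = fun x => derive1 h (f x) * partial i f x).
    by apply: gen_mul => //; apply: (gen_comp (smooth1_derive sh)).
  by apply/funext => x; rewrite partial_comp//; [exact: smooth1_derivable|exact: gen_differentiable].
Qed.

Lemma smooth_gen f : gen f -> smooth f.
Proof.
move=> gf s x; apply: gen_differentiable; elim: s => //= i s; exact: gen_partial.
Qed.

Lemma smooth_cst c : smooth ((fun=> c) : E -> R). Proof. exact/smooth_gen/gen_cst. Qed.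
Lemma smooth_coord i : smooth (fun x : E => x ord0 i). Proof. exact/smooth_gen/gen_coord. Qed.
Lemma smoothD f g : smooth f -> smooth g -> smooth (fun x => f x + g x).
Proof. by move=> sf sg; apply/smooth_gen/gen_add; exact: gen_smooth. Qed.
Lemma smoothM f g : smooth f -> smooth g -> smooth (fun x => f x * g x).
Proof. by move=> sf sg; apply/smooth_gen/gen_mul; exact: gen_smooth. Qed.
Lemma smooth_comp h f : smooth1 h -> smooth f -> smooth (fun x => h (f x)).
Proof. by move=> sh sf; apply/smooth_gen/gen_comp => //; exact: gen_smooth. Qed.
Lemma smoothZ c f : smooth f -> smooth (fun x => c * f x).
Proof. by move=> sf; apply: smoothM => //; exact: smooth_cst. Qed.
Lemma smoothN f : smooth f -> smooth (fun x => - f x).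
Proof. by move=> /(smoothZ (-1)); under eq_fun do rewrite mulN1r. Qed.
Lemma smoothB f g : smooth f -> smooth g -> smooth (fun x => f x - g x).
Proof. by move=> sf /smoothN; exact: smoothD. Qed.
Lemma smoothX f k : smooth f -> smooth (fun x => f x ^+ k).
Proof.
move=> sf; elim: k => [|k IH]; first by under eq_fun do idtac; exact: smooth_cst.
by under eq_fun do rewrite exprS; exact: smoothM.
Qed.
Lemma smooth_sum (J : Type) (s : seq J) (F : J -> E -> R) :
  (forall j, smooth (F j)) -> smooth (fun x => \sum_(j <- s) F j x).
Proof.
move=> sF; elim: s => [|j s IH]; first by under eq_fun do rewrite big_nil; exact: smooth_cst.
by under eq_fun do rewrite big_cons; exact: smoothD.
Qed.
Lemma smooth_prod (J : Type) (s : seq J) (F : J -> E -> R) :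
  (forall j, smooth (F j)) -> smooth (fun x => \prod_(j <- s) F j x).
Proof.
move=> sF; elim: s => [|j s IH]; first by under eq_fun do rewrite big_nil; exact: smooth_cst.
by under eq_fun do rewrite big_cons; exact: smoothM.
Qed.

Lemma smooth_continuous f : smooth f -> continuous f.
Proof. by move=> sf x; apply: differentiable_continuous; exact: smooth_differentiable. Qed.

Lemma partial_near i f g x : (\forall y \near x, f y = g y) -> partial i f x = partial i g x.
Proof. exact: near_eq_derive. Qed.

Lemma partial_cst i c x : partial i ((fun=> c) : E -> R) x = 0.
Proof. by rewrite /partial derive_cst. Qed.

Lemma partialZ i c f x : differentiable f x -> partial i (fun y => c * f y) x = c * partial i f x.
Proof.
move=> df; rewrite partialM//.
by rewrite partial_cst mul0r addr0.
Qed.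

Lemma partialB i f g x : differentiable f x -> differentiable g x ->
  partial i (fun y => f y - g y) x = partial i f x - partial i g x.
Proof. by move=> df dg; rewrite /partial deriveB//; exact: diff_derivable. Qed.

Lemma partial_sum i (J : Type) (s : seq J) (F : J -> E -> R) x :
  (forall j, smooth (F j)) -> partial i (fun y => \sum_(j <- s) F j y) x = \sum_(j <- s) partial i (F j) x.
Proof.
move=> sF; elim: s => [|j s IH].
  by rewrite big_nil; under [X in partial i X]eq_fun do rewrite big_nil; exact: partial_cst.
rewrite big_cons -IH -partialD; last 2 first.
- exact: smooth_differentiable.
- exact: (smooth_differentiable _ (smooth_sum s sF)).
by congr partial; apply/funext => y; rewrite big_cons.
Qed.

Lemma partial_sqr i f x : differentiable f x -> partial i (fun y => f y ^+ 2) x = 2 * f x * partial i f x.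
Proof.
move=> df; rewrite (_ : (fun y => f y ^+ 2) = (fun y => f y * f y)).
  by rewrite partialM//; ring.
by apply/funext => y; rewrite expr2.
Qed.

Lemma smooth_is_derive (f : E -> R) (x v : E) (t : R) : smooth f ->
  is_derive t 1 (fun s => f (x + s *: v)) (\sum_i v ord0 i * partial i f (x + t *: v)).
Proof.
move=> sf; set y := x + t *: v.
have df : differentiable f y by exact: smooth_differentiable.
have dv : derivable f y v by exact: diff_derivable.
have E1 := line_quotient f x v t.
apply: DeriveDef; first by rewrite /derivable E1.
rewrite {1}/derive E1 -/(derive f y v) deriveE// {1}(row_sum_delta v) linear_sum.
apply: eq_bigr => i; rewrite linearZ /partial deriveE//.
Qed.

Lemma partial_translate i v f x : partial i (fun y => f (y + v)) x = partial i f (x + v).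
Proof.
have E1 : (fun s : R => f (x + s *: 'e_i + v)) = (fun s : R => f (x + v + s *: 'e_i)) by apply/funext => h; rewrite addrAC.
rewrite /partial; transitivity ('D_1 (fun s : R => f (x + v + s *: 'e_i)) 0).
  by rewrite -E1; exact: derive_line.
by apply/esym; exact: derive_line.
Qed.

Lemma foldr_partial_translate s v f x :
  foldr partial (fun y => f (y + v)) s x = foldr partial f s (x + v).
Proof.
elim: s x => //= i s IH x; rewrite -(partial_translate i v (foldr partial f s) x); congr (partial i _ x).
by apply/funext => y; exact: IH.
Qed.

Lemma smooth_translate v f : smooth f -> smooth (fun x => f (x + v)).
Proof.
move=> sf s x.
rewrite (_ : _ _ = (foldr partial f s) \o (fun y => y + v)); last first.
  by apply/funext => y; exact: foldr_partial_translate.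
apply: differentiable_comp; last by [].
by apply: differentiableD.
Qed.

Section test_functions.
Implicit Types U V : set E.

Lemma tf_smooth U f : test_function U f -> smooth f. Proof. by case. Qed.

Lemma tf_sub U V f : U `<=` V -> test_function U f -> test_function V f.
Proof. by move=> UV [sf [K [cK KU K0]]]; split => //; exists K; split => //; exact: subset_trans UV. Qed.

Lemma tf_closed (A : set E) f : closed A -> bounded_set A -> smooth f -> (forall x, ~ A x -> f x = 0) ->
  test_function A f.
Proof.
move=> cA bA sf A0; split => //; exists A; split => //.
exact: bounded_closed_compact.
Qed.

Lemma compact_closedE (K : set E) : compact K -> closed K.
Proof. by apply: compact_closed; exact: norm_hausdorff. Qed.

Lemma tf_partial U i f : test_function U f -> test_function U (partial i f).
Proof.
move=> [sf [K [cK KU K0]]]; split; first exact: smooth_partial.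
exists K; split => // x Kx; rewrite -(partial_cst i 0 x); apply: partial_near.
have oK : open (~` K) by apply: closed_openC; exact: compact_closedE.
have := open_nbhs_nbhs (conj oK Kx).
by apply: filterS => y /K0.
Qed.

Lemma tfM U f g : test_function U f -> smooth g -> test_function U (fun x => g x * f x).
Proof.
move=> [sf [K [cK KU K0]]] sg; split; first exact: smoothM.
by exists K; split => // x /K0->; rewrite mulr0.
Qed.

Lemma tfD U f g : test_function U f -> test_function U g -> test_function U (fun x => f x + g x).
Proof.
move=> [sf [K [cK KU K0]]] [sg [L [cL LU L0]]]; split; first exact: smoothD.
exists (K `|` L); split; first exact: compactU.
- by move=> x [/KU|/LU].
- by move=> x /not_orP[/K0-> /L0->]; rewrite addr0.
Qed.

Lemma tfZ U c f : test_function U f -> test_function U (fun x => c * f x).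
Proof. by move=> tf; apply: tfM => //; exact: smooth_cst. Qed.

Lemma tf_translate U v f : test_function U f ->
  test_function [set x | U (x + v)] (fun x => f (x + v)).
Proof.
move=> [sf [K [cK KU K0]]]; split; first exact: smooth_translate.
exists ((fun x => x - v) @` K); split.
- apply: continuous_compact => //; apply: continuous_subspaceT => x.
  by apply: differentiable_continuous; apply: differentiableB.
- by move=> _ [y Ky <-] /=; rewrite subrK; exact: KU.
- by move=> x Kx; apply: K0 => Kxv; apply: Kx; exists (x + v); rewrite ?addrK.
Qed.

Lemma compact_ball (K : set E) : compact K -> exists2 r : R, 0 < r & K `<=` ball 0 r.
Proof.
move=> /compact_bounded[M [_ HM]]; exists (`|M| + 2) => [|x Kx].
  by rewrite ltr_wpDl.
have : `|x| <= `|M| + 1 by apply: HM => //; rewrite (le_lt_trans (ler_norm _))// ltrDl.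
move=> H; rewrite ballE sub0r normrN (le_lt_trans H)//.
by rewrite ltrD2l ltr1n.
Qed.

Lemma bmfun_compact f (K : set E) : continuous f -> compact K -> (forall x, ~ K x -> f x = 0) -> bmfun f.
Proof.
move=> cf cK K0; split; first exact: mbfun_continuous.
have [r r0 Kr] := compact_ball cK.
have /compact_bounded[M [_ HM]] : compact (f @` K) by apply: continuous_compact => //; exact: continuous_subspaceT.
have M1 : M < `|M| + 1 by rewrite (le_lt_trans (ler_norm _))// ltrDl.
exists (`|M| + 1), r; split => // x.
  have [Kx|/K0->] := pselect (K x); last by rewrite normr0.
  by apply: (HM _ M1); exists x.
by move=> xr; apply: K0 => /Kr.
Qed.

Lemma tf_bmfun U f : test_function U f -> bmfun f.
Proof. by move=> [sf [K [cK _ K0]]]; apply: bmfun_compact cK K0; exact: smooth_continuous. Qed.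

End test_functions.
End smooth_functions.

#[export] Hint Resolve smooth_cst smooth_coord smoothD smoothM smoothZ smoothN smoothB smoothX smooth_sum
  smooth_prod smooth_partial smooth_differentiable : regularity.
#[export] Hint Extern 0 (smooth _) => solve [auto with regularity nocore] : core.
#[export] Hint Extern 0 (differentiable _ _) => solve [auto with regularity nocore] : core.

(** * The fundamental lemma of the calculus of variations *)

Section fundamental_lemma.
Context {R : realType} {n : nat}.
Local Notation E := 'rV[R]_n.
Implicit Types (f g : E -> R) (a b : 'I_n -> R).

Lemma rV_norm_le (x : E) (M : R) : 0 <= M -> (forall i, `|x ord0 i| <= M) -> `|x| <= M.
Proof.
by move=> M0 h; rewrite [leLHS]/Num.norm /= mx_normrE; apply: bigmax_le => // -[i] /=; rewrite [i]ord1.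
Qed.

Lemma rV_norm_coord (x : E) i : `|x ord0 i| <= `|x|.
Proof.
rewrite [leRHS]/Num.norm /= mx_normrE; apply/bigmax_geP; right => /=.
by exists (ord0, i).
Qed.

Lemma norm_delta i : `|'e_i : E| <= 1.
Proof. by apply: rV_norm_le => // j; rewrite mxE; case: (_ && _); rewrite ?normr1 ?normr0. Qed.

Lemma norm_scale_delta (t : R) i : 0 <= t -> `|t *: 'e_i : E| <= t.
Proof. by move=> t0; rewrite normrZ ger0_norm// ler_piMr// norm_delta. Qed.

Definition one : E -> R := fun=> 1.

Lemma weight_one : weight one.
Proof.
split; [exact: mbfun_cst|by []|move=> r r0].
apply: (@eq_integrable _ _ _ (leb n) _ (measurable_ball_rV 0 r) (cst 1%E)) => //.
apply/integrableP; split => //.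
rewrite integral_cst//=; last exact: measurable_ball_rV.
by rewrite normr1 mul1e leb_ball// ltry.
Qed.

Local Notation "\I [ x ] F" := (wI one (fun x => F)) (at level 34, x name, F at level 41).

Definition box a b : set E := [set x | forall i, a i < x ord0 i < b i].

Lemma boxI a b a' b' : box a b `&` box a' b' =
  box (fun i => Num.max (a i) (a' i)) (fun i => Num.min (b i) (b' i)).
Proof.
apply/seteqP; split => x.
  by move=> [h1 h2] i; move: (h1 i) (h2 i); rewrite gt_max lt_min => /andP[-> ->] /andP[-> ->].
by move=> h; split => i; move: (h i); rewrite gt_max lt_min => /andP[/andP[h1 h2] /andP[h3 h4]]; apply/andP.
Qed.

Lemma ball_box (q : E) (r : R) : 0 < r -> ball q r = box (fun i => q ord0 i - r) (fun i => q ord0 i + r).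
Proof.
move=> r0; apply/seteqP; split => x.
  by move=> /ball_rVP[_ h] i; have := h i; rewrite ltr_distlC.
by move=> h; apply/ball_rVP; split => // i; rewrite ltr_distlC; exact: h.
Qed.

Lemma measurable_box a b : measurable (box a b).
Proof.
rewrite (_ : box a b = \bigcap_(i in [set: 'I_n]) [set x : E | a i < x ord0 i < b i]).
  apply: fin_bigcap_measurable => // i _.
  rewrite (_ : [set x | _] = (fun y : E => y ord0 i) @^-1` (`]a i, b i[%classic)).
    rewrite -[X in measurable X]setTI; apply: measurable_coord => //; exact: measurable_itv.
  by apply/seteqP; split => x /=; rewrite in_itv.
by apply/seteqP; split => x; [move=> h i _; exact: h|move=> h i; exact: h].
Qed.

(** Test functions of the open box that converge pointwise to its indicator. The shift by 1 inside
    [fe] keeps the support at distance 1/(k+1) from the faces. *)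
Definition boxfun a b (k : nat) (x : E) : R :=
  \prod_i (fe (k.+1%:R * (x ord0 i - a i) - 1) * fe (k.+1%:R * (b i - x ord0 i) - 1)).

Lemma smooth_boxfun a b k : smooth (boxfun a b k).
Proof.
apply: smooth_prod => i; apply: smoothM; apply: smooth_comp; try exact: smooth1_fe.
  apply: smoothB; last by [].
  by apply: smoothZ; apply: smoothB; [exact: smooth_coord|exact: smooth_cst].
apply: smoothB; last by [].
by apply: smoothZ; apply: smoothB; [exact: smooth_cst|exact: smooth_coord].
Qed.

Lemma boxfun_ge0 a b k x : 0 <= boxfun a b k x.
Proof. by apply: prodr_ge0 => i; rewrite mulr_ge0// fe_ge0. Qed.

Lemma boxfun_le1 a b k x : boxfun a b k x <= 1.
Proof.
apply: prodr_ile1 => i _; rewrite mulr_ge0 ?fe_ge0//=.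
by rewrite mulr_ile1 ?fe_ge0 ?fe_le1.
Qed.

Lemma boxfun_out a b k (x : E) :
  ~ (forall i, a i + k.+1%:R^-1 <= x ord0 i <= b i - k.+1%:R^-1) -> boxfun a b k x = 0.
Proof.
move=> /existsNP[i hi]; rewrite /boxfun (bigD1 i)//=.
have k0 : 0 < k.+1%:R :> R by [].
have [h1|h1] := leP (a i + k.+1%:R^-1) (x ord0 i); last first.
  rewrite fe_le0 ?mul0r//.
  rewrite subr_le0 -ler_pdivlMl// mulr1 lerBlDl; exact: ltW.
have [h2|h2] := leP (x ord0 i) (b i - k.+1%:R^-1); last first.
  rewrite [fe (_ (_ - x _ _) - _)]fe_le0 ?mulr0 ?mul0r//.
  rewrite subr_le0 -ler_pdivlMl// mulr1 lerBlDr addrC -lerBlDr; exact: ltW.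
by exfalso; apply: hi; rewrite h1 h2.
Qed.

Lemma closed_coord_box a b : closed [set x : E | forall i, a i <= x ord0 i <= b i].
Proof.
rewrite (_ : [set x | _] = \bigcap_(i in [set: 'I_n]) ((fun x : E => x ord0 i) @^-1` `[a i, b i])).
  apply: closed_bigI => i _; apply: closed_comp; last exact: itv_closed.
  by move=> x _; exact: coord_continuous.
by apply/seteqP; split => x /= h; [move=> i /=; rewrite in_itv/=|move=> i; have := h i I; rewrite /= in_itv].
Qed.

Lemma bounded_coord_box a b : bounded_set [set x : E | forall i, a i <= x ord0 i <= b i].
Proof.
exists (\sum_i (`|a i| + `|b i|)); split; first exact: num_real.
move=> M HM x /= h.
have M0 : 0 <= M by rewrite (le_trans _ (ltW HM))// sumr_ge0; rewrite addr_ge0.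
apply: rV_norm_le => // j.
rewrite (le_trans _ (ltW HM))// (bigD1 j)//= (le_trans (_ : _ <= `|a j| + `|b j|))//; last first.
  by rewrite lerDl sumr_ge0// => k _; rewrite addr_ge0.
have /andP[h1 h2] := h j.
have := ler_norm (b j); have := ler_norm (- a j); rewrite normrN => h3 h4.
have := normr_ge0 (a j); have := normr_ge0 (b j) => h5 h6.
by rewrite ler_norml; apply/andP; split; lra.
Qed.

Lemma tf_boxfun a b k : test_function (box a b) (boxfun a b k).
Proof.
have k0 : 0 < k.+1%:R^-1 :> R by rewrite invr_gt0.
split; first exact: smooth_boxfun.
exists [set x : E | forall i, a i + k.+1%:R^-1 <= x ord0 i <= b i - k.+1%:R^-1]; split.
- by apply: bounded_closed_compact; [exact: bounded_coord_box|exact: closed_coord_box].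
- move=> x /= h i; have /andP[h1 h2] := h i.
  by rewrite (lt_le_trans _ h1) ?ltrDl// (le_lt_trans h2)// gtrBl.
- by move=> x; exact: boxfun_out.
Qed.

Lemma fe_cvg1 (t : R) : 0 < t -> (fun k : nat => fe (k.+1%:R * t - 1)) @ \oo --> (1 : R).
Proof.
move=> t0; apply/cvgrPdist_le => e e0; near=> k.
have ek : (e^-1 + 1) / t <= k%:R by near: k; exact: nbhs_infty_ger.
set s := _ - 1; have es : e^-1 <= s.
  rewrite lerBrDr; rewrite ler_pdivrMr// in ek; apply: (le_trans ek).
  by rewrite ler_pM2r// ler_nat.
have s0 : 0 < s by rewrite (lt_le_trans _ es)// invr_gt0.
rewrite ger0_norm ?subr_ge0 ?fe_le1// feE s0.
have := expR_ge1Dx (- s^-1); have : s^-1 <= e by rewrite -[e]invrK lef_pV2 ?posrE ?invr_gt0.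
by lra.
Unshelve. all: by end_near. Qed.

Lemma cvgM1 (u v : nat -> R) : u @ \oo --> (1 : R) -> v @ \oo --> (1 : R) ->
  (fun k => u k * v k) @ \oo --> (1 : R).
Proof.
move=> hu hv; have h : (fun k => u k * v k) @ \oo --> (1 * 1 : R) by exact: cvgM.
move: h; rewrite mulr1; exact.
Qed.

Lemma cvg_prod1 (J : Type) (l : seq J) (u : J -> nat -> R) :
  (forall j, u j @ \oo --> (1 : R)) -> (fun k => \prod_(j <- l) u j k) @ \oo --> (1 : R).
Proof.
move=> hu; elim: l => [|j l IH]; first by under eq_fun do rewrite big_nil; exact: cvg_cst.
under eq_fun do rewrite big_cons.
exact: cvgM1.
Qed.

Lemma boxfun_cvg a b (x : E) : (fun k => boxfun a b k x) @ \oo --> ((x \in box a b)%:R : R).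
Proof.
have [/set_mem xb|xb] := boolP (x \in box a b).
  apply: cvg_prod1 => i; have /andP[h1 h2] := xb i.
  have c1 : 0 < x ord0 i - a i by rewrite subr_gt0.
  have c2 : 0 < b i - x ord0 i by rewrite subr_gt0.
  by apply: cvgM1; exact: fe_cvg1.
rewrite (_ : (fun => _) = fun=> 0); first exact: cvg_cst.
apply/funext => k; apply: boxfun_out => h; move/negP : xb; apply; apply/mem_set => i.
have /andP[h1 h2] := h i; have k0 : 0 < k.+1%:R^-1 :> R by rewrite invr_gt0.
by rewrite (lt_le_trans _ h1) ?ltrDl// (le_lt_trans h2)// gtrBl.
Qed.

(** Boxes are stable under intersection ([boxI]), so they are a generating family to which Dynkin's
    theorem applies. *)
Lemma sigma_box : @measurable _ E = <<s [set A : set E | exists a b, A = box a b] >>.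
Proof.
set G := [set A : set E | _].
apply/seteqP; split; last first.
  apply: smallest_sub; first exact: sigma_algebra_measurable.
  by move=> _ [a [b ->]]; exact: measurable_box.
apply: smallest_sub => //.
rewrite -bigcup_seq => A [i _ [B mB <-]].
have mc : measurable_fun [set: g_sigma_algebraType G] (fun x : g_sigma_algebraType G => (x : E) ord0 i).
  move=> mT; apply: (measurability _ (RGenOInfty.measurableE R)) => //.
  move=> _ [_ [c ->] <-]; rewrite setTI.
  rewrite (_ : _ _ = \bigcup_k (box (fun j => if j == i then c else - k%:R) (fun=> k%:R))).
    apply: bigcup_measurable => k _; apply: sub_sigma_algebra; by do 2 eexists.
  apply/seteqP; split => [x|x [k _ h]]; last first.
    by have := h i; rewrite eqxx /= in_itv andbT => /andP[].
  rewrite /= in_itv/= andbT => cx; exists (Num.truncn (\sum_j `|(x : E) ord0 j|)).+1 => // j.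
  have xj : `|x ord0 j| < (Num.truncn (\sum_j `|x ord0 j|)).+1%:R.
    rewrite (le_lt_trans _ (truncnS_gt _))// (bigD1 j)//= lerDl sumr_ge0//.
  move: xj; rewrite ltr_norml => /andP[h1 h2]; rewrite h2 andbT.
  by case: eqP => [->|].
by have := mc measurableT B mB; rewrite setTI.
Qed.

Lemma wI_restrict f (A : set E) : measurable A ->
  \int[leb n]_(x in A) f x = \I[x] f x * \1_A x.
Proof.
move=> mA; rewrite Rintegral_mkcond /wI; apply: eq_Rintegral => x _.
by rewrite /one mulr1 /patch indicE; case: ifPn => _; rewrite ?mulr1 ?mulr0.
Qed.

Lemma integrable_wint f : (leb n).-integrable setT (EFin \o f) -> wint one f.
Proof. by apply: eq_integrable => // x /=; rewrite mulr1. Qed.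

(** The integral of [f] over every box in the ball is a limit of integrals against test functions,
    hence 0; Dynkin's theorem extends this to all Borel subsets of the ball. *)
Lemma fundamental_ball f (q : E) (r : R) : 0 < r -> (leb n).-integrable setT (EFin \o f) ->
  (forall psi, test_function (ball q r) psi -> \I[x] f x * psi x = 0) ->
  {ae leb n, forall x, ball q r x -> f x = 0}.
Proof.
move=> r0 hf H0; have wf := integrable_wint hf.
have mf : mbfun f := (measurable_EFinP _ _).1 (measurable_int _ hf).
have mQ := @measurable_ball_rV R n q r.
have H1 a b : \int[leb n]_(x in box a b `&` ball q r) f x = 0.
  rewrite ball_box// boxI; set a' := (fun i => Num.max _ _); set b' := (fun i => Num.min _ _).
  rewrite wI_restrict; last exact: measurable_box.
  have m1 k : mbfun (fun x => f x * boxfun a' b' k x) by apply: mbfunM => //; apply: mbfun_continuous; apply: smooth_continuous; exact: smooth_boxfun.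
  have m2 : mbfun (fun x => f x * \1_(box a' b') x) by apply: mbfunM => //; apply: measurable_indic; exact: measurable_box.
  have bd k x : `|f x * boxfun a' b' k x| <= `|f x| by rewrite normrM ler_piMr// ger0_norm ?boxfun_ge0// boxfun_le1.
  have cv x : one x != 0 -> (fun k => f x * boxfun a' b' k x) @ \oo --> f x * \1_(box a' b') x by move=> _; apply: cvgM; [exact: cvg_cst|rewrite indicE; exact: boxfun_cvg].
  have [_ /cvg_lim <-//] := wI_cvg weight_one m1 m2 (wint_abs weight_one wf) bd cv.
  under eq_fun => k.
    rewrite H0; first over.
    apply: tf_sub (tf_boxfun a' b' k); rewrite ball_box// => x hx i; have := hx i.
    by rewrite gt_max lt_min => /andP[/andP[_ ->] /andP[_ ->]].
  by rewrite lim_cst.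
have iA A : measurable A -> (leb n).-integrable A (EFin \o f) by move=> mA; apply: (integrableS measurableT mA).
have H2 : forall A, <<s [set A : set E| exists a b, A = box a b] >> A ->
 \int[leb n]_(x in A `&` ball q r) f x = 0.
  apply: (@dynkin_induction _ _ _ (fun A => \int[leb n]_(x in A `&` ball q r) f x = 0)).
  - exact: sigma_box.
  - by move=> _ _ [a [b ->]] [a' [b' ->]]; rewrite boxI; do 2 eexists.
  - by rewrite setTI -(setIid (ball q r)) [X in X `&` _]ball_box.
  - by move=> _ [a [b ->]]; exact: H1.
  - move=> A mA HA; have := H1 (fun i => q ord0 i - r) (fun i => q ord0 i + r).
    rewrite -ball_box// setIid -[X in \int[_]_(x in X) _]setIT -(setUv A) setIUr.
    rewrite Rintegral_setU; [|exact: measurableI|by apply: measurableI => //; exact: measurableC| |].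
    + by rewrite setIC HA add0r setIC.
    + by apply: iA; apply: measurableU; apply: measurableI => //; exact: measurableC.
    + apply/disj_set2P; rewrite -setIIr setICr setI0//.
  - move=> Fk mFk tFk HFk; rewrite setI_bigcupl /Rintegral integral_bigcup.
    + rewrite eseries0// => k _ _; rewrite -[LHS]fineK.
        by rewrite -[fine _]/(\int[leb n]_(x in Fk k `&` ball q r) f x) HFk.
      by apply: integrable_fin_num; [exact: measurableI|apply: iA; exact: measurableI].
    + exact: trivIset_setIr.
    + by move=> k; exact: measurableI.
    + by apply: iA; apply: bigcup_measurable => k _; exact: measurableI.
have H3 := @integral_ae_eq _ _ _ (leb n) _ mQ (cst 0%E) _ (iA _ mQ) (measurable_cst _).
have : ae_eq (leb n) (ball q r) (EFin \o f) (cst 0%E).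
  apply: H3 => A AQ mA; rewrite integral0.
  have := H2 A; rewrite -sigma_box => /(_ mA); rewrite (setIidl AQ) => HA.
  rewrite -[LHS]fineK; first by rewrite -/(\int[leb n]_(x in A) f x) HA.
  by apply: integrable_fin_num => //; exact: iA.
by apply: filterS => x h xQ; have [] := h xQ.
Qed.

Lemma fundamental_lemma (U : set E) f : open U -> loc_integrable U f ->
  (forall psi, test_function U psi -> \int[leb n]_(x in U) (f x * psi x) = 0) ->
  {ae leb n, forall x, U x -> f x = 0}.
Proof.
move=> oU [mf lf] H0; have mU := measurable_open oU.
pose P := [set p : 'rV[rat]_n * nat| ball (qvec p.1) (p.2.+1%:R^-1 *+ 2) `<=` U].
have HP p : P p -> {ae leb n, forall x, ball (qvec p.1) (p.2.+1%:R^-1) x -> f x = 0}.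
  move=> Pp; set q := qvec p.1; set r : R := p.2.+1%:R^-1.
  have r0 : 0 < r by rewrite invr_gt0.
  have QU : ball q r `<=` U by apply: subset_trans Pp; apply: le_ball; rewrite mulr2n lerDl ltW.
  have mQ := @measurable_ball_rV R n q r.
  have iQ : (leb n).-integrable (ball q r) (EFin \o f).
    pose K := [set x : E | forall i, q ord0 i - r <= x ord0 i <= q ord0 i + r].
    have cK : compact K by apply: bounded_closed_compact; [exact: bounded_coord_box|exact: closed_coord_box].
    have mK : measurable K by apply: measurable_closed; exact: closed_coord_box.
    apply: (integrableS mK mQ); last first.
      apply: lf => // x Kx; apply: Pp; apply/ball_rVP; split; first by rewrite mulrn_wgt0.
      move=> i; have /andP[h1 h2] := Kx i; rewrite -/q -/r ltr_distlC mulr2n; apply/andP; split; lra.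
    by rewrite ball_box// => x hx i; have /andP[/ltW-> /ltW->] := hx i.
  pose g x := f x * \1_(ball q r) x.
  have ig : (leb n).-integrable setT (EFin \o g).
    move/(integrable_mkcond _ mQ) : iQ; apply: eq_integrable => // x _ /=.
    by rewrite /patch /g indicE; case: ifPn => _; rewrite ?mulr1 ?mulr0.
  apply: filterS (fundamental_ball r0 ig _).
    by move=> x h xQ; have := h xQ; rewrite /g indicE mem_set// mulr1.
  move=> psi tpsi; rewrite -(H0 psi); last exact: tf_sub tpsi.
  rewrite wI_restrict//; apply: wI_ext => x; rewrite /g !indicE.
  have [xQ|xQ] := boolP (x \in (ball q r : set E)).
    by rewrite (mem_set (QU _ (set_mem xQ))) !mulr1.
  have [_ [K [_ KQ ->]]] := tpsi; first lra.
  by move=> /KQ/mem_set; apply/negP.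
suff : {ae leb n, forall x, forall p, P p -> ball (qvec p.1) (p.2.+1%:R^-1) x -> f x = 0}.
  apply: filterS => x h; rewrite (open_bigcup_qball oU) => -[p Pp px].
  exact: h Pp px.
have : forall k, {ae leb n, forall x, forall p, pickle p = k -> P p -> ball (qvec p.1) (p.2.+1%:R^-1) x -> f x = 0}.
  move=> k; have [[p [pk Pp]]|h] := pselect (exists p, pickle p = k /\ P p).
    apply: filterS (HP p Pp) => x h p' p'k _.
    by have -> : p' = p by apply: (pcan_inj pickleK); rewrite pk p'k.
  by apply: aeW => x p pk Pp; exfalso; apply: h; exists p.
by move=> /ae_foralln; apply: filterS => x h p; exact: h (pickle p) p erefl.
Qed.

End fundamental_lemma.

Notation "\I [ x ] F" := (wI one (fun x => F)) (at level 34, x name, F at level 41).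

(** * Means along segments *)

Section line_averages.
Context {R : realType} {n : nat}.
Local Notation E := 'rV[R]_n.
Local Notation mu := (@lebesgue_measure R).
Local Notation I1 := (wI (@one R n)).
Implicit Types (f g w zeta psi : E -> R) (v x : E) (s t : R).

Definition dirder v f : E -> R := fun x => \sum_i v ord0 i * partial i f x.

Lemma tf_dirder (U : set E) v psi : test_function U psi -> test_function U (dirder v psi).
Proof.
move=> tpsi; have [_ [K [cK KU _]]] := tpsi.
rewrite /dirder; elim: index_enum => [|i l IH].
  split; first by under eq_fun do rewrite big_nil; exact: smooth_cst.
  by exists K; split => // x; rewrite big_nil.
under eq_fun do rewrite big_cons.
by apply: tfD => //; apply: tfZ; exact: tf_partial.
Qed.

(** The translation acts on the test function, so neither smoothness of [f] nor invariance of the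
    weight is required to differentiate under the integral. *)
Lemma wI_translate_derive w f v zeta t : weight w -> mbfun f -> wint w f -> test_function setT zeta ->
  is_derive t 1 (fun s => wI w (fun x => f x * zeta (x + s *: v)))
    (wI w (fun x => f x * dirder v zeta (x + t *: v))).
Proof.
move=> hw mf hf tz.
have [mz [C [r [r0 zC _]]]] := tf_bmfun tz.
have [mz' [C' [r' [r0' zC' _]]]] := tf_bmfun (tf_dirder v tz).
have bd h D s : mbfun h -> (forall x, `|h x| <= D) -> wint w (fun x => f x * h (x + s *: v)).
  move=> mh hD; apply: (@wint_le _ _ w hw _ (fun x => D * `|f x|)); last exact: wintZ (wint_abs hw hf).
    by apply: mbfunM => //; exact: mbfun_translate.
  by move=> x; rewrite normrM mulrC ler_wpM2r.
apply: (@wI_derive _ _ w hw (fun s x => f x * zeta _) (fun s x => f x * dirder v zeta _) (fun x => C' * `|f x|) t 1) => //.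
- by apply: wintZ => //; exact: wint_abs.
- by move=> s _; exact: bd zC.
- move=> s x _; rewrite mulrC.
  have D : is_derive s 1 (fun s => zeta (x + s *: v)) (dirder v zeta (x + s *: v)) by apply: smooth_is_derive; exact: tf_smooth tz.
  have := is_derive_mulr (f x) D; apply: is_derive_ext => y; by rewrite mulrC.
- by move=> s x; rewrite normrM mulrC ler_wpM2r.
Qed.

Lemma dirder_delta i psi x : dirder 'e_i psi x = partial i psi x.
Proof.
rewrite /dirder (bigD1 i)//= big1 ?addr0 ?mxE ?eqxx ?mul1r// => j ji.
by rewrite mxE (negbTE ji) andbF mul0r.
Qed.

Lemma wint_one_bmfun f : bmfun f -> wint (@one R n) f.
Proof. by apply: wint_bmfun; exact: weight_one. Qed.

Lemma ball0E x (r : R) : ball (0 : E) r x = (`|x| < r) :> Prop.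
Proof. by rewrite ballE sub0r normrN. Qed.

Lemma bmfun_indic_ball (c : E) s : 0 < s -> bmfun (\1_(ball c s) : E -> R).
Proof.
move=> s0; split; first by apply: measurable_indic; exact: measurable_ball_rV.
exists 1, (`|c| + s); split => [|x|x xb]//.
  by rewrite indicE; case: (_ \in _); rewrite ?normr1 ?normr0.
rewrite indicE memNset// => h; apply: xb; rewrite ball0E.
move: h; rewrite ballEC => h.
by have := ler_normD (x - c) c; rewrite subrK; lra.
Qed.

Lemma wI_ball (c : E) s : 0 < s -> I1 (\1_(ball c s) : E -> R) = (s *+ 2) ^+ n.
Proof.
move=> s0; have mb := measurable_ball_rV c s; rewrite /wI /Rintegral; under eq_integral do rewrite /one mulr1.
by rewrite integral_indic//= setIT leb_ball.
Qed.

Lemma norm_one_le1 (x : E) : `|(1 : R)| <= 1. Proof. by rewrite normr1. Qed.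

(** The integral of psi(x + t e) does not depend on t, and its derivative at t = 0 is the left-hand
    side. The indicator of a large ball replaces the constant 1, which is not integrable. *)
Lemma I1_partial i psi : test_function setT psi -> I1 (partial i psi) = 0.
Proof.
move=> tpsi; set e := 'e_i : E.
have ne : `|e| <= 1 := norm_delta _.
have [mz [C [r [r0 zC z0]]]] := tf_bmfun tpsi.
have [mz' [C' [r' [r0' zC' z0']]]] := tf_bmfun (tf_partial i tpsi).
pose B : set E := ball (0 : E) (r + r' + 1).
have mB : measurable B by exact: measurable_ball_rV.
have bB : bmfun (\1_B : E -> R) by exact: bmfun_indic_ball.
have := wI_translate_derive e 0 (@weight_one R n) bB.1 (wint_one_bmfun bB) tpsi.
have far h (ρ : R) s : (forall x, ~ ball 0 ρ x -> h x = 0) -> ρ <= r + r' -> `|s| <= 1 ->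
 \I[x] \1_B x * h (x + s *: e) = \I[x] h (x + s *: e).
  move=> h0 hρ hs; apply: wI_ext => x; rewrite indicE.
  have [|xB] := boolP (x \in B); first by rewrite mul1r.
  rewrite mul0r h0// => xse; move/negP : xB; apply; apply/mem_set.
  rewrite /B !ball0E in xse *.
  rewrite -[x](addrK (s *: e)) (le_lt_trans (ler_normB _ _))//.
  have : `|s *: e| <= 1 by rewrite normrZ mulr_ile1.
  by lra.
move=> D.
have Ec : \forall t \near (0 : R), \I[x] \1_B x * psi (x + t *: e) = I1 psi.
  have := nbhs0_lt (V := R) ltr01; apply: filterS => t t1.
  rewrite (far psi r)//; [|lra|lra].
  by have [_ ->] := wI_translate (v := t *: e) (wint_one_bmfun (tf_bmfun tpsi)) (fun=> erefl).
have D0 := is_derive_near Ec D.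
have D1 : is_derive (0 : R) 1 (fun=> I1 psi) 0 by exact: is_derive_cst.
have := (@derive_val _ _ _ _ _ _ _ D0); rewrite derive_val => /esym.
rewrite (far _ r'); last 3 first.
- by move=> x /z0'; rewrite dirder_delta.
- by rewrite lerDr ltW.
- by rewrite normr0.
by move=> <-; apply: wI_ext => x; rewrite scale0r addr0 dirder_delta.
Qed.

(** The mean of [g] over the segment from [x] to [x + v]. When [g] is the weak derivative of a
    function in the direction [v], this mean is the increment of that function ([dgrad_lavg]). *)
Definition lavg v g x : R := \int[mu]_s (g (x + s *: v) * \1_`[0, 1]%classic s).

Let m1 : {sigma_finite_measure set E -> \bar R} := @leb R n.
Let m2 : {sigma_finite_measure set (measurableTypeR R) -> \bar R} := mu.

Lemma measurable_line v : measurable_fun setT (fun p : E * measurableTypeR R => p.1 + p.2 *: v).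
Proof.
apply: measurable_fun_coordP => i.
rewrite (_ : (fun => _) = (fun p : E * measurableTypeR R => p.1 ord0 i + p.2 * v ord0 i)); last first.
  by apply/funext => p; rewrite !mxE.
apply: measurable_funD.
  exact: (measurableT_comp (@measurable_coord R n i) measurable_fst).
by apply: measurable_funM; [exact: measurable_snd|exact: measurable_cst].
Qed.

Definition lavg2 v g chi (p : E * measurableTypeR R) : \bar R :=
  (g (p.1 + p.2 *: v) * \1_`[0, 1]%classic (p.2 : R) * chi p.1)%:E.

Lemma measurable_lavg2 v g chi : mbfun g -> mbfun chi -> measurable_fun setT (lavg2 v g chi).
Proof.
move=> mg mchi; apply/measurable_EFinP.
apply: measurable_funM; last exact: measurableT_comp.
apply: measurable_funM; first exact: (measurableT_comp mg (measurable_line v)).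
by apply: (measurableT_comp _ measurable_snd); exact: measurable_indic.
Qed.

Lemma ge0_lavg2 v (g : E -> R) w : mbfun g -> (forall x, 0 <= g x) -> weight w ->
  (forall s x, w (x + s *: v) = w x) ->
  (\int[m2]_s \int[m1]_x lavg2 v g w (x, s) = \int[m1]_x (g x * w x)%:E)%E.
Proof.
move=> mg g0 hw wv; have w0 := weight_ge0 hw; have mw := weight_mfun hw.
transitivity (\int[m2]_s ((\int[m1]_x (g x * w x)%:E) * (\1_`[0, 1]%classic s)%:E))%E.
  apply: eq_integral => s _.
  rewrite -(ge0_integral_translate (s *: v) (f := fun x => (g x * w x)%:E)); last 2 first.
  - by apply/measurable_EFinP; exact: mbfunM.
  - by move=> x; rewrite lee_fin mulr_ge0.
  rewrite muleC -ge0_integralZl//=; last 2 first.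
  - apply/measurable_EFinP; apply: mbfunM.
      exact: mbfun_translate.
    exact: mbfun_translate.
  - by move=> x; rewrite lee_fin mulr_ge0.
  apply: eq_integral => x _; rewrite /lavg2/=; congr EFin.
  by rewrite wv; ring.
rewrite ge0_integralZl//=; last 2 first.
- by apply/measurable_EFinP; exact: measurable_indic.
- by apply: integral_ge0 => x; rewrite lee_fin mulr_ge0.
rewrite /m2 integral_indic//= setIT lebesgue_measure_itv/= lte_fin ltr01 oppr0 adde0 mule1//.
Qed.

Lemma integrable_lavg2 v g chi C : mbfun g -> wint (@one R n) g -> mbfun chi ->
  (forall x, `|chi x| <= C) -> (m1 \x m2)%E.-integrable setT (lavg2 v g chi).
Proof.
move=> mg hg mchi hC.
have C0 : 0 <= C by rewrite (le_trans _ (hC 0)).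
apply: (@le_integrable _ _ _ _ _ measurableT _ (lavg2 v (fun x => C * `|g x|) one)).
- exact: measurable_lavg2.
- move=> [x s] _; rewrite /lavg2/= mulr1 lee_fin !normrM normr_id (ger0_norm C0).
  by rewrite [_ * `|chi x|]mulrC -!mulrA ler_wpM2r// mulr_ge0.
have mCg : mbfun (fun x => C * `|g x|) by [].
apply: (proj2 (@integrable21ltyP _ _ _ _ R m1 m2 _ (measurable_lavg2 v mCg (mbfun_cst 1)))).
have := @ge0_lavg2 v (fun x => C * `|g x|) (@one R n) mCg _ weight_one (fun _ _ => erefl).
move=> H; rewrite (_ : (\int[_]_y _)%E = (\int[m2]_s \int[m1]_x lavg2 v (fun x => C * `|g x|)%R one (x, s))%E); last first.
  apply: eq_integral => s _; apply: eq_integral => x; rewrite gee0_abs// lee_fin /=.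
  by rewrite !mulr_ge0.
rewrite H; last by move=> x; rewrite mulr_ge0.
have /integrableP[_] := wintZ C (wint_abs weight_one hg).
apply: le_lt_trans; apply: eqW.
by apply: eq_integral => x; rewrite gee0_abs// lee_fin mulr_ge0.
Qed.

Lemma lavg_fubini v g chi C : mbfun g -> wint (@one R n) g -> mbfun chi ->
  (forall x, `|chi x| <= C) ->
  [/\ {ae leb n, forall x, m2.-integrable setT (fun s : R => (g (x + s *: v) * \1_`[0, 1]%classic s)%:E)},
    mbfun (lavg v g), wint (@one R n) (lavg v g) &
    (\int[leb n]_x (lavg v g x * chi x)%:E =
      \int[m2]_s \int[m1]_x lavg2 v g chi (x, s))%E].
Proof.
move=> mg hg mchi hC.
have i1 := integrable_lavg2 v mg hg (mbfun_cst 1) norm_one_le1.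
have i2 := integrable_lavg2 v mg hg mchi hC.
have A1 : {ae leb n, forall x, m2.-integrable setT (fun s : R => (g (x + s *: v) * \1_`[0, 1]%classic s)%:E)}.
  have := ae_integrable1 i1; apply: filterS => x; apply: eq_integrable => // s _.
  by rewrite /lavg2 mulr1.
have F1 := integrable_fubini_F i1.
have lE x : lavg v g x = fine (fubini_F m2 (lavg2 v g (fun=> 1)) x) by rewrite /lavg /fubini_F /Rintegral; congr fine; apply: eq_integral => s; rewrite /lavg2 mulr1.
have mF := measurable_fubini_F i1.
have ml : mbfun (lavg v g).
  rewrite /mbfun (_ : lavg v g = fine \o fubini_F m2 (lavg2 v g (fun=> 1))).
    by apply: measurableT_comp.
  by apply/funext => x; exact: lE.
have wl : wint (@one R n) (lavg v g).
  apply: (le_integrable measurableT _ _ F1).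
    by apply/measurable_EFinP; apply: mbfunM => //; exact: mbfun_cst.
  move=> x _; rewrite /one mulr1 lE.
  by case: (fubini_F _ _ x) => [r| |] /=; rewrite ?normr0 ?leey// ltry.
split => //.
rewrite -(Fubini i2); apply: ae_eq_integral => //.
- by apply/measurable_EFinP; exact: mbfunM.
- exact: (measurable_fubini_F i2).
move: A1; apply: filterS => x ix _; rewrite /lavg.
have -> : (\int[m2]_y lavg2 v g chi (x, y) = \int[m2]_s (chi x * (g (x + s *: v) * \1_`[0, 1]%classic s))%:E)%E by apply: eq_integral => s; rewrite /lavg2 mulrC.
rewrite -[RHS]fineK.
  congr EFin; rewrite mulrC -RintegralZl//.
apply: integrable_fin_num => //; exact: (integrableZl measurableT (chi x) ix).
Qed.

Lemma integrable_indic01 (c : R) : m2.-integrable setT (fun s : R => (c * \1_`[0, 1]%classic s)%:E).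
Proof.
have i1 : m2.-integrable setT (fun s : R => (\1_`[0, 1]%classic s)%:E) by exact: integrable_indic_itv.
by have := integrableZl measurableT c i1; apply: eq_integrable => // s _; rewrite /= EFinM.
Qed.

Lemma integral_indic01 (c : R) : \int[m2]_s (c * \1_`[0, 1]%classic (s : R)) = c.
Proof.
rewrite RintegralZl//; last exact: integrable_indic_itv.
by rewrite /Rintegral /m2 integral_indic//= setIT lebesgue_measure_itv/= lte_fin ltr01/=; ring.
Qed.

(** Jensen's inequality on each segment, followed by Tonelli and the invariance of the weight along
    [v]. *)
Lemma lavg_sqr v g w : mbfun g -> wint (@one R n) g -> weight w -> l2 w g ->
  (forall s x, w (x + s *: v) = w x) ->
  wint w (fun x => lavg v g x ^+ 2) /\ wI w (fun x => lavg v g x ^+ 2) <= wI w (fun x => g x ^+ 2).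
Proof.
move=> mg hg hw [_ lg] wv; have w0 := weight_ge0 hw; have mw := weight_mfun hw.
have [A1 ml _ _] := lavg_fubini v mg hg (mbfun_cst 1) norm_one_le1.
have mg2 : mbfun (fun x => g x ^+ 2) by [].
have mlw : measurable_fun setT (fun x : E => (lavg v g x ^+ 2 * w x)%:E) by apply/measurable_EFinP; apply: mbfunM => //; exact: mbfunX.
pose H := lavg2 v (fun x => g x ^+ 2) w.
have mH : measurable_fun setT H by exact: measurable_lavg2.
have H0 p : (0 <= H p)%E by rewrite lee_fin; apply: mulr_ge0 => //; apply: mulr_ge0 => //; exact: sqr_ge0.
have key : (\int[leb n]_x (lavg v g x ^+ 2 * w x)%:E <= \int[leb n]_x (g x ^+ 2 * w x)%:E)%E.
  have := @ge0_lavg2 v (fun x => g x ^+ 2) w mg2 (fun => sqr_ge0 _) hw wv.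
  rewrite -(fubini_tonelli H)// /m1 => <-.
  apply: ae_ge0_le_integral => //.
  - by move=> x _; rewrite lee_fin mulr_ge0// sqr_ge0.
  - by move=> x _; apply: integral_ge0.
  - exact: (measurable_fun_fubini_tonelli_F H).
  move: A1; apply: filterS => x ix _.
  have [->|wx0] := eqVneq (w x) 0; first by rewrite mulr0 integral_ge0.
  have wxp : 0 < w x by rewrite lt_neqAle eq_sym wx0 w0.
  have [oo|oo] := ltP (\int[m2]_y H (x, y))%E +oo%E; last by rewrite (le_trans _ oo)// leey.
  set c := lavg v g x.
  have mgx : measurable_fun [set: measurableTypeR R] (fun s : R => g (x + s *: v)).
    apply: (measurableT_comp mg); apply: measurable_fun_coordP => i.
    rewrite (_ : (fun _ => _) = (fun s : R => x ord0 i + s * v ord0 i)); last by apply/funext => s; rewrite !mxE.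
    by apply: measurable_funD; [exact: measurable_cst|apply: measurable_funM => //; exact: measurable_cst].
  have mind : measurable_fun [set: measurableTypeR R] (fun s : R => \1_`[0, 1]%classic s : R) by exact: measurable_indic.
  have iH : m2.-integrable setT (fun y => H (x, y)).
    apply/integrableP; split.
      rewrite /H /lavg2/=; apply/measurable_EFinP; apply: measurable_funM => //.
      by apply: measurable_funM => //; exact: measurable_funX.
    by under eq_integral do rewrite gee0_abs//.
  have i2 : m2.-integrable setT (EFin \o (fun s : R => g (x + s *: v) ^+ 2 * \1_`[0, 1]%classic s)).
    have := integrableZl measurableT (w x)^-1 iH; apply: eq_integrable => // s _.
    by rewrite /H /lavg2 -EFinM; congr EFin; field.
  have i3 : m2.-integrable setT (EFin \o (fun s : R => c ^+ 2 * \1_`[0, 1]%classic s)) by exact: integrable_indic01.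
  have e2 : \int[m2]_s (2 * c * (g (x + s *: v) * \1_`[0, 1]%classic s)) = 2 * c * c by rewrite RintegralZl.
  have e3 : \int[m2]_s (c ^+ 2 * \1_`[0, 1]%classic s) = c ^+ 2 by exact: integral_indic01.
  (* Jensen by expanding the square of g - c along the segment, where c is the mean. *)
  have e4 : \int[m2]_s (2 * c * (g (x + s *: v) * \1_`[0, 1]%classic s)) <=
 \int[m2]_s (g (x + s *: v) ^+ 2 * \1_`[0, 1]%classic s + c ^+ 2 * \1_`[0, 1]%classic s).
    apply: le_Rintegral => //.
    - exact: (integrableZl measurableT (2 * c) ix).
    - exact: (integrableD measurableT i2 i3).
    - move=> s _; rewrite -mulrDl mulrA ler_wpM2r//.
      by have := sqr_ge0 (g (x + s *: v) - c); rewrite sqrrB; lra.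
  rewrite RintegralD// e2 e3 in e4.
  have e5 : c ^+ 2 <= \int[m2]_s (g (x + s *: v) ^+ 2 * \1_`[0, 1]%classic (s : R)) by rewrite expr2 in e4; lra.
  rewrite -[leRHS]fineK; last exact: integrable_fin_num.
  rewrite lee_fin (_ : fine _ = \int[m2]_s (w x * (g (x + s *: v) ^+ 2 * \1_`[0, 1]%classic s))); last first.
    by apply: eq_Rintegral => s; rewrite mulrC.
  by rewrite RintegralZl// mulrC ler_wpM2l.
have fg := integrable_fin_num measurableT lg.
have ilw : wint w (fun x => lavg v g x ^+ 2).
  apply/integrableP; split => //.
  have ab x : (`|(lavg v g x ^+ 2 * w x)%:E| = (lavg v g x ^+ 2 * w x)%:E)%E by rewrite gee0_abs// lee_fin mulr_ge0// sqr_ge0.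
  under eq_integral do rewrite ab.
  by apply: le_lt_trans key _; rewrite -ge0_fin_numE// integral_ge0// => x _; rewrite lee_fin mulr_ge0// sqr_ge0.
split => //; rewrite /wI /Rintegral; apply: fine_le => //; exact: integrable_fin_num.
Qed.

Lemma lavg_int v g chi C : mbfun g -> wint (@one R n) g -> mbfun chi -> (forall x, `|chi x| <= C) ->
  m2.-integrable setT (fun s : R => ((\I[x] g x * chi (x - s *: v)) * \1_`[0, 1]%classic s)%:E) /\
  \I[x] lavg v g x * chi x = \int[m2]_s ((\I[x] g x * chi (x - s *: v)) * \1_`[0, 1]%classic (s : R)).
Proof.
move=> mg hg mchi hC.
have [_ _ _ E0] := lavg_fubini v mg hg mchi hC.
have mG := measurable_fubini_G (integrable_lavg2 v mg hg mchi hC).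
have wgc s : wint one (fun x => g x * chi (x - s *: v)).
  apply: (@wint_le _ _ _ weight_one _ (fun x => C * `|g x|)).
  - by apply: mbfunM => //; exact: (mbfun_translate (- (s *: v))).
  - by move=> x; rewrite normrM mulrC ler_wpM2r.
  - exact: (wintZ C (wint_abs weight_one hg)).
have GE s : (fubini_G m1 (lavg2 v g chi) s = ((\I[x] g x * chi (x - s *: v)) * \1_`[0, 1]%classic s)%:E)%E.
  have [w1 I1E] := wI_translate (v := s *: v) (wgc s) (fun=> erefl).
  rewrite -I1E /fubini_G EFinM muleC -EFinM mulrC EFinM.
  rewrite fineK; last exact: integrable_fin_num.
  rewrite muleC -integralZl//; apply: eq_integral => x _.
  by rewrite /lavg2/= addrK -EFinM /one; congr EFin; ring.
split.
  apply: (le_integrable measurableT _ _ (integrable_indic01 (C * \I[x] (`|g x|)))).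
  - rewrite (_ : (fun s : R => _) = fubini_G m1 (lavg2 v g chi)); first exact: mG.
    by apply/funext => s; rewrite GE.
  - move=> s _; rewrite /= lee_fin !normrM ler_wpM2r//.
    apply: le_trans (wI_abs weight_one (wgc s)) _.
    have C0 : 0 <= C by rewrite (le_trans _ (hC 0)).
    rewrite (ger0_norm C0) ger0_norm; last by apply: (wI_ge0 weight_one).
    rewrite -(wIZ C (wint_abs weight_one hg)).
    apply: (wI_le weight_one); [exact: (wint_abs weight_one)|exact: (wintZ C (wint_abs weight_one hg))|].
    by move=> x; rewrite normrM mulrC ler_wpM2r.
rewrite /wI; congr fine.
have -> : (\int[leb n]_x (lavg v g x * chi x * one x)%:E = \int[leb n]_x (lavg v g x * chi x)%:E)%E by apply: eq_integral => x; rewrite /one mulr1.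
by rewrite E0; apply: eq_integral => s; rewrite -GE.
Qed.

(** Replacing a segment mean of [g] by [g] itself costs only the deviation of [kappa] from [chi]
    along the segment. This converts uniform convergence of the test factor into convergence of the
    pairing. *)
Lemma lavg_test v g chi kappa C e : mbfun g -> wint (@one R n) g -> mbfun chi -> mbfun kappa ->
  (forall x, `|chi x| <= C) -> (forall x, `|kappa x| <= C) ->
  (forall s x, 0 <= s <= 1 -> `|chi (x - s *: v) - kappa x| <= e) ->
  `|\I[x] lavg v g x * chi x - \I[x] g x * kappa x| <= e * \I[x] (`|g x|).
Proof.
move=> mg hg mchi mk hC hK he.
have [i1 ->] := lavg_int v mg hg mchi hC.
rewrite -[X in - X]integral_indic01 -RintegralB//; last exact: integrable_indic01.
have i2 := integrableB measurableT i1 (integrable_indic01 (\I[x] g x * kappa x)).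
apply: le_trans (le_normr_Rintegral measurableT i2) _.
rewrite -[leRHS]integral_indic01; apply: le_Rintegral => //.
- exact: integrable_norm i2.
- exact: integrable_indic01.
move=> s _; rewrite -mulrBl normrM indicE.
have [/set_mem|] := boolP (s \in (`[0, 1]%classic : set R)); last by rewrite normr0 !mulr0.
rewrite /= in_itv/= => s01; rewrite normr1 !mulr1.
have w1 h : mbfun h -> (forall x, `|h x| <= C) -> wint one (fun x => g x * h x).
  move=> mh hh; apply: (@wint_le _ _ _ weight_one _ (fun x => C * `|g x|)).
  - exact: mbfunM.
  - by move=> x; rewrite normrM mulrC ler_wpM2r.
  - exact: (wintZ C (wint_abs weight_one hg)).
have wa : wint (@one R n) (fun x => g x * chi (x - s *: v)) by apply: (w1 (fun x => chi (x - s *: v))) => //; exact: (mbfun_translate (- (s *: v))).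
have wb := w1 _ mk hK.
rewrite -wIB//.
apply: le_trans (wI_abs weight_one (wintB wa wb)) _.
rewrite -(wIZ e (wint_abs weight_one hg)).
apply: (wI_le weight_one); [exact: (wint_abs weight_one (wintB wa wb))|..].
  exact: (wintZ e (wint_abs weight_one hg)).
by move=> x; rewrite -mulrBr normrM mulrC ler_wpM2r// he.
Qed.

End line_averages.

(** * Weak gradients, increments, and the chain rule for squares *)

Section weak_gradient.
Context {R : realType} {n : nat}.
Local Notation E := 'rV[R]_n.
Local Notation mu := (@lebesgue_measure R).
Local Notation wint1 := (wint (@one R n)).
Implicit Types (f g w psi chi : E -> R) (v x : E) (s t : R) (U V : set E) (G : 'I_n -> E -> R).

(** [G] is a weak gradient of [f] on [U]. The integrals extend over the whole space because test
    functions vanish off [U]; hence [f] and [G] may take any values there. *)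
Definition dgrad U f G := forall i psi, test_function U psi ->
  \I[x] f x * partial i psi x = - \I[x] G i x * psi x.

Definition gdir v G : E -> R := fun x => \sum_i v ord0 i * G i x.

Lemma dgrad_sub U V f G : V `<=` U -> dgrad U f G -> dgrad V f G.
Proof. by move=> VU h i psi tpsi; apply: h; exact: tf_sub tpsi. Qed.

Lemma wint1_tf f psi U : mbfun f -> wint1 f -> test_function U psi -> wint1 (fun x => f x * psi x).
Proof.
move=> mf hf tpsi; have [mp [C [r [_ hC _]]]] := tf_bmfun tpsi.
apply: (@wint_le _ _ _ weight_one _ (fun x => C * `|f x|)) => //.
  by move=> x; rewrite normrM mulrC ler_wpM2r.
exact: (wintZ C (wint_abs weight_one hf)).
Qed.

Lemma gdir_mbfun v G : (forall i, mbfun (G i)) -> mbfun (gdir v G).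
Proof. by move=> mG; apply: mbfun_sum => i; exact: mbfunZ. Qed.

Lemma gdir_wint w v G : (forall i, wint w (G i)) -> wint w (gdir v G).
Proof. by move=> mG; apply: wint_sum => i; apply: wintZ. Qed.

Lemma dgrad_dirder U f G v psi : mbfun f -> wint1 f -> (forall i, mbfun (G i)) ->
  (forall i, wint1 (G i)) -> dgrad U f G -> test_function U psi ->
  \I[x] f x * dirder v psi x = - \I[x] gdir v G x * psi x.
Proof.
move=> mf hf mG hG hd tpsi.
have wfi i : wint1 (fun x => f x * partial i psi x) by apply: wint1_tf (tf_partial i tpsi).
have wGi i : wint1 (fun x => G i x * psi x) by apply: wint1_tf tpsi.
transitivity (\sum_i v ord0 i * \I[x] f x * partial i psi x).
  under [RHS]eq_bigr do rewrite -wIZ//.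
  rewrite -wI_sum; last by move=> i; exact: wintZ.
  by apply: wI_ext => x; rewrite mulr_sumr; apply: eq_bigr => i; rewrite mulrCA.
under eq_bigr do rewrite hd// mulrN -wIZ//.
rewrite sumrN -wI_sum; last by move=> i; exact: wintZ.
congr (- _); apply: wI_ext => x; rewrite mulr_suml; apply: eq_bigr => i _.
by rewrite mulrA.
Qed.

Lemma dgrad_line_derive U f G v psi s : mbfun f -> wint1 f -> (forall i, mbfun (G i)) ->
  (forall i, wint1 (G i)) -> dgrad U f G -> test_function U (fun x => psi (x - s *: v)) ->
  is_derive s 1 (fun s => \I[x] f x * psi (x - s *: v)) (\I[x] gdir v G x * psi (x - s *: v)).
Proof.
move=> mf hf mG hG hd tpsi.
have t0 : test_function setT psi.
  have /(tf_sub (@subsetT _ _)) := tf_translate (s *: v) tpsi.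
  by under eq_fun do rewrite addrK.
have := wI_translate_derive (- v) s weight_one mf hf t0.
rewrite (_ : _ _ = \I[x] gdir v G x * psi (x - s *: v)).
  by apply: is_derive_ext => t; apply: wI_ext => x; rewrite scalerN.
rewrite -[RHS]opprK -(dgrad_dirder v mf hf mG hG hd tpsi) -wIN.
apply: wI_ext => x; rewrite -mulrN; congr (_ _).
rewrite /dirder -sumrN; apply: eq_bigr => i _.
rewrite mxE mulNr scalerN; congr (- (_ _)).
by rewrite (partial_translate i (- (s *: v)) psi).
Qed.

Lemma wI_difference U f psi v : mbfun f -> wint1 f ->
  (forall s, 0 <= s <= 1 -> test_function U (fun x => psi (x - s *: v))) ->
  \I[x] (f (x + v) - f x) * psi x = \I[x] f x * psi (x - 1 *: v) - \I[x] f x * psi (x - 0 *: v).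
Proof.
move=> mf hf tpsi; have w s : 0 <= s <= 1 -> wint1 (fun x => f x * psi (x - s *: v)) by move=> /tpsi; exact: wint1_tf.
have w0 := w 0; have w1 := w 1; rewrite lexx ler01/= in w0; rewrite lexx ler01/= in w1.
have [w1' <-] := wI_translate (v := v) (w1 isT) (fun=> erefl).
rewrite -wIB//; last exact: w0.
by apply: wI_ext => x; rewrite scale1r addrK scale0r subr0 mulrBl.
Qed.

Lemma dgrad_line_mvt U f G v psi : mbfun f -> wint1 f -> (forall i, mbfun (G i)) ->
  (forall i, wint1 (G i)) -> dgrad U f G ->
  (forall s, 0 <= s <= 1 -> test_function U (fun x => psi (x - s *: v))) ->
  exists2 s, 0 <= s <= 1 & \I[x] (f (x + v) - f x) * psi x = \I[x] gdir v G x * psi (x - s *: v).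
Proof.
move=> mf hf mG hG hd tpsi.
have [s s01 E1] := MVT_is_derive ler01 (fun s s01 => dgrad_line_derive mf hf mG hG hd (tpsi s s01)).
exists s => //; rewrite subr0 mulr1 in E1; rewrite -E1; exact: wI_difference mf hf tpsi.
Qed.

(** Both sides are tested against [psi]. The function s -> int f psi(. - s v) is C^1 with derivative
    int (v . G) psi(. - s v), so the fundamental theorem of calculus and Fubini identify the two
    pairings, and the fundamental lemma removes [psi]. *)
Lemma dgrad_lavg U V f G v : mbfun f -> wint1 f -> (forall i, mbfun (G i)) ->
  (forall i, wint1 (G i)) -> dgrad U f G -> open V ->
  (forall x s, V x -> 0 <= s <= 1 -> U (x + s *: v)) ->
  {ae leb n, forall x, V x -> f (x + v) - f x = lavg v (gdir v G) x}.
Proof.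
move=> mf hf mG hG hd oV VU.
have mg := gdir_mbfun v mG; have hg := gdir_wint v hG.
have [_ ml wl _] := lavg_fubini v mg hg (mbfun_cst 1) norm_one_le1.
pose h x := f (x + v) - f x - lavg v (gdir v G) x.
have [wfv _] := wI_translate (v := v) hf (fun=> erefl).
have mfv : mbfun (fun x => f (x + v)) by [].
have wh : wint1 h by apply: wintB => //; exact: wintB.
have mh : mbfun h by apply: mbfunB => //; exact: mbfunB.
have ih : (leb n).-integrable setT (EFin \o h) by move: wh; apply: eq_integrable => // x; rewrite /one mulr1.
suff : {ae leb n, forall x, V x -> h x = 0}.
  by apply: filterS => x hx Vx; apply/eqP; rewrite -subr_eq0; apply/eqP; exact: hx.
apply: fundamental_lemma => //.
  split; first exact: measurable_funS mh.
  move=> K cK _; apply: integrableS ih => //.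
  by apply: measurable_closed; exact: compact_closedE.
move=> psi tpsi.
rewrite wI_restrict; last exact: measurable_open.
have tp s : 0 <= s <= 1 -> test_function U (fun x => psi (x - s *: v)).
  move=> s01; apply: tf_sub (tf_translate _ tpsi) => x /= Vx.
  by have := VU _ _ Vx s01; rewrite subrK.
have -> : \I[x] h x * psi x * \1_V x = \I[x] h x * psi x.
  apply: wI_ext => x; rewrite indicE; have [|xV] := boolP (x \in V); first by rewrite mulr1.
  have [_ [K [_ KV ->]]] := tpsi; first lra.
  by move=> /KV/mem_set; apply/negP.
have [mp [C [r [_ hC _]]]] := tf_bmfun tpsi.
have [i1 E1] := lavg_int v mg hg mp hC.
have wa : wint1 (fun x => (f (x + v) - f x) * psi x) by apply: wint1_tf tpsi; [exact: mbfunB|exact: wintB].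
have wb : wint1 (fun x => lavg v (gdir v G) x * psi x) by exact: wint1_tf tpsi.
have -> : \I[x] h x * psi x = \I[x] (f (x + v) - f x) * psi x - \I[x] lavg v (gdir v G) x * psi x by rewrite -wIB//; apply: wI_ext => x; rewrite -mulrBl.
rewrite E1; apply/eqP; rewrite subr_eq0; apply/eqP.
pose phi s := \I[x] f x * psi (x - s *: v).
pose dphi s := \I[x] gdir v G x * psi (x - s *: v).
have t0 : test_function setT psi by exact: tf_sub tpsi.
have D s : 0 <= s <= 1 -> is_derive s 1 phi (dphi s) by move=> /tp; exact: dgrad_line_derive.
have cphi s : {for s, continuous phi}.
  apply/differentiable_continuous; rewrite -derivable1_diffP.
  have [d _] := wI_translate_derive (- v) s weight_one mf hf t0.
  by move: d; apply: near_eq_derivable; near=> t; apply: wI_ext => x; rewrite scalerN.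
have cdphi s : {for s, continuous dphi}.
  apply/differentiable_continuous; rewrite -derivable1_diffP.
  have [d _] := wI_translate_derive (- v) s weight_one mg hg t0.
  by move: d; apply: near_eq_derivable; near=> t; apply: wI_ext => x; rewrite scalerN.
have H : (\int[mu]_(x in `[0%R, 1%R]) (dphi x)%:E = (phi 1)%:E - (phi 0)%:E)%E.
  apply: continuous_FTC2 => //.
  - by apply/continuous_in_subspaceT => s _; exact: cdphi.
  - split.
    + move=> s; rewrite in_itv/= => /andP[/ltW s0 /ltW s1].
      have h01 : 0 <= s <= 1 by rewrite s0 s1.
      by have [] := D s h01.
    + exact: cvg_at_right_filter (cphi 0).
    + exact: cvg_at_left_filter (cphi 1).
  - move=> s; rewrite in_itv/= => /andP[/ltW s0 /ltW s1]; rewrite derive1E.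
    by apply: derive_val; apply: D; rewrite s0 s1.
rewrite (wI_difference mf hf tp) -/(phi 1) -/(phi 0).
rewrite [RHS](_ : _ = \int[mu]_(s in `[0%R, 1%R]) dphi s); first by rewrite /Rintegral H.
rewrite [RHS]Rintegral_mkcond; apply: eq_Rintegral => s _; rewrite /patch indicE.
by case: ifPn => _; rewrite ?mulr1 ?mulr0.
Unshelve. all: end_near. Qed.

Lemma wI_ae w f g : weight w -> mbfun f -> mbfun g -> {ae leb n, forall x, f x = g x} ->
  wI w f = wI w g.
Proof.
move=> hw mf mg fg; have mw := weight_mfun hw; congr fine.
apply: ae_eq_integral => //.
- by apply/measurable_EFinP; exact: mbfunM.
- by apply/measurable_EFinP; exact: mbfunM.
- by move: fg; apply: filterS => x -> _.
Qed.

(** Almost everywhere the increment is a segment mean of v . G, and segment means contract the L^2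
    norm of a weight invariant along [v]. *)
Lemma translate_l2_bound U V f G v w : mbfun f -> wint1 f -> (forall i, mbfun (G i)) ->
  (forall i, wint1 (G i)) -> dgrad U f G -> open V ->
  (forall x s, V x -> 0 <= s <= 1 -> U (x + s *: v)) ->
  weight w -> (forall s x, w (x + s *: v) = w x) -> l2 w (gdir v G) ->
  wint w (fun x => (f (x + v) - f x) ^+ 2 * \1_V x) ->
  wI w (fun x => (f (x + v) - f x) ^+ 2 * \1_V x) <= wI w (fun x => gdir v G x ^+ 2).
Proof.
move=> mf hf mG hG hd oV VU hw wv lG hi.
have mg := gdir_mbfun v mG; have hg := gdir_wint v hG.
have [_ ml _ _] := lavg_fubini v mg hg (mbfun_cst 1) norm_one_le1.
have [wl le] := lavg_sqr mg hg hw lG wv.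
have mV : mbfun (fun x => \1_V x : R) by apply: measurable_indic; exact: measurable_open.
apply: le_trans le.
rewrite (@wI_ae w _ (fun x => lavg v (gdir v G) x ^+ 2 * \1_V x) hw).
- apply: wI_le => //.
    apply: (@wint_le _ _ _ hw _ (fun x => lavg v (gdir v G) x ^+ 2)) => //.
    move=> x; rewrite normrM ger0_norm ?sqr_ge0// ler_piMr ?sqr_ge0// indicE.
    by case: (_ \in _); rewrite ?normr1 ?normr0.
  by move=> x; rewrite ler_piMr ?sqr_ge0// indicE; case: (_ \in _).
- by apply: mbfunM => //; apply: mbfunX; apply: mbfunB => //; exact: mbfun_translate.
- by apply: mbfunM => //; exact: mbfunX.
have := dgrad_lavg mf hf mG hG hd oV VU; apply: filterS => x hx.
rewrite indicE; have [/set_mem/hx->//|_] := boolP (x \in V).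
by rewrite !mulr0.
Qed.

Lemma compact_uniform (K : set E) (P : E -> E -> Prop) : compact K ->
  (forall x, K x -> exists2 d, 0 < d & forall x' y, `|x' - x| < d -> `|y - x| < d -> P x' y) ->
  exists2 d, 0 < d & forall x y, K x -> `|y - x| < d -> P x y.
Proof.
move=> /compact_near_coveringP cK H.
have := cK R (0 : R)^'+ (fun d x => forall y, `|y - x| < d -> P x y) _.
case.
  move=> x Kx; have [d d0 Hd] := H x Kx.
  exists (ball x (d / 2), [set t : R| 0 < t < d / 2]) => /=.
    split; first by apply: nbhsx_ballx; exact: divr_gt0.
    exists (d / 2) => /=//.
    by move=> t; rewrite /ball_/= sub0r normrN => td t0; rewrite t0 (le_lt_trans (ler_norm _)).
  move=> [x' t] /= [xx' /andP[t0 td]] y yx'.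
  rewrite ballEC in xx'.
  apply: Hd; first lra.
  by have := ler_distD x' y x; lra.
move=> e /= e0 He; exists (e / 2); first exact: divr_gt0.
move=> x y Kx xy; apply: (He (e / 2)) Kx y xy; last exact: divr_gt0.
rewrite /ball_/= sub0r normrN gtr0_norm ?divr_gt0//; lra.
Qed.

Lemma compact_unif_continuous (K : set E) f : compact K -> (forall x, K x -> {for x, continuous f}) ->
  forall e, 0 < e -> exists2 d, 0 < d & forall x y, K x -> `|y - x| < d -> `|f y - f x| <= e.
Proof.
move=> cK cf e e0; apply: compact_uniform => // x Kx.
have e2 : 0 < e / 2 by [].
have /cvgrPdist_le/(_ _ e2)/nbhs_ballP[d /= d0 Hd] := cf x Kx.
exists d => // x' y hx' hy.
have h1 : `|f x - f x'| <= e / 2 by apply: Hd; rewrite ballEC.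
have h2 : `|f x - f y| <= e / 2 by apply: Hd; rewrite ballEC.
by have := ler_distD (f x) (f y) (f x'); have := distrC (f y) (f x); lra.
Qed.

Lemma compact_sub_open (K U : set E) : compact K -> open U -> K `<=` U ->
  exists2 d, 0 < d & forall x y, K x -> `|y - x| < d -> U y.
Proof.
move=> cK oU KU; apply: compact_uniform => // x /KU Ux.
have /nbhs_ballP[d /= d0 Hd] := open_nbhs_nbhs (conj oU Ux).
by exists d => // x' y _ hy; apply: Hd; rewrite ballEC.
Qed.

Lemma is_derive_eps (Phi : R -> R) (L J : R) : 0 <= J ->
  (forall e, 0 < e -> exists2 d, 0 < d & forall t, `|t| < d -> `|Phi t - Phi 0 - t * L| <= e * `|t| * J) ->
  is_derive (0 : R) 1 Phi L.
Proof.
move=> J0 H.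
have C : (fun t => t^-1 *: ((Phi \o shift 0) (t *: 1) - Phi 0)) @ 0^' --> L.
  apply/cvgrPdist_le => e e0.
  have [|d d0 Hd] := H (e / (J + 1)) => //.
  near=> t.
  have t0 : t != 0 by near: t; exact: nbhs_dnbhs_neq.
  have td : `|t| < d by near: t; exact: dnbhs0_lt.
  have := Hd t td; rewrite /= addr0 [t *: 1]mulr1.
  have -> : L - t^-1 *: (Phi t - Phi 0) = - t^-1 * (Phi t - Phi 0 - t * L) by rewrite /GRing.scale/=; field.
  rewrite normrM normrN normfV => Ht.
  rewrite ler_pdivrMl ?normr_gt0// (le_trans Ht)//.
  rewrite mulrAC [leRHS]mulrC ler_wpM2r// mulrAC ler_pdivrMr ?ltr_wpDl//.
  by rewrite ler_pM2l// lerDl.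
apply: DeriveDef; first by apply/cvg_ex; exists L.
exact/cvg_lim.
Unshelve. all: by end_near. Qed.

Lemma gdir_scale_delta t (i : 'I_n) G x : gdir (t *: 'e_i) G x = t * G i x.
Proof.
rewrite /gdir (bigD1 i)//= big1 ?addr0 ?mxE ?eqxx ?mulr1// => j ji.
by rewrite !mxE (negbTE ji) andbF mulr0 mul0r.
Qed.

Lemma continuous_mul f g x : {for x, continuous f} -> {for x, continuous g} ->
  {for x, continuous (fun y => f y * g y)}.
Proof. by move=> hf hg; exact: continuousM. Qed.

(* The difference quotients of [f] converge weakly to [G i], and [f x + f (x + t e)]
   converges uniformly, so the limit of the product can be taken. *)
Lemma dgrad_sqr U f G C : open U -> mbfun f -> wint1 f -> (forall x, `|f x| <= C) ->
  (forall x, U x -> {for x, continuous f}) -> (forall i, mbfun (G i)) ->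
  (forall i, wint1 (G i)) -> dgrad U f G ->
  dgrad U (fun x => f x ^+ 2) (fun i x => 2 * f x * G i x).
Proof.
move=> oU mf hf fC cf mG hG hd i psi tpsi.
have C0 : 0 <= C by rewrite (le_trans _ (fC 0)).
have [spsi [K [cK KU K0]]] := tpsi.
have [mp [D [r [_ hD _]]]] := tf_bmfun tpsi.
set e := 'e_i : E.
have ne : `|e| <= 1 := norm_delta _.
have [d0 d00 Ud] := compact_sub_open cK oU KU.
pose F x := psi x * f x.
have cF x : K x -> {for x, continuous F} by move=> Kx; apply: continuous_mul; [exact: smooth_continuous|exact: cf (KU x Kx)].
have F0 x : ~ K x -> F x = 0 by move=> /K0; rewrite /F => ->; rewrite mul0r.
have unif (h : E -> R) : (forall x, K x -> {for x, continuous h}) -> (forall x, ~ K x -> h x = 0) ->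
 forall eps, 0 < eps -> exists2 d, 0 < d & forall x y, `|y - x| < d -> `|h y - h x| <= eps.
  move=> ch h0 eps eps0; have [d dp Hd] := compact_unif_continuous cK ch eps0.
  exists d => // x y xy; have [Kx|Kx] := pselect (K x); first exact: Hd.
  have [Ky|Ky] := pselect (K y); first by rewrite distrC; apply: Hd => //; rewrite distrC.
  by rewrite !h0// subrr normr0 ltW.
pose kappa x := 2 * F x.
pose chi t x := psi x * (f (x + t *: e) + f x).
have mF : mbfun F by exact: mbfunM.
have bF x : `|F x| <= D * C by rewrite normrM ler_pM.
have mk : mbfun kappa by exact: mbfunZ.
have mchi t : mbfun (chi t) by apply: mbfunM => //; apply: mbfunD => //; exact: mbfun_translate.
have D0 : 0 <= D by rewrite (le_trans _ (hD 0)).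
have bchi t x : `|chi t x| <= D * (2 * C).
  rewrite normrM ler_pM// (le_trans (ler_normD _ _))//; have := fC x; have := fC (x + t *: e); lra.
have bk x : `|kappa x| <= D * (2 * C) by rewrite normrM ger0_norm// mulrCA ler_wpM2l.
have mG2 : mbfun (fun x => f x ^+ 2) by [].
have h2 : wint1 (fun x => f x ^+ 2).
  apply: (@wint_le _ _ _ weight_one _ (fun x => C * `|f x|)) => //.
    by move=> x; rewrite normrX expr2 ler_wpM2r.
  exact: (wintZ C (wint_abs weight_one hf)).
pose V := [set x : E| exists2 y, K y & `|x - y| < d0 / 2].
have oV : open V.
  rewrite (_ : V = \bigcup_(y in K) ball y (d0 / 2)).
    by apply: bigcup_open => y _; exact: ball_open.
  apply/seteqP; split => x [y Ky h]; exists y => //.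
    by rewrite ballEC.
  by move: h; rewrite ballEC.
pose Phi t := \I[x] f x ^+ 2 * psi (x + t *: (- e)).
have t0 : test_function setT psi by exact: tf_sub tpsi.
have D1 := wI_translate_derive (- e) 0 weight_one mG2 h2 t0.
have D2 : is_derive (0 : R) 1 Phi (\I[x] G i x * kappa x).
  apply: (@is_derive_eps _ _ (\I[x] (`|G i x|))); first by apply: (wI_ge0 weight_one).
  move=> eps eps0.
  have ep3 : 0 < eps / 3 by [].
  have epC : 0 < eps / 3 / (C + 1) by [].
  have [d1 d10 H1] := unif F cF F0 _ ep3.
  have cpsi x : K x -> {for x, continuous psi} by move=> _; exact: smooth_continuous.
  have [d2 d20 H2] := unif psi cpsi K0 _ epC.
  exists (Num.min (d0 / 2) (Num.min d1 d2)) => //.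
  move=> t; rewrite !lt_min => /and3P[td0 td1 td2].
  have nte s : 0 <= s <= 1 -> `|s *: (t *: e)| <= `|t|.
    move=> /andP[s0 s1]; rewrite !normrZ (ger0_norm s0) mulrA (le_trans (ler_piMr _ ne))//.
    by rewrite ler_piMl.
  have VU x s : V x -> 0 <= s <= 1 -> U (x + s *: (t *: e)).
    move=> [y Ky xy] s01; apply: (Ud y) => //.
    rewrite addrAC (le_lt_trans (ler_normD _ _))// (lt_le_trans (ltrD xy (le_lt_trans (nte s s01) td0)))//.
    by lra.
  have mg := gdir_mbfun (t *: e) mG; have hg := gdir_wint (t *: e) hG.
  have gE x : gdir (t *: e) G x = t * G i x by exact: gdir_scale_delta.
  have Phi0 : Phi 0 = \I[x] f x ^+ 2 * psi x by apply: wI_ext => x; rewrite scale0r addr0.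
  have w1 : wint1 (fun x => f x ^+ 2 * psi (x + t *: - e)) by exact: (wint1_tf mG2 h2 (tf_translate (t *: - e) tpsi)).
  have [w1' I1E] := wI_translate (v := t *: e) w1 (fun=> erefl).
  have eE x : x + t *: e + t *: - e = x by rewrite scalerN addrK.
  have -> : Phi t - Phi 0 = \I[x] (f (x + t *: e) - f x) * chi t x.
    rewrite Phi0 /Phi -I1E -wIB//; last exact: (wint1_tf mG2 h2 tpsi).
    by apply: wI_ext => x; rewrite eE /chi; ring.
  have -> : \I[x] (f (x + t *: e) - f x) * chi t x = \I[x] lavg (t *: e) (gdir (t *: e) G) x * chi t x.
    have [_ ml _ _] := lavg_fubini (t *: e) mg hg (mbfun_cst 1) norm_one_le1.
    apply: wI_ae; [exact: weight_one| | |].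
    - by apply: mbfunM => //; apply: mbfunB => //; exact: mbfun_translate.
    - exact: mbfunM.
    have := dgrad_lavg mf hf mG hG hd oV VU; apply: filterS => x hx.
    have [Kx|/K0 Kx] := pselect (K x); last by rewrite /chi Kx mul0r !mulr0.
    by rewrite hx//; exists x; rewrite // subrr normr0 divr_gt0.
  have -> : t * \I[x] G i x * kappa x = \I[x] gdir (t *: e) G x * kappa x.
    rewrite -wIZ; first by apply: wI_ext => x; rewrite gE mulrA.
    apply: (@wint_le _ _ _ weight_one _ (fun x => D * (2 * C) * `|G i x|)) => //.
      by move=> x; rewrite normrM mulrC ler_wpM2r.
    exact: (wintZ _ (wint_abs weight_one (hG i))).
  apply: le_trans (lavg_test (e := eps) mg hg (mchi t) mk (bchi t) bk _) _.
    move=> s x s01; set y := x - _.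
    have yx : `|y - x| <= `|t| by rewrite addrAC subrr sub0r normrN nte.
    have yt : `|(y + t *: e) - x| <= `|t|.
      have -> : y + t *: e - x = (1 - s) *: (t *: e) by rewrite /y scalerBl scale1r addrAC (addrAC x) subrr sub0r addrC.
      by apply: nte; lra.
    have yty : `|y - (y + t *: e)| <= `|t|.
      rewrite opprD addrA subrr sub0r normrN -[t *: e]scale1r; apply: nte; lra.
    have h1 := H1 x y (le_lt_trans yx td1); have h2' := H1 x _ (le_lt_trans yt td1).
    have h3 := H2 _ y (le_lt_trans yty td2).
    have -> : chi t y - kappa x = (psi y - psi (y + t *: e)) * f (y + t *: e) + (F (y + t *: e) - F x) + (F y - F x) by rewrite /chi /kappa /F; ring.
    have h4 : `|(psi y - psi (y + t *: e)) * f (y + t *: e)| <= eps / 3 by rewrite normrM (le_trans (ler_pM _ _ h3 (fC _)))// mulrAC ler_pdivrMr ?ltr_wpDl// ler_pM2l// lerDl ler01.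
    apply: le_trans (ler_normD _ _) _; apply: le_trans (lerD (ler_normD _ _) (lexx _)) _.
    by lra.
  rewrite -mulrA ler_pM2l//.
  rewrite -(wIZ `|t| (wint_abs weight_one (hG i))); apply: eqW.
  by apply: wI_ext => x; rewrite gE normrM.
have := @derive_val _ _ _ _ _ _ _ D2; rewrite (@derive_val _ _ _ _ _ _ _ D1) => E1.
have -> : \I[x] 2 * f x * G i x * psi x = \I[x] G i x * kappa x by apply: wI_ext => x; rewrite /kappa /F; ring.
rewrite -E1 -wIN.
apply: wI_ext => x; rewrite scale0r addr0 -mulrN; congr (_ _).
rewrite -[partial i psi x]dirder_delta /dirder -sumrN; apply: eq_bigr => j _.
by rewrite [(- e) ord0 j]mxE mulNr opprK.
Qed.

End weak_gradient.

(** * A smooth step function *)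

Section plateau.
Context {R : realType}.
Implicit Types s t : R.

Lemma expR2_fe_half : expR 2 * fe (2^-1 : R) = 1.
Proof. by rewrite feE invr_gt0 ltr0n invrK expRxMexpNx_1. Qed.

(** Two nested copies of [fe]. The inner one vanishes for s >= 0 and puts the outer argument at 1,
    where exp(1) normalizes the value to 1. For s <= -1/2 the inner term is at least 1, because
    exp(2) fe(1/2) = 1, and the outer factor vanishes. *)
Definition plateau s : R := expR 1 * fe (1 - expR 2 * fe (- s)).

Lemma plateau1 s : 0 <= s -> plateau s = 1.
Proof. by move=> s0; rewrite /plateau [fe (- s)]fe_le0 ?oppr_le0// mulr0 subr0 feE ltr01 invr1 expRxMexpNx_1. Qed.

Lemma plateau0 s : s <= - 2^-1 -> plateau s = 0.
Proof.
move=> s0; rewrite /plateau [fe (1 - _)]fe_le0 ?mulr0// subr_le0 -[X in X <= _]expR2_fe_half.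
by rewrite ler_pM2l ?expR_gt0// fe_homo// lerNr.
Qed.

Lemma plateau_ge0 s : 0 <= plateau s.
Proof. by rewrite mulr_ge0 ?expR_ge0 ?fe_ge0. Qed.

Lemma plateau_homo : {homo plateau : s t / s <= t}.
Proof.
move=> s t st; rewrite /plateau ler_pM2l ?expR_gt0// fe_homo// lerD2l lerN2.
by rewrite ler_pM2l ?expR_gt0// fe_homo// lerN2.
Qed.

Lemma plateau_le1 s : plateau s <= 1.
Proof. by have := plateau_homo (ler_norm s); rewrite (plateau1 (normr_ge0 s)). Qed.

Lemma smooth1_plateau : smooth1 plateau.
Proof.
rewrite (_ : plateau = fun s => (0 * s + expR 1) * fe (- expR 2 * fe (-1 * s + 0) + 1)); last first.
  by apply/funext => s; rewrite mul0r add0r mulN1r addr0 mulNr addrC.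
apply/smooth1_gen/gen1_mul; first exact: gen1_affine.
apply: (gen1_comp (g := fun s => fe (- expR 2 * s + 1))); first exact/smooth1_comp_affine/smooth1_fe.
exact/gen1_smooth/smooth1_comp_affine/smooth1_fe.
Qed.

End plateau.

#[export] Hint Resolve plateau_ge0 : positivity.

Notation nn := (rshift _ (ord0 : 'I_1)).

(** * The weight x_n^a on the half space and integration by parts up to the flat boundary *)

Section half_space.
Context {R : realType} {m : nat}.
Local Notation E := 'rV[R]_(m + 1).
Local Notation I1 := (wI (@one R (m + 1))).
Local Notation wint1 := (wint (@one R (m + 1))).
Implicit Types (f g psi zeta : E -> R) (x v : E) (s t a : R) (B : set E) (i : 'I_(m + 1)).

Definition hp : set E := [set x | 0 < xn x].

(** Setting the weight to 0 for x_n <= 0 turns integrals over the half space into integrals over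
    R^n; for a = 0 it is the indicator of the open half space. *)
Definition wt a x : R := if 0 < xn x then xn x `^ a else 0.
Local Notation "\I_ a [ x ] F" := (wI (wt a) (fun x => F)) (at level 34, a at level 0, x name, F at level 41).

Lemma smooth_xn : smooth (@xn R m). Proof. exact: smooth_coord. Qed.
Lemma continuous_xn : continuous (@xn R m). Proof. exact: smooth_continuous smooth_xn. Qed.
Lemma partial_xn i x : partial i (@xn R m) x = (i == nn)%:R. Proof. exact: partial_coord. Qed.
Lemma xnD x v : xn (x + v) = xn x + xn v. Proof. by rewrite /xn mxE. Qed.
Lemma xnZ s x : xn (s *: x) = s * xn x. Proof. by rewrite /xn mxE. Qed.
Lemma xnN x : xn (- x) = - xn x. Proof. by rewrite /xn mxE. Qed.

Lemma xn_dist x y : `|xn x - xn y| <= `|x - y|.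
Proof. by rewrite -xnN -xnD; exact: rV_norm_coord. Qed.

Lemma open_hp : open hp.
Proof.
rewrite (_ : hp = (@xn R m) @^-1` [set s | 0 < s]); last by [].
apply: open_comp => //.
by move=> x _; exact: continuous_xn.
Qed.

Lemma mbfun_xn : mbfun (@xn R m). Proof. exact: mbfun_continuous continuous_xn. Qed.

Lemma wt_gt0 a x : hp x -> 0 < wt a x.
Proof. by rewrite /hp /wt /= => x0; rewrite x0 powR_gt0. Qed.
Lemma wt_hp a x : wt a x != 0 -> hp x.
Proof. by rewrite /wt /hp /=; case: ifP => //; rewrite eqxx. Qed.
Lemma wtE a x : hp x -> wt a x = xn x `^ a.
Proof. by rewrite /wt /hp /= => ->. Qed.
Lemma wt_out a x : ~ hp x -> wt a x = 0.
Proof. by rewrite /wt /hp /=; case: ifP. Qed.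
Lemma wt_translate a v x : xn v = 0 -> wt a (x + v) = wt a x.
Proof. by move=> v0; rewrite /wt xnD v0 addr0. Qed.

Lemma mbfun_wt a : mbfun (wt a).
Proof.
rewrite (_ : wt a = fun x => if x \in hp then xn x `^ a else 0).
  apply: mbfun_if; first exact: measurable_open open_hp.
  exact: (measurableT_comp (@measurable_powR R a) mbfun_xn).
by apply/funext => x; rewrite /wt; case: ifPn => h; case: ifPn => // h';
 [case/negP: h'; exact/mem_set|move/set_mem: h' => h'; case/negP: h].
Qed.

Lemma mbfun_xnV : mbfun (fun x : E => (xn x)^-1).
Proof.
rewrite (_ : (fun => _) = fun x : E => xn x * (xn x ^+ 2) `^ (-1)).
  apply: mbfunM mbfun_xn _.
  exact: (measurableT_comp (@measurable_powR R (-1)) (mbfunX 2 mbfun_xn)).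
apply/funext => x; rewrite powR_inv1 ?sqr_ge0//.
by have [->|x0] := eqVneq (xn x) 0; [rewrite invr0 mul0r|field].
Qed.

Lemma weight_wt a : 0 <= a -> weight (wt a).
Proof.
move=> a0; split; first exact: mbfun_wt.
  by move=> x; rewrite /wt; case: ifP => // _; exact: powR_ge0.
move=> r r0; have mb := @measurable_ball_rV R (m + 1) 0 r.
have : (leb (m + 1)).-integrable (ball 0 r) (cst (r `^ a)%:E).
  apply/integrableP; split => //.
  by under eq_integral do rewrite /=; rewrite integral_cst//= leb_ball//= -EFinM ltry.
apply: le_integrable => //.
  by apply/measurable_EFinP; apply: measurable_funTS; exact: mbfun_wt.
move=> x; rewrite ball0E => xr /=; rewrite lee_fin (ger0_norm (powR_ge0 _ _)) /wt.
case: ifPn => x0; last by rewrite normr0 powR_ge0.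
rewrite ger0_norm ?powR_ge0//; apply: ge0_ler_powR; rewrite ?nnegrE ?_//.
by rewrite (le_trans (ler_norm _))// (le_trans (rV_norm_coord _ _))// ltW.
Qed.

Lemma compact_hp (K : set E) : compact K -> K `<=` hp -> exists2 e, 0 < e & forall x, K x -> e <= xn x.
Proof.
move=> cK Kh; have [d d0 Hd] := compact_sub_open cK open_hp Kh.
exists (d / 2) => //.
move=> x Kx; rewrite leNgt; apply/negP => xd.
have : hp (x - (d / 2) *: 'e_nn).
  apply: (Hd x) => //; rewrite addrAC subrr sub0r normrN.
  by apply: (@le_lt_trans _ _ (d / 2)); [apply: norm_scale_delta|]; lra.
rewrite /hp /= xnD xnN xnZ {2}/xn mxE !eqxx mulr1; lra.
Qed.

(** On the compact support the weight is bounded below by a positive constant, so weighted square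
    integrability implies unweighted integrability of the product. *)
Lemma tf_hp_wint a g psi : 0 <= a -> l2 (wt a) g -> test_function hp psi -> wint1 (fun x => g x * psi x).
Proof.
move=> a0 lg tpsi; have [spsi [K [cK Kh K0]]] := tpsi.
have [e e0 He] := compact_hp cK Kh.
have [mp [C [r [r0 hC hr]]]] := tf_bmfun tpsi.
have C0 : 0 <= C by rewrite (le_trans _ (hC 0)).
have bh : bmfun (fun x => (e `^ a)^-1 * psi x ^+ 2).
  split; first by apply: mbfunZ; exact: mbfunX.
  exists ((e `^ a)^-1 * C ^+ 2), r; split => // x.
    rewrite normrM normrX ger0_norm ?powR_ge0// ler_wpM2l ?powR_ge0//.
    by rewrite ler_sqr ?nnegrE.
  by move=> /hr->; rewrite expr0n mulr0.
have w1 := wint_one_bmfun bh.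
have w2 : wint1 (fun x => g x ^+ 2 * wt a x) by have := lg.2; apply: eq_integrable => // x; rewrite /one mulr1.
apply: (@wint_le _ _ _ weight_one _ (fun x => g x ^+ 2 * wt a x + (e `^ a)^-1 * psi x ^+ 2)).
- by apply: mbfunM => //; exact: l2_mfun lg.
- move=> x; have [Kx|/K0->] := pselect (K x); last first.
    rewrite mulr0 normr0 addr_ge0// mulr_ge0 ?sqr_ge0//.
    by have [_ + _] := weight_wt a0; apply.
  have ea : 0 < e `^ a by [].
  have le : e `^ a <= wt a x.
    rewrite wtE; last exact: Kh.
    by rewrite ge0_ler_powR ?nnegrE ?He// ltW// (lt_le_trans e0)// He.
  rewrite normrM; have := amgm `|g x| `|psi x| ea; rewrite !sqr_normr.
  have := ler_wpM2r (sqr_ge0 (g x)) le; have := mulr_ge0 (ltW ea) (sqr_ge0 (g x)).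
  have : 0 <= (e `^ a)^-1 * psi x ^+ 2 by rewrite mulr_ge0 ?sqr_ge0// invr_ge0 ltW.
  by rewrite mulrC; lra.
- exact: wintD.
Qed.

(** The condition that removes the boundary term at x_n = 0: linear vanishing of the normal
    component of a vector field. For tangential indices it is void. *)
Definition okn i zeta := i = nn -> exists C, forall x, hp x -> `|zeta x| <= C * xn x.

(** This is x_n^(-a) d_i (x_n^a zeta), the i-th term of the weighted divergence. *)
Definition dvg a i zeta x : R := partial i zeta x + (if i == nn then a * zeta x / xn x else 0).

(** For t + 1 = k x_n this bounds x_n times the derivative of the cutoff fe(k x_n - 1) uniformly in
    k. With y = 1/t it reduces to y + y^2 <= 3 exp y. *)
Lemma fe'_bound t : (t + 1) * fe' t <= 3.
Proof.
have [t0|t0] := leP t 0; first by rewrite fe'_le0// mulr0.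
rewrite fe'E t0; set y := t^-1.
have y0 : 0 <= y by rewrite invr_ge0 ltW.
have -> : (t + 1) * (t ^- 2 * expR (- y)) = (y + y ^+ 2) * expR (- y) by rewrite /y; field; rewrite gt_eqF.
rewrite expRN ler_pdivrMr ?expR_gt0//.
by have := expR_ge1Dxn 0 y0; have := expR_ge1Dxn 1 y0; rewrite /= !factS fact0 !muln1 divr1; lra.
Qed.

Lemma fe'_cvg0 (t : R) : 0 < t -> (fun k : nat => k.+1%:R * fe' (k.+1%:R * t - 1)) @ \oo --> (0 : R).
Proof.
move=> t0; apply/cvgrPdist_le => e e0; near=> k.
have k2 : 2 / t <= k%:R by near: k; exact: nbhs_infty_ger.
have ke : 4 / (t ^+ 2 * e) <= k%:R by near: k; exact: nbhs_infty_ger.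
rewrite sub0r normrN ger0_norm ?mulr_ge0 ?fe'_ge0//.
have kk : k%:R <= k.+1%:R :> R by rewrite ler_nat.
have h1 : 2 <= k.+1%:R * t by rewrite -ler_pdivrMr// (le_trans k2).
have h2 : 4 <= k.+1%:R * (t ^+ 2 * e) by rewrite -ler_pdivrMr ?exprn_gt0// (le_trans ke).
have kp : 0 < k.+1%:R :> R by [].
move: (k.+1%:R) h1 h2 kp => K h1 h2 kp.
set s := K * t - 1; have s0 : 0 < s by rewrite /s; lra.
rewrite fe'E s0.
have : expR (- s^-1) <= 1 by rewrite expR_le1 oppr_le0 invr_ge0 ltW.
move=> h3; apply: (@le_trans _ _ (K * s ^- 2)); first rewrite mulrA ler_piMr// ltW.
rewrite ler_pdivrMr ?exprn_gt0//.
have hs : K * t <= 2 * s by rewrite /s; lra.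
have : (K * t) ^+ 2 <= (2 * s) ^+ 2 by rewrite ler_sqr ?nnegrE//; nra.
move=> h4; have : K * 4 <= K * (K * (t ^+ 2 * e)) by rewrite ler_pM2l.
have := ler_wpM2l (ltW e0) h4; lra.
Unshelve. all: by end_near. Qed.

Section cutoff.
Variables (a : R) (k : nat).

(** The weight multiplied by a cutoff that vanishes near x_n = 0. The product is smooth, so the
    unweighted definition of a weak gradient in the open half space can be tested with it. *)
Definition cutoff s : R := s `^ a * fe (k.+1%:R * s - 1).

Let k0 : 0 < k.+1%:R^-1 :> R. Proof. by rewrite invr_gt0. Qed.
Let fe0 s : s <= k.+1%:R^-1 -> fe (k.+1%:R * s - 1) = 0.
Proof. by move=> sk; rewrite fe_le0// subr_le0 -ler_pdivlMl// mulr1. Qed.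

Lemma smooth1_cutoff : smooth1 cutoff.
Proof.
apply: smooth1_gen; apply: (gen1_powR _ k0) => [|s /ltW]; last exact: fe0.
exact/gen1_smooth/smooth1_comp_affine/smooth1_fe.
Qed.

Lemma derive_cutoff s : 0 < s ->
  derive1 cutoff s = s `^ a * (a / s * fe (k.+1%:R * s - 1) + k.+1%:R * fe' (k.+1%:R * s - 1)).
Proof.
move=> s0; rewrite derive1E; apply: derive_val.
have D1 : is_derive s 1 (fun s : R => k.+1%:R * s - 1) k.+1%:R.
  have := is_deriveB (is_derive_mulr k.+1%:R (is_derive_id s 1)) (is_derive_cst (1 : R) s 1).
  by rewrite mul1r subr0; apply: is_derive_ext => y; rewrite /= mulrC.
have D2 := @is_derive1_comp _ _ _ s _ _ (is_derive_fe (k.+1%:R * s - 1)) D1.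
apply: (is_derive_mul (is_derive1_powR a s0) D2).
have -> : s `^ (a - 1) = s `^ a * s^-1 by rewrite powRD ?powR_inv1 ?(ltW s0)// (gt_eqF s0) implybT.
rewrite /=; ring.
Qed.

Lemma derive_cutoff0 s : s <= 0 -> derive1 cutoff s = 0.
Proof.
move=> s0; rewrite derive1E; apply: derive_val.
apply: is_derive_near (is_derive_cst (0 : R) s 1).
have : s < k.+1%:R^-1 by exact: le_lt_trans k0.
by move=> /near_lt; apply: filterS => t /ltW tk; rewrite /cutoff fe0// mulr0.
Qed.

Lemma tf_cutoff B zeta : test_function B zeta ->
  test_function (hp `&` B) (fun x => zeta x * cutoff (xn x)).
Proof.
move=> [sz [K [cK KB K0]]]; split.
  by apply: smoothM => //; apply: smooth_comp smooth_xn; exact: smooth1_cutoff.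
exists (K `&` xn @^-1` [set s| k.+1%:R^-1 <= s]); split.
- apply: compact_closedI => //; apply: preimage_closed; last exact: closed_ge.
  by move=> ? _; exact: continuous_xn.
- by move=> x [/KB Bx] /= xk; split => //; exact: lt_le_trans xk.
- move=> x Kx; have [Kx'|/K0->] := pselect (K x); last lra.
  rewrite /cutoff fe0 ?mulr0//; rewrite leNgt; apply/negP => xk.
  by apply: Kx; split => //=; exact: ltW.
Qed.

Lemma partial_tf_cutoff i zeta x : smooth zeta ->
  partial i (fun x => zeta x * cutoff (xn x)) x =
  (dvg a i zeta x * fe (k.+1%:R * xn x - 1) +
   (i == nn)%:R * zeta x * (k.+1%:R * fe' (k.+1%:R * xn x - 1))) * wt a x.
Proof.
move=> sz; rewrite partialM; last 2 first.
- exact: smooth_differentiable.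
- by apply: smooth_differentiable; apply: smooth_comp smooth_xn; exact: smooth1_cutoff.
rewrite partial_comp; last 2 first.
- exact: smooth1_derivable smooth1_cutoff.
- exact: smooth_differentiable smooth_xn.
rewrite partial_xn /wt; case: ifPn => x0; last first.
  rewrite mulr0 derive_cutoff0 ?leNgt// mul0r mulr0 add0r /cutoff fe0 ?mulr0//.
  by rewrite (le_trans _ (ltW k0))// leNgt.
rewrite derive_cutoff// /cutoff /dvg; case: ifPn => _ /=; first lra.
by ring.
Qed.

End cutoff.

(* Integration by parts up to the flat boundary: the test functions are cut off
   by [fe (k x_n - 1)]; the resulting error involves [zeta k fe' (k x_n - 1)], which
   is bounded because [zeta] vanishes linearly when [i] is the normal direction. *)
Lemma dgrad_ibp a B f G i zeta : 0 <= a -> dgrad (hp `&` B) f G -> l2 (wt a) f -> l2 (wt a) (G i) ->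
  test_function B zeta -> okn i zeta ->
  \I_a[x] f x * dvg a i zeta x = - \I_a[x] G i x * zeta x.
Proof.
move=> a0 hd lf lG tz ok; have hw := weight_wt a0.
have [sz _] := tz; have mf := l2_mfun lf; have mG := l2_mfun lG.
have [C C0 HC] : exists2 C, 0 <= C & forall x, hp x -> (i == nn)%:R * `|zeta x| <= C * xn x.
  have [/eqP/ok[C HC]|] := boolP (i == nn); last by exists 0 => // x; rewrite mul0r.
  exists `|C| => // x hx; rewrite mul1r (le_trans (HC x hx))// ler_wpM2r ?ler_norm// ltW//.
have [mz [D [r [r0 hD hr]]]] := tf_bmfun tz.
have [mdz [D' [r' [r0' hD' hr']]]] := tf_bmfun (tf_partial i tz).
(* A dominating function: [D'] bounds the derivative of [zeta], [a * C] the term a zeta / x_n, and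
   [3 * C] the derivative of the cutoff, by [fe'_bound]. *)
pose kap x := if x \in (ball 0 (r + r') : set E) then D' + a * C + 3 * C else 0.
have D0 : 0 <= D' by rewrite (le_trans _ (hD' 0)).
have K0 : 0 <= D' + a * C + 3 * C by [].
have mb := @measurable_ball_rV R (m + 1) 0 (r + r').
have bk : bmfun kap.
  split; first by apply: mbfun_if => //; exact: mbfun_cst.
  exists (D' + a * C + 3 * C), (r + r'); split => //.
    by move=> x; rewrite /kap; case: ifP; rewrite ?normr0// ger0_norm.
  by move=> x xb; rewrite /kap memNset.
pose F k x := if x \in hp then dvg a i zeta x * fe (k.+1%:R * xn x - 1) +
 (i == nn)%:R * zeta x * (k.+1%:R * fe' (k.+1%:R * xn x - 1)) else 0.
have mhp : measurable hp := measurable_open open_hp.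
have mdvg : mbfun (dvg a i zeta).
  apply: mbfunD => //; case: (_ == _); last exact: mbfun_cst.
  apply: mbfunM => //.
  exact: mbfun_xnV.
have mFk k : mbfun (F k).
  apply: mbfun_if => //; apply: mbfunD; apply: mbfunM.
  - exact: mdvg.
  - by apply: mbfun_continuous; apply: smooth_continuous; have := smooth_comp (@smooth1_comp_affine R _ k.+1%:R (-1) (@smooth1_fe R)) smooth_xn.
  - exact: mbfunZ.
  - by apply: mbfun_continuous; apply: smooth_continuous; have := smoothZ k.+1%:R (smooth_comp (@smooth1_comp_affine R _ k.+1%:R (-1) (@smooth1_fe' R)) smooth_xn).
have dz x : hp x -> `|dvg a i zeta x| <= D' + a * C.
  move=> hx; rewrite (le_trans (ler_normD _ _))// lerD//.
  have := HC x hx; case: (_ == _); rewrite ?mul1r => Hx; last by rewrite normr0 mulr_ge0.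
  rewrite -mulrA normrM (ger0_norm a0) ler_wpM2l// normf_div (gtr0_norm hx) ler_pdivrMr//.
have Fkap k x : `|F k x| <= kap x.
  rewrite /F; case: ifPn => [/set_mem hx|_]; last by rewrite normr0 /kap; case: ifP.
  rewrite /kap; case: ifPn => [_|/negP xb]; last first.
    have nx : r + r' <= `|x| by rewrite leNgt; apply/negP => xr; apply: xb; apply/mem_set; rewrite ball0E.
    have z0 : zeta x = 0 by apply: hr; rewrite ball0E; move: nx; lra.
    have dz0 : partial i zeta x = 0 by apply: hr'; rewrite ball0E; move: r0; lra.
    by rewrite /dvg z0 dz0 (mulr0, mul0r) add0r; case: ifP; rewrite !(mulr0, mul0r, addr0) normr0.
  rewrite (le_trans (ler_normD _ _))// lerD//.
    by rewrite normrM (ger0_norm (fe_ge0 _)) (le_trans (ler_piMr _ (fe_le1 _)))// dz.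
  rewrite !normrM normr_nat (ger0_norm (fe'_ge0 _)) (@ger0_norm _ k.+1%:R)//.
  have h1 := HC x hx; have := fe'_bound (k.+1%:R * xn x - 1); rewrite subrK.
  have : 0 <= (k.+1%:R * fe' (k.+1%:R * xn x - 1) : R) by rewrite mulr_ge0 ?fe'_ge0.
  move=> h2 h3; apply: (@le_trans _ _ (C * xn x * (k.+1%:R * fe' (k.+1%:R * xn x - 1)))).
    by rewrite ler_wpM2r.
  have := ler_wpM2l C0 h3; lra.
have wfk : wint (wt a) (fun x => `|f x| * kap x).
  apply: (wint_mul hw); last exact: l2_bmfun.
  by apply: l2_le lf => [|//|x]; [exact: hw|rewrite normr_id].
have Fcvg x : wt a x != 0 -> F ^~ x @ \oo --> dvg a i zeta x.
  move=> /wt_hp hx; rewrite /F mem_set//.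
  have h1 : (fun k => dvg a i zeta x * fe (k.+1%:R * xn x - 1)) @ \oo --> dvg a i zeta x * 1 by apply: cvgM; [exact: cvg_cst|exact: fe_cvg1].
  have h2 : (fun k => (i == nn)%:R * zeta x * (k.+1%:R * fe' (k.+1%:R * xn x - 1))) @ \oo --> (i == nn)%:R * zeta x * 0 by apply: cvgM; [exact: cvg_cst|exact: fe'_cvg0].
  rewrite -[X in _ --> X]addr0 -[X in _ --> X + _]mulr1 -(mulr0 ((i == nn)%:R * zeta x)).
  exact: cvgD h1 h2.
have L1 : (fun k => \I_a[x] f x * F k x) @ \oo --> \I_a[x] f x * dvg a i zeta x.
  apply: (proj2 (wI_cvg hw _ _ wfk _ _)).
  - by move=> k; exact: mbfunM.
  - exact: mbfunM.
  - by move=> k x; rewrite normrM ler_wpM2l.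
  - by move=> x wx; apply: cvgM; [exact: cvg_cst|exact: Fcvg].
have wGz : wint (wt a) (fun x => `|G i x| * `|zeta x|).
  have /(wint_abs hw) := wint_mul hw lG (l2_bmfun hw (tf_bmfun tz)).
  by apply: wint_ext => x; rewrite normrM.
have mfe k : mbfun (fun x => fe (k.+1%:R * xn x - 1)) by apply: mbfun_continuous; apply: smooth_continuous; have := smooth_comp (@smooth1_comp_affine R _ k.+1%:R (-1) (@smooth1_fe R)) smooth_xn.
have L2 : (fun k => \I_a[x] G i x * (zeta x * fe (k.+1%:R * xn x - 1))) @ \oo --> \I_a[x] G i x * zeta x.
  apply: (proj2 (wI_cvg hw _ _ wGz _ _)).
  - by move=> k; apply: mbfunM => //; exact: mbfunM.
  - exact: mbfunM.
  - move=> k x; rewrite !normrM ler_wpM2l// (ger0_norm (fe_ge0 _)) ler_piMr ?fe_le1//.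
  - move=> x /wt_hp hx; apply: cvgM; first exact: cvg_cst.
    rewrite -[X in _ --> X]mulr1; apply: cvgM; [exact: cvg_cst|exact: fe_cvg1].
have E1 k : \I_a[x] f x * F k x = - \I_a[x] G i x * (zeta x * fe (k.+1%:R * xn x - 1)).
  have := hd i _ (tf_cutoff a k tz).
  rewrite (_ : I1 _ = \I_a[x] f x * F k x); last first.
    apply: eq_Rintegral => x _; rewrite partial_tf_cutoff// /one mulr1 mulrA /F.
    by case: ifPn => // /negP hx; rewrite wt_out ?mulr0// => /mem_set.
  move=> ->; congr (- _); apply: eq_Rintegral => x _; rewrite /one mulr1 /cutoff /wt.
  case: ifPn => x0; first ring.
  rewrite fe_le0 ?mulr0// subr_le0 (@le_trans _ _ 0)// pmulr_rle0// leNgt//.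
rewrite -(cvg_lim (@norm_hausdorff _ _) L1) (funext E1).
have L3 : (fun k : nat => - \I_a[x] G i x * (zeta x * fe (k.+1%:R * xn x - 1))) @ \oo --> - \I_a[x] G i x * zeta x by exact: cvgN.
by rewrite (cvg_lim (@norm_hausdorff _ _) L3).
Qed.

End half_space.

Arguments weight_wt {R} m {a} a0.

#[export] Hint Resolve smooth_xn mbfun_xn mbfun_wt : regularity.

Notation "\I_ a [ x ] F" := (wI (wt a) (fun x => F)) (at level 34, a at level 0, x name, F at level 41).

(** * Calculus of weak gradients in the half space and the integral over its flat boundary *)

Section weak_calculus.
Context {R : realType} {m : nat}.
Local Notation E := 'rV[R]_(m + 1).
Local Notation mu := (@lebesgue_measure R).
Local Notation I1 := (wI (@one R (m + 1))).
Local Notation wint1 := (wint (@one R (m + 1))).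
Implicit Types (f g psi eta : E -> R) (x v : E) (s t a : R) (U V B : set E) (i : 'I_(m + 1)).

Lemma dgrad_ext U f g (G H : 'I_(m + 1) -> E -> R) : (forall x, U x -> f x = g x) ->
  (forall i x, U x -> G i x = H i x) -> dgrad U f G -> dgrad U g H.
Proof.
move=> fg GH hd i psi tpsi; have [_ [K [_ KU K0]]] := tpsi.
have [_ [K' [_ KU' K0']]] := tf_partial i tpsi.
rewrite -(@wI_ext _ _ _ (fun x => f x * partial i psi x)); last first.
  by move=> x; have [/KU' Kx|/K0'->] := pselect (K' x); [rewrite fg|rewrite !mulr0].
rewrite hd//; congr (- _); apply: wI_ext => x.
by have [/KU Kx|/K0->] := pselect (K x); [rewrite GH|rewrite !mulr0].
Qed.

Lemma dgradN U f (G : 'I_(m + 1) -> E -> R) : dgrad U f G -> dgrad U (fun x => - f x) (fun i x => - G i x).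
Proof.
have N F H : \I[x] - F x * H x = - \I[x] F x * H x by rewrite -wIN; apply: wI_ext => x; rewrite mulNr.
by move=> h i psi tpsi; rewrite !N h.
Qed.

Lemma dgrad_tf U phi : test_function setT phi -> dgrad U phi (fun i => partial i phi).
Proof.
move=> tphi i psi tpsi; have [sphi _] := tphi; have [spsi _] := tpsi.
have t0 : test_function setT psi := tf_sub (@subsetT _ _) tpsi.
have w1 : wint1 (fun x => phi x * partial i psi x) by exact: wint_one_bmfun (tf_bmfun (tfM (tf_partial i t0) sphi)).
have w2 : wint1 (fun x => partial i phi x * psi x) by exact: wint_one_bmfun (tf_bmfun (tfM t0 (smooth_partial i sphi))).
apply/eqP; rewrite -addr_eq0 -wID//; apply/eqP.
rewrite -[RHS](I1_partial i (tfM t0 sphi)); apply: wI_ext => x.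
by rewrite partialM//; exact: smooth_differentiable.
Qed.

Lemma dgrad_translate U f G v : mbfun f -> (forall i, mbfun (G i)) -> dgrad U f G ->
  dgrad [set x | U (x + v)] (fun x => f (x + v)) (fun i x => G i (x + v)).
Proof.
move=> mf mG hd i psi tpsi.
have tr g : mbfun g -> \I[x] g (x + v) = I1 g.
  move=> mg; rewrite /wI /Rintegral; congr fine.
  have mg' : measurable_fun [set: E] (fun x => (g x * one x)%:E) by apply/measurable_EFinP; apply: mbfunM => //; exact: mbfun_cst.
  exact: (integral_translate v mg').
have tp : test_function U (fun x => psi (x - v)) by apply: tf_sub (tf_translate (- v) tpsi) => x /=; rewrite subrK.
have mp : mbfun (fun x => psi (x - v)) by apply: mbfun_continuous; apply: smooth_continuous; case: tp.
have mdp : mbfun (partial i (fun x => psi (x - v))) by apply: mbfun_continuous; apply: smooth_continuous; apply: smooth_partial; case: tp.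
have := hd i _ tp; rewrite -(tr _ (mbfunM mf mdp)) -(tr _ (mbfunM (mG i) mp)) => H.
rewrite [RHS](_ : _ = - \I[x] G i (x + v) * psi (x + v - v)).
  rewrite -H; apply: wI_ext => x; congr (_ _).
  by rewrite (partial_translate i (- v) psi (x + v)) addrK.
by congr (- _); apply: wI_ext => x; rewrite addrK.
Qed.

Lemma wint1_bounded f psi C U : mbfun f -> (forall x, `|f x| <= C) -> test_function U psi ->
  wint1 (fun x => f x * psi x).
Proof. by move=> mf fC tpsi; apply: wint_one_bmfun; exact: bmfunM mf fC (tf_bmfun tpsi). Qed.

Section weighted.
Variables (a : R) (B : set E) (f : E -> R) (G : 'I_(m + 1) -> E -> R) (C : R).
Hypotheses (a0 : 0 <= a) (hd : dgrad (hp `&` B) f G) (mf : mbfun f)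
  (fC : forall x, `|f x| <= C) (lG : forall i, l2 (wt a) (G i)).

(** The factor [eta] localizes: for a test function [psi] of the half space, [eta * psi] is one of
    the half space intersected with [B]. The product thus has a weak gradient in the entire half
    space. *)
Lemma dgrad_mul eta : test_function B eta ->
  dgrad hp (fun x => eta x * f x) (fun i x => eta x * G i x + partial i eta x * f x).
Proof.
move=> te i psi tpsi; have [se [K [cK KB K0]]] := te; have [sp [K' [cK' Kh K0']]] := tpsi.
have tp : test_function (hp `&` B) (fun x => eta x * psi x).
  split; first exact: smoothM.
  exists (K `&` K'); split; first by apply: compact_closedI => //; exact: compact_closedE.
    by move=> x [/KB ? /Kh].
  move=> x /not_andP[/K0->|/K0'->]; by rewrite ?mul0r ?mulr0.
have w1 : wint1 (fun x => f x * (eta x * partial i psi x)) by exact: wint1_bounded mf fC (tfM (tf_partial i tpsi) se).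
have w2 : wint1 (fun x => f x * (partial i eta x * psi x)) by exact: wint1_bounded mf fC (tfM tpsi (smooth_partial i se)).
have w3 : wint1 (fun x => G i x * (eta x * psi x)) by exact: tf_hp_wint a0 (lG i) (tfM tpsi se).
have := hd i tp.
have -> : \I[x] f x * partial i (fun x => eta x * psi x) x =
    \I[x] f x * (eta x * partial i psi x) + \I[x] f x * (partial i eta x * psi x).
  by rewrite -wID//; apply: wI_ext => x; rewrite partialM ?mulrDr//; exact: smooth_differentiable.
move=> H; have -> : \I[x] eta x * f x * partial i psi x = \I[x] f x * (eta x * partial i psi x).
  by apply: wI_ext => x; ring.
rewrite -[LHS](addrK (\I[x] f x * (partial i eta x * psi x))) H -opprD -wID//.
by congr (- _); apply: wI_ext => x; ring.
Qed.

Lemma dgradB g H D : dgrad (hp `&` B) g H -> mbfun g -> (forall x, `|g x| <= D) ->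
  (forall i, l2 (wt a) (H i)) ->
  dgrad (hp `&` B) (fun x => f x - g x) (fun i x => G i x - H i x).
Proof.
move=> hg mg gD lH i psi tpsi.
have tph : test_function hp psi by apply: tf_sub tpsi => [].
have := hd i tpsi; have := hg i _ tpsi => E2 E1.
have -> : \I[x] (f x - g x) * partial i psi x =
    \I[x] f x * partial i psi x - \I[x] g x * partial i psi x.
  rewrite -wIB; first by apply: wI_ext => x; rewrite mulrBl.
  - exact: wint1_bounded mf fC (tf_partial i tpsi).
  - exact: wint1_bounded mg gD (tf_partial i tpsi).
rewrite E1 E2 opprK addrC -opprB; congr (- _).
rewrite -wIB; first by apply: wI_ext => x; rewrite mulrBl.
- exact: tf_hp_wint a0 (lG i) tph.
- exact: tf_hp_wint a0 (lH i) tph.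
Qed.

End weighted.

(* The part of [G] at height above [e] is integrable for the unweighted measure. *)
Definition trunc (e : R) B (G : 'I_(m + 1) -> E -> R) i x : R :=
  if x \in (B `&` [set x | e < xn x] : set E) then G i x else 0.

Section truncation.
Variables (a r : R) (B : set E) (G : 'I_(m + 1) -> E -> R).
Hypotheses (a0 : 0 <= a) (oB : open B) (Br : B `<=` ball 0 r) (lG : forall i, l2 (wt a) (G i)).

Lemma open_above e : open (B `&` [set x : E | e < xn x]).
Proof.
apply: openI => //; rewrite (_ : [set x : E | _] = (@xn R m) @^-1` [set s | e < s])//.
by apply: open_comp; [move=> x _; exact: continuous_xn|exact: open_gt].
Qed.

Lemma mbfun_trunc e i : mbfun (trunc e B G i).
Proof. by apply: mbfun_if; [exact: (measurable_open (@open_above e))|exact: l2_mfun (lG i)]. Qed.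

Lemma wint1_trunc e i : 0 < e -> wint1 (trunc e B G i).
Proof.
move=> e0; have ea : 0 < e `^ a by [].
have w2 : wint1 (fun x => G i x ^+ 2 * wt a x) by have := (lG i).2; apply: eq_integrable => // x _; rewrite /one mulr1.
have mB := @measurable_ball_rV R (m + 1) 0 (`|r| + 1).
have bb : bmfun (fun x => if x \in (ball 0 (`|r| + 1) : set E) then (1 : R) else 0).
  split; first by apply: mbfun_if => //; exact: mbfun_cst.
  exists 1, (`|r| + 1); split => [|x|x xb]; first by rewrite ltr_wpDl.
    by case: ifP; rewrite ?normr1 ?normr0.
  by rewrite memNset.
apply: (wint_le weight_one (mbfun_trunc e i) _ (wintD (wint_one_bmfun bb) (wintZ (e `^ a)^-1 w2))) => x.
have w0 : 0 <= wt a x by have [_ + _] := weight_wt m a0; apply.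
rewrite /trunc; case: ifPn => [/set_mem[Bx /= ex]|_]; last first.
  rewrite normr0 addr_ge0//; first by case: ifP.
rewrite mem_set; last first.
  by have := Br Bx; rewrite !ball0E => h; rewrite (lt_le_trans h)// (le_trans (ler_norm _))// lerDl.
have ew : e `^ a <= wt a x.
  rewrite wtE; last exact: lt_trans ex.
  apply: ge0_ler_powR => //; rewrite ?nnegrE; [exact: ltW|exact: ltW (lt_trans e0 ex)|exact: ltW].
have h : G i x ^+ 2 <= (e `^ a)^-1 * (G i x ^+ 2 * wt a x) by rewrite -ler_pdivrMl ?invr_gt0// invrK mulrC ler_wpM2l ?sqr_ge0.
apply: le_trans (lerD (lexx 1) h); rewrite -sqr_normr.
have := sqr_ge0 (`|G i x| - 1); have := sqr_ge0 (`|G i x|); rewrite sqrrB1; lra.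
Qed.

Lemma trunc_le e i x : `|trunc e B G i x| <= `|G i x|.
Proof. by rewrite /trunc; case: ifP; rewrite ?normr0. Qed.

Lemma dgrad_trunc e f : 0 <= e -> dgrad (hp `&` B) f G ->
  dgrad (B `&` [set x | e < xn x]) f (trunc e B G).
Proof.
move=> e0 hd; apply: (@dgrad_ext _ f f G) => // [i x Ux|].
  by rewrite /trunc mem_set.
apply: dgrad_sub hd => x [Bx /= ex]; split => //; exact: le_lt_trans ex.
Qed.

(** A test function of the open half space lives above some positive height, where the truncated
    gradient is integrable without weight and [dgrad_sqr] applies. *)
Lemma dgrad_sqr_wt f : dgrad (hp `&` B) f G -> bmfun f ->
  (forall x, (hp `&` B) x -> {for x, continuous f}) ->
  dgrad (hp `&` B) (fun x => f x ^+ 2) (fun i x => 2 * f x * G i x).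
Proof.
move=> hd bf cf i psi tpsi; have [sp [K [cK Kh K0]]] := tpsi.
have [e e0 He] := @compact_hp R m K cK (fun x Kx => (Kh x Kx).1).
have e2 : 0 < e / 2 by [].
have [mf [D [r' [_ fD _]]]] := bf.
have tU : test_function (B `&` [set x | e / 2 < xn x]) psi.
  split => //; exists K; split => // x Kx; split; first by case: (Kh x Kx).
  by have := He x Kx; rewrite /=; lra.
rewrite (dgrad_sqr (@open_above _) mf (wint_one_bmfun bf) fD _ (@mbfun_trunc _) _ (dgrad_trunc (ltW e2) hd) i tU).
- congr (- _); apply: wI_ext => x; rewrite /trunc; case: ifPn => // /negP xU.
  rewrite K0 ?mulr0// => Kx; apply: xU; apply/mem_set; split; first by case: (Kh x).
  by have := He x Kx; rewrite /=; lra.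
- by move=> x [Bx /= ex]; apply: cf; split => //; exact: lt_trans ex.
- by move=> j; exact: wint1_trunc.
Qed.

(** Above height 1/(k+1) the gradient is integrable without weight and [translate_l2_bound] applies.
    A tangential shift preserves both the weight and this height, and dominated convergence lets k
    tend to infinity. *)
Lemma shift_bound f v V : dgrad (hp `&` B) f G -> bmfun f -> xn v = 0 -> open V ->
  (forall x s, V x -> 0 <= s <= 1 -> B (x + s *: v)) ->
  \I_a[x] (f (x + v) - f x) ^+ 2 * \1_V x <= \I_a[x] gdir v G x ^+ 2.
Proof.
move=> hd bf v0 oV VB; have hw := weight_wt m a0; have [mf _] := bf.
have wv s x : wt a (x + s *: v) = wt a x by apply: wt_translate; rewrite xnZ v0 mulr0.
have lD : l2 (wt a) (fun x => f (x + v) - f x).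
  apply: (l2B hw); last exact: l2_bmfun.
  by apply: l2_translate => [x|]; [exact: wt_translate|exact: l2_bmfun].
have lg : l2 (wt a) (gdir v G) by apply: l2_sum => // i; exact: l2Z.
pose Ve (k : nat) := V `&` [set x : E | k.+1%:R^-1 < xn x].
have oVe k : open (Ve k).
  apply: openI => //; rewrite (_ : [set x : E | _] = (@xn R m) @^-1` [set s | k.+1%:R^-1 < s])//.
  by apply: open_comp; [move=> x _; exact: continuous_xn|exact: open_gt].
have m1 (A : set E) : open A -> mbfun (fun x => \1_A x : R) by move=> oA; apply: measurable_indic; exact: measurable_open.
have i01 (A : set E) x : `|\1_A x : R| <= 1 by rewrite indicE; case: (_ \in _); rewrite ?normr1 ?normr0.
have wVe (A : set E) : open A -> wint (wt a) (fun x => (f (x + v) - f x) ^+ 2 * \1_A x).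
  move=> oA; apply: (wint_le hw _ _ lD.2); first by apply: mbfunM; [exact: mbfunX (l2_mfun lD)|exact: m1].
  by move=> x; rewrite normrM normrX sqr_normr ler_piMr ?sqr_ge0.
have H k : \I_a[x] (f (x + v) - f x) ^+ 2 * \1_(Ve k) x <= \I_a[x] gdir v G x ^+ 2.
  have k0 : 0 < k.+1%:R^-1 :> R by rewrite invr_gt0.
  have lt' : l2 (wt a) (gdir v (trunc k.+1%:R^-1 B G)).
    have lt1 i : l2 (wt a) (trunc k.+1%:R^-1 B G i) by apply: (l2_le hw _ _ (lG i)) => [|x]; [exact: mbfun_trunc|exact: trunc_le].
    by apply: (l2_sum hw) => i; exact: l2Z.
  apply: le_trans (_ : \I_a[x] gdir v (trunc k.+1%:R^-1 B G) x ^+ 2 <= _).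
    apply: (translate_l2_bound mf (wint_one_bmfun bf) (@mbfun_trunc k.+1%:R^-1) _ (dgrad_trunc _ hd)) => //.
    - by move=> i; exact: wint1_trunc.
    - by move=> x s [Vx /= ex] s01; split; [exact: VB|rewrite /= xnD xnZ v0 mulr0 addr0].
    - exact: wVe.
  apply: (wI_le hw); [exact: lt'.2|exact: lg.2|move=> x].
  rewrite /gdir /trunc; case: (boolP (x \in _)) => // _.
  by under eq_bigr do rewrite mulr0; rewrite big1// expr0n sqr_ge0.
have wd := (wVe setT openT).
have L : (fun k => \I_a[x] (f (x + v) - f x) ^+ 2 * \1_(Ve k) x) @ \oo -->
    \I_a[x] (f (x + v) - f x) ^+ 2 * \1_V x.
  apply: (proj2 (wI_cvg hw _ _ lD.2 _ _)).
  - by move=> k; apply: mbfunM; [exact: mbfunX (l2_mfun lD)|exact: m1].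
  - by apply: mbfunM; [exact: mbfunX (l2_mfun lD)|exact: m1].
  - by move=> k x; rewrite normrM normrX sqr_normr ler_piMr ?sqr_ge0.
  move=> x /wt_hp hx; apply: cvgM; first exact: cvg_cst.
  have xV : \forall k \near \oo, (\1_(Ve k) x : R) = \1_V x.
    near=> k; have xk : k.+1%:R^-1 < xn x.
      rewrite invf_plt ?posrE//; have : (xn x)^-1 < k%:R by near: k; exact: nbhs_infty_gtr.
      by move=> h; rewrite (lt_le_trans h)// ler_nat.
    rewrite !indicE; congr (nat_of_bool _)%:R; apply/idP/idP => /set_mem.
      by move=> [Vx _]; exact/mem_set.
    by move=> Vx; apply/mem_set.
  by apply: cvg_near_cst; move: xV; apply: filterS => k ->.
rewrite -(cvg_lim (@norm_hausdorff _ _) L); apply: limr_le; first by apply/cvg_ex; eexists; exact: L.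
by apply: nearW.
Unshelve. all: by end_near. Qed.

End truncation.

Definition flatI (g : E -> R) : R := wI (@one R m) (fun y => g (emb y)).

Let m1 : {sigma_finite_measure set 'rV[R]_m -> \bar R} := @leb R m.
Let m2 : {sigma_finite_measure set (measurableTypeR R) -> \bar R} := mu.

Lemma integral_rcons f : mbfun f -> wint1 f ->
  (\int[leb (m + 1)]_x (f x)%:E = \int[leb m]_y \int[mu]_s (f (rV_rcons y s))%:E)%E.
Proof.
move=> mf wf; pose p (q : 'rV[R]_m * measurableTypeR R) := (f (rV_rcons q.1 q.2))%:E.
have mp : measurable_fun setT p by apply/measurable_EFinP; exact: (measurableT_comp mf (@measurable_rV_rcons R m)).
have T (g : E -> \bar R) : measurable_fun setT g -> (forall x, (0 <= g x)%E) ->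
 (\int[leb _]_x g x = \int[m1 \x m2]_q g (rV_rcons q.1 q.2))%E.
  move=> mg g0; rewrite ge0_integral_rcons//.
  rewrite (@fubini_tonelli1 _ _ _ _ _ m1 m2 (fun q => g (rV_rcons q.1 q.2)))//.
  exact: (measurableT_comp mg (@measurable_rV_rcons R m)).
have mfE : measurable_fun [set: E] (EFin \o f) by exact/measurable_EFinP.
have ip : (m1 \x m2)%E.-integrable setT p.
  apply/integrableP; split => //.
  rewrite -(T (fun x => `|(f x)%:E|%E))//; last exact: measurableT_comp.
  have /integrableP[_] := wf; apply: le_lt_trans; apply: eqW.
  by apply: eq_integral => x _; rewrite /one mulr1.
rewrite (integral12_prod_meas1 ip) integralE [RHS]integralE; congr (_ - _)%E.
  by rewrite T//; [apply: eq_integral => q _; rewrite !funeposE|exact: measurable_funepos].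
by rewrite T//; [apply: eq_integral => q _; rewrite !funenegE|exact: measurable_funeneg].
Qed.

Lemma embE (y : 'rV[R]_m) : emb y = rV_rcons y 0.
Proof. by rewrite /emb /rV_rcons raddf0. Qed.

Lemma xn_rcons (y : 'rV[R]_m) s : xn (rV_rcons y s) = s.
Proof. exact: rV_rconsr. Qed.

Lemma xn_emb (y : 'rV[R]_m) : xn (emb y) = 0.
Proof. by rewrite embE xn_rcons. Qed.

Lemma rV_rcons_line (y : 'rV[R]_m) s : rV_rcons y s = emb y + s *: 'e_nn.
Proof.
have H (v w : E) k : (v + s *: w) ord0 k = v ord0 k + s * w ord0 k by rewrite !mxE.
apply/rowP => i; rewrite embE H; case: (split_ordP i) => j ->.
  by rewrite [delta_mx _ _ _ _]mxE !rV_rconsl eq_lrshift andbF mulr0 addr0.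
by rewrite [j]ord1 [delta_mx _ _ _ _]mxE !rV_rconsr !eqxx mulr1 add0r.
Qed.

(** Fubini in the normal variable, and the fundamental theorem of calculus on [0, M] with M beyond
    the support. *)
Lemma flat_ftc X : test_function setT X -> wI (wt 0) (partial nn X) = - flatI X.
Proof.
move=> tX; have [sX _] := tX; have [mX [C [r [r0 hC hr]]]] := tf_bmfun tX.
have [mdX [C' [r' [r0' hC' hr']]]] := tf_bmfun (tf_partial nn tX).
have m0 : mbfun (fun x : E => wt 0 x : R) := mbfun_wt 0.
pose f x := partial nn X x * wt 0 x.
have w01 x : 0 <= (wt 0 x : R) <= 1 by rewrite /wt powRr0; case: ifP; rewrite ?lexx ?ler01.
have bf : bmfun f.
  split; first exact: mbfunM.
  exists C', r'; split => // x; last by move=> /hr' h; rewrite /f h mul0r.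
  have /andP[w0 w1] := w01 x; rewrite normrM (ger0_norm w0) (le_trans (ler_piMr _ w1))//.
have wX : wint (@one R m) (fun y => X (emb y)).
  apply: wint_one_bmfun; split.
    rewrite /mbfun (_ : (fun y => _) = X \o (fun y : 'rV[R]_m => rV_rcons y 0)).
      apply: (measurableT_comp mX).
      exact: (measurableT_comp (@measurable_rV_rcons R m) (measurable_fun_pair (@measurable_id _ _ _) (@measurable_cst _ _ _ _ _ (0 : measurableTypeR R)))).
    by apply/funext => y; rewrite /= embE.
  exists C, r; split => // y yr; apply: hr => h; apply: yr.
  move: h => /ball_rVP[_ h]; apply/ball_rVP; split => // i.
  by have := h (lshift 1 i); rewrite embE rV_rconsl !mxE.
rewrite /flatI -wIN// /wI /Rintegral; congr fine.
rewrite (integral_rcons (f := f) (proj1 bf) (wint_one_bmfun bf)).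
apply: eq_integral => y _; rewrite /one mulr1.
pose M := r + r'; have M0 : 0 < M by exact: addr_gt0.
pose phi (s : R) := X (emb y + s *: 'e_nn).
have Dphi (s : R) : is_derive s 1 phi (partial nn X (rV_rcons y s)).
  have := smooth_is_derive (emb y) 'e_nn s sX.
  by rewrite -[X in is_derive _ _ _ X]/(dirder _ _ _) dirder_delta -rV_rcons_line.
have far (s : R) : M <= `|s| -> X (rV_rcons y s) = 0 /\ partial nn X (rV_rcons y s) = 0.
  move=> Ms; have h : `|s| <= `|rV_rcons y s|.
    by rewrite -[X in `|X| <= _](xn_rcons y s); exact: rV_norm_coord.
  by split; [apply: hr|apply: hr']; rewrite ball0E => h'; move: h h' Ms r0 r0'; rewrite /M; lra.
have cphi s : {for s, continuous phi} by apply/differentiable_continuous; rewrite -derivable1_diffP; have [] := Dphi s.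
pose dphi (s : R) := partial nn X (rV_rcons y s).
have cdphi s : {for s, continuous dphi}.
  apply/differentiable_continuous; rewrite -derivable1_diffP.
  have [d _] := smooth_is_derive (emb y) 'e_nn s (smooth_partial nn sX).
  by move: d; apply: near_eq_derivable; near=> t; rewrite /dphi rV_rcons_line.
have H : (\int[mu]_(x in `[0%R, M]) (dphi x)%:E = (phi M)%:E - (phi 0)%:E)%E.
  apply: continuous_FTC2 => //.
  - by apply/continuous_in_subspaceT => s _; exact: cdphi.
  - split; first by move=> s _; have [] := Dphi s.
    + exact: cvg_at_right_filter (cphi 0).
    + exact: cvg_at_left_filter (cphi M).
  - by move=> s _; rewrite derive1E; exact: derive_val.
have phiM : phi M = 0 by rewrite /phi -rV_rcons_line; have [] := far M _; rewrite ?gtr0_norm.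
rewrite phiM sub0e /phi scale0r addr0 in H; rewrite EFinN -H.
rewrite -integral_itv_obnd_cbnd; last first.
  apply/measurable_EFinP; apply: measurable_funTS.
  exact: (measurableT_comp mdX (measurableT_comp (@measurable_rV_rcons R m) (measurable_fun_pair (@measurable_cst _ _ _ _ _ y) (@measurable_id _ (measurableTypeR R) _)))).
rewrite [RHS]integral_mkcond; apply: eq_integral => s _; rewrite /patch /f.
case: ifPn => [|/negP sM].
  rewrite inE/= in_itv/= => /andP[s0 _]; rewrite /wt xn_rcons s0 powRr0 mulr1//.
have [s0|s0] := ltP 0 s; last by rewrite /wt xn_rcons ltNge s0 mulr0.
rewrite (proj2 (far s _)) ?mul0r// gtr0_norm// leNgt; apply/negP => sM'.
by apply: sM; rewrite inE/= in_itv/= s0 ltW.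
Unshelve. all: by end_near. Qed.

End weak_calculus.

(** * The convex penalty *)

Section two_phase_penalty.
Context {R : realType}.
Variables (lp lm : R).
Hypotheses (lp0 : 0 < lp) (lm0 : 0 < lm).
Implicit Types (s t e : R).

Definition jd (lp lm s : R) : R := lp * Num.max s 0 + lm * Num.max (- s) 0.

Lemma jd_pos s : 0 <= s -> jd lp lm s = lp * s.
Proof. by move=> s0; rewrite /jd max_l// max_r ?oppr_le0// mulr0 addr0. Qed.

Lemma jd_neg s : s <= 0 -> jd lp lm s = - lm * s.
Proof. by move=> s0; rewrite /jd max_r// max_l ?oppr_ge0// mulr0 add0r mulNr mulrN. Qed.

(** The penalty is the maximum of the two linear functions lp s and -lm s. Convexity and the
    Lipschitz bound are drawn from these inequalities together with [jd_cases]. *)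
Lemma jd_ge s : lp * s <= jd lp lm s /\ - lm * s <= jd lp lm s.
Proof.
have [s0|/ltW s0] := leP 0 s.
  by rewrite jd_pos//; split => //; have := mulr_ge0 (ltW lp0) s0; have := mulr_ge0 (ltW lm0) s0; lra.
by rewrite jd_neg//; split => //; have := mulr_ge0_le0 (ltW lp0) s0; have := mulr_ge0_le0 (ltW lm0) s0; lra.
Qed.

Lemma jd_cases s : jd lp lm s = lp * s \/ jd lp lm s = - lm * s.
Proof. by have [s0|/ltW s0] := leP 0 s; [left; exact: jd_pos|right; exact: jd_neg]. Qed.

Lemma jd_convex s t e : 0 <= e <= 1 -> jd lp lm (s + e * (t - s)) <= jd lp lm s + e * (jd lp lm t - jd lp lm s).
Proof.
move=> /andP[e0 e1]; have [s1 s2] := jd_ge s; have [t1 t2] := jd_ge t.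
have f0 : 0 <= 1 - e by rewrite subr_ge0.
have [->|->] := jd_cases (s + e * (t - s)).
  by have := ler_wpM2l e0 t1; have := ler_wpM2l f0 s1; lra.
by have := ler_wpM2l e0 t2; have := ler_wpM2l f0 s2; lra.
Qed.

Lemma jd_lip s t : `|jd lp lm (s + t) - jd lp lm s| <= (lp + lm) * `|t|.
Proof.
have [s1 s2] := jd_ge s; have [t1 t2] := jd_ge (s + t).
have h := ler_norm t; have h' := ler_norm (- t); rewrite normrN in h'.
have a1 := ler_wpM2l (ltW lp0) h; have a2 := ler_wpM2l (ltW lp0) h'.
have b1 := ler_wpM2l (ltW lm0) h; have b2 := ler_wpM2l (ltW lm0) h'.
have n0 := normr_ge0 t; have c1 := mulr_ge0 (ltW lp0) n0; have c2 := mulr_ge0 (ltW lm0) n0.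
rewrite ler_norml; have [E1|E1] := jd_cases (s + t); have [E2|E2] := jd_cases s;
  by rewrite E1 in t1 t2 *; rewrite E2 in s1 s2 *; apply/andP; split; lra.
Qed.

Lemma jd_norm s : `|jd lp lm s| <= (lp + lm) * `|s|.
Proof. by have := jd_lip 0 s; rewrite add0r [jd lp lm 0]jd_pos// mulr0 subr0. Qed.

Lemma mbfun_jd n (f : 'rV[R]_n -> R) : mbfun f -> mbfun (fun x => jd lp lm (f x)).
Proof.
move=> mf; apply: mbfunD; apply: mbfunZ; apply: measurable_maxr => //; try exact: mbfun_cst.
exact: mbfunN.
Qed.

End two_phase_penalty.

Lemma jdN (R : realType) (lp lm s : R) : jd lm lp (- s) = jd lp lm s.
Proof. by rewrite /jd opprK addrC. Qed.

(** * Integration over the flat part *)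

Section flat_integral.
Context {R : realType} {m : nat}.
Local Notation E := 'rV[R]_(m + 1).
Implicit Types (f : E -> R) (k y : 'rV[R]_m).

Lemma embD y k : emb (y + k) = emb y + emb k :> E.
Proof. by rewrite /emb add_row_mx addr0. Qed.

Lemma embB y k : emb (y - k) = emb y - emb k :> E.
Proof. by apply/eqP; rewrite -subr_eq opprK -embD subrK. Qed.

Lemma ball_emb y (r : R) : ball 0 r (emb y : E) -> ball 0 r y.
Proof.
move=> /ball_rVP[r0 h]; apply/ball_rVP; split => // i.
by have := h (lshift 1 i); rewrite embE rV_rconsl !mxE.
Qed.

Lemma mbfun_emb f : mbfun f -> mbfun (fun y : 'rV[R]_m => f (emb y)).
Proof.
move=> mf; rewrite /mbfun (_ : (fun y => _) = f \o (fun y : 'rV[R]_m => rV_rcons y 0)).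
  apply: (measurableT_comp mf).
  exact: (measurableT_comp (@measurable_rV_rcons R m) (measurable_fun_pair (@measurable_id _ _ _) (@measurable_cst _ _ _ _ _ (0 : measurableTypeR R)))).
by apply/funext => y; rewrite /= embE.
Qed.

Lemma bmfun_emb f : bmfun f -> bmfun (fun y : 'rV[R]_m => f (emb y)).
Proof.
move=> [mf [C [r [r0 hC hr]]]]; split; first exact: mbfun_emb.
by exists C, r; split => // y yr; apply: hr => /ball_emb.
Qed.

Lemma flatI_translate f k : mbfun f -> flatI (fun x => f (x + emb k)) = flatI f.
Proof.
move=> mf; rewrite /flatI /wI /Rintegral; congr fine.
have mg : measurable_fun [set: 'rV[R]_m] (fun y => (f (emb y) * one y)%:E) by apply/measurable_EFinP; apply: mbfunM; [exact: mbfun_emb|exact: mbfun_cst].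
rewrite -(integral_translate k mg); apply: eq_integral => y _.
by rewrite embD.
Qed.

End flat_integral.

(** * Local minimizers: flux identities and the Caccioppoli inequality *)

Section local_minimizer.
Context {R : realType} {m : nat}.
Local Notation E := 'rV[R]_(m + 1).
Implicit Types (f g u phi zeta eta : E -> R) (x v z : E) (s t a lp lm r : R) (B : set E) (i : 'I_(m + 1)) (G Gam : 'I_(m + 1) -> E -> R).

(** A variation with its weak gradient, compactly supported in [B]. The set [B] may cross the flat
    part and the gradient is tested in the open half space only, so the trace of [phi] there is
    free. *)
Definition admissible a B phi Gam := [/\ continuous phi,
  (exists K, [/\ compact K, K `<=` B & forall x, ~ K x -> phi x = 0 /\ forall i, Gam i x = 0]),
  (forall i, l2 (wt a) (Gam i)) & dgrad hp phi Gam].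

(* The first-order condition is what minimality of [u] leaves after linearizing
   the Dirichlet part; the penalty is convex and is kept as it is. *)
Record local_min a lp lm z r u G : Prop := LocalMin {
  lmin_a : 0 <= a < 1;
  lmin_p : 0 < lp;
  lmin_m : 0 < lm;
  lmin_r : 0 < r;
  lmin_z : xn z = 0;
  lmin_bm : bmfun u;
  lmin_cont : forall x, ball z r x -> {for x, continuous u};
  lmin_l2 : forall i, l2 (wt a) (G i);
  lmin_supp : forall i x, ~ ball z r x -> G i x = 0;
  lmin_grad : dgrad (hp `&` ball z r) u G;
  lmin_EL : forall phi Gam, admissible a (ball z r) phi Gam ->
    0 <= \I_a[x] \sum_i G i x * Gam i x +
      flatI (fun x => jd lp lm (u x + phi x) - jd lp lm (u x)) }.

Lemma lmin_a0 a lp lm z r u G : local_min a lp lm z r u G -> 0 <= a.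
Proof. by case=> /andP[]. Qed.

Lemma lmin_rho a lp lm z r u G : local_min a lp lm z r u G -> 0 < r / 8.
Proof. by case=> *; pos. Qed.

Lemma continuous_addv v : continuous (fun x : E => x + v).
Proof.
by move=> x; apply: differentiable_continuous; apply: differentiableD.
Qed.

Lemma continuous_translate g v x : {for x + v, continuous g} -> {for x, continuous (fun y : E => g (y + v))}.
Proof. by move=> cg; apply: (@continuous_comp _ _ _ (fun y : E => y + v) g x) => //; exact: continuous_addv. Qed.

Lemma continuous_tf_mul U eta g : test_function U eta -> (forall x, U x -> {for x, continuous g}) ->
  continuous (fun x => eta x * g x).
Proof.
move=> [se [K [cK KU K0]]] cg x; have [Kx|Kx] := pselect (K x).
  by apply: continuous_mul; [exact: smooth_continuous|exact: cg (KU x Kx)].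
have oK : nbhs x (~` K) by apply: open_nbhs_nbhs; split => //; apply: closed_openC; exact: compact_closedE.
have near0 : \forall y \near x, eta y * g y = 0 by apply: filterS oK => y Ky; rewrite K0// mul0r.
rewrite /continuous_at (K0 _ Kx) mul0r; exact: cvg_near_cst near0.
Qed.

Lemma tf_partial_zero B eta (K : set E) i x : compact K -> (forall x, ~ K x -> eta x = 0) -> ~ K x -> partial i eta x = 0.
Proof.
move=> cK K0 Kx; rewrite -(partial_cst i 0 x); apply: partial_near.
have : nbhs x (~` K) by apply: open_nbhs_nbhs; split => //; apply: closed_openC; exact: compact_closedE.
by apply: filterS => y; exact: K0.
Qed.

Lemma admissibleN a B phi Gam : 0 <= a -> admissible a B phi Gam ->
  admissible a B (fun x => - phi x) (fun i x => - Gam i x).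
Proof.
move=> a0 [cphi [K [cK KB K0]] lGam gphi]; split.
- by move=> x; apply: continuousN; exact: cphi.
- exists K; split => // x Kx; have [-> Z] := K0 x Kx; rewrite oppr0; split => // i.
  by rewrite Z oppr0.
- by move=> i; exact/l2N.
- exact: dgradN.
Qed.

Lemma admissible_tf a B zeta : 0 <= a -> test_function B zeta -> admissible a B zeta (fun i => partial i zeta).
Proof.
move=> a0 tz; have [sz [K [cK KB K0]]] := tz; split.
- exact: smooth_continuous.
- exists K; split => // x Kx; split; first exact: K0.
  by move=> i; exact: tf_partial_zero K0 Kx.
- by move=> i; apply: (l2_bmfun (weight_wt m a0)); exact: tf_bmfun (tf_partial i tz).
- by apply: dgrad_tf; exact: tf_sub (@subsetT _ _) tz.
Qed.

Lemma l2_dvg a B zeta i : 0 <= a -> test_function B zeta -> okn i zeta -> l2 (wt a) (dvg a i zeta).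
Proof.
move=> a0 tz ok; have hw := weight_wt m a0.
have mz : mbfun zeta by case: (tf_bmfun tz).
have [mdz [D [r' [r0 hD hr]]]] := tf_bmfun (tf_partial i tz).
apply: (l2D hw); first exact: (l2_bmfun hw (tf_bmfun (tf_partial i tz))).
have [/eqP iE|_] := boolP (i == _); last exact: l2_0.
have [C HC] := ok iE; have [_ [D' [r'' [r0' hD' hr']]]] := tf_bmfun tz.
split; first by apply: mbfunM; [exact: mbfunZ|exact: mbfun_xnV].
pose g (x : E) := if x \in (ball 0 r'' : set E) then (a * C) ^+ 2 else 0.
have bg : bmfun g.
  split; first by apply: mbfun_if; [exact: measurable_ball_rV|exact: mbfun_cst].
  exists ((a * C) ^+ 2), r''; split => // x; last by move=> xb; rewrite /g memNset.
  by rewrite /g; case: ifP; rewrite ?normr0 ?sqr_ge0// ger0_norm// sqr_ge0.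
pose f x := if x \in (@hp R m) then (a * zeta x / xn x) ^+ 2 else 0.
have mhp := measurable_open (@open_hp R m).
have wf : wint (wt a) f.
  apply: (wint_le hw _ _ (wint_bmfun hw bg)).
    by apply: mbfun_if => //; apply: mbfunX; apply: mbfunM; [exact: mbfunZ|exact: mbfun_xnV].
  move=> x; rewrite /f /g; case: ifPn => [/set_mem hx|_]; last first.
    by rewrite normr0; case: ifP; rewrite ?sqr_ge0.
  case: ifPn => [_|/negP xb]; last by rewrite hr' ?mulr0 ?mul0r ?expr0n ?normr0// => h; apply: xb; exact/mem_set.
  rewrite normrX -mulrA normrM (ger0_norm a0) !exprMn ler_wpM2l ?sqr_ge0//.
  have h : `|zeta x / xn x| <= C by rewrite normf_div (gtr0_norm hx) ler_pdivrMr// HC.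
  by rewrite -[`|_| ^+ 2]/(_ ^+ 2) ler_sqr ?nnegrE// (le_trans _ h).
move: wf; apply: eq_integrable => // x _; congr EFin; rewrite /f.
by case: ifPn => // /negP hx; rewrite wt_out ?mulr0// => /mem_set.
Qed.

Variables (a lp lm r : R) (z : E) (u : E -> R) (G : 'I_(m + 1) -> E -> R).
Hypothesis hu : local_min a lp lm z r u G.

Let a0 := lmin_a0 hu.
Let hw := weight_wt m a0.
Let lp0 := lmin_p hu.
Let lm0 := lmin_m hu.
Let lG := lmin_l2 hu.
Let mu := proj1 (lmin_bm hu).

(** The weighted Dirichlet pairing of [u] with [zeta]. Since it vanishes on traceless [zeta]
    ([ell_trace0]), it acts on traces: formally it is minus the integral over the flat part of zeta
    times the flux, the limit of x_n^a d_n u. *)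
Definition ell G zeta : R := \I_a[x] \sum_i G i x * partial i zeta x.

Lemma wint_dot F H : (forall i, l2 (wt a) (F i)) -> (forall i, l2 (wt a) (H i)) ->
  wint (wt a) (fun x => \sum_(i < m + 1) F i x * H i x).
Proof. by move=> lF lH; apply: wint_sum => i; exact: (wint_mul hw). Qed.

Lemma l2_tf B zeta : test_function B zeta -> l2 (wt a) zeta.
Proof. by move=> tz; apply: (l2_bmfun hw); exact: tf_bmfun tz. Qed.

Lemma l2_partial B zeta i : test_function B zeta -> l2 (wt a) (partial i zeta).
Proof. by move=> tz; exact: l2_tf (tf_partial i tz). Qed.

Lemma ell_EL t zeta : test_function (ball z r) zeta ->
  0 <= t * ell G zeta + flatI (fun x => jd lp lm (u x + t * zeta x) - jd lp lm (u x)).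
Proof.
move=> tz; have [sz _] := tz.
have t2 : test_function (ball z r) (fun x => t * zeta x) by apply: tfM; by [].
have := lmin_EL hu (admissible_tf a0 t2).
rewrite (_ : wI (wt a) _ = t * ell G zeta)// -wIZ; last exact: wint_dot (fun i => l2_partial i tz).
apply: wI_ext => x; rewrite mulr_sumr; apply: eq_bigr => i _.
rewrite partialZ; first by rewrite mulrCA.
exact: smooth_differentiable.
Qed.

Lemma wint_jd phi : bmfun phi ->
  wint (@one R m) (fun y => jd lp lm (u (emb y) + phi (emb y)) - jd lp lm (u (emb y))).
Proof.
move=> bp; have mue := mbfun_emb mu; have bpe := bmfun_emb bp.
have w1 := wintZ (lp + lm) (wint_abs weight_one (wint_one_bmfun bpe)).
apply: (wint_le weight_one _ _ w1) => [|y]; last exact: jd_lip.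
by apply: mbfunB; apply: mbfun_jd => //; apply: mbfunD => //; case: bpe.
Qed.

(* Both [zeta] and [- zeta] are admissible. *)
Lemma ell_trace0 zeta : test_function (ball z r) zeta -> (forall y, zeta (emb y) = 0) -> ell G zeta = 0.
Proof.
move=> tz z0.
have H t : 0 <= t * ell G zeta.
  have := ell_EL t tz; rewrite (_ : flatI _ = 0) ?addr0// -(wI0 (@one R m)).
  by apply: wI_ext => y; rewrite z0 mulr0 addr0 subrr.
by have := H 1; have := H (-1); lra.
Qed.

(** On the compact flat part of the support [u] exceeds some d > 0. A small variation of either sign
    therefore stays in the range where the penalty is linear, and the two inequalities give an
    equality. *)
Lemma ell_pos zeta : test_function [set x | ball z r x /\ (xn x = 0 -> 0 < u x)] zeta ->
  ell G zeta = - lp * flatI zeta.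
Proof.
move=> tz; have [sz [K [cK KU K0]]] := tz.
have tz' : test_function (ball z r) zeta by apply: tf_sub tz => x [].
have [mz [C [r' [r0' hC hr']]]] := tf_bmfun tz.
have C0 : 0 <= C by rewrite (le_trans _ (hC 0)).
pose K1 := K `&` (@xn R m) @^-1` [set 0].
have cK1 : compact K1.
  apply: compact_closedI => //; apply: preimage_closed; last exact: closed_eq.
  by move=> ? _; exact: continuous_xn.
have [d d0 Hd] : exists2 d, 0 < d & forall x, K1 x -> d < u x.
  have [K10|K10] := pselect (K1 !=set0); last by exists 1 => // x K1x; case: K10; exists x.
  have cu : {within K1, continuous (fun x => - u x)} by apply: continuous_in_subspaceT => x /set_mem[/KU[Bx _] _]; exact: continuousN (lmin_cont hu Bx).
  have [c /set_mem[/KU[_ uc] /uc{}uc] Hc] := EVT_max_rV K10 cK1 cu.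
  by exists (u c / 2) => [|x /mem_set/Hc]; lra.
pose t := d / (C + 1); have t0 : 0 < t by rewrite divr_gt0// ltr_wpDl.
have H s : `|s| = t -> 0 <= s * (ell G zeta + lp * flatI zeta).
  move=> st; have := ell_EL s tz'.
  rewrite (_ : flatI _ = s * (lp * flatI zeta)) ?mulrDr//.
  rewrite /flatI mulrA -wIZ; last exact: wint_one_bmfun (bmfun_emb (tf_bmfun tz)).
  apply: wI_ext => y; have [Ky|/K0->] := pselect (K (emb y)); last first.
    by rewrite !mulr0 addr0 subrr.
  have uy : d < u (emb y) by apply: Hd; split => //=; exact: xn_emb.
  have sz' : `|s * zeta (emb y)| <= d.
    rewrite normrM st /t mulrAC ler_pdivrMr ?ltr_wpDl// ler_pM2l//.
    by rewrite (le_trans (hC _))// lerDl.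
  have := ler_norm (- (s * zeta (emb y))); rewrite normrN => h.
  rewrite !jd_pos//; first by ring.
  - exact: ltW (lt_trans d0 uy).
  - by lra.
have := H t (gtr0_norm t0); have := H (- t); rewrite normrN => /(_ (gtr0_norm t0)).
rewrite mulNr oppr_ge0 => h1 h2.
have : t * (ell G zeta + lp * flatI zeta) == 0 by rewrite eq_le h1 h2.
rewrite mulf_eq0 (gt_eqF t0)/= => /eqP; lra.
Qed.

Section translation.
Variable k : 'rV[R]_m.
Let h : E := emb k.
Let h0 : xn h = 0. Proof. exact: xn_emb. Qed.
Let wth x : wt a (x + h) = wt a x. Proof. exact: wt_translate. Qed.

Definition Du x : R := u (x + emb k) - u x.
Definition DG i x : R := G i (x + emb k) - G i x.
Definition dom2 : set E := [set x | ball z r x /\ ball z r (x + emb k)].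

Lemma open_dom2 : open dom2.
Proof.
rewrite (_ : dom2 = ball z r `&` ball (z - h) r).
  by apply: openI; apply: ball_open; exact: lmin_r hu.
by apply/seteqP; split => x [h1 h2]; split => //; move: h2; rewrite !ballE;
  rewrite opprD addrA addrAC.
Qed.

Lemma bmfun_Du : bmfun Du.
Proof.
have [mu' [C [s [s0 hC hs]]]] := lmin_bm hu.
have mD : mbfun Du by apply: mbfunB => //; exact: mbfun_translate.
split => //; exists (C + C), (s + `|h|); split => [|x|x xs]; first by rewrite ltr_wpDr.
  by rewrite (le_trans (ler_normB _ _))// lerD.
rewrite /Du !hs ?subr0// ball0E; apply/negP; rewrite -leNgt.
  by move: xs; rewrite ball0E => /negP; rewrite -leNgt; have := normr_ge0 h; lra.
by have := lerB_normD x h; move: xs; rewrite ball0E => /negP; rewrite -leNgt -/h; lra.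
Qed.

Lemma l2_DG i : l2 (wt a) (DG i).
Proof. by apply: (l2B hw) => //; exact: l2_translate wth (lG i). Qed.

Lemma Du_continuous x : dom2 x -> {for x, continuous Du}.
Proof.
move=> [Bx Bxh]; have c1 := lmin_cont hu Bx; have c2 := lmin_cont hu Bxh.
apply: continuousB => //.
exact: continuous_translate c2.
Qed.

Lemma dgrad_Du : dgrad (hp `&` dom2) Du DG.
Proof.
have [mu' [C [s [s0 hC hs]]]] := lmin_bm hu.
have d1 : dgrad (hp `&` dom2) (fun x => u (x + h)) (fun i x => G i (x + h)).
  have d := @dgrad_translate _ _ _ _ _ h mu' (fun i => l2_mfun (lG i)) (lmin_grad hu).
  by apply: dgrad_sub d => x [hx [_ xh]]; split => //; rewrite /hp /= xnD h0 addr0.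
have d2 : dgrad (hp `&` dom2) u G by apply: dgrad_sub (lmin_grad hu) => x [hx []].
apply: (dgradB a0 d1 (mbfun_translate h mu') (fun => hC _) _ d2 mu' hC lG) => i.
exact: l2_translate wth (lG i).
Qed.

(* Test with [eta Du] and with its backward translate; the penalty terms cancel
   because the penalty is convex. *)
Lemma caccioppoli eta : test_function dom2 eta -> (forall x, 0 <= eta x <= 1) ->
  \I_a[x] eta x * \sum_i DG i x ^+ 2 <=
  - \I_a[x] \sum_i Du x * DG i x * partial i eta x.
Proof.
move=> te e01; have [se [K [cK KU K0]]] := te.
have [mD [C [s [s0 hC hs]]]] := bmfun_Du.
have e1 x : `|eta x| <= 1 by have /andP[h1 h2] := e01 x; rewrite ger0_norm.
pose phi x := eta x * Du x.
pose Gam i x := eta x * DG i x + partial i eta x * Du x.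
have me : mbfun eta by exact: mbfun_continuous (smooth_continuous se).
have lGam i : l2 (wt a) (Gam i).
  apply: (l2D hw); first exact: (l2_bounded hw me e1 (l2_DG i)).
  apply: (l2_ext (f := fun x => Du x * partial i eta x)) => [x|]; first exact: mulrC.
  exact: (l2_bounded hw mD hC (l2_partial i te)).
have cphi : continuous phi by apply: continuous_tf_mul te _; exact: Du_continuous.
have gphi : dgrad hp phi Gam := dgrad_mul a0 dgrad_Du mD hC l2_DG te.
have Z x : ~ K x -> phi x = 0 /\ forall i, Gam i x = 0.
  move=> Kx; rewrite /phi /Gam K0// mul0r; split => // i.
  by rewrite mul0r (tf_partial_zero _ _ cK K0 Kx) ?mul0r ?addr0//.
have ad1 : admissible a (ball z r) phi Gam by split => //; exists K; split => // x /KU[].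
have mphi : mbfun phi by exact: mbfunM.
have bphi : bmfun phi := bmfun_compact cphi cK (fun x Kx => (Z x Kx).1).
have d3 := @dgrad_translate _ _ _ _ _ (- h) mphi (fun i => l2_mfun (lGam i)) gphi.
have ad2 : admissible a (ball z r) (fun x => phi (x - h)) (fun i x => Gam i (x - h)).
  split.
  - by move=> x; apply: continuous_translate; exact: cphi.
  - exists ((fun x => x + h) @` K); split.
    + apply: continuous_compact => //; apply: continuous_subspaceT => x.
      exact: continuous_addv.
    + by move=> _ [x /KU[_ ?] <-].
    + move=> x Kx; have [| Z2] := Z (x - h) => //.
      by move=> Kxh; apply: Kx; exists (x - h) => //; rewrite subrK.
  - by move=> i; apply: l2_translate => // x; rewrite -[in RHS](subrK h x) wth.
  - by apply: dgrad_sub d3 => x; rewrite /hp /= xnD xnN h0 subr0.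
have {}ad2 := admissibleN a0 ad2.
have EL1 := lmin_EL hu ad1; have EL2 := lmin_EL hu ad2.
have mhb : mbfun (fun x => phi (x - h)) by [].
have tr : flatI (fun x => jd lp lm (u x + - phi (x - h)) - jd lp lm (u x)) =
    flatI (fun x => jd lp lm (u (x + h) - phi x) - jd lp lm (u (x + h))).
  rewrite -(flatI_translate k); last first.
    apply: mbfunB; apply: mbfun_jd => //; apply: mbfunD => //; exact: mbfunN.
  by apply: wI_ext => y; rewrite addrK.
have lGb i : l2 (wt a) (fun x => - Gam i (x - h)) by case: ad2.
have lGh i : l2 (wt a) (fun x => G i (x + h)) by exact: l2_translate wth (lG i).
have trI : \I_a[x] \sum_i G i x * - Gam i (x - h) =
    - \I_a[x] \sum_i G i (x + h) * Gam i x.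
  have [_ <-] := wI_translate (wint_dot lG lGb) wth.
  rewrite -wIN; apply: wI_ext => x; rewrite -sumrN; apply: eq_bigr => i _.
  by rewrite addrK mulrN.
rewrite tr trI in EL2.
have w1 := wint_jd bphi.
have w2 : wint (@one R m) (fun y => jd lp lm (u (emb y + h) - phi (emb y)) - jd lp lm (u (emb y + h))).
  have muh := mbfun_emb (mbfun_translate h mu).
  have bpe := bmfun_emb bphi.
  apply: (wint_le weight_one _ _ (wintZ (lp + lm) (wint_abs weight_one (wint_one_bmfun bpe)))) => [|y].
    by apply: mbfunB; apply: mbfun_jd => //; apply: mbfunB => //; case: bpe.
  by rewrite -[`|phi _|]normrN; exact: jd_lip.
have conv : flatI (fun x => jd lp lm (u x + phi x) - jd lp lm (u x)) +
    flatI (fun x => jd lp lm (u (x + h) - phi x) - jd lp lm (u (x + h))) <= 0.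
  rewrite -wID//; rewrite -(wI0 (@one R m)); apply: (wI_le weight_one).
  - exact: wintD.
  - exact: wint0.
  move=> y; set s1 := u (emb y); set s2 := u (emb y + h).
  have c1 := jd_convex lp0 lm0 s1 s2 (e01 (emb y)); have c2 := jd_convex lp0 lm0 s2 s1 (e01 (emb y)).
  rewrite /phi /Du -/s1 -/h -/s2.
  by rewrite (_ : s2 - eta (emb y) * (s2 - s1) = s2 + eta (emb y) * (s1 - s2)); [lra|ring].
have main : \I_a[x] \sum_i G i (x + h) * Gam i x - \I_a[x] \sum_i G i x * Gam i x <= 0 by lra.
rewrite -wIB in main; [|exact: wint_dot..].
have wA : wint (wt a) (fun x => eta x * \sum_i DG i x ^+ 2).
  apply: (wint_ext (f := fun x => \sum_i DG i x * (eta x * DG i x))).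
    by move=> x; rewrite mulr_sumr; apply: eq_bigr => i _; ring.
  by apply: wint_dot => i; [exact: l2_DG|exact: (l2_bounded hw me e1 (l2_DG i))].
have wB : wint (wt a) (fun x => \sum_i Du x * DG i x * partial i eta x).
  apply: (wint_ext (f := fun x => \sum_i DG i x * (Du x * partial i eta x))).
    by move=> x; apply: eq_bigr => i _; ring.
  by apply: wint_dot => i; [exact: l2_DG|exact: (l2_bounded hw mD hC (l2_partial i te))].
rewrite -subr_le0 opprK -wID//; apply: le_trans main; apply: eqW.
apply: wI_ext => x; rewrite mulr_sumr -big_split -sumrB /=; apply: eq_bigr => i _.
by rewrite /Gam /DG -/h; ring.
Qed.

(** The weighted Laplacian x_n^(-b) div (x_n^b grad eta). *)
Definition Lop (b : R) eta x : R := \sum_i dvg b i (partial i eta) x.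

(** Since 2 Du grad Du is the gradient of Du^2, a further integration by parts moves both
    derivatives onto [eta], with no boundary term by [okn]. In weak form: Du^2 is a subsolution with
    Neumann condition on the flat part. *)
Lemma caccioppoli_Lop eta : test_function dom2 eta -> (forall x, 0 <= eta x <= 1) ->
  (forall i, okn i (partial i eta)) ->
  2 * \I_a[x] eta x * \sum_i DG i x ^+ 2 <= \I_a[x] Du x ^+ 2 * Lop a eta x.
Proof.
move=> te e01 ok; have [mD [C [s [s0 hC hs]]]] := bmfun_Du.
have bD2 : bmfun (fun x => Du x ^+ 2) by have := bmfunM mD hC bmfun_Du; congr bmfun; apply/funext => x; rewrite expr2.
have lH i : l2 (wt a) (fun x => 2 * Du x * DG i x).
  apply: (l2_ext (f := fun x => 2 * (Du x * DG i x))) => [x|]; first by rewrite mulrA.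
  by apply: l2Z; exact: (l2_bounded hw mD hC (l2_DG i)).
have dr : dom2 `<=` ball 0 (`|z| + r) by move=> x [+ _]; rewrite ball0E ballEC => h1; have := lerB_normD x (- z); rewrite normrN -[x - z]addrC addrC; have := ler_dist_dist x z; have := ler_normD (x - z) z; rewrite subrK; lra.
have D2 := dgrad_sqr_wt a0 open_dom2 dr l2_DG dgrad_Du bmfun_Du (fun x h => Du_continuous h.2).
have ibp i : \I_a[x] Du x ^+ 2 * dvg a i (partial i eta) x =
    - \I_a[x] 2 * Du x * DG i x * partial i eta x.
  exact: (dgrad_ibp a0 D2 (l2_bmfun hw bD2) (lH i) (tf_partial i te) (ok i)).
have wL i : wint (wt a) (fun x => Du x ^+ 2 * dvg a i (partial i eta) x).
  apply: (wint_mul hw (l2_bmfun hw bD2)); apply: (l2_dvg a0 (tf_partial i te)); exact: ok.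
have -> : \I_a[x] Du x ^+ 2 * Lop a eta x =
 - (2 * \I_a[x] \sum_i Du x * DG i x * partial i eta x).
  transitivity (\sum_i \I_a[x] Du x ^+ 2 * dvg a i (partial i eta) x).
    by rewrite -wI_sum//; apply: wI_ext => x; rewrite mulr_sumr.
  rewrite (eq_bigr _ (fun i _ => ibp i)) sumrN; congr (- _).
  rewrite -wI_sum; last by move=> i; exact: (wint_mul hw (lH i) (l2_partial i te)).
  rewrite -wIZ; last first.
    apply: wint_sum => i; apply: (wint_ext (f := fun x => DG i x * (Du x * partial i eta x))).
      by move=> x; ring.
    by apply: (wint_mul hw (l2_DG i)); exact: (l2_bounded hw mD hC (l2_partial i te)).
  by apply: wI_ext => x; rewrite mulr_sumr; apply: eq_bigr => i _; ring.
by rewrite -mulrN ler_pM2l//; exact: caccioppoli.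
Qed.

End translation.
End local_minimizer.

(** * Radial profiles and the derivative of radial means *)

Section radial.
Context {R : realType} {m : nat}.
Local Notation E := 'rV[R]_(m + 1).
Local Notation dim := ((m + 1)%:R : R).
Implicit Types (f g : E -> R) (p x y : E) (r s t a : R) (i : 'I_(m + 1)).

Definition sqd p x : R := \sum_i (x ord0 i - p ord0 i) ^+ 2.

Lemma sqd_ge0 p x : 0 <= sqd p x.
Proof. by apply: sumr_ge0 => i _; exact: sqr_ge0. Qed.

Lemma sqdxx p : sqd p p = 0.
Proof. by rewrite /sqd big1// => i _; rewrite subrr expr0n. Qed.

Lemma sqd_coord p x i : (x ord0 i - p ord0 i) ^+ 2 <= sqd p x.
Proof. by rewrite /sqd (bigD1 i)//= lerDl; apply: sumr_ge0 => j _; exact: sqr_ge0. Qed.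

Lemma sqd_norm p x r : 0 <= r -> sqd p x <= r ^+ 2 -> `|x - p| <= r.
Proof.
move=> r0 h; apply: rV_norm_le => // i; rewrite !mxE -ler_sqr ?nnegrE// sqr_normr.
exact: le_trans (sqd_coord p x i) h.
Qed.

Lemma sqd_coord_norm p x r i : 0 <= r -> sqd p x <= r ^+ 2 -> `|x ord0 i - p ord0 i| <= r.
Proof. by move=> r0 /(sqd_norm r0); apply: le_trans; have := rV_norm_coord (x - p) i; rewrite !mxE. Qed.

Lemma norm_sqd p x s : `|x - p| <= s -> sqd p x <= dim * s ^+ 2.
Proof.
move=> h; apply: (@le_trans _ _ (\sum_(i < m + 1) s ^+ 2)); last first.
  by rewrite sumr_const card_ord mulr_natl.
apply: ler_sum => i _; rewrite -sqr_normr ler_sqr ?nnegrE//; last exact: le_trans h.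
by apply: le_trans h; have := rV_norm_coord (x - p) i; rewrite !mxE.
Qed.

Lemma smooth_sqd p : smooth (sqd p).
Proof.
apply: smooth_sum => i; apply: smoothX; apply: smoothB; first exact: smooth_coord.
exact: smooth_cst.
Qed.

Lemma partial_sqd i p x : partial i (sqd p) x = 2 * (x ord0 i - p ord0 i).
Proof.
have sc j : smooth (fun y : E => y ord0 j - p ord0 j) by apply: smoothB; [exact: smooth_coord|exact: smooth_cst].
rewrite /sqd partial_sum; last by move=> j; exact: smoothX.
rewrite (bigD1 i)//= big1 ?addr0 => [|j ji]; rewrite partial_sqr; try exact: smooth_differentiable.
  rewrite partialB//.
  by rewrite partial_coord partial_cst eqxx subr0 mulr1.
rewrite partialB//.
by rewrite partial_coord partial_cst eq_sym (negbTE ji) subr0 mulr0.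
Qed.

Definition radial (g : R -> R) p r x : R := g (1 - sqd p x / r ^+ 2).

Lemma smooth_radial (g : R -> R) p r : smooth1 g -> smooth (radial g p r).
Proof.
move=> sg; have := smooth_comp (@smooth1_comp_affine R g (- (r ^+ 2)^-1) 1 sg) (smooth_sqd p).
by congr smooth; apply/funext => x; rewrite /radial mulNr addrC mulrC.
Qed.

Lemma partial_radial (g : R -> R) p r i x : smooth1 g ->
  partial i (radial g p r) x = - (2 * (x ord0 i - p ord0 i) / r ^+ 2) * radial (derive1 g) p r x.
Proof.
move=> sg; have s1 : smooth (fun x => 1 - sqd p x / r ^+ 2).
  apply: smoothB; first exact: smooth_cst.
  by apply: smoothM; [exact: smooth_sqd|exact: smooth_cst].
rewrite /radial (@partial_comp _ _ i g (fun x => 1 - sqd p x / r ^+ 2)); last 2 first.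
- exact: smooth1_derivable.
- exact: smooth_differentiable.
rewrite mulrC; congr (_ * _).
rewrite partialB//; last by apply: smooth_differentiable; apply: smoothM; [exact: smooth_sqd|exact: smooth_cst].
rewrite partial_cst partialM//; last exact: smooth_differentiable (smooth_sqd _).
by rewrite partial_cst mulr0 !add0r partial_sqd.
Qed.

Lemma compact_sqd p r : 0 <= r -> compact [set x | sqd p x <= r ^+ 2].
Proof.
move=> r0; apply: bounded_closed_compact.
  exists (`|p| + r); split; first exact: num_real.
  move=> M hM x /= h; have := sqd_norm r0 h; have := ler_normD (x - p) p; rewrite subrK; lra.
apply: (@preimage_closed _ _ (sqd p) [set s | s <= r ^+ 2]); last exact: closed_le.
by move=> x _; exact: smooth_continuous (smooth_sqd p) x.
Qed.

Lemma tf_radial (g : R -> R) p r (B : set E) : 0 < r -> smooth1 g -> (forall s, s <= 0 -> g s = 0) ->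
  (forall x, sqd p x <= r ^+ 2 -> B x) -> test_function B (radial g p r).
Proof.
move=> r0 sg g0 hB; split; first exact: smooth_radial.
exists [set x | sqd p x <= r ^+ 2]; split => //; first exact: compact_sqd (ltW r0).
move=> x /negP; rewrite -ltNge => h; apply: g0.
by rewrite subr_le0 ler_pdivlMr ?exprn_gt0// mul1r ltW.
Qed.

Definition bump p r := radial fe p r.
(** Normalized so that grad bump = - (x - p) psi / r^2 ([partial_bump]); this is the kernel of the
    means [Sf]. *)
Definition psi p r x : R := 2 * radial fe' p r x.
Definition fe'' : R -> R := derive1 fe'.

Lemma fe''_flat : fe'' = flatfun (flat_deriv 'X^2).
Proof. by apply/funext => s; rewrite /fe'' derive1E; exact: (@derive_val _ _ _ _ _ _ _ (is_derive_flatfun _ _)). Qed.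

Lemma flatfun_bound (q : {poly R}) : exists2 C, 0 <= C & forall s, s <= 1 -> `|flatfun q s| <= C.
Proof.
have [C HC] := poly_expR_bound q; have C0 : 0 <= C.
  by have := HC 1; rewrite expr1n mulr1; exact: le_trans.
exists C => // s s1; have [s0|s0] := ltP 0 s; last first.
  by rewrite /flatfun ltNge s0 normr0.
by apply: le_trans (HC s) _; rewrite ler_piMr// expr_le1// ltW.
Qed.

Lemma psi_ge0 p r x : 0 <= psi p r x.
Proof. by rewrite mulr_ge0// fe'_ge0. Qed.

Lemma bump_ge0 p r x : 0 <= bump p r x. Proof. exact: fe_ge0. Qed.
Lemma bump_le1 p r x : bump p r x <= 1. Proof. exact: fe_le1. Qed.

Lemma bump_out p r x : 0 < r -> r ^+ 2 <= sqd p x -> bump p r x = 0.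
Proof. by move=> r0 h; apply: fe_le0; rewrite subr_le0 ler_pdivlMr ?exprn_gt0// mul1r. Qed.
Lemma psi_out p r x : 0 < r -> r ^+ 2 <= sqd p x -> psi p r x = 0.
Proof.
by move=> r0 h; rewrite /psi /radial fe'_le0 ?mulr0// subr_le0 ler_pdivlMr ?exprn_gt0// mul1r.
Qed.

Lemma radial_arg p r x : 0 < r -> sqd p x <= r ^+ 2 / 2 -> 2^-1 <= 1 - sqd p x / r ^+ 2.
Proof.
move=> r0 h; have : sqd p x / r ^+ 2 <= 2^-1; last by lra.
by rewrite ler_pdivrMr ?exprn_gt0// mulrC.
Qed.

Lemma radial_arg1 p r x : 1 - sqd p x / r ^+ 2 <= 1.
Proof. by rewrite gerBl divr_ge0 ?sqd_ge0// sqr_ge0. Qed.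

Lemma bump_lb p r x : 0 < r -> sqd p x <= r ^+ 2 / 2 -> expR (- 2) <= bump p r x.
Proof.
move=> r0 /(radial_arg r0) h; rewrite /bump /radial.
by apply: le_trans (fe_homo h); rewrite feE invr_gt0 ltr0n invrK.
Qed.

Lemma psi_lb p r x : 0 < r -> sqd p x <= r ^+ 2 / 2 -> expR (- 2) <= psi p r x.
Proof.
move=> r0 /(radial_arg r0); have := radial_arg1 p r x; rewrite /psi /radial.
move: (1 - _) => s s1 s2; have s0 : 0 < s by lra.
rewrite fe'E s0; have h1 : 1 <= s ^- 2 by rewrite invf_cp1 ?exprn_gt0// expr_le1// ltW.
have h2 : expR (- 2) <= expR (- s^-1) by rewrite ler_expR lerN2 -[2]invrK lef_pV2 ?posrE// invr_gt0.
have e0 := expR_gt0 (- 2 : R); have := ler_pM ler01 (ltW e0) h1 h2; rewrite mul1r; lra.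
Qed.

Lemma psi_ub : exists2 C, 0 < C & forall p r x, psi p r x <= C.
Proof.
have [C C0 HC] := flatfun_bound 'X^2; exists (2 * C + 1) => [|p r x]; first by lra.
have := HC _ (radial_arg1 p r x); have := ler_norm (fe' (1 - sqd p x / r ^+ 2)).
rewrite /psi /radial /fe'; lra.
Qed.

Lemma partial_bump p r i x : partial i (bump p r) x = - ((x ord0 i - p ord0 i) / r ^+ 2) * psi p r x.
Proof. by rewrite partial_radial ?fe_derive1 /psi; [ring|exact: smooth1_fe]. Qed.

Lemma partial_bump_le : exists2 C, 0 < C & forall p s i x, 0 < s -> `|partial i (bump p s) x| <= C / s :> R.
Proof.
have [C C0 HC] := psi_ub; exists C => // p s i x s0; rewrite partial_bump.
have [xs|xs] := leP (sqd p x) (s ^+ 2); last first.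
  by rewrite (psi_out s0 (ltW xs)) mulr0 normr0 divr_ge0// ltW.
have hc := sqd_coord_norm i (ltW s0) xs.
rewrite normrM normrN normf_div (ger0_norm (psi_ge0 _ _ _)) (ger0_norm (sqr_ge0 s)).
apply: (@le_trans _ _ (s / s ^+ 2 * C)); last by apply: eqW; field; rewrite gt_eqF.
have s2 : 0 < (s ^+ 2)^-1 by [].
by apply: ler_pM; rewrite ?psi_ge0 ?HC ?mulr_ge0 ?(ltW s2)// ler_pM2r.
Qed.

Lemma partial2_bump p r i x : 0 < r -> partial i (partial i (bump p r)) x =
  - psi p r x / r ^+ 2 + 4 * (x ord0 i - p ord0 i) ^+ 2 / r ^+ 4 * radial fe'' p r x.
Proof.
move=> r0; rewrite (_ : partial i (bump p r) = fun x => (- 2 / r ^+ 2) * ((x ord0 i - p ord0 i) * radial fe' p r x)).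
  have sx : smooth (fun x : E => x ord0 i - p ord0 i) by apply: smoothB; [exact: smooth_coord|exact: smooth_cst].
  have sf : smooth (radial fe' p r) by apply: smooth_radial; exact: smooth1_fe'.
  rewrite partialZ; last by apply: smooth_differentiable; exact: smoothM.
  rewrite partialM; try exact: smooth_differentiable.
  rewrite partialB//.
  rewrite partial_coord partial_cst eqxx subr0 mul1r partial_radial; last exact: smooth1_fe'.
  by rewrite -/fe'' /psi; field; rewrite gt_eqF.
by apply/funext => y; rewrite partial_bump /psi; ring.
Qed.

Lemma tf_bump p r (B : set E) : 0 < r -> (forall x, sqd p x <= r ^+ 2 -> B x) -> test_function B (bump p r).
Proof. by move=> r0 h; apply: tf_radial => //; [exact: smooth1_fe|exact: fe_le0]. Qed.

Lemma tf_psi p r (B : set E) : 0 < r -> (forall x, sqd p x <= r ^+ 2 -> B x) -> test_function B (psi p r).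
Proof. by move=> r0 h; apply: tfZ; apply: tf_radial => //; [exact: smooth1_fe'|exact: fe'_le0]. Qed.

(* Centers of balls on which the radial identities hold. *)
Definition good_center a p r := xn p = 0 \/ a = 0 /\ r < xn p.

Lemma sqd_xn p x r : 0 < r -> sqd p x <= r ^+ 2 -> `|xn x - xn p| <= r.
Proof.
move=> r0 h; rewrite -ler_sqr ?nnegrE ?_// sqr_normr.
exact: le_trans (sqd_coord p x nn) h.
Qed.

(** The normal derivative of the bump has the factor x_n - p_n. For p on the flat part this is x_n
    itself; otherwise the ball stays at height at least p_n - r > 0. *)
Lemma okn_bump a p r i : 0 < r -> good_center a p r -> okn i (partial i (bump p r)).
Proof.
move=> r0 gc ->; have [C C0 HC] := psi_ub.
have r2 : 0 < r ^+ 2 by [].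
case: gc => [p0|[_ rp]].
  exists (C / r ^+ 2) => x hx; rewrite partial_bump -/(xn x) -/(xn p) p0 subr0.
  rewrite normrM normrN normf_div (gtr0_norm hx) (gtr0_norm r2) (ger0_norm (psi_ge0 _ _ _)).
  by rewrite mulrC mulrA mulrAC ler_pM2r// ler_wpM2r ?invr_ge0// ltW.
exists (C / r / (xn p - r)) => x hx.
have [h|h] := leP (sqd p x) (r ^+ 2); last first.
  rewrite partial_bump psi_out ?mulr0 ?normr0 ?(ltW h)//.
have hxp := sqd_xn r0 h; have xr : xn p - r <= xn x by move: hxp; rewrite ler_norml; lra.
have pr : 0 < xn p - r by rewrite subr_gt0.
rewrite partial_bump -/(xn x) -/(xn p) normrM normrN normf_div (gtr0_norm r2) (ger0_norm (psi_ge0 _ _ _)).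
apply: (@le_trans _ _ (r / r ^+ 2 * C)).
  apply: ler_pM; [by rewrite divr_ge0// ltW|exact: psi_ge0| |exact: HC].
  by rewrite ler_pM2r// invr_gt0.
have -> : r / r ^+ 2 * C = C / r by field; rewrite gt_eqF.
have k : 1 <= xn x / (xn p - r) by rewrite ler_pdivlMr// mul1r.
have -> : C / r / (xn p - r) * xn x = C / r * (xn x / (xn p - r)) by ring.
by rewrite ler_peMr// divr_ge0// ltW.
Qed.

Lemma Lop_bump a p r x : 0 < r -> good_center a p r -> hp x ->
  Lop a (bump p r) x = (- (dim + a) * psi p r x + 4 * (sqd p x / r ^+ 2) * radial fe'' p r x) / r ^+ 2.
Proof.
move=> r0 gc hx; have rn : r != 0 by [].
have hn : a * partial nn (bump p r) x / xn x = - a * psi p r x / r ^+ 2.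
  have xn0 : xn x != 0 by [].
  rewrite partial_bump -/(xn x) -/(xn p); case: gc => [->|[-> _]]; last by rewrite oppr0 !mul0r.
  by field; rewrite xn0 rn.
rewrite /Lop /dvg big_split /= -big_mkcond big_pred1_eq hn.
under eq_bigr do rewrite partial2_bump//.
rewrite big_split /= sumr_const card_ord -mulr_suml -mulr_suml -mulr_sumr -/(sqd p x) -mulr_natl.
by field.
Qed.

(** The homogeneous dimension of x_n^a dx: a half ball of radius r centered on the flat part has
    mass comparable to r to this power. *)
Definition Nw a : R := dim + a.

(** A mean at scale r, normalized by the power of r and not by the mass of the kernel, hence a mean
    only up to a constant factor. *)
Definition Sf a f p r : R := r `^ (- Nw a) * \I_a[x] f x * psi p r x.

Lemma is_derive_radial (g : R -> R) p x (r : R) : smooth1 g -> 0 < r ->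
  is_derive r 1 (fun s => radial g p s x) (2 * (sqd p x / r ^+ 3) * radial (derive1 g) p r x).
Proof.
move=> sg r0; have rn : r != 0 by [].
have D0 : is_derive r 1 (fun s : R => s^-1) (- r ^- 2).
  have := is_deriveV rn (is_derive_id r 1); rewrite /GRing.scale/= mulr1; exact: is_derive_ext.
have D1 : is_derive r 1 (fun s : R => 1 - sqd p x / s ^+ 2) (2 * (sqd p x / r ^+ 3)).
  have := is_derive_mulr (- sqd p x) (is_derive_mul D0 D0 erefl).
  move=> D2; have D3 := is_deriveD (is_derive_cst (1 : R) r 1) D2.
  have D4 : 0 + (- r ^- 2 / r + r^-1 * - r ^- 2) * - sqd p x = 2 * (sqd p x / r ^+ 3) by field.
  rewrite D4 in D3; apply: is_derive_ext D3 => s /=.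
  by rewrite fctE /cst -invfM -expr2 mulrN mulrC.
by rewrite mulrC; exact: (@is_derive1_comp _ g _ r _ _ (smooth1_is_derive _ sg) D1).
Qed.

Lemma is_derive_psi p x (r : R) : 0 < r ->
  is_derive r 1 (fun s => psi p s x) (4 * (sqd p x / r ^+ 3) * radial fe'' p r x).
Proof.
move=> r0; have := is_derive_mulr 2 (is_derive_radial p x (@smooth1_fe' R) r0).
rewrite (_ : _ 2 = 4 * (sqd p x / r ^+ 3) * radial fe'' p r x); last lra.
by apply: is_derive_ext => s; rewrite mulrC.
Qed.

Lemma powR_Nw a r : 0 < r -> r `^ (Nw a) = r ^+ (m + 1) * r `^ a.
Proof. by move=> r0; rewrite /Nw powRD ?powR_mulrn ?(ltW r0)// (gt_eqF r0) implybT. Qed.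

(** The kernel is made for this: the r-derivative of r^(-N) psi is r^(1-N) times the weighted
    Laplacian of the bump, as a comparison of [Lop_bump] with [is_derive_psi] shows. Means of
    subsolutions are therefore nondecreasing. *)
Lemma Sf_derive a f p r : 0 <= a -> bmfun f -> 0 < r -> good_center a p r ->
  is_derive r 1 (Sf a f p) (r `^ (1 - Nw a) * \I_a[x] f x * Lop a (bump p r) x).
Proof.
move=> a0 bf r0 gc; have hw := weight_wt m a0.
have [mf [C [r1 [r10 fC fr]]]] := bf; have C0 : 0 <= C by rewrite (le_trans _ (fC 0)).
have [D D0 HD] := flatfun_bound (flat_deriv ('X^2 : {poly R})).
have r2 : 0 < r / 2 by [].
have rt t : `|t - r| < r / 2 -> r / 2 < t by rewrite ltr_norml; lra.
have mps t : mbfun (psi p t) by apply: mbfun_continuous; apply: smooth_continuous; apply: smoothZ; apply: smooth_radial; exact: smooth1_fe'.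
have wfps t : wint (wt a) (fun x => f x * psi p t x).
  have [C' C'0 HC'] := psi_ub; apply: (wint_bmfun hw).
  have := bmfunM (C := C') (mps t) _ bf; move=> /(_ _)/wrap[x|].
    by rewrite ger0_norm ?psi_ge0.
  by congr bmfun; apply/funext => x; rewrite mulrC.
have Dw := @wI_derive _ _ _ hw (fun t x => f x * psi p t x)
 (fun t x => f x * (4 * (sqd p x / t ^+ 3) * radial fe'' p t x))
 (fun x => (4 * D / (r / 2)) * `|f x|) r _ r2.
have {}Dw := Dw (wintZ _ (wint_abs hw (wint_bmfun hw bf))) (fun t _ => wfps t).
have {}Dw : is_derive r 1 (fun t => \I_a[x] f x * psi p t x)
    (\I_a[x] f x * (4 * (sqd p x / r ^+ 3) * radial fe'' p r x)).
  apply: Dw.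
    move=> t x /rt tr; have t0 : 0 < t by exact: lt_trans tr.
    have := is_derive_mulr (f x) (is_derive_psi p x t0).
    by rewrite mulrC; apply: is_derive_ext => s; rewrite mulrC.
  move=> t x /rt tr; have t0 : 0 < t by exact: lt_trans tr.
  rewrite normrM mulrC ler_wpM2r//.
  have [h|h] := leP (sqd p x) (t ^+ 2); last first.
    rewrite /radial fe''_flat /flatfun ifF ?mulr0 ?normr0.
      by rewrite divr_ge0 ?(ltW r2)// mulr_ge0.
    apply/negbTE; rewrite -leNgt subr_le0 ler_pdivlMr ?exprn_gt0// mul1r; exact: ltW.
  have hD : `|radial fe'' p t x| <= D by rewrite fe''_flat HD// radial_arg1.
  have q0 : 0 <= sqd p x / t ^+ 3 by rewrite divr_ge0 ?sqd_ge0// exprn_ge0// ltW.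
  have q1 : sqd p x / t ^+ 3 <= (r / 2)^-1.
    rewrite ler_pdivrMr ?exprn_gt0// -ler_pdivrMl ?invr_gt0// invrK.
    apply: (@le_trans _ _ (t * t ^+ 2)); last by rewrite -exprS.
    by rewrite ler_pM ?sqd_ge0 ?(ltW r2) ?(ltW tr).
  rewrite normrM (ger0_norm (mulr_ge0 _ q0))// -mulrA [leRHS]mulrAC -mulrA ler_pM2l//.
  by apply: ler_pM.
have := is_derive_mul (is_derive1_powR (- Nw a) r0) Dw erefl.
rewrite (_ : _ + _ = r `^ (1 - Nw a) * \I_a[x] f x * Lop a (bump p r) x) => [//|].
have P b : r `^ (b - 1) = r `^ b * r^-1 by rewrite powRD ?powR_inv1 ?(ltW r0)// (gt_eqF r0) implybT.
have P1 : r `^ (1 - Nw a) = r `^ (- Nw a) * r by rewrite addrC powRD ?powRr1 ?(ltW r0)// (gt_eqF r0) implybT.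
have wfd : wint (wt a) (fun x => f x * (4 * (sqd p x / r ^+ 3) * radial fe'' p r x)).
  have tfr : test_function setT (fun x => (4 * sqd p x / r ^+ 3) * radial fe'' p r x).
    apply: tfM.
      apply: tf_radial => //; first by rewrite fe''_flat; exact: smooth1_flatfun.
      by move=> s s0; rewrite fe''_flat /flatfun ltNge s0.
    apply: smoothM => //.
    by apply: smoothZ; exact: smooth_sqd.
  have := wint_mul hw (l2_bmfun hw bf) (l2_bmfun hw (tf_bmfun tfr)).
  by apply: wint_ext => x; ring.
have rn : r != 0 by [].
have key : - (Nw a / r) * \I_a[x] f x * psi p r x +
 \I_a[x] f x * (4 * (sqd p x / r ^+ 3) * radial fe'' p r x) =
 r * \I_a[x] f x * Lop a (bump p r) x.
  rewrite -(wIZ _ (wfps r)) -(wID (wintZ _ (wfps r)) wfd).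
  have wL : wint (wt a) (fun x => f x * Lop a (bump p r) x).
    have := wintZ (r^-1) (wintD (wintZ (- (Nw a / r)) (wfps r)) wfd); apply: eq_integrable => // x _.
    congr EFin; have [hx|hx] := pselect (hp x); last by rewrite wt_out// !mulr0.
    by rewrite (Lop_bump r0 gc hx) -/(Nw a); congr (_ * _); field.
  rewrite -(wIZ r wL); apply: eq_Rintegral => x _; have [hx|hx] := pselect (hp x); last by rewrite wt_out// !mulr0.
  by rewrite (Lop_bump r0 gc hx) -/(Nw a); congr (_ * _); field.
by rewrite P P1 -[RHS]mulrA -key; ring.
Qed.

End radial.

Arguments Nw {R} m a.

#[export] Hint Resolve smooth_sqd : regularity.
#[export] Hint Resolve sqd_ge0 psi_ge0 bump_ge0 : positivity.

(** * Mass estimates, monotone means of squared increments, and the tangential Lipschitz bound *)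

Section growth.
Context {R : realType} {m : nat}.
Local Notation E := 'rV[R]_(m + 1).
Local Notation dim := ((m + 1)%:R : R).
Implicit Types (f g : E -> R) (p x : E) (r s t : R) (i : 'I_(m + 1)) (k : 'rV[R]_m).

Lemma dim_ge1 : 1 <= dim. Proof. by rewrite ler1n addn1. Qed.

Lemma nondecreasing_derive (F dF : R -> R) s t : s <= t ->
  (forall v : R, s <= v <= t -> is_derive v 1 F (dF v)) -> (forall v, s <= v <= t -> 0 <= dF v) -> F s <= F t.
Proof.
move=> st HD d0; have [c cst E1] := MVT_is_derive st HD.
by rewrite -subr_ge0 E1 mulr_ge0 ?subr_ge0//; exact: d0.
Qed.

Section mass.
Variable a : R.
Hypothesis a0 : 0 <= a.
Let hw := weight_wt m a0.

Lemma mass_lb : exists2 c, 0 < c & forall p r d g, 0 < r -> 0 <= xn p -> 0 <= d ->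
  wint (wt a) g -> (forall x, 0 <= g x) -> (forall x, hp x -> sqd p x <= r ^+ 2 / 2 -> d <= g x) ->
  d * c * r `^ (Nw m a) <= wI (wt a) g.
Proof.
have d1 := dim_ge1; have dp : 0 < dim by exact: lt_le_trans d1.
(* The cube of half-side s = r q around p + 2 s e_n lies above height s, and its points are within 3
   s of p in each coordinate, so that their squared distance to p is at most dim (3 s)^2 = r^2 / (4
   dim). *)
pose q : R := (6 * dim)^-1; have q0 : 0 < q by rewrite invr_gt0 mulr_gt0.
exists (2 ^+ (m + 1) * q `^ (Nw m a)); first by rewrite mulr_gt0 ?exprn_gt0 ?powR_gt0.
move=> p r d g r0 p0 d0 wg g0 gd; pose s := r * q; have s0 : 0 < s by exact: mulr_gt0.
pose c : E := p + (2 * s) *: 'e_nn.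
have inb x : ball c s x -> s <= xn x /\ sqd p x <= r ^+ 2 / 2.
  rewrite ballE => h.
  have hc i : `|c ord0 i - x ord0 i| < s by apply: le_lt_trans h; have := rV_norm_coord (c - x) i; rewrite !mxE.
  have cE i : c ord0 i = p ord0 i + (2 * s) * (i == nn)%:R by rewrite /c !mxE.
  split.
    have := hc nn; rewrite cE eqxx mulr1 ltr_norml => /andP[_]; move: p0; rewrite /xn; lra.
  apply: le_trans (_ : dim * (3 * s) ^+ 2 <= _).
    apply: norm_sqd; apply: rV_norm_le => [|i]; first by rewrite mulr_ge0// ltW.
    rewrite !mxE; have := hc i; rewrite cE; case: (_ == _); rewrite ?mulr1 ?mulr0 ltr_norml ler_norml => /andP[h1 h2].
      by apply/andP; split; lra.
    by apply/andP; split; lra.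
  rewrite /s /q; have -> : dim * (3 * (r / (6 * dim))) ^+ 2 = r ^+ 2 * (4 * dim)^-1.
    by field; rewrite gt_eqF.
  rewrite ler_pM2l ?exprn_gt0// lef_pV2 ?posrE ?mulr_gt0//; lra.
have mb := @measurable_ball_rV R (m + 1) c s.
have w1 : wint (wt a) (fun x => d * (\1_(ball c s) x)) by exact: (wintZ d (wint_bmfun hw (bmfun_indic_ball c s0))).
apply: le_trans (_ : \I_a[x] d * (\1_(ball c s) x) <= _); last first.
  apply: (wI_le hw) => // x; rewrite indicE; case: (boolP (_ \in _)) => [/set_mem/inb[xs xr]|_].
    by rewrite mulr1 gd//; exact: lt_le_trans xs.
  by rewrite mulr0.
have -> : d * (2 ^+ (m + 1) * q `^ (Nw m a)) * r `^ (Nw m a) = wI (@one R (m + 1)) (fun x => (d * s `^ a) * \1_(ball c s) x).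
  rewrite wIZ; last exact: wint_one_bmfun (bmfun_indic_ball c s0).
  rewrite wI_ball// -mulrA -[s *+ 2]mulr_natl exprMn -mulrA -powRM ?(ltW q0) ?(ltW r0)//.
  by rewrite [q * r]mulrC -/s powR_Nw//; ring.
rewrite /wI; apply: le_Rintegral => //.
  exact: (wintZ (d * s `^ a) (wint_one_bmfun (bmfun_indic_ball c s0))).
move=> x _; rewrite /one mulr1 -mulrA [_ * wt a x]mulrC [leRHS]mulrA.
rewrite indicE; case: (boolP (_ \in _)) => [/set_mem/inb[xs _]|_]; last by rewrite !mulr0.
rewrite /= !mulr1 [leRHS]mulrC ler_wpM2l// wtE; last exact: lt_le_trans xs.
by apply: ge0_ler_powR => //; rewrite ?nnegrE ?(ltW s0)// (le_trans (ltW s0)).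
Qed.

Lemma mass_ub : exists2 C, 0 < C & forall p r D g, 0 < r -> xn p = 0 \/ a = 0 -> 0 <= D ->
  wint (wt a) g -> (forall x, hp x -> sqd p x <= r ^+ 2 -> g x <= D) ->
  (forall x, r ^+ 2 < sqd p x -> g x <= 0) -> wI (wt a) g <= D * C * r `^ (Nw m a).
Proof.
exists (2 `^ a * 4 ^+ (m + 1)); first by rewrite mulr_gt0 ?exprn_gt0 ?powR_gt0.
move=> p r D g r0 pa D0 wg gD gout.
have r2 : 0 < 2 * r by [].
have mb := @measurable_ball_rV R _ p (2 * r).
have ii : wint one (\1_(ball p (2 * r)) : E -> R) by exact: wint_one_bmfun (bmfun_indic_ball p r2).
have -> : D * (2 `^ a * 4 ^+ (m + 1)) * r `^ (Nw m a) =
 wI one (fun x => (D * (2 * r) `^ a) * \1_(ball p (2 * r)) x).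
  rewrite wIZ// wI_ball//.
  have -> : 2 * r *+ 2 = 4 * r by rewrite -mulr_natl mulrA -natrM.
  by rewrite powR_Nw// powRM ?(ltW r0)// exprMn; ring.
apply: le_Rintegral => //.
  exact: (wintZ (D * (2 * r) `^ a) ii).
move=> x _; rewrite mulr1.
have w0 : 0 <= wt a x by case: hw => _ + _; apply.
have p2 : 0 <= (2 * r) `^ a by [].
have rhs0 : 0 <= D * (2 * r) `^ a * \1_(ball p (2 * r)) x by rewrite !mulr_ge0// indicE.
have [h|h] := leP (sqd p x) (r ^+ 2); last first.
  by apply: le_trans rhs0; rewrite mulr_le0_ge0// gout.
have [hx|hx] := pselect (hp x); last by rewrite wt_out// mulr0.
have nb := sqd_norm (ltW r0) h.
rewrite indicE mem_set; last by rewrite ballEC; lra.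
rewrite mulr1; apply: le_trans (ler_wpM2r w0 (gD x hx h)) _; rewrite ler_wpM2l// wtE//.
case: pa => [p0|->]; last by rewrite !powRr0.
apply: ge0_ler_powR => //; rewrite ?nnegrE; [exact: ltW|exact: ltW|].
by have := sqd_xn r0 h; rewrite p0 subr0; have := ler_norm (xn x); lra.
Qed.

Lemma wint_radial (g1 : R -> R) f p r : bmfun f -> 0 < r -> smooth1 g1 -> (forall s, s <= 0 -> g1 s = 0) ->
  wint (wt a) (fun x => f x * radial g1 p r x).
Proof.
move=> bf r0 sg gz; apply: (wint_mul hw (l2_bmfun hw bf)).
by apply: (l2_bmfun hw); apply: (@tf_bmfun _ _ setT); exact: tf_radial.
Qed.

Lemma wint_psi f p r : bmfun f -> 0 < r -> wint (wt a) (fun x => f x * psi p r x).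
Proof.
move=> bf r0; apply: wint_ext (wintZ 2 (wint_radial p bf r0 (@smooth1_fe' R) (@fe'_le0 R))) => x.
by rewrite /psi; ring.
Qed.

(* The value of a continuous function at [p] is recovered from [Sf] at small radii. *)
Lemma val_le_Sf : exists2 c, 0 < c & forall f p r A, bmfun f -> (forall x, 0 <= f x) ->
  {for p, continuous f} -> 0 <= xn p -> 0 < r -> (forall t, 0 < t < r -> Sf a f p t <= A) -> c * f p <= A.
Proof.
have [c c0 Hc] := mass_lb; exists (expR (- 2) * c); first by rewrite mulr_gt0 ?expR_gt0.
move=> f p r A bf f0 cf p0 r0 HA.
apply/ler_addgt0Pr => e e0.
set b := expR (- 2) * c; have b0 : 0 < b by rewrite mulr_gt0 ?expR_gt0.
have eb : 0 < e / b by [].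
have /cvgrPdist_le/(_ _ eb)/nbhs_ballP[d /= d0 Hd] := cf.
pose t := Num.min r d / 2.
have t0 : 0 < t by rewrite divr_gt0// lt_min r0 d0.
have tr : t < r.
  have : Num.min r d <= r by rewrite ge_min lexx.
  by rewrite /t; lra.
have td : t < d.
  have : Num.min r d <= d by rewrite ge_min lexx orbT.
  by rewrite /t; lra.
have [fe|fe] := leP (f p) (e / b).
  have A0 : 0 <= A.
    apply: le_trans (HA t _); last by rewrite t0.
    by rewrite mulr_ge0 ?powR_ge0//; apply: (wI_ge0 hw) => x; rewrite mulr_ge0// psi_ge0.
  have : b * f p <= e by rewrite mulrC -ler_pdivlMr.
  lra.
have H := HA t; rewrite t0 tr in H; have {}H := H isT.
have lb : (f p - e / b) * expR (- 2) * c * t `^ (Nw m a) <= \I_a[x] f x * psi p t x.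
  apply: (Hc p) => //.
  - by rewrite mulr_ge0 ?expR_ge0// subr_ge0 ltW.
  - exact: wint_psi.
  - by move=> x; rewrite mulr_ge0// psi_ge0.
  move=> x hx h; apply: ler_pM; [by rewrite subr_ge0 ltW|exact: expR_ge0| |exact: psi_lb].
  have bx : ball p d x.
    rewrite ballEC; apply: le_lt_trans td; apply: sqd_norm; first exact: ltW.
    by apply: le_trans h _; rewrite ler_pdivrMr// ler_peMr ?sqr_ge0//; lra.
  by have := Hd x bx; rewrite ler_norml => /andP[]; lra.
have tN : 0 < t `^ (Nw m a) by [].
have : (f p - e / b) * expR (- 2) * c <= A.
  apply: le_trans H; by rewrite /Sf powRN ler_pdivlMl// mulrC.
by rewrite -mulrA -/b mulrBl divfK ?gt_eqF// mulrC; lra.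
Qed.

End mass.

Lemma norm_emb k : `|emb k : E| <= `|k|.
Proof.
apply: rV_norm_le => // i; rewrite embE; case: (split_ordP i) => j ->.
  by rewrite rV_rconsl rV_norm_coord.
by rewrite [j]ord1 rV_rconsr normr0.
Qed.

Section local_growth.
Context `(hu : @local_min R m a lp lm z r u G).
Let a0 := lmin_a0 hu.
Let hw := weight_wt m a0.
Let rho := r / 8.
Let rho0 : 0 < rho := lmin_rho hu.

Definition DG2 (G : 'I_(m + 1) -> E -> R) k x := \sum_i DG G k i x ^+ 2.

(** Centers within 2 rho of [z], radii up to 2 rho and shifts up to rho reach at most 5 rho from
    [z]. The choice rho = r / 8 leaves room for this in the ball of radius r. *)
Lemma dom2_near p s k x : `|p - z| <= 2 * rho -> 0 <= s <= 2 * rho -> `|k| <= rho ->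
  sqd p x <= s ^+ 2 -> dom2 r z k x.
Proof.
move=> pz /andP[s0 s1] kr /(sqd_norm s0) xp.
have xz : `|x - z| <= 4 * rho by have := ler_distD p x z; lra.
have r8 : r = 8 * rho by rewrite /rho; field.
have ek := norm_emb k; split; rewrite ballEC r8.
  by have := rho0; lra.
rewrite addrAC; have := ler_normD (x - z) (emb k); have := rho0; lra.
Qed.

Let bD2 k : bmfun (fun x => Du u k x ^+ 2).
Proof.
have bD := bmfun_Du hu k; have [mD [C [s [s0 hC hs]]]] := bD.
by have := bmfunM mD hC bD; congr bmfun; apply/funext => x; rewrite expr2.
Qed.

Lemma caccioppoli_bump p s k : 0 < s -> good_center a p s -> (forall x, sqd p x <= s ^+ 2 -> dom2 r z k x) ->
  2 * \I_a[x] bump p s x * DG2 G k x <= \I_a[x] Du u k x ^+ 2 * Lop a (bump p s) x.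
Proof.
move=> s0 gc hd; apply: (caccioppoli_Lop hu (tf_bump s0 hd)).
  by move=> x; rewrite bump_ge0 bump_le1.
by move=> i; exact: okn_bump gc.
Qed.

Lemma DG2_ge0 k x : 0 <= DG2 G k x.
Proof. by apply: sumr_ge0 => i _; exact: sqr_ge0. Qed.

Lemma Sf_mono p s t k : 0 < s <= t -> (forall v, v <= t -> good_center a p v) -> `|p - z| <= 2 * rho ->
  t <= 2 * rho -> `|k| <= rho ->
  Sf a (fun x => Du u k x ^+ 2) p s <= Sf a (fun x => Du u k x ^+ 2) p t.
Proof.
move=> /andP[s0 st] gc pz t2 kr.
apply: (nondecreasing_derive (dF := fun v => v `^ (1 - (Nw m a)) * \I_a[x] Du u k x ^+ 2 * Lop a (bump p v) x) st).
  move=> v /andP[sv vt]; apply: (Sf_derive a0 (bD2 k)); [exact: lt_le_trans sv|exact: gc].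
move=> v /andP[sv vt]; have v0 : 0 < v by exact: lt_le_trans sv.
rewrite mulr_ge0 ?powR_ge0//.
apply: le_trans (caccioppoli_bump v0 (gc v vt) (fun => dom2_near pz _ kr)).
  by rewrite mulr_ge0//; apply: (wI_ge0 hw) => x; rewrite mulr_ge0 ?bump_ge0 ?DG2_ge0.
by rewrite (ltW v0) (le_trans vt).
Qed.

(** At the fixed radius 2 rho the squared increments are controlled through [shift_bound] by |k|^2
    times the Dirichlet energy of [u]. Monotonicity then carries the bound down to all smaller
    radii. *)
Lemma Sf_start : exists2 A, 0 <= A & forall p k, `|p - z| <= 2 * rho -> `|k| <= rho ->
  Sf a (fun x => Du u k x ^+ 2) p (2 * rho) <= A * `|k| ^+ 2.
Proof.
have [C C0 HC] := @psi_ub R m.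
pose S x := \sum_i `|G i x|.
have lS : l2 (wt a) S.
  apply: (l2_sum hw) => i; apply: (l2_le hw _ _ (lmin_l2 hu i)).
    exact: mbfun_norm (l2_mfun (lmin_l2 hu i)).
  by move=> x; rewrite normr_id.
exists ((2 * rho) `^ (- (Nw m a)) * (C * \I_a[x] S x ^+ 2)).
  rewrite mulr_ge0 ?powR_ge0// mulr_ge0 ?(ltW C0)//; apply: (wI_ge0 hw) => x; exact: sqr_ge0.
move=> p k pz kr; rewrite -!mulrA; apply: ler_wpM2l => //.
set h : E := emb k; have h0 : xn h = 0 := xn_emb k.
have r8 : r = 8 * rho by rewrite /rho; field.
have kh := norm_emb k; rewrite -/h in kh.
pose V : set E := ball z (5 * rho).
have oV : open V by apply: ball_open; rewrite mulr_gt0.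
have VB x s : V x -> 0 <= s <= 1 -> ball z r (x + s *: h).
  rewrite /V !ballE r8 => xz /andP[s0 s1].
  rewrite opprD addrA; have := ler_normB (z - x) (s *: h); rewrite normrZ (ger0_norm s0).
  have : s * `|h| <= `|h| by rewrite ler_piMl.
  by have := rho0; lra.
have Br : ball z r `<=` ball 0 (`|z| + r).
  move=> x; rewrite ball0E ballEC => h1.
  by have := ler_normD (x - z) z; rewrite subrK; lra.
have oB : open (ball z r) by apply: ball_open; exact: lmin_r hu.
have sb := shift_bound a0 oB Br (lmin_l2 hu) (lmin_grad hu) (lmin_bm hu) h0 oV VB.
have w1 : wint (wt a) (fun x => Du u k x ^+ 2 * \1_V x).
  apply: (wint_le hw _ _ (wint_bmfun hw (bD2 k))).
    apply: mbfunM; first by case: (bD2 k).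
    by apply: measurable_indic; exact: measurable_open.
  move=> x; rewrite normrM ger0_norm ?sqr_ge0// ler_piMr ?sqr_ge0// indicE.
  by case: (_ \in _); rewrite ?normr1 ?normr0.
have lg : l2 (wt a) (gdir h G) by apply: (l2_sum hw) => i; apply: l2Z; exact: lmin_l2 hu i.
apply: le_trans (_ : C * \I_a[x] Du u k x ^+ 2 * \1_V x <= _).
  have r2 : 0 < 2 * rho by [].
  rewrite -(wIZ C w1); apply: (wI_le hw (wint_psi a0 p (bD2 k) r2) (wintZ C w1)).
  move=> x; rewrite [leRHS]mulrCA; apply: ler_wpM2l; first exact: sqr_ge0.
  have [xs|xs] := leP (sqd p x) ((2 * rho) ^+ 2); last first.
    by rewrite (psi_out r2 (ltW xs)) mulr_ge0 ?(ltW C0)// indicE.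
  rewrite indicE mem_set ?mulr1// /V ballEC.
  have := sqd_norm _ xs; rewrite mulr_ge0 ?_// => /(_ isT).
  by have := ler_distD p x z; have := rho0; lra.
rewrite ler_pM2l//; apply: le_trans sb _.
rewrite mulrC -wIZ; last exact: lS.2.
apply: (wI_le hw); [exact: lg.2|exact: wintZ lS.2|move=> x].
rewrite -exprMn -sqr_normr ler_sqr ?nnegrE//; last first.
  by rewrite mulr_ge0// sumr_ge0.
rewrite /gdir /S mulr_sumr; apply: le_trans (ler_norm_sum _ _ _) _; apply: ler_sum => i _.
by rewrite normrM ler_wpM2r// (le_trans (rV_norm_coord h i)).
Qed.

Lemma Sf_bound : exists2 A, 0 <= A & forall p k t, xn p = 0 -> `|p - z| <= 2 * rho -> `|k| <= rho ->
  0 < t <= 2 * rho -> Sf a (fun x => Du u k x ^+ 2) p t <= A * `|k| ^+ 2.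
Proof.
have [A A0 HA] := Sf_start; exists A => // p k t p0 pz kr t2.
apply: le_trans (HA p k pz kr); apply: Sf_mono => //.
by move=> v _; left.
Qed.

Lemma Du_sqr_continuous p k : `|p - z| <= 2 * rho -> `|k| <= rho -> {for p, continuous (fun x => Du u k x ^+ 2)}.
Proof.
move=> pz kr; have c1 : {for p, continuous (Du u k)}.
  apply: (Du_continuous hu); apply: (@dom2_near p 0) => //.
    by rewrite lexx mulr_ge0// ltW.
  by rewrite sqdxx sqr_ge0.
rewrite (_ : (fun x => _) = (fun x => Du u k x * Du u k x)); first exact: continuous_mul.
by apply/funext => x; rewrite expr2.
Qed.

Lemma flat_lipschitz : exists2 M, 0 <= M & forall p k, xn p = 0 -> `|p - z| <= 2 * rho -> `|k| <= rho ->
  `|u (p + emb k) - u p| <= M * `|k|.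
Proof.
have [A A0 HA] := Sf_bound; have [c c0 Hc] := val_le_Sf a0.
exists (Num.sqrt (A / c)) => [|p k p0 pz kr]; first exact: sqrtr_ge0.
rewrite -ler_sqr ?nnegrE ?sqrtr_ge0// sqr_normr exprMn sqr_sqrtr ?_//.
rewrite mulrAC ler_pdivlMr// mulrC.
apply: (Hc (fun x => Du u k x ^+ 2) p (2 * rho)) => //.
- exact: Du_sqr_continuous.
- by rewrite p0.
-
by move=> t /andP[t0 t1]; apply: HA => //; rewrite t0 ltW.
Qed.

Lemma Lop_bump_le : exists2 C, 0 < C & forall p s x, 0 < s -> good_center a p s -> hp x ->
  Lop a (bump p s) x <= C / s ^+ 2 /\ (s ^+ 2 < sqd p x -> Lop a (bump p s) x = 0).
Proof.
have [D D0 HD] := flatfun_bound (flat_deriv ('X^2 : {poly R})).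
exists (4 * D + 1) => [|p s x s0 gc hx]; first by lra.
have s2 : 0 < s ^+ 2 by [].
rewrite (Lop_bump s0 gc hx).
have out : s ^+ 2 < sqd p x -> radial fe'' p s x = 0.
  move=> h; rewrite /radial fe''_flat /flatfun ifF//; apply/negbTE.
  by rewrite -leNgt subr_le0 ler_pdivlMr// mul1r ltW.
split; last first.
  by move=> h; rewrite psi_out ?(ltW h)// out// !mulr0 addr0 mul0r.
rewrite ler_pM2r ?invr_gt0//.
have Na : 0 <= dim + a by [].
have := mulr_ge0 Na (psi_ge0 p s x).
have [h|h] := leP (sqd p x) (s ^+ 2); last by rewrite out// mulr0 mulNr; lra.
have q1 : sqd p x / s ^+ 2 <= 1 by rewrite ler_pdivrMr// mul1r.
have q0 : 0 <= sqd p x / s ^+ 2 by rewrite divr_ge0 ?sqd_ge0// ltW.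
have hD : radial fe'' p s x <= D by apply: le_trans (ler_norm _) _; rewrite /radial fe''_flat; apply: HD; exact: radial_arg1.
have : sqd p x / s ^+ 2 * radial fe'' p s x <= D by apply: le_trans (ler_wpM2l q0 hD) _; rewrite ler_piMl.
by rewrite mulNr; lra.
Qed.

(** Caccioppoli at scale s, followed by the bound on the mean at scale 2 s. The factor [expR 2]
    arises because [psi p (2 * s)] is at least exp(-2) on the support of [bump p s]. *)
Lemma energy_bound : exists2 A, 0 <= A & forall p k s, xn p = 0 -> `|p - z| <= 2 * rho -> `|k| <= rho ->
  0 < s <= rho -> \I_a[x] bump p s x * DG2 G k x <= A * `|k| ^+ 2 * (s `^ (Nw m a) / s ^+ 2).
Proof.
have [A A0 HA] := Sf_bound; have [C C0 HC] := Lop_bump_le.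
exists (C * expR 2 * (2 `^ (Nw m a)) * A) => [|p k s p0 pz kr /andP[s0 s1]].
  by rewrite !mulr_ge0 ?expR_ge0 ?powR_ge0 ?(ltW C0).
have s2 : 0 < 2 * s by [].
have gc : good_center a p s by left.
have dn x : sqd p x <= s ^+ 2 -> dom2 r z k x by apply: dom2_near => //; rewrite (ltW s0); have := rho0; lra.
have cb := caccioppoli_bump s0 gc dn.
have I0 : 0 <= \I_a[x] bump p s x * DG2 G k x by apply: (wI_ge0 hw) => x; rewrite mulr_ge0 ?bump_ge0 ?DG2_ge0.
apply: le_trans (_ : wI _ (fun x => Du u k x ^+ 2 * Lop a (bump p s) x) <= _); first lra.
have wL : wint (wt a) (fun x => Du u k x ^+ 2 * Lop a (bump p s) x).
  apply: (wint_mul hw (l2_bmfun hw (bD2 k))); apply: (l2_sum hw) => i.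
  apply: (l2_dvg a0 (tf_partial i (tf_bump s0 dn))); exact: okn_bump gc.
have wP := wint_psi a0 p (bD2 k) s2.
apply: le_trans (_ : C / s ^+ 2 * expR 2 * \I_a[x] Du u k x ^+ 2 * psi p (2 * s) x <= _).
  rewrite -wIZ//; apply: le_Rintegral => //; first exact: wintZ.
  move=> x _; have [hx|hx] := pselect (hp x); last by rewrite wt_out// !mulr0.
  rewrite ler_wpM2r ?(ltW (wt_gt0 a hx))//.
  have [L1 L2] := HC p s x s0 gc hx.
  rewrite mulrCA ler_wpM2l ?sqr_ge0//.
  have K0 : 0 <= C / s ^+ 2 by [].
  have [xs|xs] := leP (sqd p x) (s ^+ 2); last first.
    by rewrite L2// mulr_ge0 ?psi_ge0// mulr_ge0 ?expR_ge0.
  apply: le_trans L1 _; rewrite -[leRHS]mulrA ler_peMr//.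
  have : expR (- 2) <= psi p (2 * s) x by apply: psi_lb => //; rewrite exprMn; have := sqr_ge0 s; lra.
  by rewrite expRN => h; rewrite -ler_pdivrMl ?expR_gt0// mulr1.
have SE : \I_a[x] Du u k x ^+ 2 * psi p (2 * s) x = (2 * s) `^ (Nw m a) * Sf a (fun x => Du u k x ^+ 2) p (2 * s) by rewrite /Sf mulrA powRN divff ?mul1r// gt_eqF// powR_gt0.
have HS : Sf a (fun x => Du u k x ^+ 2) p (2 * s) <= A * `|k| ^+ 2 by apply: HA => //; rewrite s2; lra.
rewrite SE; apply: le_trans (ler_wpM2l _ (ler_wpM2l _ HS)) _; rewrite ?powR_ge0//.
  by rewrite mulr_ge0 ?expR_ge0// divr_ge0 ?(ltW C0)// sqr_ge0.
rewrite powRM ?(ltW s0)//; apply: eqW; ring.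
Qed.

End local_growth.
End growth.

(** * Symmetry of second derivatives of smooth functions *)

Section mixed_partials.
Context {R : realType} {n : nat}.
Local Notation E := 'rV[R]_n.
Implicit Types (f : E -> R) (x v : E) (i j : 'I_n) (h s t : R).

Lemma smooth_is_derive_delta f x i s : smooth f ->
  is_derive s 1 (fun s => f (x + s *: 'e_i)) (partial i f (x + s *: 'e_i)).
Proof.
move=> sf; have := smooth_is_derive x 'e_i s sf.
by rewrite -[X in is_derive _ _ _ X]/(dirder _ _ _) dirder_delta.
Qed.

Lemma mixed_mvt f x i j h : smooth f -> 0 < h -> exists y, `|y - x| <= 2 * h /\
  f (x + h *: 'e_i + h *: 'e_j) - f (x + h *: 'e_i) -
  (f (x + h *: 'e_j) - f x) = partial j (partial i f) y * h ^+ 2.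
Proof.
move=> sf h0; set ei := 'e_i : E; set ej := 'e_j : E.
pose phi s := f (x + h *: ej + s *: ei) - f (x + s *: ei).
have D s : is_derive s 1 phi (partial i f (x + h *: ej + s *: ei) - partial i f (x + s *: ei)) by exact: (is_deriveB (smooth_is_derive_delta _ i s sf) (smooth_is_derive_delta _ i s sf)).
have [s /andP[s0 sh] E1] := MVT_is_derive (ltW h0) (fun s _ => D s).
have [t /andP[t0 th] E2] := MVT_is_derive (ltW h0) (fun t _ => smooth_is_derive_delta (x + s *: ei) j t (smooth_partial i sf)).
rewrite subr0 in E1 E2.
exists (x + s *: ei + t *: ej); split.
  have -> : x + s *: ei + t *: ej - x = s *: ei + t *: ej by rewrite -(addrA x) addrAC subrr add0r.
  apply: le_trans (ler_normD _ _) _.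
  by have := norm_scale_delta i s0; have := norm_scale_delta j t0; rewrite -/ei -/ej; lra.
move: E1; rewrite /phi scale0r !addr0 => E1.
have e1 : x + h *: ei + h *: ej = x + h *: ej + h *: ei by rewrite addrAC.
rewrite e1 E1; move: E2; rewrite scale0r addr0 (addrAC x) => ->.
by rewrite -mulrA -expr2.
Qed.

Lemma eq_of_near_eq (f g : E -> R) x : {for x, continuous f} -> {for x, continuous g} ->
  (forall h, 0 < h -> exists y1 y2, [/\ `|y1 - x| <= h, `|y2 - x| <= h & f y1 = g y2]) -> f x = g x.
Proof.
move=> cf cg H; apply/eqP; rewrite -subr_eq0 -normr_le0; apply/ler_addgt0Pr => e e0; rewrite add0r.
have e2 : 0 < e / 2 by [].
have /cvgrPdist_le/(_ _ e2)/nbhs_ballP[d1 /= d10 H1] := cf.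
have /cvgrPdist_le/(_ _ e2)/nbhs_ballP[d2 /= d20 H2] := cg.
pose h := Num.min d1 d2 / 2; have h0 : 0 < h by rewrite divr_gt0// lt_min d10.
have hd1 : h < d1.
  have : Num.min d1 d2 <= d1 by rewrite ge_min lexx.
  by move: h0; rewrite /h; lra.
have hd2 : h < d2.
  have : Num.min d1 d2 <= d2 by rewrite ge_min lexx orbT.
  by move: h0; rewrite /h; lra.
have [y1 [y2 [n1 n2 E3]]] := H h h0.
have b1 : `|f x - f y1| <= e / 2 by apply: H1; rewrite ballEC; exact: le_lt_trans hd1.
have b2 : `|g x - g y2| <= e / 2 by apply: H2; rewrite ballEC; exact: le_lt_trans hd2.
by have := ler_distD (g y2) (f x) (g x); rewrite -E3 in b2 *; rewrite distrC in b2; lra.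
Qed.

Lemma partialC f i j x : smooth f -> partial i (partial j f) x = partial j (partial i f) x.
Proof.
move=> sf; apply: eq_of_near_eq.
- by apply: smooth_continuous; do 2!apply: smooth_partial.
- by apply: smooth_continuous; do 2!apply: smooth_partial.
move=> h h0; have h2 : 0 < h / 2 by [].
have [y1 [n1 E1]] := mixed_mvt x j i sf h2.
have [y2 [n2 E2]] := mixed_mvt x i j sf h2.
have hh : 2 * (h / 2) = h by field.
rewrite hh in n1 n2; exists y1, y2; split; [by []|by []|].
have h0' : (h / 2) ^+ 2 != 0 by [].
have E3 : partial i (partial j f) y1 * (h / 2) ^+ 2 = partial j (partial i f) y2 * (h / 2) ^+ 2.
  rewrite -[LHS]E1 -[RHS]E2 (addrAC x); move: (f _) (f _) (f _) (f _) => A B C D; ring.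
exact: (mulIf h0' E3).
Qed.

End mixed_partials.

(** * The flux functional under tangential shifts and derivatives *)

Section ell_calculus.
Context {R : realType} {m : nat}.
Local Notation E := 'rV[R]_(m + 1).
Implicit Types (f xi zeta : E -> R) (p x y : E) (s t : R) (i : 'I_(m + 1)) (k : 'rV[R]_m).
Context `(hu : @local_min R m a lp lm z r u G).
Let a0 := lmin_a0 hu.
Let hw := weight_wt m a0.
Let lG := lmin_l2 hu.
Local Notation L := (ell a G).

Lemma wint_G i : wint (wt a) (G i).
Proof.
have := wint_mul hw (lG i) (l2_bmfun hw (bmfun_indic_ball z (lmin_r hu))).
apply: wint_ext => x; rewrite indicE; case: (boolP (x \in _)) => [|/negP xb]; first by rewrite mulr1.
by rewrite (lmin_supp hu) ?mulr0// => h; apply: xb; exact/mem_set.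
Qed.

Lemma ellE (B : set E) xi : test_function B xi -> L xi = \sum_i \I_a[x] G i x * partial i xi x.
Proof.
move=> tx; rewrite /ell wI_sum// => i.
by apply: (wint_mul hw (lG i)); exact: (l2_bmfun hw (tf_bmfun (tf_partial i tx))).
Qed.

Let w1 (B : set E) xi i : test_function B xi -> wint (wt a) (fun x => G i x * partial i xi x).
Proof. by move=> tx; apply: (wint_mul hw (lG i)); exact: (l2_bmfun hw (tf_bmfun (tf_partial i tx))). Qed.

Lemma ellD (B : set E) xi zeta : test_function B xi -> test_function B zeta ->
  L (fun x => xi x + zeta x) = L xi + L zeta.
Proof.
move=> tx tz; rewrite !(@ellE B)//; last exact: tfD.
rewrite -big_split; apply: eq_bigr => i _ /=; rewrite -wID; [|exact: w1 tx|exact: w1 tz].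
apply: wI_ext => x; rewrite partialD ?mulrDr//; apply: smooth_differentiable; [by case: tx|by case: tz].
Qed.

Lemma ellZ (B : set E) c xi : test_function B xi -> L (fun x => c * xi x) = c * L xi.
Proof.
move=> tx; rewrite !(@ellE B)//; last exact: tfZ.
rewrite mulr_sumr; apply: eq_bigr => i _; rewrite -wIZ; last exact: w1 tx.
by apply: wI_ext => x; rewrite partialZ; [rewrite mulrCA|apply: smooth_differentiable; case: tx].
Qed.

Lemma ell_sum (B : set E) (J : Type) (l : seq J) (xi : J -> E -> R) : (forall j, test_function B (xi j)) ->
  L (fun x => \sum_(j <- l) xi j x) = \sum_(j <- l) L (xi j).
Proof.
move=> tx; elim: l => [|j l IH].
  rewrite big_nil -[RHS](wI0 (@wt R m a)); apply: wI_ext => x.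
  apply: big1 => i; rewrite (_ : (fun => _) = fun=> 0) ?partial_cst ?mulr0//.
  by apply/funext => y; rewrite big_nil.
have ts : test_function B (fun x => \sum_(j <- l) xi j x).
  elim: l {IH} => [|j' l IH]; last by under eq_fun do rewrite big_cons; exact: tfD.
  under eq_fun do rewrite big_nil; have := tfZ 0 (tx j).
  by under eq_fun do rewrite mul0r.
rewrite big_cons -IH -(ellD (tx j) ts); congr ell.
by apply/funext => x; rewrite big_cons.
Qed.

Lemma partial_sqd_out xi p c i x : (forall x, c < sqd p x -> xi x = 0) -> c < sqd p x -> partial i xi x = 0.
Proof.
move=> xi0 h1; rewrite -(partial_cst i 0 x); apply: partial_near.
have o : open [set y| c < sqd p y].
  rewrite (_ : [set y | _] = (sqd p) @^-1` [set v | c < v])//.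
  by apply: open_comp; [move=> y _; exact: smooth_continuous (smooth_sqd p) y|exact: open_gt].
have : nbhs x [set y | c < sqd p y] by exact: open_nbhs_nbhs.
by apply: filterS => y /= /xi0.
Qed.

Lemma wint_bump_DG2 p s k : wint (wt a) (fun x => bump p s x * DG2 G k x).
Proof.
have e1 x : `|bump p s x| <= 1 by rewrite ger0_norm ?bump_ge0 ?bump_le1.
have mb : mbfun (bump p s) by apply: mbfun_continuous; apply: smooth_continuous; apply: smooth_radial; exact: smooth1_fe.
apply: (wint_ext (f := fun x => \sum_i DG G k i x * (bump p s x * DG G k i x))).
  by move=> x; rewrite /DG2 mulr_sumr; apply: eq_bigr => i _; ring.
have lDG i : l2 (wt a) (DG G k i) := l2_DG hu k i.
by apply: (wint_dot hu) => i //; exact: (l2_bounded hw mb e1).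
Qed.

Section dot_product.
Variables (X : 'I_(m + 1) -> E -> R) (p : E) (s l : R).
Hypothesis tX : forall i, test_function (ball z r) (X i).
Local Notation dot X := (\I_a[x] \sum_i G i x * X i x).

Let lX i : l2 (wt a) (X i).
Proof. exact: (l2_bmfun hw (tf_bmfun (tX i))). Qed.

Section bounds.
Hypotheses (s0 : 0 < s) (X0 : forall i x, s ^+ 2 / 2 < sqd p x -> X i x = 0).

(* Moving the test function amounts to moving the gradient. *)
Lemma dot_shift k : 0 < l ->
  `|dot (fun i x => X i (x - emb k)) - dot X| <=
    (l * (expR 2 * \I_a[x] bump p s x * DG2 G k x) +
     l^-1 * \I_a[x] \sum_i X i x ^+ 2) / 2.
Proof.
move=> l0; set h := emb k.
have lDG i : l2 (wt a) (DG G k i) := l2_DG hu k i.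
have wth x : wt a (x + h) = wt a x by apply: wt_translate; exact: xn_emb.
have -> : dot (fun i x => X i (x - h)) - dot X = \I_a[x] \sum_i DG G k i x * X i x.
  have wG' : wint (wt a) (fun x => \sum_i G i (x + h) * X i x) by apply: (wint_dot hu) => i //; exact: l2_translate wth (lG i).
  have -> : dot (fun i x => X i (x - h)) = \I_a[x] \sum_i G i (x + h) * X i x.
    have wl : wint (wt a) (fun x => \sum_i G i x * X i (x - h)).
      apply: wint_sum => i; apply: (wint_mul hw (lG i)).
      exact: (l2_bmfun hw (tf_bmfun (tf_translate (- h) (tX i)))).
    rewrite -(proj2 (wI_translate (v := h) wl wth)).
    by apply: wI_ext => x; apply: eq_bigr => i; rewrite addrK.
  rewrite -wIB//; last exact: (wint_dot hu).
  by apply: wI_ext => x; rewrite -sumrB; apply: eq_bigr => i; rewrite -mulrBl.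
have wE : wint (wt a) (fun x => \sum_i DG G k i x * X i x) by exact: (wint_dot hu).
have wA := wint_bump_DG2 p s k.
have wB : wint (wt a) (fun x => \sum_i X i x ^+ 2) by apply: wint_sum => i; exact: (lX i).2.
apply: le_trans (wI_abs hw wE) _.
rewrite [leRHS](_ : _ = \I_a[x] ((l / 2 * expR 2) * (bump p s x * DG2 G k x) +
 (l^-1 / 2) * \sum_i X i x ^+ 2)); last first.
  rewrite wID; [|exact: wintZ..].
  by rewrite !wIZ//; ring.
apply: (wI_le hw (wint_abs hw wE)); first by apply: wintD; exact: wintZ.
move=> x; apply: le_trans (ler_norm_sum _ _ _) _.
rewrite !mulr_sumr -big_split /=; apply: ler_sum => i _.
have li : 0 < l^-1 by rewrite invr_gt0.
have [h1|h1] := leP (sqd p x) (s ^+ 2 / 2); last first.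
  rewrite X0// mulr0 normr0 expr0n mulr0 addr0; apply: mulr_ge0; last by rewrite mulr_ge0 ?bump_ge0 ?sqr_ge0.
  by rewrite mulr_ge0 ?expR_ge0// ltW// divr_gt0.
rewrite normrM; have := amgm `|DG G k i x| `|X i x| l0.
rewrite !sqr_normr.
have b1 := bump_lb s0 h1.
have b2 : 1 <= expR 2 * bump p s x by move: b1; rewrite expRN => b1; rewrite -ler_pdivrMl ?expR_gt0// mulr1.
have := ler_wpM2r (sqr_ge0 (DG G k i x)) b2; rewrite mul1r => b3.
have := ler_wpM2l (ltW l0) b3; lra.
Qed.

End bounds.

Lemma dot_derive v t :
  is_derive t 1 (fun t => dot (fun i x => X i (x - t *: v))) (- dot (fun i x => dirder v (X i) (x - t *: v))).
Proof.
have tXT i : test_function setT (X i) by exact: tf_sub (tX i).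
have ldX i : l2 (wt a) (fun x => dirder v (X i) (x - t *: v)) by exact: (l2_bmfun hw (tf_bmfun (tf_translate (- (t *: v)) (tf_dirder v (tX i))))).
have D j : is_derive t 1 (fun t => \I_a[x] G j x * X j (x - t *: v))
 (- \I_a[x] G j x * dirder v (X j) (x - t *: v)).
  have := wI_translate_derive (- v) t hw (l2_mfun (lG j)) (wint_G j) (tXT j).
  rewrite (_ : _ (fun x => G j x * _) = - \I_a[x] G j x * dirder v (X j) (x - t *: v)).
    by apply: is_derive_ext => q; apply: wI_ext => x; rewrite scalerN.
  rewrite -wIN; apply: wI_ext => x; rewrite -mulrN scalerN; congr (_ _).
  by rewrite /dirder -sumrN; apply: eq_bigr => i; rewrite mxE mulNr.
have := is_derive_sum D; rewrite sumrN -wI_sum; last by move=> j; exact: (wint_mul hw (lG j)).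
apply: is_derive_ext => q; rewrite fct_sumE -wI_sum// => j.
by apply: (wint_mul hw (lG j)); exact: (l2_bmfun hw (tf_bmfun (tf_translate (- (q *: v)) (tX j)))).
Qed.

End dot_product.

Lemma emb_delta (j : 'I_m) t : emb (t *: 'e_j) = t *: 'e_(lshift 1 j) :> E.
Proof.
have H (v : 'rV[R]_m) l : (t *: v) ord0 l = t * v ord0 l by rewrite mxE.
have H' (v : E) l : (t *: v) ord0 l = t * v ord0 l by rewrite mxE.
apply/rowP => i; rewrite H' embE [delta_mx _ _ _ _]mxE /=; case: (split_ordP i) => l ->.
  by rewrite rV_rconsl !mxE eqxx (inj_eq (@lshift_inj _ _)).
by rewrite [l]ord1 rV_rconsr eq_rlshift mulr0.
Qed.

Lemma ell_shift xi p s k l : test_function (ball z r) xi -> 0 < s ->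
  (forall x, s ^+ 2 / 2 < sqd p x -> xi x = 0) -> 0 < l ->
  `|L (fun x => xi (x - emb k)) - L xi| <=
    (l * (expR 2 * \I_a[x] bump p s x * DG2 G k x) +
     l^-1 * \I_a[x] \sum_i partial i xi x ^+ 2) / 2.
Proof.
move=> tx s0 xi0 l0.
have E1 : L (fun x => xi (x - emb k)) = \I_a[x] \sum_i G i x * partial i xi (x - emb k).
  apply: wI_ext => x; apply: eq_bigr => i _; congr (_ _).
  by rewrite (partial_translate i (- emb k) xi).
rewrite E1.
exact: (dot_shift (fun i => tf_partial i tx) s0 (fun i x => @partial_sqd_out xi p _ i x xi0) k l0).
Qed.

Section partial_bounds.
Variables (p : E) (s l B : R) (j : 'I_m) (hs : nat -> R).
Hypotheses (s0 : 0 < s) (l0 : 0 < l) (hs0 : forall q, 0 < hs q) (hsc : hs @ \oo --> (0 : R)).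
Hypothesis HB : forall q, \I_a[x] bump p s x * DG2 G (hs q *: 'e_j) x <= B * hs q ^+ 2.

(** The pairing with a shifted field is differentiable in the shift, so its derivative is already
    the limit of the quotients along the one sequence [hs]. An energy bound along a single sequence
    thus suffices, and for a = 0 no better one will be at hand. *)
Lemma dot_partial_bound (X : 'I_(m + 1) -> E -> R) : (forall i, test_function (ball z r) (X i)) ->
  (forall i x, s ^+ 2 / 2 < sqd p x -> X i x = 0) ->
  `|\I_a[x] \sum_i G i x * partial (lshift 1 j) (X i) x| <=
    (l * (expR 2 * B) + l^-1 * \I_a[x] \sum_i X i x ^+ 2) / 2.
Proof.
move=> tX X0; set e := lshift 1 j; set D := wI _ _; set K := wI _ _; set M := (X in _ <= X).
have [Phi PhiE [dv dvE]] : exists2 Phi : R -> R,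
 (forall t, Phi t = \I_a[x] \sum_i G i x * X i (x - t *: 'e_e)) &
 is_derive (0 : R) 1 Phi (- D).
  exists (fun t => \I_a[x] \sum_i G i x * X i (x - t *: 'e_e)) => //.
  have := dot_derive tX 'e_e 0.
  rewrite (_ : wI _ _ = D)//; apply: wI_ext => x; apply: eq_bigr => i _.
  by rewrite dirder_delta scale0r subr0.
have bound q : `|(hs q)^-1 * (Phi (hs q) - Phi 0)| <= M.
  rewrite normrM normfV (gtr0_norm (hs0 q)) ler_pdivrMl//.
  have -> : Phi 0 = \I_a[x] \sum_i G i x * X i x by rewrite PhiE; apply: wI_ext => x; rewrite scale0r subr0.
  have lq : 0 < l / hs q by [].
  have := dot_shift tX s0 X0 (hs q *: 'e_j) lq; rewrite emb_delta -/e -PhiE.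
  move=> h; apply: le_trans h _; rewrite /M -/K invf_div.
  have hn : hs q != 0 by [].
  have -> : hs q * ((l * (expR 2 * B) + l^-1 * K) / 2) =
 (l / hs q * (expR 2 * (B * hs q ^+ 2)) + hs q / l * K) / 2.
    by field; rewrite hn gt_eqF.
  rewrite ler_pM2r ?invr_gt0// lerD2r ler_pM2l// ler_pM2l ?expR_gt0//; exact: HB.
have Lim : (fun q => (hs q)^-1 * (Phi (hs q) - Phi 0)) @ \oo --> - D.
  have C0 : (fun t => t^-1 *: ((Phi \o shift 0) (t *: 1) - Phi 0)) @ (0 : R)^' --> - D by rewrite -dvE; exact: dv.
  have /cvgr_dnbhsP/(_ hs) := C0.
  move=> /(_ (conj (fun q => lt0r_neq0 (hs0 q)) hsc)); apply: cvg_trans; apply: near_eq_cvg; apply: nearW => q /=.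
  by rewrite addr0 [hs q *: 1]mulr1.
have Lim' : (fun q => `|(hs q)^-1 * (Phi (hs q) - Phi 0)|) @ \oo --> `|D| by rewrite -[X in _ --> X]normrN; exact: cvg_norm.
rewrite -(cvg_lim (@norm_hausdorff _ _) Lim'); apply: limr_le; first by apply/cvg_ex; eexists; exact: Lim'.
by apply: nearW.
Qed.

Lemma ell_partial_bound xi : test_function (ball z r) xi -> (forall x, s ^+ 2 / 2 < sqd p x -> xi x = 0) ->
  `|L (partial (lshift 1 j) xi)| <=
    (l * (expR 2 * B) + l^-1 * \I_a[x] \sum_i partial i xi x ^+ 2) / 2.
Proof.
move=> tx xi0; have sx : smooth xi by case: tx.
have -> : L (partial (lshift 1 j) xi) =
 \I_a[x] \sum_i G i x * partial (lshift 1 j) (partial i xi) x.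
  by apply: wI_ext => x; apply: eq_bigr => i; rewrite partialC.
apply: dot_partial_bound => i; first exact: tf_partial.
by move=> x; exact: partial_sqd_out.
Qed.

End partial_bounds.

End ell_calculus.

(** * Dependence of the averaged flux on the scale, and the case a > 0 *)

Section scaling.
Context {R : realType} {m : nat}.
Local Notation E := 'rV[R]_(m + 1).
Local Notation dim := ((m + 1)%:R : R).
Implicit Types (zeta : E -> R) (p x y : E) (s t : R) (i : 'I_(m + 1)) (k : 'rV[R]_m).

Lemma growth_arith (X Y F1 F2 : R) : 0 <= X -> X - F1 <= Y - F2 -> F2 <= F1 + Y.
Proof. by lra. Qed.

Lemma close_le (X Y B : R) : `|X - Y| <= B -> Y <= X + B.
Proof. by rewrite ler_norml => /andP[]; lra. Qed.

Lemma chain_arith (S F1 F2 X Y e A : R) : S <= F1 + Y -> F1 <= F2 + X -> F2 <= A -> Y <= e -> S <= A + X + e.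
Proof. by lra. Qed.

Lemma emb0 : emb 0 = 0 :> E. Proof. by rewrite /emb row_mx0. Qed.

Lemma local_minN a lp lm z r u (G : 'I_(m + 1) -> E -> R) : local_min a lp lm z r u G ->
  local_min a lm lp z r (fun x => - u x) (fun i x => - G i x).
Proof.
move=> hu; have a0 : 0 <= a by have /andP[] := lmin_a hu.
have hw := weight_wt m a0.
have [mf [C [s [s0 hC hs]]]] := lmin_bm hu.
split; [exact: lmin_a hu|exact: lmin_m hu|exact: lmin_p hu|exact: lmin_r hu|exact: lmin_z hu| | | | | |].
- split; first exact: mbfunN.
  by exists C, s; split => // x; [rewrite normrN|move=> /hs->; rewrite oppr0].
- by move=> x /(lmin_cont hu) cu; apply: continuousN.
- by move=> i; apply: l2N; exact: lmin_l2 hu i.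
- by move=> i x /(lmin_supp hu i)->; rewrite oppr0.
- exact: dgradN (lmin_grad hu).
- move=> phi Gam adm.
  have := lmin_EL hu (admissibleN a0 adm); congr (0 <= _ + _).
    by apply: wI_ext => x; apply: eq_bigr => i _; rewrite mulrN mulNr.
  by apply: wI_ext => y; rewrite -(jdN lp lm (u _ + _)) -(jdN lp lm (u _)) opprD opprK.
Qed.

Lemma ellN a (G : 'I_(m + 1) -> E -> R) zeta : wint (wt a) (fun x => \sum_i G i x * partial i zeta x) ->
  ell a (fun i x => - G i x) zeta = - ell a G zeta.
Proof.
move=> w; rewrite /ell -wIN//; apply: wI_ext => x; rewrite -sumrN; apply: eq_bigr => i _.
by rewrite mulNr.
Qed.

Lemma flatI_bump_lb : exists2 c, 0 < c & forall p t, xn p = 0 -> 0 < t -> c * t ^+ m <= flatI (bump p t).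
Proof.
have d1 := @dim_ge1 R m; have dp : 0 < dim by exact: lt_le_trans d1.
pose q : R := (2 * dim)^-1; have q0 : 0 < q by rewrite invr_gt0 mulr_gt0.
exists (expR (- 2) * (q *+ 2) ^+ m); first by rewrite mulr_gt0 ?expR_gt0// exprn_gt0// mulrn_wgt0.
move=> p t p0 t0; pose y0 : 'rV[R]_m := \row_i p ord0 (lshift 1 i).
have pE : p = emb y0.
  apply/rowP => i; rewrite embE; case: (split_ordP i) => j ->.
    by rewrite rV_rconsl mxE.
  by rewrite [j]ord1 rV_rconsr -[RHS]p0.
pose s := t * q; have s0 : 0 < s by exact: mulr_gt0.
have mb := @measurable_ball_rV R m y0 s.
have wi := wint_one_bmfun (bmfun_indic_ball y0 s0).
have bb : bmfun (fun y : 'rV[R]_m => bump p t (emb y)) by apply: bmfun_emb; apply: (@tf_bmfun _ _ setT); exact: tf_bump.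
have step : wI one (fun y : 'rV[R]_m => expR (- 2) * \1_(ball y0 s) y) <= flatI (bump p t).
  apply: (wI_le weight_one (wintZ _ wi) (wint_one_bmfun bb)) => y.
  rewrite indicE; case: (boolP (_ \in _)) => [/set_mem yb|_]; last by rewrite mulr0; exact: bump_ge0.
  rewrite mulr1; apply: bump_lb => //.
  apply: le_trans (_ : dim * s ^+ 2 <= _).
    apply: norm_sqd; rewrite pE -opprB normrN.
    by rewrite -embB; apply: le_trans (norm_emb _) _; move: yb; rewrite ballE => /ltW.
  have -> : dim * (t * (2 * dim)^-1) ^+ 2 = t ^+ 2 * (4 * dim)^-1 by field; rewrite gt_eqF.
  rewrite ler_pM2l ?exprn_gt0// lef_pV2 ?posrE ?mulr_gt0//; lra.
apply: le_trans step; rewrite wIZ// wI_ball//.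
by rewrite -mulrA ler_pM2l ?expR_gt0// -exprMn /s -mulrnAr mulrC.
Qed.

Context `(hu : @local_min R m a lp lm z r u G).
Let a0 := lmin_a0 hu.
Let hw := weight_wt m a0.
Let lG := lmin_l2 hu.
Local Notation L := (ell a G).
Let rho := r / 8.
Let rho0 : 0 < rho := lmin_rho hu.
Local Notation N := (Nw m a).

Lemma near_ball p s x : `|p - z| <= 2 * rho -> 0 <= s <= 2 * rho -> sqd p x <= s ^+ 2 -> ball z r x.
Proof.
by move=> pz sr xs; have [] := @dom2_near _ _ _ _ _ _ _ _ _ hu p s 0 x pz sr _ xs; rewrite ?normr0 ?(ltW rho0).
Qed.

(** The derivative of [bump p s] in the scale s. *)
Definition dbump p s x : R := sqd p x / s ^+ 3 * psi p s x.

Lemma tf_dbump p s (B : set E) : 0 < s -> (forall x, sqd p x <= s ^+ 2 -> B x) -> test_function B (dbump p s).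
Proof.
move=> s0 h; apply: tfM; first exact: tf_psi.
by apply: smoothM; [exact: smooth_sqd|exact: smooth_cst].
Qed.

Lemma partial_dbump p s i x : 0 < s -> partial i (dbump p s) x =
  (x ord0 i - p ord0 i) * (2 / s ^+ 3 * psi p s x - 4 * sqd p x / s ^+ 5 * radial fe'' p s x).
Proof.
move=> s0; have sr : smooth (radial fe' p s) by apply: smooth_radial; exact: smooth1_fe'.
rewrite (_ : dbump p s = fun x => 2 / s ^+ 3 * (sqd p x * radial fe' p s x)); last first.
  by apply/funext => y; rewrite /dbump /psi; ring.
rewrite partialZ; last by apply: smooth_differentiable; apply: smoothM => //; exact: smooth_sqd.
rewrite partialM; [|exact: smooth_differentiable (smooth_sqd _)|exact: smooth_differentiable].
rewrite partial_sqd partial_radial; last exact: smooth1_fe'.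
by rewrite -/fe'' /psi; field; rewrite gt_eqF.
Qed.

Lemma is_derive_partial_bump p i x s : 0 < s ->
  is_derive s 1 (fun t => partial i (bump p t) x) (partial i (dbump p s) x).
Proof.
move=> s0; have sn : s != 0 by [].
have D0 : is_derive s 1 (fun t : R => t^-1) (- s ^- 2).
  have := is_deriveV sn (is_derive_id s 1); rewrite /GRing.scale/= mulr1; exact: is_derive_ext.
have D1 := is_derive_mul (is_derive_mul D0 D0 erefl) (is_derive_psi p x s0) erefl.
have := is_derive_mulr (- (x ord0 i - p ord0 i)) D1.
rewrite (_ : _ * _ = partial i (dbump p s) x); last by rewrite partial_dbump//; field.
apply: is_derive_ext => t; rewrite partial_bump; case: (eqVneq t 0) => [->|t0]; last by field.
by rewrite invr0 expr0n /= invr0; ring.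
Qed.

Lemma ell_bump_derive p s : 0 < s -> `|p - z| <= 2 * rho -> s <= rho ->
  is_derive s 1 (fun t => L (bump p t)) (L (dbump p s)).
Proof.
move=> s0 pz sr; have s2 : 0 < s / 2 by [].
have [D D0 HD] := flatfun_bound (flat_deriv ('X^2 : {poly R})).
have [C C0 HC] := @psi_ub R m.
have rt t : `|t - s| < s / 2 -> s / 2 < t by rewrite ltr_norml; lra.
have rt' t : `|t - s| < s / 2 -> t < 2 * s by rewrite ltr_norml; lra.
pose K := (2 * C + 4 * D) / (s / 2) ^+ 2.
have wg : wint (wt a) (fun x => K * \sum_i `|G i x|) by apply: wintZ; apply: wint_sum => i; apply: (wint_abs hw); exact: (wint_G hu).
have Kb t x i : `|t - s| < s / 2 -> `|partial i (dbump p t) x| <= K.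
  move=> /rt tr; have t0 : 0 < t by exact: lt_trans tr.
  rewrite partial_dbump//; have [h|h] := leP (sqd p x) (t ^+ 2); last first.
    rewrite psi_out ?(ltW h)// /radial fe''_flat /flatfun ifF.
      by rewrite !mulr0 subr0 mulr0 normr0 divr_ge0 ?sqr_ge0// addr_ge0// mulr_ge0 ?(ltW C0).
    by apply/negbTE; rewrite -leNgt subr_le0 ler_pdivlMr ?exprn_gt0// mul1r ltW.
  have hx := sqd_coord_norm i (ltW t0) h.
  have hD : `|radial fe'' p t x| <= D by rewrite fe''_flat HD// radial_arg1.
  have hC : `|psi p t x| <= C by rewrite ger0_norm ?psi_ge0// HC.
  have tn : t != 0 by [].
  rewrite normrM; apply: (@le_trans _ _ (t * ((2 * C + 4 * D) / t ^+ 3))).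
    apply: ler_pM => //; apply: le_trans (ler_normB _ _) _.
    rewrite [leRHS]mulrDl; apply: lerD.
      rewrite normrM [X in X * _ <= _]ger0_norm ?divr_ge0 ?exprn_ge0 ?(ltW t0)//.
      by rewrite mulrAC ler_pM2r ?invr_gt0 ?exprn_gt0// ler_pM2l.
    rewrite normrM.
    have -> : 4 * sqd p x / t ^+ 5 = 4 * (sqd p x / t ^+ 2) / t ^+ 3 by field.
    have q0 : 0 <= sqd p x / t ^+ 2 by rewrite divr_ge0 ?sqd_ge0// exprn_ge0// ltW.
    have q1 : sqd p x / t ^+ 2 <= 1 by rewrite ler_pdivrMr ?exprn_gt0// mul1r.
    rewrite ger0_norm; last by rewrite mulr_ge0 ?invr_ge0 ?exprn_ge0 ?(ltW t0)// mulr_ge0.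
    rewrite mulrAC ler_pM2r ?invr_gt0 ?exprn_gt0// -mulrA ler_pM2l//.
    by apply: le_trans (ler_wpM2l q0 hD) _; rewrite ler_piMl.
  have -> : t * ((2 * C + 4 * D) / t ^+ 3) = (2 * C + 4 * D) / t ^+ 2 by field.
  apply: ler_wpM2l => //.
  rewrite lef_pV2 ?posrE ?exprn_gt0// ler_sqr ?nnegrE ?(ltW s2) ?(ltW t0)//; exact: ltW.
apply: (@wI_derive _ _ _ hw (fun t x => \sum_i G i x * partial i _ x)
 (fun t x => \sum_i G i x * partial i _ x) (fun x : E => K * \sum_i `|G i x|) s _ s2 wg).
- move=> t ts; have t0 : 0 < t by exact: lt_trans (rt t ts).
  have tb : test_function (ball z r) (bump p t).
    apply: (tf_bump t0) => x; apply: near_ball => //; rewrite (ltW t0); have := rt' t ts; lra.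
  by apply: (wint_dot hu (lmin_l2 hu)) => i; exact: (l2_partial hu i tb).
- move=> t x ts; have t0 : 0 < t by exact: lt_trans (rt t ts).
  have := is_derive_sum (fun i => is_derive_mulr (G i x) (is_derive_partial_bump p i x t0)).
  rewrite (_ : \sum_i _ = \sum_i G i x * partial i (dbump p t) x); last by apply: eq_bigr => i _; exact: mulrC.
  by apply: is_derive_ext => v; rewrite fct_sumE; apply: eq_bigr => i _; exact: mulrC.
- move=> t x ts; apply: le_trans (ler_norm_sum _ _ _) _; rewrite mulr_sumr; apply: ler_sum => i _.
  by rewrite normrM mulrC ler_wpM2r// Kb.
Qed.

Definition xbump p s (j : 'I_m) x : R := (x ord0 (lshift 1 j) - p ord0 (lshift 1 j)) * bump p s x.

Lemma tf_xbump p s j (B : set E) : 0 < s -> (forall x, sqd p x <= s ^+ 2 -> B x) -> test_function B (xbump p s j).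
Proof.
move=> s0 h; apply: tfM; first exact: tf_bump.
by apply: smoothB; [exact: smooth_coord|exact: smooth_cst].
Qed.

Lemma partial_xbump p s j i x : partial i (xbump p s j) x =
  (i == lshift 1 j)%:R * bump p s x + (x ord0 (lshift 1 j) - p ord0 (lshift 1 j)) * partial i (bump p s) x.
Proof.
have sb : smooth (bump p s) by apply: smooth_radial; exact: smooth1_fe.
rewrite partialM; last by [].
  rewrite partialB//.
  by rewrite partial_coord partial_cst subr0 addrC.
by apply: smooth_differentiable; apply: smoothB; [exact: smooth_coord|exact: smooth_cst].
Qed.

(** Euler's relation: the bump is a function of (x - p) / s, so s d/ds acts on it as - (x - p) .
    grad. The tangential terms combine with m times the bump into a divergence; the normal term
    carries the factor x_n, so its trace vanishes and [ell] does not see it. *)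
Lemma dilation_identity p s x : 0 < s -> xn p = 0 ->
  m%:R * bump p s x - s * dbump p s x =
  \sum_(j < m) partial (lshift 1 j) (xbump p s j) x + xn x * partial nn (bump p s) x.
Proof.
move=> s0 p0; under eq_bigr do rewrite partial_xbump eqxx mul1r partial_bump.
rewrite big_split /= sumr_const card_ord -[bump p s x *+ m]mulr_natl -addrA; congr (_ _).
rewrite partial_bump -/(xn x) -/(xn p) p0 subr0 /dbump /sqd big_split_ord /= big_ord1.
rewrite -/(xn x) -/(xn p) p0 subr0.
have -> : s * ((\sum_(i < m) (x ord0 (lshift 1 i) - p ord0 (lshift 1 i)) ^+ 2 + xn x ^+ 2) / s ^+ 3 * psi p s x) =
 \sum_(i < m) ((x ord0 (lshift 1 i) - p ord0 (lshift 1 i)) ^+ 2) * (psi p s x / s ^+ 2) +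
 xn x ^+ 2 / s ^+ 2 * psi p s x.
  by rewrite -mulr_suml; field; rewrite gt_eqF.
rewrite opprD; congr (_ + _); last lra.
by rewrite -sumrN; apply: eq_bigr => j _; ring.
Qed.

Lemma ell_dilation p s : 0 < s -> `|p - z| <= 2 * rho -> s <= rho -> xn p = 0 ->
  m%:R * L (bump p s) - s * L (dbump p s) = \sum_(j < m) L (partial (lshift 1 j) (xbump p s j)).
Proof.
move=> s0 pz sr p0.
have hB x : sqd p x <= s ^+ 2 -> ball z r x by apply: near_ball => //; rewrite (ltW s0); have := rho0; lra.
have tb := tf_bump s0 hB; have td := tf_dbump s0 hB.
have tx j : test_function (ball z r) (partial (lshift 1 j) (xbump p s j)) by apply: tf_partial; exact: tf_xbump.
have tn : test_function (ball z r) (fun x => xn x * partial nn (bump p s) x) by apply: tfM; [exact: tf_partial|exact: smooth_xn].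
have ts : test_function (ball z r) (fun x => \sum_(j < m) partial (lshift 1 j) (xbump p s j) x).
  elim: (index_enum _) => [|j' l IH]; last by under eq_fun do rewrite big_cons; exact: tfD.
  under eq_fun do rewrite big_nil; have := tfZ 0 tb.
  by under eq_fun do rewrite mul0r.
have E0 : L (fun x => xn x * partial nn (bump p s) x) = 0 by apply: (ell_trace0 hu tn) => y; rewrite xn_emb mul0r.
rewrite -mulNr -(ellZ hu m%:R tb) -(ellZ hu (- s) td).
rewrite -(ellD hu (tfZ m%:R tb) (tfZ (- s) td)) -(ell_sum hu _ tx).
rewrite [RHS](_ : _ = L (fun x => \sum_(j < m) partial (lshift 1 j) (xbump p s j) x) + L (fun x => xn x * partial nn (bump p s) x)); last by rewrite E0 addr0.
rewrite -(ellD hu ts tn); congr (ell a G); apply/funext => x.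
by rewrite -dilation_identity// mulNr.
Qed.

Lemma xbump_energy : exists2 C, 0 < C & forall p s j, xn p = 0 -> 0 < s ->
  \I_a[x] \sum_i partial i (xbump p s j) x ^+ 2 <= C * s `^ N.
Proof.
have [C C0 HC] := @partial_bump_le R m; have [M M0 HM] := @mass_ub R m a a0.
exists (dim * (1 + C) ^+ 2 * M) => //.
move=> p s j p0 s0; have tx : test_function setT (xbump p s j) by exact: tf_xbump.
apply: (HM) => //; first lra.
- by apply: wint_sum => i; exact: (l2_bmfun hw (tf_bmfun (tf_partial i tx))).2.
- move=> x hx xs; apply: (@le_trans _ _ (\sum_(i < m + 1) (1 + C) ^+ 2)); last first.
    by rewrite sumr_const card_ord mulr_natl.
  apply: ler_sum => i _; rewrite -sqr_normr ler_sqr ?nnegrE//.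
  rewrite partial_xbump; apply: le_trans (ler_normD _ _) _; apply: lerD.
    rewrite normrM normr_nat (ger0_norm (bump_ge0 _ _ _)); case: (_ == _) => /=.
      by rewrite mul1r bump_le1.
    by rewrite mul0r.
  rewrite normrM (_ : C = s * (C / s)); last by field; rewrite gt_eqF.
  by apply: ler_pM => //; [exact: sqd_coord_norm (ltW s0) xs|exact: HC].
- move=> x xs; rewrite big1// => i _; rewrite partial_xbump partial_bump.
  by rewrite (bump_out s0 (ltW xs)) (psi_out s0 (ltW xs)) !mulr0 addr0 expr0n.
Qed.

Lemma ell_xbump_bound : exists2 C, 0 < C & forall p s j, xn p = 0 -> `|p - z| <= 2 * rho -> 0 < s <= rho / 2 ->
  `|L (partial (lshift 1 j) (xbump p s j))| <= C * (s `^ N / s).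
Proof.
have [C C0 HC] := xbump_energy; have [A A0 HA] := energy_bound hu.
exists ((expR 2 * (A * (2 `^ N / 4)) + C) / 2).
  by rewrite divr_gt0// ltr_wpDl// mulr_ge0 ?expR_ge0 ?powR_ge0.
move=> p s j p0 pz /andP[s0 s1]; have s2 : 0 < 2 * s by [].
have hB x : sqd p x <= s ^+ 2 -> ball z r x by apply: near_ball => //; rewrite (ltW s0); have := rho0; lra.
have tx : test_function (ball z r) (xbump p s j) by exact: tf_xbump.
pose hs (q : nat) := rho / q.+1%:R.
have hs0 q : 0 < hs q by rewrite divr_gt0.
have hsc : hs @ \oo --> (0 : R).
  rewrite -(mulr0 rho); apply: cvgM; [exact: cvg_cst|exact: cvg_harmonic].
have nd (q : nat) : `|hs q *: 'e_j : 'rV[R]_m| <= hs q.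
  exact/norm_scale_delta/ltW.
have hsr q : hs q <= rho by rewrite /hs ler_pdivrMr// ler_peMr ?(ltW rho0)// ler1n.
have B0 : 0 <= (2 * s) `^ N / (2 * s) ^+ 2 by [].
have out x : (2 * s) ^+ 2 / 2 < sqd p x -> xbump p s j x = 0.
  move=> h; rewrite /xbump bump_out ?mulr0//; apply: ltW; apply: le_lt_trans h.
  by rewrite exprMn; have := sqr_ge0 s; lra.
have HB q : \I_a[x] bump p (2 * s) x * DG2 G (hs q *: 'e_j) x <=
 A * ((2 * s) `^ N / (2 * s) ^+ 2) * hs q ^+ 2.
  apply: le_trans (HA p _ (2 * s) p0 pz (le_trans (nd q) (hsr q)) _) _.
    by rewrite s2; have : 2 * s <= rho by lra.
  rewrite mulrAC; apply: ler_wpM2l => //.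
  by rewrite ler_sqr ?nnegrE ?(ltW (hs0 q)).
(* The weight l = s balances the two terms: s times the energy of order s^(N-2), and 1/s times the
   squared gradient of [xbump], of order s^N. *)
have := ell_partial_bound hu s2 s0 hs0 hsc HB tx out.
move=> h; apply: le_trans h _.
rewrite [leRHS]mulrAC ler_pM2r ?invr_gt0// [leRHS]mulrDl; apply: lerD.
  rewrite powRM ?(ltW s0)//; apply: eqW; field; rewrite gt_eqF//.
by rewrite mulrA mulrC ler_pM2r ?invr_gt0// HC.
Qed.

(** The power s^(-m) compensates the m-dimensional mass of the trace of the bump, so that a constant
    flux would give a constant function of s. *)
Definition Fs p s : R := s `^ (- m%:R) * L (bump p s).

Lemma Fs_derive : exists2 C, 0 <= C & forall p s, xn p = 0 -> `|p - z| <= 2 * rho -> 0 < s <= rho / 2 ->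
  exists2 d, is_derive s 1 (Fs p) d & `|d| <= C * s `^ (a - 1).
Proof.
have [C C0 HC] := ell_xbump_bound; exists (m%:R * C) => //.
move=> p s p0 pz /andP[s0 s1]; have sr : s <= rho by have := rho0; lra.
exists (- m%:R * s `^ (- m%:R - 1) * L (bump p s) + s `^ (- m%:R) * L (dbump p s)).
  exact: (is_derive_mul (is_derive1_powR (- m%:R) s0) (ell_bump_derive s0 pz sr) (erefl _)).
have P : s `^ (- m%:R) = s `^ (- m%:R - 1) * s by rewrite powRD ?powR_inv1 ?(ltW s0)// ?(gt_eqF s0) ?implybT// divfK// gt_eqF.
have key (q X Y : R) : - m%:R * q * X + q * s * Y = - q * (m%:R * X - s * Y) by ring.
rewrite P key ell_dilation// normrM normrN (ger0_norm (powR_ge0 _ _)).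
apply: (@le_trans _ _ (s `^ (- m%:R - 1) * \sum_(j < m) (C * (s `^ N / s)))).
  apply: ler_wpM2l => //.
  by apply: le_trans (ler_norm_sum _ _ _) _; apply: ler_sum => j _; apply: HC => //; rewrite s0.
rewrite sumr_const card_ord -[(C * _) *+ m]mulr_natl.
have -> : s `^ N / s = s `^ (N - 1) by rewrite powRD ?powR_inv1 ?_// (gt_eqF s0) implybT.
have -> : a - 1 = - m%:R - 1 + (N - 1) by rewrite /Nw; ring.
rewrite [s `^ (_ (N - 1))]powRD ?(gt_eqF s0) ?implybT//.
by apply: eqW; ring.
Qed.

(** Integrating C s^(a-1) costs at most (C / a) s^a uniformly in the lower radius t; this is where a
    > 0 enters. *)
Lemma Fs_growth : 0 < a -> exists2 C, 0 <= C & forall p s t, xn p = 0 -> `|p - z| <= 2 * rho ->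
  0 < t -> t <= s -> s <= rho / 2 -> Fs p s <= Fs p t + C * s `^ a.
Proof.
move=> a1; have [C C0 HC] := Fs_derive; exists (C / a); first by rewrite divr_ge0.
move=> p s t p0 pz t0 ts sr.
have /choice[d Hd] : forall v, exists d, 0 < v <= rho / 2 -> is_derive v 1 (Fs p) d /\ `|d| <= C * v `^ (a - 1).
  move=> v; have [v0|] := boolP (0 < v <= rho / 2); last by exists 0.
  by have [d h1 h2] := HC p v p0 pz v0; exists d.
have an : a != 0 by [].
have := @nondecreasing_derive R (fun v => C / a * v `^ a - Fs p v) (fun v => C / a * (a * v `^ (a - 1)) - d v) t s ts.
have : 0 <= C / a * t `^ a by rewrite mulr_ge0 ?powR_ge0// divr_ge0// ltW.
move=> h0 H; apply: (growth_arith h0); apply: H.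
- move=> v /andP[tv vs]; have v0 : 0 < v by exact: lt_le_trans tv.
  have [|D _] := Hd v; first lra.
  have D1 := is_derive_mulr (C / a) (is_derive1_powR a v0).
  have E1 : a * v `^ (a - 1) * (C / a) = C / a * (a * v `^ (a - 1)) by ring.
  rewrite E1 in D1; have D2 := is_deriveB D1 D; apply: is_derive_ext D2 => w.
  by rewrite fctE mulrC.
- move=> v /andP[tv vs]; have v0 : 0 < v by exact: lt_le_trans tv.
  have [|_ h] := Hd v; first lra.
  have := ler_norm (d v); rewrite mulrA divfK//; lra.
Qed.

(* At the center of the positivity set the small-scale value of [Fs] is the exact jump [- lp]. *)
Lemma Fs_pos_limit : 0 < a -> (forall e, 0 < e -> exists2 k, `|k| <= e & 0 < u (z + emb k)) ->
  exists c C, [/\ 0 < c, 0 <= C & forall s, 0 < s <= rho / 4 -> Fs z s <= - lp * c + C * s `^ a].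
Proof.
move=> a1 Hpos; have [c c0 Hc] := flatI_bump_lb; have [C C0 HC] := Fs_growth a1.
have [A A0 HA] := energy_bound hu.
exists c, C; split => // s /andP[s0 s1].
have s2 : 0 < 2 * s by rewrite mulr_gt0.
have z0 : xn z = 0 by exact: lmin_z hu.
have hB x : sqd z x <= s ^+ 2 -> ball z r x by apply: near_ball; rewrite ?subrr ?normr0 ?(ltW s0)/=; have := rho0; lra.
have tb := tf_bump s0 hB.
pose K := \I_a[x] \sum_i partial i (bump z s) x ^+ 2.
pose M := (expR 2 * (A * ((2 * s) `^ N / (2 * s) ^+ 2)) + K) / 2.
have K0 : 0 <= K by apply: (wI_ge0 hw) => x; apply: sumr_ge0 => i _; exact: sqr_ge0.
have M0 : 0 <= M by rewrite divr_ge0// addr_ge0// mulr_ge0 ?expR_ge0// mulr_ge0// divr_ge0 ?powR_ge0 ?sqr_ge0.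
have smN : 0 <= s `^ (- m%:R) by exact: powR_ge0.
apply/ler_addgt0Pr => e e0.
(* How close to [z] a point p = z + k with u(p) > 0 must be taken for the bump at [p] to replace the
   bump at [z] at cost at most [e]. *)
pose e1 := Num.min rho (e / (s `^ (- m%:R) * M + 1)).
have den : 0 < s `^ (- m%:R) * M + 1 by rewrite ltr_wpDl// mulr_ge0.
have e10 : 0 < e1 by rewrite lt_min rho0 divr_gt0.
have [k ke kpos] := Hpos e1 e10; pose p := z + emb k.
have kr : `|k| <= rho by apply: le_trans ke _; rewrite ge_min lexx.
have ke' : `|k| * (s `^ (- m%:R) * M + 1) <= e by rewrite -ler_pdivlMr//; apply: le_trans ke _; rewrite ge_min lexx orbT.
have p0 : xn p = 0 by rewrite /p xnD xn_emb z0 addr0.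
have pz : `|p - z| <= 2 * rho.
  rewrite /p addrAC subrr add0r; have := norm_emb (k : 'rV[R]_m); have := rho0; lra.
have mv : `|L (bump p s) - L (bump z s)| <= `|k| * M.
  have [k0|kn] := eqVneq k 0.
    have pE : p = z by rewrite /p k0 emb0 addr0.
    by rewrite pE subrr normr0 k0 normr0 mul0r.
  have k0 : 0 < `|k| by rewrite normr_gt0.
  have out x : (2 * s) ^+ 2 / 2 < sqd z x -> bump z s x = 0.
    move=> h; rewrite bump_out//; apply: ltW; apply: le_lt_trans h.
    by rewrite exprMn; have := sqr_ge0 s; lra.
  (* With the weight l = 1/|k| both terms of [ell_shift] are linear in |k|, since the energy of the
     increments is quadratic in it. *)
  have ki : 0 < `|k|^-1 by rewrite invr_gt0.
  have := ell_shift hu k tb s2 out ki.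
  rewrite (_ : (fun x => bump z s (x - emb k)) = bump p s); last first.
    apply/funext => x; rewrite /bump /radial; congr (fe (1 - _ / _)).
    by apply: eq_bigr => i _; rewrite /p !mxE; congr (_ ^+ 2); ring.
  move=> h; apply: le_trans h _; rewrite invrK /M [leRHS]mulrA ler_pM2r ?invr_gt0// [leRHS]mulrDr lerD2r.
  rewrite ler_pdivrMl// mulrCA mulrA -expr2 mulrCA ler_pM2l ?expR_gt0//.
  have zz : `|z - z| <= 2 * rho by rewrite subrr normr0; have := rho0; lra.
  have ss : 0 < 2 * s <= rho by rewrite s2; have := rho0; lra.
  have HA2 := HA z k (2 * s) z0 zz kr ss; apply: le_trans HA2 _.
  by apply: eqW; ring.
have hp0 : ball z r p.
  apply: (@near_ball p 0) => //; first by have := rho0; lra.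
  by rewrite sqdxx sqr_ge0.
have cu : {for p, continuous u} := lmin_cont hu hp0.
have /nbhs_ballP[d /= d0 Hd] : \forall x \near p, 0 < u x by exact: (cvgr_gt _ cu).
(* Within this radius of [p] the function is positive, so [ell_pos] gives the flux at scale t
   exactly; [Fs_growth] carries the value up to scale s. *)
pose t := Num.min s (d / 2); have t0 : 0 < t by rewrite lt_min s0 divr_gt0.
have ts : t <= s by rewrite ge_min lexx.
have td : t < d.
  have : t <= d / 2 by rewrite ge_min lexx orbT.
  lra.
have tp : test_function [set x | ball z r x /\ (xn x = 0 -> 0 < u x)] (bump p t).
  apply: tf_bump => // x xt; split.
    by apply: (near_ball pz _ xt); rewrite (ltW t0); have := rho0; lra.
  move=> _; apply: Hd; rewrite ballEC; apply: le_lt_trans td.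
  by apply: sqd_norm => //; exact: ltW.
have Ft : Fs p t <= - lp * c.
  rewrite /Fs (ell_pos hu tp) mulNr mulrN mulNr lerN2 mulrCA ler_pM2l ?(lmin_p hu)//.
  by rewrite powRN powR_mulrn ?(ltW t0)// mulrC ler_pdivlMr ?exprn_gt0// Hc.
have Fp := HC p s t p0 pz t0 ts _.
have {}Fp : Fs p s <= Fs p t + C * s `^ a by apply: Fp; have := rho0; lra.
have h1 : Fs z s <= Fs p s + s `^ (- m%:R) * (`|k| * M) by rewrite /Fs -mulrDr; apply: ler_wpM2l => //; exact: close_le.
have h2 : s `^ (- m%:R) * (`|k| * M) <= e by apply: le_trans ke'; rewrite mulrCA mulrDr mulr1 lerDl.
exact: chain_arith h1 Fp Ft h2.
Qed.

End scaling.

Arguments Fs {R m} a G p s.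

(** The one-sided bounds for [u] and for [- u] concern opposite fluxes. Their sum reads 0 <= - (lp
    c1 + lm c2) + (C1 + C2) s^a, which fails for small s. *)
Lemma no_touch_weighted (R : realType) (m : nat) (a lp lm r : R) (z : 'rV[R]_(m + 1)) u G :
  local_min a lp lm z r u G -> 0 < a ->
  (forall e, 0 < e -> exists2 k : 'rV[R]_m, `|k| <= e & 0 < u (z + emb k)) ->
  (forall e, 0 < e -> exists2 k : 'rV[R]_m, `|k| <= e & u (z + emb k) < 0) -> False.
Proof.
move=> hu a0 Hp Hn; have huN := local_minN hu.
have [c1 [C1 [c10 C10 H1]]] := Fs_pos_limit hu a0 Hp.
have [|c2 [C2 [c20 C20 H2]]] := Fs_pos_limit huN a0.
  by move=> e /Hn[k ke kn]; exists k => //; rewrite oppr_gt0.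
have lp0 := lmin_p hu; have lm0 := lmin_m hu; have r0 := lmin_r hu.
have J : 0 < lp * c1 + lm * c2 by [].
pose b := (lp * c1 + lm * c2) / (C1 + C2 + 1).
have den : 0 < C1 + C2 + 1 by [].
have b0 : 0 < b by rewrite divr_gt0.
pose s := Num.min (r / 8 / 4) (b `^ a^-1).
have s0 : 0 < s by rewrite lt_min divr_gt0//= powR_gt0.
have s1 : 0 < s <= r / 8 / 4 by rewrite s0 ge_min lexx.
have sa : s `^ a <= b.
  have sb : s <= b `^ a^-1 by rewrite ge_min lexx orbT.
  have := ge0_ler_powR (ltW a0) _ _ sb; rewrite !nnegrE powR_ge0 (ltW s0) => /(_ isT isT).
  by rewrite -powRrM mulVf ?gt_eqF// powRr1// ltW.
have := H1 s s1; have := H2 s s1.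
have -> : Fs a (fun i x => - G i x) z s = - Fs a G z s.
  rewrite /Fs ellN ?mulrN//.
  have hB x : sqd z x <= s ^+ 2 -> ball z r x.
    apply: (near_ball hu); first by rewrite subrr normr0; lra.
    by case/andP: s1; lra.
  by apply: (wint_dot hu (lmin_l2 hu)) => i; exact: (l2_partial hu i (tf_bump s0 hB)).
have h : (C1 + C2) * s `^ a <= (C1 + C2) * b by rewrite ler_wpM2l// addr_ge0.
have : (C1 + C2 + 1) * b = lp * c1 + lm * c2 by rewrite mulrC divfK// gt_eqF.
lra.
Qed.

(** Selects one scale that serves infinitely many difference steps, when each step comes with a
    scale of its own out of finitely many. *)
Lemma infinite_pigeonhole (f : nat -> nat) K : (forall q, (f q < K)%N) ->
  exists2 i, (i < K)%N & forall n, exists q, (n <= q)%N /\ f q = i.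
Proof.
move=> fK; apply: contrapT => H.
have /choice[n Hn] : forall i, exists n, (i < K)%N -> forall q, (n <= q)%N -> f q <> i.
  move=> i; apply: contrapT => Hi; apply: H; exists i.
    by apply: contrapT => iK; apply: Hi; exists 0%N.
  move=> n; apply: contrapT => Hq; apply: Hi; exists n => _ q nq fq.
  by apply: Hq; exists q.
pose M := (\sum_(i < K) n i)%N.
apply: (Hn _ _ M) => //.
by rewrite {2}/M (bigD1 (Ordinal (fK M)))//= leq_addr.
Qed.

(** The drops telescope to at most tau(0), so they cannot all be as large as d. *)
Lemma descent_pigeonhole (R : realFieldType) (tau : nat -> R) K d : 0 <= tau K -> tau 0%N < K%:R * d ->
  exists2 i, (i < K)%N & tau i - tau i.+1 < d.
Proof.
move=> tK t0; apply: contrapT => H.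
have Hi i : (i < K)%N -> d <= tau i - tau i.+1 by move=> iK; rewrite leNgt; apply/negP => h; apply: H; exists i.
have : K%:R * d <= tau 0%N - tau K.
  elim: K Hi {tK t0 H} => [|K IH] Hi; first by rewrite mul0r subrr.
  have := Hi K (ltnSn K); have := IH (fun i h => Hi i (ltnW h)).
  by rewrite -natr1 mulrDl mul1r; lra.
lra.
Qed.

Lemma growth_slope (R : realType) (F dF : R -> R) s t c : s <= t ->
  (forall v : R, s <= v <= t -> is_derive v 1 F (dF v)) -> (forall v, s <= v <= t -> c <= dF v) ->
  (t - s) * c <= F t - F s.
Proof.
move=> st D Dc; suff : F s - s * c <= F t - t * c by rewrite mulrBl; lra.
apply: (nondecreasing_derive (F := fun v => F v - v * c) (dF := fun v => dF v - 1 * c) st) => v hv.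
  by apply: is_deriveB; [exact: D|exact: is_derive_mulr (is_derive_id _ _)].
by rewrite mul1r subr_ge0 Dc.
Qed.

Lemma dilate_arith (R : realFieldType) (q t : R) : q <= t ^+ 2 -> 2 * q + 2 * (2 * t) ^+ 2 <= (5 * t) ^+ 2 / 2.
Proof. by have := sqr_ge0 t; lra. Qed.

Lemma scale_arith (R : realFieldType) (J P X d : R) : 0 < P -> 0 < X -> P^-1 * J * X <= d -> J <= d * (P / X).
Proof.
move=> P0 X0 h; have -> : J = P^-1 * J * X * (P / X) by field; rewrite !gt_eqF.
by rewrite ler_pM2r// divr_gt0.
Qed.

(** * The case a = 0: Lipschitz bound off the flat part and existence of good scales *)

Section unweighted.
Context {R : realType} {m : nat}.
Local Notation E := 'rV[R]_(m + 1).
Implicit Types (f g : E -> R) (p x : E) (s t : R) (i : 'I_(m + 1)) (k : 'rV[R]_m).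

Lemma bump_mono p s t x : 0 < s <= t -> bump p s x <= bump p t x.
Proof.
move=> /andP[s0 st]; apply: fe_homo; rewrite lerD2l lerN2 ler_wpM2l ?sqd_ge0//.
have t0 : 0 < t by exact: lt_le_trans st.
by rewrite lef_pV2 ?posrE ?exprn_gt0// ler_sqr ?nnegrE ?(ltW s0) ?(ltW t0).
Qed.

Lemma powR_Nw0 s : 0 < s -> s `^ (Nw m 0) = s ^+ (m + 1).
Proof. by move=> s0; rewrite powR_Nw// powRr0 mulr1. Qed.

Context `(hu : @local_min R m 0 lp lm z r u G).
Let hw := @weight_wt R m 0 (lexx 0).
Let lG := lmin_l2 hu.
Let rho := r / 8.
Let rho0 : 0 < rho := lmin_rho hu.
Local Notation N := (Nw m (0 : R)).

Definition flatten p : E := p - xn p *: 'e_nn.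

Lemma xn_delta : xn ('e_nn : E) = 1.
Proof. by rewrite /xn mxE !eqxx. Qed.

Lemma xn_flatten p : xn (flatten p) = 0.
Proof. by rewrite /flatten xnD xnN xnZ xn_delta mulr1 subrr. Qed.

Lemma flatten_coord p i : flatten p ord0 i = if i == nn then 0 else p ord0 i.
Proof.
rewrite !mxE /=; case: eqP => [->|_]; first by rewrite mulr1 subrr.
by rewrite mulr0 subr0.
Qed.

Lemma flatten_near p s : `|p - z| <= s -> `|flatten p - z| <= s.
Proof.
move=> ps; have s0 : 0 <= s by exact: le_trans ps.
apply: rV_norm_le => // i.
have -> : (flatten p - z) ord0 i = flatten p ord0 i - z ord0 i by rewrite !mxE.
rewrite flatten_coord; case: eqP => [->|_].
  by have := lmin_z hu; rewrite /xn => ->; rewrite subrr normr0.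
by apply: le_trans ps; have := rV_norm_coord (p - z) i; rewrite !mxE.
Qed.

Lemma sqd_flatten p x : sqd (flatten p) x <= 2 * sqd p x + 2 * xn p ^+ 2.
Proof.
rewrite /sqd mulr_sumr; apply: (@le_trans _ _ (\sum_i (2 * (x ord0 i - p ord0 i) ^+ 2 + (if i == nn then 2 * xn p ^+ 2 else 0)))).
  apply: ler_sum => i _; rewrite flatten_coord; case: eqP => [->|_].
    rewrite /xn; have := sqr_ge0 (x ord0 nn - 2 * p ord0 nn); nra.
  by rewrite addr0; have := sqr_ge0 (x ord0 i - p ord0 i); lra.
by rewrite big_split /= -big_mkcond big_pred1_eq.
Qed.

(** For a = 0 balls inside the half space are good centers too. The mean around [p] is monotone up
    to the radius t = x_n(p) / 2, where it is dominated by the mean of radius 5 t around the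
    projection of [p]: points within t of [p] have squared distance at most 10 t^2 < (5 t)^2 / 2 to
    that projection. *)
Lemma tangential_lipschitz : exists2 M, 0 <= M & forall p k, 0 <= xn p <= rho / 2 -> `|p - z| <= rho ->
  `|k| <= rho -> `|u (p + emb k) - u p| <= M * `|k|.
Proof.
have [M1 M10 H1] := flat_lipschitz hu; have [A A0 HA] := Sf_bound hu.
have [c c0 Hc] := @val_le_Sf R m 0 (lexx 0); have [C C0 HC] := @psi_ub R m.
pose A2 := C * expR 2 * 5 `^ N * A.
exists (M1 + Num.sqrt (A2 / c)) => [|p k /andP[p0 p1] pz kr]; first by rewrite addr_ge0 ?sqrtr_ge0.
have pz2 : `|p - z| <= 2 * rho by have := rho0; lra.
have [pe|pn] := eqVneq (xn p) 0.
  by apply: le_trans (H1 p k pe pz2 kr) _; rewrite ler_wpM2r// lerDl sqrtr_ge0.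
have pp : 0 < xn p by rewrite lt_def pn.
have A20 : 0 <= A2 by rewrite !mulr_ge0 ?_.
apply: (@le_trans _ _ (Num.sqrt (A2 / c) * `|k|)); last by rewrite ler_wpM2r// lerDr.
rewrite -ler_sqr ?nnegrE ?sqrtr_ge0// sqr_normr exprMn sqr_sqrtr ?_//.
rewrite mulrAC ler_pdivlMr// mulrC.
have bD : bmfun (fun x => Du u k x ^+ 2).
  have [mD [D [q [q0 hD hq]]]] := bmfun_Du hu k.
  have bD := bmfun_Du hu k.
  by have := bmfunM mD hD bD; congr bmfun; apply/funext => x; rewrite expr2.
pose t := xn p / 2; have t0 : 0 < t by rewrite divr_gt0.
apply: (Hc (fun x => Du u k x ^+ 2) p t) => //.
- exact: (Du_sqr_continuous hu).
move=> s /andP[s0 st].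
have gc v : v <= t -> good_center 0 p v by move=> vt; right; split => //; move: vt; rewrite /t; lra.
have st' : 0 < s <= t by rewrite s0 ltW.
have t2 : t <= 2 * rho by rewrite /t; have := rho0; lra.
apply: le_trans (Sf_mono hu st' gc pz2 t2 kr) _.
have t5 : 0 < 5 * t by [].
have fz : `|flatten p - z| <= 2 * rho by exact: flatten_near.
have h5 : 0 < 5 * t <= 2 * rho by rewrite /t; lra.
have HS := HA _ k _ (xn_flatten p) fz kr h5.
have main : \I_0[x] Du u k x ^+ 2 * psi p t x <=
    C * expR 2 * \I_0[x] Du u k x ^+ 2 * psi (flatten p) (5 * t) x.
  have w5 := wint_psi (lexx 0) (flatten p) bD t5.
  rewrite -wIZ//; apply: (wI_le hw (wint_psi (lexx 0) p bD t0)) => [|x]; first exact: wintZ.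
  rewrite [leRHS]mulrCA; apply: ler_wpM2l; first exact: sqr_ge0.
  have c20 : 0 <= C * expR 2 by rewrite mulr_ge0 ?expR_ge0// ltW.
  have [xs|xs] := leP (t ^+ 2) (sqd p x); first by rewrite psi_out// mulr_ge0// psi_ge0.
  apply: le_trans (HC p t x) _; rewrite -mulrA ler_peMr ?(ltW C0)//.
  have : expR (- 2) <= psi (flatten p) (5 * t) x.
    apply: psi_lb => //; apply: le_trans (sqd_flatten p x) _.
    have -> : xn p = 2 * t by rewrite /t; lra.
    exact: dilate_arith (ltW xs).
  by rewrite expRN => h; rewrite -ler_pdivrMl ?expR_gt0// mulr1.
have -> : A2 * `|k| ^+ 2 = C * expR 2 * 5 `^ N * (A * `|k| ^+ 2) by rewrite /A2; ring.
apply: le_trans (ler_wpM2l _ HS); last by rewrite !mulr_ge0 ?expR_ge0 ?powR_ge0 ?(ltW C0).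
rewrite /Sf !powRN powRM ?(ltW t0)// invfM.
have P5 : 5 `^ N != 0 :> R by [].
have key (q Y : R) : C * expR 2 * 5 `^ N * ((5 `^ N)^-1 * q * Y) = q * (C * expR 2 * Y) by field.
by rewrite key; apply: ler_wpM2l => //; rewrite invr_ge0 powR_ge0.
Qed.

Lemma wI_bump_DG2_ge0 p s k : 0 <= \I_0[x] bump p s x * DG2 G k x.
Proof. by apply: (wI_ge0 hw) => x; rewrite mulr_ge0 ?bump_ge0 ?DG2_ge0. Qed.

(** The derivative of the mean at radius v is at least v^(-m) times twice the energy at v, and the
    energy increases with v. Integration over [s, 2 s] bounds the energy at scale s by the increment
    of the mean over one dyadic step. *)
Lemma energy_increment k s : `|k| <= rho -> 0 < s <= rho ->
  (2 * s) ^- m * (\I_0[x] bump z s x * DG2 G k x) * (2 * s) <=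
  Sf 0 (fun x => Du u k x ^+ 2) z (2 * s) - Sf 0 (fun x => Du u k x ^+ 2) z s.
Proof.
move=> kr /andP[s0 s1].
have bD : bmfun (fun x => Du u k x ^+ 2).
  have [mD [D [q [q0 hD hq]]]] := bmfun_Du hu k.
  by have := bmfunM mD hD (bmfun_Du hu k); congr bmfun; apply/funext => x; rewrite expr2.
set J := wI _ _; pose c := 2 * ((2 * s) ^- m * J).
have J0 : 0 <= J := wI_bump_DG2_ge0 z s k.
have ss : s <= 2 * s by lra.
have zz : `|z - z| <= 2 * rho by rewrite subrr normr0; have := rho0; lra.
have D v : s <= v <= 2 * s -> is_derive v 1 (Sf 0 (fun x => Du u k x ^+ 2) z)
    (v `^ (1 - N) * \I_0[x] Du u k x ^+ 2 * Lop 0 (bump z v) x).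
  move=> /andP[sv _]; apply: (Sf_derive (lexx 0) bD); first exact: lt_le_trans sv.
  by left; exact: lmin_z hu.
suff Dc v : s <= v <= 2 * s -> c <= v `^ (1 - N) * \I_0[x] Du u k x ^+ 2 * Lop 0 (bump z v) x.
  have := growth_slope ss D Dc; rewrite /c; move: (Sf _ _ _ _) (Sf _ _ _ _) => F1 F2 h1.
  apply: le_trans h1.
  by apply: eqW; ring.
move=> /andP[sv vs]; have v0 : 0 < v by exact: lt_le_trans sv.
rewrite /c.
have gc : good_center 0 z v by left; exact: lmin_z hu.
have cb := caccioppoli_bump hu v0 gc (fun x => @dom2_near R m 0 lp lm z r u G hu z v k x zz _ kr).
have h2 : 0 <= v <= 2 * (r / 8) by move: s1; rewrite /rho; lra.
have {}cb := cb h2.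
have Jv : J <= \I_0[x] bump z v x * DG2 G k x.
  apply: (wI_le hw (wint_bump_DG2 hu z s k) (wint_bump_DG2 hu z v k)) => x.
  by rewrite ler_wpM2r ?DG2_ge0// bump_mono// s0.
have -> : v `^ (1 - N) = v ^- m.
  have -> : 1 - N = - m%:R by rewrite /Nw; ring.
  by rewrite powRN powR_mulrn// ltW.
have j2 : 2 * J <= \I_0[x] Du u k x ^+ 2 * Lop 0 (bump z v) x by apply: le_trans cb; rewrite ler_pM2l.
have j0 : 0 <= 2 * J by apply: mulr_ge0; [exact: ler0n|exact: J0].
have s2 : 0 < 2 * s by [].
have j1 : (2 * s) ^- m <= v ^- m by rewrite lef_pV2 ?posrE ?exprn_gt0//; apply: lerXn2r => //; rewrite nnegrE ltW.
have j3 : 0 <= (2 * s) ^- m by [].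
rewrite [leLHS]mulrCA; exact: (ler_pM j3 j0 j1 j2).
Qed.

(* The bounded nondecreasing quantities [Sf] can make a definite step only at
   boundedly many dyadic scales, for each difference step [hs q]. *)
Lemma good_scale e s0 : 0 < e -> 0 < s0 -> exists s (hs : nat -> R), [/\ 0 < s <= s0, s <= rho,
  forall q, 0 < hs q, hs @ \oo --> (0 : R) & forall q j,
  \I_0[x] bump z s x * DG2 G (hs q *: 'e_j) x <= e * (s ^+ m / s) * hs q ^+ 2].
Proof.
move=> e0 s00; have [A A0 HA] := Sf_bound hu.
pose s1 := Num.min s0 rho; have s10 : 0 < s1 by rewrite lt_min s00 rho0.
have s1r : s1 <= rho by rewrite ge_min lexx orbT.
have s1s : s1 <= s0 by rewrite ge_min lexx.
(* The means for the m directions sum to at most m A h^2 at the top scale. Of more than B dyadic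
   steps one therefore has an increment below (m A + 1) h^2 / K, and B is chosen to make this small
   enough relative to e; the factor 2^m converts (2 S)^m into S^m. *)
pose B := (m%:R * A + 1) * 2 ^+ m / e.
have B0 : 0 <= B by rewrite mulr_ge0 ?exprn_ge0// addr_ge0 mulr_ge0.
pose K := Num.bound B; have BK : B < K%:R := archi_boundP B0.
have K0 : 0 < K%:R :> R by [].
pose S (i : nat) := s1 / 2 ^+ i.
have S0 (i : nat) : 0 < S i by rewrite divr_gt0// exprn_gt0.
have Sle (i : nat) : S i <= s1 by rewrite ler_pdivrMr ?exprn_gt0// ler_peMr ?_// exprn_ege1// ler1n.
have SS (i : nat) : 2 * S i.+1 = S i by rewrite /S exprS; field; rewrite gt_eqF// exprn_gt0.
pose h (q : nat) := rho / q.+1%:R.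
have h0 q : 0 < h q by rewrite divr_gt0.
have hr q : h q <= rho by rewrite /h ler_pdivrMr// ler_peMr ?(ltW rho0)// ler1n.
have nd q (j : 'I_m) : `|h q *: 'e_j : 'rV[R]_m| <= h q.
  exact/norm_scale_delta/ltW.
have zz : `|z - z| <= 2 * rho by rewrite subrr normr0; have := rho0; lra.
have z0 := lmin_z hu.
pose T q j s := Sf 0 (fun x => Du u (h q *: 'e_j) x ^+ 2) z s.
have T0 q j s : 0 <= T q j s by rewrite mulr_ge0 ?powR_ge0//; apply: (wI_ge0 hw) => x; rewrite mulr_ge0 ?sqr_ge0 ?psi_ge0.
have inc q j (i : nat) : (2 * S i) ^- m * (\I_0[x] bump z (S i) x * DG2 G (h q *: 'e_j) x) * (2 * S i) <=
    T q j (2 * S i) - T q j (S i).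
  have hS : 0 < S i <= rho by rewrite S0 (le_trans (Sle i)).
  exact: (energy_increment (le_trans (nd q j) (hr q)) hS).
have p2 (i : nat) : 0 < 2 * S i by [].
have inc0 q j (i : nat) : 0 <= T q j (2 * S i) - T q j (S i).
  apply: le_trans (inc q j i); apply: mulr_ge0; last exact: ltW (p2 i).
  apply: mulr_ge0; last exact: wI_bump_DG2_ge0.
  by rewrite invr_ge0 exprn_ge0// ltW.
have /choice[f Hf] : forall q, exists i : nat, (i < K)%N /\ forall j,
    \I_0[x] bump z (S i) x * DG2 G (h q *: 'e_j) x <= e * (S i ^+ m / S i) * h q ^+ 2.
  move=> q; pose tau (i : nat) := \sum_j T q j (2 * S i).
  have hq2 : 0 < h q ^+ 2 by [].
  pose d := (m%:R * A + 1) * h q ^+ 2 / K%:R.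
  have [||i iK Hi] := @descent_pigeonhole R tau K d.
  - by apply: sumr_ge0 => j _.
  - rewrite mulrC divfK ?gt_eqF//; apply: (@le_lt_trans _ _ (m%:R * A * h q ^+ 2)); last lra.
    apply: (@le_trans _ _ (\sum_(j < m) A * h q ^+ 2)); last by rewrite sumr_const card_ord -mulrA mulr_natl.
    apply: ler_sum => j _; have s2 : 0 < 2 * S 0%N <= 2 * rho.
      by rewrite mulr_gt0//= ler_pM2l// (le_trans (Sle _)).
    apply: le_trans (HA z _ _ z0 zz (le_trans (nd q j) (hr q)) s2) _.
    by rewrite ler_wpM2l// ler_sqr ?nnegrE// ltW.
  exists i; split => // j; set J := wI _ _.
  have Jd : (2 * S i) ^- m * J * (2 * S i) <= d.
    apply: ltW; apply: le_lt_trans Hi; apply: le_trans (inc q j i) _.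
    rewrite /tau SS -sumrB (bigD1 j)//= lerDl; apply: sumr_ge0 => l _.
    exact: inc0.
  have := scale_arith (exprn_gt0 m (p2 i)) (p2 i) Jd.
  move=> h1; apply: le_trans h1 _.
  have dK : d * 2 ^+ m <= e * h q ^+ 2.
    rewrite /d mulrAC ler_pdivrMr// mulrAC [leRHS]mulrAC ler_pM2r//.
    by rewrite [leRHS]mulrC -ler_pdivrMr// ltW.
  rewrite exprMn; have -> : d * (2 ^+ m * S i ^+ m / (2 * S i)) = (d * 2 ^+ m) * (S i ^+ m / S i) / 2.
    by field; rewrite gt_eqF.
  have -> : e * (S i ^+ m / S i) * h q ^+ 2 = (e * h q ^+ 2) * (S i ^+ m / S i) by ring.
  have X0 : 0 <= S i ^+ m / S i by rewrite ltW.
  have := ler_wpM2r X0 dK; have : 0 <= d * 2 ^+ m * (S i ^+ m / S i).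
    by rewrite mulr_ge0// mulr_ge0 ?exprn_ge0// divr_ge0// mulr_ge0 ?(ltW hq2)// addr_ge0// mulr_ge0.
  clear; lra.
(* So far the scale depends on the difference step; infinitely many of the steps share one of the K
   scales. *)
have [i iK /choice[g Hg]] := infinite_pigeonhole (fun q => (Hf q).1).
exists (S i), (h \o g); split.
- by rewrite S0 (le_trans (Sle i)).
- exact: le_trans (Sle i) s1r.
- by move=> /=.
- apply: (@squeeze_cvgr _ _ _ _ (fun=> 0) h); [|exact: cvg_cst|].
    apply: nearW => q; rewrite (ltW (h0 _))/= ler_pM2l// lef_pV2 ?posrE//.
    by rewrite ler_nat ltnS; have [] := Hg q.
  rewrite -(mulr0 rho); apply: cvgM; [exact: cvg_cst|exact: cvg_harmonic].
- move=> q j; have [_ fg] := Hg q; have := (Hf (g q)).2 j.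
  by rewrite fg.
Qed.

End unweighted.

Lemma homo_derive_ge0 (R : realType) (g : R -> R) (x d : R) : {homo g : s t / s <= t} ->
  is_derive x 1 g d -> 0 <= d.
Proof.
move=> hg [dg gE]; rewrite -gE; apply: limr_ge => //.
apply: nearW => h; rewrite [h *: 1]mulr1 /GRing.scale /=.
have [h0|h0] := leP 0 h; first by rewrite mulr_ge0 ?invr_ge0// subr_ge0 hg// lerDr.
by rewrite nmulr_rge0 ?invr_lt0// subr_le0 hg// gerDr ltW.
Qed.

(** * Bumps in the tangential variables and cutoffs in the normal one *)

Section tangential_cylinder.
Context {R : realType} {m : nat}.
Local Notation E := 'rV[R]_(m + 1).
Local Notation en := ('e_nn : E).
Implicit Types (x y : E) (s t h d sg : R).

Definition tsq x y : R := \sum_(j < m) (y ord0 (lshift 1 j) - x ord0 (lshift 1 j)) ^+ 2.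

Definition tbump x sg y : R := fe (1 - tsq x y / sg ^+ 2).

(** A cutoff in height: 1 for x_n <= h and 0 for x_n >= h + d / 2. *)
Definition slab h d y : R := plateau ((h - xn y) / d).

Lemma smooth_tsq x : smooth (tsq x).
Proof. by apply: smooth_sum => j; apply: smoothX; apply: smoothB; [exact: smooth_coord|exact: smooth_cst]. Qed.

Lemma smooth_tbump x sg : smooth (tbump x sg).
Proof.
apply: smooth_comp; first exact: smooth1_fe.
apply: smoothB => //.
by apply: smoothM; [exact: smooth_tsq|exact: smooth_cst].
Qed.

Lemma smooth_slab h d : smooth (slab h d).
Proof.
apply: smooth_comp; first exact: smooth1_plateau.
by apply: smoothM; [apply: smoothB; [exact: smooth_cst|exact: smooth_xn]|exact: smooth_cst].
Qed.

Lemma tbump_ge0 x sg y : 0 <= tbump x sg y. Proof. exact: fe_ge0. Qed.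
Lemma tbump_le1 x sg y : tbump x sg y <= 1. Proof. exact: fe_le1. Qed.

Lemma tbump_near x sg y j : 0 < sg -> tbump x sg y != 0 ->
  `|y ord0 (lshift 1 j) - x ord0 (lshift 1 j)| <= sg.
Proof.
move=> s0 b0; have : tsq x y <= sg ^+ 2.
  rewrite leNgt; apply: contraNN b0 => h; rewrite /tbump fe_le0//.
  by rewrite subr_le0 ler_pdivlMr ?exprn_gt0// mul1r ltW.
rewrite /tsq (bigD1 j)//= => h; rewrite -ler_sqr ?nnegrE ?_// sqr_normr.
by apply: le_trans h; rewrite lerDl; apply: sumr_ge0 => l _; exact: sqr_ge0.
Qed.

Lemma sqd_tsq x y : sqd x y = tsq x y + (xn y - xn x) ^+ 2.
Proof. by rewrite /sqd big_split_ord /= big_ord1. Qed.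

Lemma tbump_emb x sg (y : 'rV[R]_m) : xn x = 0 -> tbump x sg (emb y) = bump x sg (emb y).
Proof. by move=> x0; rewrite /bump /radial sqd_tsq xn_emb x0 subr0 expr0n addr0. Qed.

Lemma coord_addn y t j : (y + t *: en) ord0 (lshift 1 j) = y ord0 (lshift 1 j).
Proof. by rewrite !mxE eqxx /= eq_lrshift mulr0 addr0. Qed.

Lemma tbump_addn x sg y t : tbump x sg (y + t *: en) = tbump x sg y.
Proof. by rewrite /tbump /tsq; congr (fe (1 - _ / _)); apply: eq_bigr => j; rewrite coord_addn. Qed.

Lemma xn_addn y t : xn (y + t *: en) = xn y + t.
Proof. by rewrite xnD xnZ xn_delta mulr1. Qed.

Lemma slab_addn h d y t : slab h d (y + t *: en) = slab (h - t) d y.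
Proof. by rewrite /slab xn_addn opprD addrA addrAC. Qed.

Lemma partial_tbump x sg y : partial nn (tbump x sg) y = 0.
Proof.
rewrite /partial derive_line (_ : (fun s : R => _) = cst (tbump x sg y)) ?derive_cst//.
by apply/funext => s; rewrite tbump_addn.
Qed.

Lemma partial_slab_le0 h d y : 0 < d -> partial nn (slab h d) y <= 0.
Proof.
move=> d0; have sx : smooth (fun y : E => (h - xn y) / d).
  by apply: smoothM; [apply: smoothB; [exact: smooth_cst|exact: smooth_xn]|exact: smooth_cst].
have E1 := @partial_comp _ _ nn plateau (fun y => _ / d) y
 (smooth1_derivable (@smooth1_plateau R)) (smooth_differentiable y sx).
rewrite [leLHS]E1.
apply: mulr_ge0_le0.
  exact: (homo_derive_ge0 (@plateau_homo R) (smooth1_is_derive _ (@smooth1_plateau R))).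
have -> : (fun y : E => (h - xn y) / d) = (fun y => d^-1 * (h - xn y)) by apply/funext => x; rewrite mulrC.
have df : differentiable (fun y : E => h - xn y) y by apply: smooth_differentiable; apply: smoothB; [exact: smooth_cst|exact: smooth_xn].
rewrite partialZ// partialB//.
by rewrite partial_cst partial_xn eqxx sub0r mulrN1 oppr_le0 invr_ge0 ltW.
Qed.

Lemma partial_slab0 h d y : 0 < d -> xn y < h \/ h + d < xn y -> partial nn (slab h d) y = 0.
Proof.
move=> d0 hy; have [c H] : exists c, \forall x \near y, slab h d x = c.
  have ox (A : set R) : open A -> open [set x : E| A (xn x)] by move=> oA; apply: open_comp => // x _; exact: continuous_xn.
  case: hy => hy; [exists 1; have := open_nbhs_nbhs (conj (ox _ (@open_lt _ h)) hy)|exists 0; have := open_nbhs_nbhs (conj (ox _ (@open_gt _ _)) hy)].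
    by apply: filterS => x /= xh; apply: plateau1; rewrite divr_ge0 ?(ltW d0)// subr_ge0 ltW.
  apply: filterS => x /= xh; apply: plateau0; rewrite ler_pdivrMr//; lra.
by rewrite (partial_near (g := fun=> c) _ H) partial_cst.
Qed.

(** The weight is invariant under tangential shifts, so the integral of a shifted test function is
    constant in the shift and its derivative vanishes. *)
Lemma tangential_partial_wI0 a (j : 'I_m) X : 0 <= a -> test_function setT X ->
  wI (@wt R m a) (partial (lshift 1 j) X) = 0.
Proof.
move=> a0 tX; have hw := weight_wt m a0; set e := lshift 1 j.
have [mX [C [q [q0 hC hq]]]] := tf_bmfun tX.
have [_ [_ [q' [q0' _ hq']]]] := tf_bmfun (tf_partial e tX).
have QE : ball (0 : E) (q + q' + 1) = [set x : E| `|x| < q + q' + 1] by apply/seteqP; split => x; rewrite /= ball0E.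
pose Q : set E := ball (0 : E) (q + q' + 1).
have Q0 : 0 < q + q' + 1 by [].
have bQ := bmfun_indic_ball (0 : E) Q0.
have D := wI_translate_derive 'e_e 0 hw (proj1 bQ) (wint_bmfun hw bQ) tX.
have {D} : is_derive (0 : R) 1 (fun s => wI (wt a) X) (wI (wt a) (partial e X)).
  have -> : wI (wt a) (partial e X) = \I_a[x] \1_Q x * dirder 'e_e X (x + 0 *: 'e_e).
    apply: wI_ext => x; rewrite dirder_delta scale0r addr0 indicE.
    case: (boolP (x \in Q)) => [|/negP xQ]; first by rewrite mul1r.
    rewrite mul0r hq'// ball0E => h; apply: xQ; apply/mem_set; rewrite /Q ball0E; lra.
  apply: is_derive_near D; have : \forall s \near (0 : R), `|s| < 1.
    exact: nbhs0_lt.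
  apply: filterS => s s1; have wth x : wt a (x + s *: 'e_e) = wt a x :> R.
    apply: wt_translate; rewrite xnZ /xn mxE eq_rlshift andbF mulr0//.
  rewrite -(proj2 (wI_translate (wint_bmfun hw (tf_bmfun tX)) wth)); apply: wI_ext => x.
  rewrite indicE; case: (boolP (x \in Q)) => [|/negP xQ]; first by rewrite mul1r.
  rewrite mul0r hq// ball0E => h; apply: xQ; apply/mem_set; rewrite /Q ball0E.
  have n1 : `|s *: 'e_e : E| <= `|s|.
    rewrite normrZ ler_piMr//; apply: rV_norm_le => // l; rewrite mxE.
    by case: (_ && _); rewrite ?normr1 ?normr0.
  have := ler_normB (x + s *: 'e_e) (s *: 'e_e); rewrite addrK; lra.
move=> D; have D0 : is_derive (0 : R) 1 (fun=> wI (wt a) X : R) 0 := is_derive_cst _ _ _.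
by rewrite -(@derive_val _ _ _ _ _ _ _ D) (@derive_val _ _ _ _ _ _ _ D0).
Qed.

End tangential_cylinder.

#[export] Hint Resolve smooth_tsq smooth_tbump smooth_slab : regularity.
#[export] Hint Resolve tbump_ge0 : positivity.

(** * Smallness of the tangential terms and of the flux variation at a good scale *)

Section good_scales.
Context {R : realType} {m : nat}.
Local Notation E := 'rV[R]_(m + 1).
Local Notation dim := ((m + 1)%:R : R).
Implicit Types (f g zeta : E -> R) (p x y : E) (s t h sg : R) (i : 'I_(m + 1)) (k : 'rV[R]_m) (j : 'I_m).

Lemma wI_ext_hp a f g : (forall x, hp x -> f x = g x) -> wI (@wt R m a) f = wI (wt a) g.
Proof.
move=> fg; apply: eq_Rintegral => x _; have [hx|hx] := pselect (hp x); first by rewrite fg.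
by rewrite wt_out// !mulr0.
Qed.

Lemma wt0_hp x : hp x -> wt 0 x = 1 :> R.
Proof. by move=> hx; rewrite wtE// powRr0. Qed.

Lemma wI_one_hp f : (forall x, ~ hp x -> f x = 0) -> wI (@one R (m + 1)) f = wI (wt 0) f.
Proof.
move=> f0; apply: eq_Rintegral => x _; have [hx|hx] := pselect (hp x); first by rewrite wt0_hp.
by rewrite f0// !mul0r.
Qed.

Lemma bump_translate p k s x : bump p s (x - emb k) = bump (p + emb k) s x.
Proof.
congr (fe (1 - _ / _)).
by apply: eq_bigr => i _; rewrite !mxE; congr (_ ^+ 2); ring.
Qed.

Lemma tf_box (c : E) b q zeta : b < q -> smooth zeta -> (forall y, zeta y != 0 -> `|y - c| <= b) ->
  test_function (ball c q) zeta.
Proof.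
move=> bq sz z0; apply: (@tf_sub _ _ [set y| `|y - c| <= b]).
  by move=> y /= h; rewrite ballEC; exact: le_lt_trans bq.
apply: tf_closed => //.
- apply: (@preimage_closed _ _ (fun y => `|y - c|) [set s| s <= b]) => //.
  move=> y _; apply: continuous_comp; [exact: continuous_addv|exact: norm_continuous].
- exists (`|c| + b); split; first exact: num_real.
  by move=> M hM y /= h; have := ler_normD (y - c) c; rewrite subrK; lra.
- by move=> y h; apply/eqP; apply: contrapT => /negP; move=> /z0.
Qed.

Lemma bump_energy : exists2 C, 0 <= C & forall p s, xn p = 0 -> 0 < s ->
  \I_0[x] \sum_i partial i (bump p s) x ^+ 2 <= C * (s ^+ m / s).
Proof.
have hw := @weight_wt R m 0 (lexx 0).
have [C C0 HC] := @partial_bump_le R m; have [K K0 HK] := @mass_ub R m 0 (lexx 0).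
exists (dim * C ^+ 2 * K) => [|p s p0 s0]//.
have tb : test_function setT (bump p s) by exact: tf_bump.
have -> : dim * C ^+ 2 * K * (s ^+ m / s) = dim * (C / s) ^+ 2 * K * s `^ (Nw m 0) by rewrite powR_Nw0// [s ^+ (m + 1)]exprD expr1; field; rewrite gt_eqF.
apply: (HK) => //; first lra.
- by apply: wint_sum => i; exact: (l2_bmfun hw (tf_bmfun (tf_partial i tb))).2.
- move=> x _ xs; apply: (@le_trans _ _ (\sum_(i < m + 1) (C / s) ^+ 2)); last first.
    by rewrite sumr_const card_ord mulr_natl.
  apply: ler_sum => i _; rewrite -sqr_normr ler_sqr ?nnegrE//.
  exact: HC.
- move=> x xs; rewrite big1// => i _; rewrite partial_bump.
  by rewrite (psi_out s0 (ltW xs)) mulr0 expr0n.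
Qed.

Context `(hu : @local_min R m 0 lp lm z r u G).
Let hw := @weight_wt R m 0 (lexx 0).
Let lG := lmin_l2 hu.
Local Notation L := (ell 0 G).
Let rho := r / 8.
Let rho0 : 0 < rho := lmin_rho hu.
Let z0 := lmin_z hu.

(** The energy of the tangential increments at scale S is at most e^2 times its natural size
    S^(m-1), along one sequence of steps and in all tangential directions at once. *)
Definition scale_ok S e := [/\ 0 < S <= rho, 0 < e & exists hs : nat -> R, [/\ forall q, 0 < hs q,
  hs @ \oo --> (0 : R) & forall q j,
  \I_0[x] bump z S x * DG2 G (hs q *: 'e_j) x <= e ^+ 2 * (S ^+ m / S) * hs q ^+ 2]].

(** The sup-norm ball of this radius around [z] lies where the squared distance is at most S^2 / 2,
    and there [bump z S] is bounded below ([half_sqd], [bump_lb]). *)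
Definition inner_radius S := S / (2 * dim).

Let dim1 : 1 <= dim. Proof. exact: dim_ge1. Qed.

Lemma half_le S : 0 <= S -> inner_radius S <= S / 2.
Proof.
move=> S0; have d0 : 0 < dim by [].
by rewrite /inner_radius invfM mulrA ler_piMr ?divr_ge0// invf_le1.
Qed.

Lemma half_sqd S y : 0 <= S -> `|y - z| <= inner_radius S -> sqd z y <= S ^+ 2 / 2.
Proof.
move=> S0 h; apply: le_trans (norm_sqd h) _.
have d0 : dim != 0 by [].
have -> : dim * inner_radius S ^+ 2 = inner_radius S * (S / 2) by rewrite /inner_radius; field.
rewrite expr2 -mulrA ler_wpM2r ?divr_ge0//; have := half_le S0; lra.
Qed.

Lemma tf_half S e zeta : scale_ok S e -> smooth zeta -> (forall y, zeta y != 0 -> `|y - z| <= inner_radius S) ->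
  test_function (ball z r) zeta /\ forall y, S ^+ 2 / 2 < sqd z y -> zeta y = 0.
Proof.
move=> [/andP[S0 S1] _ _] sz h; split.
  apply: tf_box sz h; have := half_le (ltW S0); have := lmin_r hu; rewrite /rho in S1; lra.
move=> y; apply: contraTeq => /h hy; rewrite -leNgt; exact: half_sqd (ltW S0) hy.
Qed.

(** Applies [dot_partial_bound] to the vector field whose only component is [zeta] in the direction
    j: up to sign this is the integral of d_jj u zeta, and second tangential derivatives are small
    at a good scale. The weight l = S / e gives both terms the order e S^m. *)
Lemma tangential_dot_bound : exists2 C, 0 <= C & forall S e zeta j, scale_ok S e -> smooth zeta ->
  (forall y, `|zeta y| <= 1) -> (forall y, zeta y != 0 -> `|y - z| <= inner_radius S) ->
  `|\I_0[x] G (lshift 1 j) x * partial (lshift 1 j) zeta x| <= C * (e * S ^+ m).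
Proof.
have [K K0 HK] := @mass_ub R m 0 (lexx 0).
exists ((expR 2 + K) / 2) => [|S e zeta j sok sz z1 zs]; first rewrite divr_ge0// addr_ge0 ?expR_ge0// ltW.
have [tz zout] := tf_half sok sz zs; have [/andP[S0 S1] e0 [hs [hs0 hsc HB]]] := sok.
set c := lshift 1 j; pose X i : E -> R := fun x => (i == c)%:R * zeta x.
have tX i : test_function (ball z r) (X i) by exact: tfZ.
have X0 i x : S ^+ 2 / 2 < sqd z x -> X i x = 0 by move=> /zout zx; rewrite /X zx mulr0.
have l0 : 0 < S / e by [].
have := dot_partial_bound hu S0 l0 hs0 hsc (fun q => HB q j) tX X0.
have -> : \I_0[x] \sum_i G i x * partial (lshift 1 j) (X i) x =
 \I_0[x] G c x * partial c zeta x.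
  apply: wI_ext => x; rewrite (bigD1 c)//= big1 ?addr0 => [|i ic].
    by rewrite /X eqxx partialZ ?mul1r//; exact: smooth_differentiable.
  by rewrite /X (negbTE ic) partialZ ?mul0r ?mulr0//; exact: smooth_differentiable.
have -> : \I_0[x] \sum_i X i x ^+ 2 = \I_0[x] zeta x ^+ 2.
  apply: wI_ext => x; rewrite (bigD1 c)//= big1 ?addr0 => [|i ic]; first by rewrite /X eqxx mul1r.
  by rewrite /X (negbTE ic) mul0r expr0n.
move=> h; apply: le_trans h _.
have mz : \I_0[x] zeta x ^+ 2 <= K * S ^+ m.+1.
  rewrite -[K]mul1r -[m.+1]addn1 -powR_Nw0//; apply: (HK z) => //; first lra.
  - exact: (l2_bmfun hw (tf_bmfun tz)).2.
  - by move=> x _ _; rewrite -sqr_normr expr_le1.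
  - by move=> x xs; rewrite zout ?expr0n//; have := sqr_ge0 S; lra.
have li : 0 <= (S / e)^-1 by [].
have -> : (expR 2 + K) / 2 * (e * S ^+ m) =
 (S / e * (expR 2 * (e ^+ 2 * (S ^+ m / S))) + (S / e)^-1 * (K * S ^+ m.+1)) / 2.
  by rewrite [S ^+ m.+1]exprS; field; rewrite !gt_eqF.
by rewrite ler_pM2r ?invr_gt0// lerD2l ler_wpM2l.
Qed.

(** Along the segment from z to z + k the derivative of the flux is, up to sign, the sum of k_j
    L(d_j bump). Each L(d_j bump) has order e S^(m-1), with the weight 1/e in [ell_partial_bound],
    and |k| <= S. *)
Lemma flux_nearly_constant th : 0 < th <= 1 -> exists2 C, 0 <= C & forall S e k, scale_ok S e ->
  `|k| + th * S <= inner_radius S -> L (bump z (th * S)) - L (bump (z + emb k) (th * S)) <= C * (e * S ^+ m).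
Proof.
move=> /andP[th0 th1]; have [C C0 HC] := bump_energy.
exists (m%:R * ((expR 2 + C / th) / 2)) => [|S e k sok kS].
  by rewrite mulr_ge0// divr_ge0// addr_ge0 ?expR_ge0// divr_ge0// ltW.
have [/andP[S0 S1] e0 [hs [hs0 hsc HB]]] := sok.
pose sg := th * S; have s0 : 0 < sg by exact: mulr_gt0.
have h2 := half_le (ltW S0).
have kle : `|k| <= S by move: kS; rewrite -/sg; lra.
pose b t := bump (z + emb (t *: k)) sg.
have bout t y : 0 <= t <= 1 -> b t y != 0 -> `|y - z| <= inner_radius S.
  move=> /andP[t0 t1] b0; have : sqd (z + emb (t *: k)) y <= sg ^+ 2.
    by rewrite leNgt; apply: contraNN b0 => h; rewrite /b bump_out// ltW.
  move=> /(sqd_norm (ltW s0)) h; have := norm_emb (t *: k); rewrite normrZ (ger0_norm t0) => h'.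
  have := ler_normD (y - (z + emb (t *: k))) (emb (t *: k)).
  have -> : y - (z + emb (t *: k)) + emb (t *: k) = y - z by rewrite opprD addrA subrK.
  have : t * `|k| <= `|k| by rewrite ler_piMl.
  by move: kS; rewrite -/sg; lra.
have sb t : smooth (b t) by apply: smooth_radial; exact: smooth1_fe.
have bt t : 0 <= t <= 1 -> test_function (ball z r) (b t) /\ forall y, S ^+ 2 / 2 < sqd z y -> b t y = 0 by move=> t01; apply: (tf_half sok (sb t)) => y; exact: bout.
have bE t x : b t x = b 0 (x - t *: emb k).
  have ek : emb (t *: k) = t *: emb k :> E by apply/rowP => i; rewrite /emb !mxE; case: splitP => l; rewrite mxE ?mulr0.
  by rewrite -ek /b scale0r emb0 addr0 bump_translate.
have [|tb0 _] := bt 0; first lra.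
have tX i : test_function (ball z r) (partial i (b 0)) by exact: tf_partial.
pose v : E := emb k.
have D t := dot_derive hu tX v t.
have pb t i x : partial i (b t) x = partial i (b 0) (x - t *: v).
  have -> : b t = (fun x => b 0 (x - (t *: v))) by apply/funext => y; rewrite bE.
  exact: partial_translate.
have LE t : L (b t) = \I_0[x] \sum_i G i x * partial i (b 0) (x - t *: v) by rewrite /ell; apply: wI_ext => x; apply: eq_bigr => i; rewrite pb.
have vl j : v ord0 (lshift 1 j) = k ord0 j by rewrite /v embE rV_rconsl.
have vr : v ord0 nn = 0 by exact: xn_emb.
have dE t : \I_0[x] \sum_i G i x * dirder v (partial i (b 0)) (x - t *: v) =
 \sum_(j < m) k ord0 j * \I_0[x] \sum_i G i x * partial i (partial (lshift 1 j) (b t)) x.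
  have tbt : test_function setT (b t) by exact: tf_bump.
  have pp j i x : partial (lshift 1 j) (partial i (b 0)) (x - t *: v) = partial i (partial (lshift 1 j) (b t)) x.
    rewrite (partialC i _ x (sb t)).
    have -> : partial i (b t) = (fun x => partial i (b 0) (x - (t *: v))) by apply/funext => y; rewrite pb.
    by symmetry; exact: partial_translate.
  have wj j : wint (wt 0) (fun x => \sum_i G i x * partial i (partial (lshift 1 j) (b t)) x) by apply: (wint_dot hu lG) => i; exact: (l2_bmfun hw (tf_bmfun (tf_partial i (tf_partial (lshift 1 j) tbt)))).
  transitivity (\I_0[x] \sum_(j < m) k ord0 j * \sum_i G i x * partial i (partial (lshift 1 j) (b t)) x).
    apply: wI_ext => x; under [RHS]eq_bigr do rewrite mulr_sumr.
    rewrite exchange_big /=; apply: eq_bigr => i _.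
    rewrite /dirder big_split_ord /= big_ord1 vr mul0r addr0 mulr_sumr; apply: eq_bigr => j _.
    by rewrite vl pp mulrCA.
  rewrite wI_sum; last by move=> j; exact: wintZ.
  by apply: eq_bigr => j; rewrite wIZ.
have [Phi PhiE DPhi] : exists2 Phi : R -> R, (forall t, Phi t = L (b t)) &
 forall t : R, is_derive t 1 Phi (- \sum_(j < m) k ord0 j * \I_0[x] \sum_i G i x * partial i (partial (lshift 1 j) (b t)) x).
  exists (fun t => \I_0[x] \sum_i G i x * partial i (b 0) (x - t *: v)) => [t|t].
    by rewrite LE.
  by rewrite -dE; exact: D.
have [t t01] := MVT_is_derive ler01 (fun s _ => DPhi s).
rewrite !PhiE subr0 mulr1 => h.
have -> : bump z (th * S) = b 0 by rewrite /b scale0r emb0 addr0.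
have -> : bump (z + emb k) (th * S) = b 1 by rewrite /b scale1r.
rewrite -opprB h opprK.
have [tbt bto] := bt t t01.
have l0 : 0 < e^-1 by rewrite invr_gt0.
have B j : `|L (partial (lshift 1 j) (b t))| <= (expR 2 + C / th) / 2 * (e * (S ^+ m / S)).
  have := ell_partial_bound hu S0 l0 hs0 hsc (fun q => HB q j) tbt bto.
  move=> h'; apply: le_trans h' _; rewrite invrK.
  have zk : xn (z + emb (t *: k)) = 0 by rewrite xnD xn_emb addr0.
  have K1 := HC _ sg zk s0.
  have K2 : sg ^+ m / sg <= S ^+ m / S / th.
    have -> : sg ^+ m / sg = th ^+ m * (S ^+ m / S / th) by rewrite /sg exprMn; field; rewrite !gt_eqF.
    rewrite ler_piMl//.
    by rewrite exprn_ile1// ltW.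
  have -> : (expR 2 + C / th) / 2 * (e * (S ^+ m / S)) =
 (e^-1 * (expR 2 * (e ^+ 2 * (S ^+ m / S))) + e * (C * (S ^+ m / S / th))) / 2.
    by field; rewrite !gt_eqF.
  rewrite ler_pM2r ?invr_gt0// lerD2l ler_pM2l//; apply: le_trans K1 _.
  by rewrite ler_wpM2l.
apply: le_trans (ler_norm _) _; apply: le_trans (ler_norm_sum _ _ _) _.
apply: (@le_trans _ _ (\sum_(j < m) S * ((expR 2 + C / th) / 2 * (e * (S ^+ m / S))))).
  apply: ler_sum => j _; rewrite normrM; apply: ler_pM => //.
    exact: le_trans (rV_norm_coord k j) kle.
  exact: B.
rewrite sumr_const card_ord -[_ m]mulr_natl; apply: eqW.
by field; rewrite !gt_eqF.
Qed.

End good_scales.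
Arguments scale_ok {R m} z r G S e.
Arguments inner_radius {R} m S.

Lemma increment_arith (R : realFieldType) (a1 b1 a0 b0 c : R) : `|a1 - b1| <= c -> `|a0 - b0| <= c ->
  b1 - b0 - 2 * c <= a1 - a0.
Proof. by rewrite !ler_norml => /andP[? ?] /andP[? ?]; lra. Qed.

(** * Normal increments controlled by the flux *)

Section hat.
Context {R : realType} {m : nat}.
Local Notation E := 'rV[R]_(m + 1).
Local Notation en := ('e_nn : E).
Implicit Types (p x y : E) (s t d h sg : R) (i : 'I_(m + 1)) (k : 'rV[R]_m) (j : 'I_m).
Context `(hu : @local_min R m 0 lp lm z r u G).
Let hw := @weight_wt R m 0 (lexx 0).
Let lG := lmin_l2 hu.
Local Notation L := (ell 0 G).
Let rho := r / 8.
Let z0 := lmin_z hu.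

(** A nonnegative averaging weight on the part of a vertical cylinder between heights h and h + d;
    for h >= 0 its total mass is the flat integral of the bump. *)
Definition normal_weight x sg d h y : R := - (tbump x sg y * partial nn (slab h d) y).

(** A test function with the trace of the bump whose normal derivative in the half space is minus
    the averaging weight. The middle factor is 1 for x_n >= 0 and makes the support bounded from
    below. *)
Definition hat x sg d h y : R := slab h d y * plateau (sg^-1 * xn y + 0) * tbump x sg y.

Lemma normal_weight_ge0 x sg d h y : 0 < d -> 0 <= normal_weight x sg d h y.
Proof.
by move=> d0; rewrite oppr_ge0 mulr_ge0_le0 ?tbump_ge0// partial_slab_le0.
Qed.

Lemma smooth_normal_weight x sg d h : smooth (normal_weight x sg d h).
Proof. by apply: smoothN; apply: smoothM; [exact: smooth_tbump|apply: smooth_partial; exact: smooth_slab]. Qed.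

Lemma normal_weight_addn x sg d h y t : normal_weight x sg d h (y - t *: en) = normal_weight x sg d (h + t) y.
Proof.
have E1 : tbump x sg (y - t *: en) = tbump x sg y by rewrite -scaleNr tbump_addn.
have E2 : partial nn (slab h d) (y - t *: en) = partial nn (slab (h + t) d) y.
  have F1 : slab (h + t) d = (fun w : E => slab h d (w + - (t *: en))) by apply/funext => w; rewrite -scaleNr slab_addn opprK.
  by rewrite F1; exact: esym (partial_translate nn (- (t *: en)) (slab h d) y).
by rewrite /normal_weight E1 E2.
Qed.

Lemma normal_weight_supp x sg d h y : 0 < sg -> 0 < d -> normal_weight x sg d h y != 0 ->
  (forall j, `|y ord0 (lshift 1 j) - x ord0 (lshift 1 j)| <= sg) /\ h <= xn y <= h + d.
Proof.
move=> s0 d0 w0; split.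
  move=> j; apply: tbump_near => //; apply: contraNneq w0 => b0.
  by rewrite /normal_weight b0 mul0r oppr0.
apply/andP; split; rewrite leNgt; apply: contraNN w0 => hy; rewrite /normal_weight partial_slab0 ?mulr0 ?oppr0//.
  by left.
by right.
Qed.

Lemma smooth_hat x sg d h : smooth (hat x sg d h).
Proof.
apply: smoothM; last exact: smooth_tbump.
apply: smoothM; first exact: smooth_slab.
exact: (smooth_comp (@smooth1_comp_affine R plateau sg^-1 0 (@smooth1_plateau R)) (@smooth_xn R m)).
Qed.

Lemma hat_supp x sg d h y : 0 < sg -> 0 < d -> hat x sg d h y != 0 ->
  (forall j, `|y ord0 (lshift 1 j) - x ord0 (lshift 1 j)| <= sg) /\ - sg <= xn y <= h + d.
Proof.
move=> s0 d0 w0; split.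
  move=> j; apply: tbump_near => //; apply: contraNneq w0 => b0.
  by rewrite /hat b0 mulr0.
apply/andP; split; rewrite leNgt; apply: contraNN w0 => hy; rewrite /hat.
  rewrite (_ : plateau (_ + 0) = 0) ?mulr0 ?mul0r//; apply: plateau0.
  rewrite addr0 mulrC ler_pdivrMr//; lra.
rewrite /slab plateau0 ?mul0r//.
by rewrite ler_pdivrMr//; lra.
Qed.

Lemma hat_norm x sg d h y : `|hat x sg d h y| <= 1.
Proof.
have p0 (s : R) : 0 <= plateau s <= 1 by rewrite plateau_ge0 plateau_le1.
have [/andP[a0 a1] /andP[b0 b1]] := (p0 ((h - xn y) / d), p0 (sg^-1 * xn y + 0)).
have c0 := tbump_ge0 x sg y; have c1 := tbump_le1 x sg y.
rewrite ger0_norm; first exact: (mulr_ile1 (mulr_ge0 a0 b0) c0 (mulr_ile1 a0 b0 a1 b1) c1).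
exact: (mulr_ge0 (mulr_ge0 a0 b0) c0).
Qed.

Lemma hat_partial x sg d h y : 0 < sg -> hp y -> partial nn (hat x sg d h) y = - normal_weight x sg d h y.
Proof.
move=> s0 hy; rewrite opprK.
have H : \forall w \near y, hat x sg d h w = tbump x sg w * slab h d w.
  have := open_nbhs_nbhs (conj open_hp hy); apply: filterS => w hw'.
  by rewrite /hat plateau1 ?mulr1 1?mulrC// addr0 mulr_ge0 ?invr_ge0 ?ltW.
rewrite (partial_near _ H) partialM; [|exact: smooth_differentiable (smooth_tbump _ _)|exact: smooth_differentiable (smooth_slab _ _)].
by rewrite partial_tbump mul0r addr0.
Qed.

Lemma hat_emb x sg d h (y : 'rV[R]_m) : xn x = 0 -> 0 < d -> 0 <= h -> hat x sg d h (emb y) = bump x sg (emb y).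
Proof.
move=> x0 d0 h0; rewrite /hat /slab xn_emb mulr0 addr0 !plateau1// ?mul1r ?tbump_emb//.
Qed.

Variable M : R.
Hypothesis HM : forall p k, 0 <= xn p <= rho / 2 -> `|p - z| <= rho -> `|k| <= rho ->
  `|u (p + emb k) - u p| <= M * `|k|.
Hypothesis M0 : 0 <= M.

Lemma cyl_near x sg b y : xn x = 0 -> 0 <= b -> 0 <= sg ->
  (forall j, `|y ord0 (lshift 1 j) - x ord0 (lshift 1 j)| <= sg) -> - sg <= xn y <= b ->
  `|y - z| <= `|x - z| + sg + b.
Proof.
move=> x0 b0 s0 hj /andP[n1 n2]; apply: rV_norm_le => [|i]; first by rewrite !addr_ge0.
have E1 (w v : E) l : (w - v) ord0 l = w ord0 l - v ord0 l by rewrite !mxE.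
rewrite E1; case: (split_ordP i) => j ->.
  have := rV_norm_coord (x - z) (lshift 1 j); rewrite E1; have := hj j.
  have := ler_normD (y ord0 (lshift 1 j) - x ord0 (lshift 1 j)) (x ord0 (lshift 1 j) - z ord0 (lshift 1 j)).
  by rewrite addrA subrK; lra.
rewrite [j]ord1; have -> : z ord0 nn = 0 by [].
by rewrite subr0 -/(xn y) ler_norml; have := normr_ge0 (x - z); lra.
Qed.

(** From x + tau e_n to y + tau e_n: the vertical displacement is below d and costs [sg] by
    continuity at x + tau e_n, and the tangential one costs M sg by the Lipschitz bound. *)
Lemma cylinder_oscillation x y sg tau d : xn x = 0 -> 0 < sg ->
  (forall j, `|y ord0 (lshift 1 j) - x ord0 (lshift 1 j)| <= sg) -> 0 <= xn y -> xn y < d -> 0 <= tau ->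
  `|x - z| + sg + (tau + xn y) <= rho / 2 ->
  (forall w, ball (x + tau *: en) d w -> `|u (x + tau *: en) - u w| <= sg) ->
  `|u (y + tau *: en) - u (x + tau *: en)| <= (M + 1) * sg.
Proof.
move=> x0 s0 hj y0 yd tau0 hr Hd.
pose k : 'rV[R]_m := \row_j (y ord0 (lshift 1 j) - x ord0 (lshift 1 j)).
have kE : y = x + xn y *: en + emb k.
  have E1 (w v : E) l : (w + v) ord0 l = w ord0 l + v ord0 l by rewrite mxE.
  apply/rowP => i; rewrite E1; case: (split_ordP i) => j ->.
    by rewrite coord_addn embE rV_rconsl mxE addrC subrK.
  rewrite ord1 -/(xn y) -/(xn _) -/(xn _).
  by rewrite xn_addn x0 xn_emb add0r addr0.
have ks : `|k| <= sg by apply: rV_norm_le => [|j]; [|rewrite mxE].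
pose q := x + (xn y + tau) *: en.
have qn : xn q = xn y + tau by rewrite xn_addn x0 add0r.
have qz : `|q - z| <= rho / 2.
  apply: le_trans (cyl_near x0 _ _ _ _) hr => //.
    by move=> j; rewrite coord_addn subrr normr0 ltW.
  rewrite qn [tau + _]addrC lexx andbT; apply: (@le_trans _ _ 0); first by rewrite oppr_le0 ltW.
  exact: addr_ge0.
have yq : y + tau *: en = q + emb k.
  transitivity (x + xn y *: en + emb k + tau *: en); first by rewrite -kE.
  by rewrite /q scalerDl addrAC -!addrA; congr (_ + (_ + _)); exact: addrC.
have q0 : 0 <= xn q <= rho / 2.
  have h1 := rV_norm_coord (q - z) nn; have h2 := ler_norm ((q - z) ord0 nn).
  have h3 : (q - z) ord0 nn = xn q by rewrite -/(xn _) xnD xnN z0 subr0.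
  by rewrite {1}qn addr_ge0//= -h3; exact: le_trans (le_trans h2 h1) qz.
have xz := normr_ge0 (x - z); have r0 := lmin_r hu.
have h1 : `|u (q + emb k) - u q| <= M * sg.
  have qz2 : `|q - z| <= rho by rewrite /rho in qz *; lra.
  have kz2 : `|k| <= rho by rewrite /rho in hr *; lra.
  by apply: le_trans (HM q0 qz2 kz2) _; rewrite ler_wpM2l.
have h2 : `|u (x + tau *: en) - u q| <= sg.
  apply: Hd; rewrite ballE /q scalerDl addrA [x + xn y *: en + _]addrAC opprD addrA subrr sub0r normrN.
  by apply: le_lt_trans yd; exact: norm_scale_delta.
rewrite yq; have := ler_normB (u (q + emb k) - u q) (u (x + tau *: en) - u q).
have -> : u (q + emb k) - u q - (u (x + tau *: en) - u q) = u (q + emb k) - u (x + tau *: en) by ring.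
by rewrite mulrDl mul1r => h3; apply: le_trans h3 _; exact: lerD.
Qed.

(* The average over a thin cylinder of the increment of [u] in the normal direction
   is governed by the flux, i.e. by [ell] of a bump with the same trace. *)
Lemma hat_estimate : exists2 C, 0 <= C & forall S e x t sg, scale_ok z r G S e -> xn x = 0 -> 0 < t ->
  0 < sg -> `|x - z| + sg + t < inner_radius m S ->
  (u (x + t *: en) - u x - 2 * ((M + 1) * sg)) * flatI (bump x sg) <= t * (- L (bump x sg) + C * (e * S ^+ m)).
Proof.
have [C C0 HC] := tangential_dot_bound hu; exists (m%:R * C); first by rewrite mulr_ge0.
move=> S e x t sg sok x0 t0 s0 hS.
have [/andP[S0 S1] e0 _] := sok.
have hh : inner_radius m S <= rho / 2 by have := @half_le R m _ (ltW S0); rewrite /rho; lra.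
have r0 := lmin_r hu; have xz := normr_ge0 (x - z).
have inb y : `|y - z| <= inner_radius m S -> ball z r y by move=> h; rewrite ballEC; move: hh; rewrite /rho; lra.
have nt : `|t *: en| <= t by exact/norm_scale_delta/ltW.
have bx : ball z r x by apply: inb; lra.
have bxt : ball z r (x + t *: en).
  apply: inb; have := ler_normD (x - z) (t *: en); rewrite addrAC; lra.
have /cvgrPdist_le/(_ _ s0)/nbhs_ballP[d1 /= d10 H1] := lmin_cont hu bx.
have /cvgrPdist_le/(_ _ s0)/nbhs_ballP[d2 /= d20 H2] := lmin_cont hu bxt.
pose gap := inner_radius m S - (`|x - z| + sg + t); have gap0 : 0 < gap by rewrite subr_gt0.
pose d := Num.min (Num.min d1 d2) gap / 4.
have d0 : 0 < d by rewrite divr_gt0// !lt_min d10 d20 gap0.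
have [dd1 dd2 dg] : [/\ 2 * d < d1, 2 * d < d2 & 2 * d < gap].
  have : Num.min (Num.min d1 d2) gap <= Num.min d1 d2 by rewrite ge_min lexx.
  have : Num.min (Num.min d1 d2) gap <= gap by rewrite ge_min lexx orbT.
  have : Num.min d1 d2 <= d1 by rewrite ge_min lexx.
  have : Num.min d1 d2 <= d2 by rewrite ge_min lexx orbT.
  by rewrite /d; split; lra.
have sn : `|x - z| + sg + (t + 2 * d) <= inner_radius m S by move: dg; rewrite /gap; lra.
have hs h y : 0 <= h <= t + d -> hat x sg d h y != 0 -> `|y - z| <= inner_radius m S.
  move=> /andP[h0 h1] w0; have [hj /andP[n1 n2]] := hat_supp s0 d0 w0.
  apply: le_trans (cyl_near x0 _ _ hj _) sn => //.
  by rewrite n1; lra.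
have thz h : 0 <= h <= t + d -> test_function (ball z r) (hat x sg d h) by move=> h01; have [] := tf_half hu sok (smooth_hat x sg d h) (fun y => hs h y h01).
have tb : test_function (ball z r) (bump x sg).
  apply: tf_bump => // y ys; apply: inb.
  have := sqd_norm (ltW s0) ys; have := ler_normD (y - x) (x - z); rewrite addrA subrK; lra.
(* [hat] and [bump] have the same trace, so [ell] takes the same value on both. Removing the
   tangential components of the pairing, small by [tangential_dot_bound], leaves the normal
   component paired with the averaging weight. *)
have flux h : 0 <= h <= t + d ->
    \I_0[y] G nn y * normal_weight x sg d h y <= - L (bump x sg) + m%:R * C * (e * S ^+ m).
  move=> h01; have th := thz h h01; have /andP[h0 _] := h01.
  have -> : L (bump x sg) = L (hat x sg d h).
    have tN : test_function (ball z r) (fun y => -1 * bump x sg y) by exact: tfZ.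
    have := ell_trace0 hu (tfD th tN); rewrite (ellD hu th tN) (ellZ hu (-1) tb) => E1.
    by apply/eqP; rewrite eq_sym -subr_eq0 -mulN1r; apply/eqP; apply: E1 => y; rewrite hat_emb// mulN1r subrr.
  have wn : wint (wt 0) (fun y => G nn y * partial nn (hat x sg d h) y) by apply: (wint_mul hw (lG nn)); exact: (l2_bmfun hw (tf_bmfun (tf_partial nn th))).
  have -> : \I_0[y] G nn y * normal_weight x sg d h y = - \I_0[y] G nn y * partial nn (hat x sg d h) y by rewrite -wIN//; apply: wI_ext_hp => y hy; rewrite hat_partial// mulrN opprK.
  rewrite (ellE hu th) big_split_ord /= big_ord1.
  have : `|\sum_(j < m) \I_0[y] G (lshift 1 j) y * partial (lshift 1 j) (hat x sg d h) y| <= m%:R * C * (e * S ^+ m).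
    apply: le_trans (ler_norm_sum _ _ _) _; apply: (@le_trans _ _ (\sum_(j < m) C * (e * S ^+ m))).
      apply: ler_sum => j _; apply: HC sok (smooth_hat x sg d h) _ _ => y; first exact: hat_norm.
      exact: hs.
    by rewrite sumr_const card_ord -[(C * _) *+ m]mulr_natl mulrA.
  by rewrite ler_norml => /andP[]; lra.
have [F FN] : exists F : E -> R, F = normal_weight x sg d d by exists (normal_weight x sg d d).
pose G0 i y := if y \in (hp : set E) then G i y else 0.
have [mu [Cu [qu [qu0 huC huq]]]] := lmin_bm hu.
have mG0 i : mbfun (G0 i) by apply: mbfun_if; [exact: measurable_open open_hp|exact: l2_mfun (lG i)].
have G0E i y : hp y -> G0 i y = G i y by move=> hy; rewrite /G0 mem_set.
have G0out i y : ~ hp y -> G0 i y = 0 by move=> hy; rewrite /G0 memNset.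
have wG0 i : wint one (G0 i).
  have := wint_G hu i; rewrite /wint; congr (integrable _ _ _); apply/funext => y.
  have [hy|hy] := pselect (hp y); first by rewrite G0E// wt0_hp.
  by rewrite G0out// wt_out// !mulr0 mul0r.
have du : dgrad (hp `&` ball z r) u G0 by apply: dgrad_ext (lmin_grad hu) => // i y [hy _]; rewrite G0E.
have Fs s y : F (y - s *: (t *: en)) = normal_weight x sg d (d + s * t) y by rewrite FN scalerA normal_weight_addn.
have FE s : (fun y => F (y - s *: (t *: en))) = normal_weight x sg d (d + s * t) by exact: funext (Fs s).
have tF s : 0 <= s <= 1 -> test_function (hp `&` ball z r) (fun y => F (y - s *: (t *: en))).
  move=> /andP[s00 s11]; rewrite FE.
  have st0 : 0 <= s * t := mulr_ge0 s00 (ltW t0).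
  have st1 : s * t <= t := ler_piMl (ltW t0) s11.
  apply: (@tf_sub _ _ ([set y | d <= xn y] `&` [set y | `|y - z| <= inner_radius m S])).
    by move=> y [/= h1 /inb h2]; split => //; exact: lt_le_trans h1.
  apply: tf_closed.
  - apply: closedI.
      by apply: (@preimage_closed _ _ (@xn R m) [set s | d <= s]); [move=> y _; exact: continuous_xn|exact: closed_ge].
    apply: (@preimage_closed _ _ (fun y => `|y - z|) [set s | s <= inner_radius m S]); last exact: closed_le.
    move=> y _; apply: (@continuous_comp _ _ _ (fun y : E => y + - z) (fun y : E => `|y|)); [exact: continuous_addv|exact: norm_continuous].
  - exists (`|z| + inner_radius m S); split; first exact: num_real.
    by move=> q hq y [_ /= h]; have := ler_normD (y - z) z; rewrite subrK; lra.
  - exact: smooth_normal_weight.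
  - move=> y ny; apply/eqP; apply: contrapT => /negP w0; apply: ny.
    have [hj /andP[n1 n2]] := normal_weight_supp s0 d0 w0; split => /=; first lra.
    apply: le_trans (cyl_near x0 _ _ hj _) sn => //.
    by apply/andP; split; lra.
(* The averaged increment over the height t equals t times the normal pairing at an intermediate
   height d + s t, to which [flux] applies. *)
have [s s01 Es] := dgrad_line_mvt mu (wint_one_bmfun (lmin_bm hu)) mG0 wG0 du tF.
have /andP[s00 s11] := s01.
have st0 : 0 <= s * t := mulr_ge0 s00 (ltW t0).
have st1 : s * t <= t := ler_piMl (ltW t0) s11.
have tF0 : test_function (hp `&` ball z r) F.
  have s01' : 0 <= (0 : R) <= 1 by rewrite lexx ler01.
  have t00 : d + 0 * t = d by rewrite mul0r addr0.
  by have := tF 0 s01'; rewrite FE t00 -FN.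
have bF := tf_bmfun tF0.
have rhsE : wI one (fun y => gdir (t *: en) G0 y * F (y - s *: (t *: en))) =
 t * \I_0[y] G nn y * normal_weight x sg d (d + s * t) y.
  rewrite -wIZ; last first.
    apply: (wint_mul hw (lG nn)); apply: (l2_bmfun hw).
    by have := tf_bmfun (tF s s01); rewrite FE.
  rewrite wI_one_hp; last first.
    move=> y hy; have g0 : gdir (t *: en) G0 y = 0 by rewrite gdir_scale_delta G0out// mulr0.
    by rewrite g0 mul0r.
  by apply: wI_ext_hp => y hy; rewrite gdir_scale_delta (G0E _ _ hy) Fs mulrA.
have lhs : (u (x + t *: en) - u x - 2 * ((M + 1) * sg)) * wI (@one R _) F <=
 wI (@one R _) (fun y => (u (y + t *: en) - u y) * F y).
  rewrite -wIZ; last exact: wint_one_bmfun.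
  apply: wI_le; [exact: weight_one|apply: wintZ; exact: wint_one_bmfun| |].
    apply: (wint1_bounded (C := Cu + Cu)) (tF0) => [|y]; first by apply: mbfunB => //; mbfun_translate.
    by apply: le_trans (ler_normB _ _) _; apply: lerD.
  move=> y; have [->|w0] := eqVneq (F y) 0; first by rewrite !mulr0.
  have := w0; rewrite {1}FN => /(normal_weight_supp s0 d0)[hj /andP[n1 n2]].
  apply: ler_wpM2r; first by rewrite FN; exact: normal_weight_ge0.
  have osc tau d' : 0 <= tau <= t -> 2 * d < d' ->
 (forall w, ball (x + tau *: en) d' w -> `|u (x + tau *: en) - u w| <= sg) ->
 `|u (y + tau *: en) - u (x + tau *: en)| <= (M + 1) * sg.
    move=> /andP[tau0 tau1] dd'; apply: cylinder_oscillation => //; try lra.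
  have B0 (w : E) : ball (x + 0 *: en) d1 w -> `|u (x + 0 *: en) - u w| <= sg by rewrite scale0r addr0 => /H1.
  have t00 : 0 <= (0 : R) <= t by rewrite lexx ltW.
  have t01 : 0 <= t <= t by rewrite lexx ltW.
  have o0 := osc 0 d1 t00 dd1 B0; rewrite scale0r !addr0 in o0.
  have o1 := osc t d2 t01 dd2 H2.
  exact: increment_arith o1 o0.
have IF : wI (@one R _) F = flatI (bump x sg).
  rewrite FN.
  have td : test_function setT (hat x sg d d) by apply: tf_sub (thz d _); rewrite ?lerDr ?ltW.
  rewrite (_ : flatI (bump x sg) = flatI (hat x sg d d)); last by apply: wI_ext => y; rewrite hat_emb// ltW.
  rewrite -[RHS]opprK -(flat_ftc td) -wIN wI_one_hp; first by apply: wI_ext_hp => y hy; rewrite hat_partial// opprK.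
  move=> y hy; apply/eqP; apply: contrapT => /negP w0.
  have [_ /andP[n1 _]] := normal_weight_supp s0 d0 w0; apply: hy; rewrite /hp/=; lra.
rewrite -IF; apply: le_trans lhs _; rewrite Es rhsE ler_pM2l//; apply: flux.
by rewrite addr_ge0 ?(ltW d0)//= addrC lerD2r.
Qed.

End hat.

Lemma drop_arith (R : realDomainType) (D F1 Fh F0 X : R) : D <= Fh - F1 -> 0 <= X -> X <= F0 - Fh -> 0 <= F1 ->
  D <= F0.
Proof. lra. Qed.

(** * Green's identity and a touching principle for strictly superharmonic functions *)

Section maximum_principle.
Context {R : realType} {m : nat}.
Local Notation E := 'rV[R]_(m + 1).
Implicit Types (f g eta P : E -> R) (p x y : E) (s t d : R) (i : 'I_(m + 1)).

Lemma bmfunB f g : bmfun f -> bmfun g -> bmfun (fun x => f x - g x).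
Proof.
move=> [mf [C [q [q0 fC fq]]]] [mg [D [s [s0 gD gs]]]]; split; first exact: mbfunB.
exists (C + D), (q + s); split; first exact: addr_gt0.
  by move=> x; apply: le_trans (ler_normB _ _) _; exact: lerD.
move=> x; rewrite ball0E => h; rewrite fq ?gs ?subr0// ball0E; lra.
Qed.

Lemma partial_bump_flat p s (y : 'rV[R]_m) : 0 < s -> good_center 0 p s -> partial nn (bump p s) (emb y) = 0.
Proof.
move=> s0 gc; rewrite partial_bump; case: gc => [p0|[_ sp]].
  by rewrite -[_ ord0 nn]/(xn (emb y)) xn_emb -[p ord0 nn]/(xn p) p0 subrr mul0r oppr0 mul0r.
rewrite psi_out ?mulr0//; apply: le_trans (sqd_coord p (emb y) nn).
rewrite -[_ ord0 nn]/(xn (emb y)) xn_emb -[p ord0 nn]/(xn p) sub0r sqrrN.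
by rewrite ler_sqr ?nnegrE; [exact: ltW|exact: ltW|exact: ltW (lt_trans s0 sp)].
Qed.

Lemma Lop0E eta x : Lop 0 eta x = \sum_i partial i (partial i eta) x.
Proof. by apply: eq_bigr => i _; rewrite /dvg !mul0r; case: ifP; rewrite addr0. Qed.

(** The divergence theorem for P grad eta - eta grad P. Tangential components integrate to 0, and
    the normal one leaves only the term with d_n P, because d_n eta vanishes on the flat part. *)
Lemma green P eta : smooth P -> test_function setT eta -> (forall y : 'rV[R]_m, partial nn eta (emb y) = 0) ->
  \I_0[x] P x * Lop 0 eta x =
  \I_0[x] eta x * \sum_i partial i (partial i P) x + flatI (fun x => eta x * partial nn P x).
Proof.
move=> sP te en0; have hw := @weight_wt R m 0 (lexx 0).
pose X i x := P x * partial i eta x - partial i P x * eta x.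
have sp i : smooth (partial i P) by exact: smooth_partial.
have tA i : test_function setT (fun x => P x * partial i eta x) by exact: tfM (tf_partial i te) sP.
have tB i : test_function setT (fun x => partial i P x * eta x) by exact: tfM te (sp i).
have tX i : test_function setT (X i).
  have tN := tfZ (-1) (tB i); have := tfD (tA i) tN.
  by congr test_function; apply/funext => x; rewrite mulN1r.
have dX i x : partial i (X i) x = P x * partial i (partial i eta) x - eta x * partial i (partial i P) x.
  have se := tf_smooth te; have spe := smooth_partial i se.
  have [d1 d2 d3 d4] : [/\ differentiable P x, differentiable eta x, differentiable (partial i P) x & differentiable (partial i eta) x] by split; exact: smooth_differentiable.
  rewrite /X partialB; [|exact: smooth_differentiable (tf_smooth (tA i))|exact: smooth_differentiable (tf_smooth (tB i))].
  by rewrite (partialM i d1 d4) (partialM i d3 d2) opprD addrA addrK [eta x * _]mulrC.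
have wd i := wint_bmfun hw (tf_bmfun (tf_partial i (tX i))).
have S1 : \sum_i wI (wt 0) (partial i (X i)) = flatI (fun x => eta x * partial nn P x).
  rewrite big_split_ord /= big_ord1 big1 ?add0r => [|j _]; last exact: tangential_partial_wI0.
  rewrite (flat_ftc (tX nn)) /flatI -wIN.
  by apply: wI_ext => y; rewrite /X en0 mulr0 sub0r opprK mulrC.
rewrite -S1 -wI_sum// -wID.
- apply: wI_ext => x; rewrite Lop0E !mulr_sumr -big_split /=; apply: eq_bigr => i _.
  by rewrite dX addrC subrK.
- apply: (wint_ext (f := fun x => \sum_i partial i (partial i P) x * eta x)).
    by move=> x; rewrite mulr_sumr; apply: eq_bigr => i _; rewrite mulrC.
  by apply: wint_sum => i; exact: (wint_bmfun hw (tf_bmfun (tfM te (smooth_partial i (sp i))))).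
- by apply: wint_sum => i; exact: wd.
Qed.

Context `(hu : @local_min R m 0 lp lm z r u G).
Let hw := @weight_wt R m 0 (lexx 0).
Local Notation L := (ell 0 G).

Lemma wI_Lop eta : test_function (ball z r) eta -> (forall i, okn i (partial i eta)) ->
  \I_0[x] u x * Lop 0 eta x = - L eta.
Proof.
move=> te ok; rewrite (ellE hu te) -sumrN.
have lu := l2_bmfun hw (lmin_bm hu).
transitivity (\sum_i \I_0[x] u x * dvg 0 i (partial i eta) x).
  rewrite -wI_sum; first by apply: wI_ext => x; rewrite mulr_sumr.
  by move=> i; apply: (wint_mul hw lu); apply: (l2_dvg (lexx 0) (tf_partial i te)); exact: ok.
apply: eq_bigr => i _.
exact: (dgrad_ibp (lexx 0) (lmin_grad hu) lu (lmin_l2 hu i) (tf_partial i te) (ok i)).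
Qed.

(** [radial cap p (2 * s)] is 1 on the ball of radius s around [p]; multiplied by it, [P] becomes a
    test function without being changed near [p]. *)
Definition cap (s : R) : R := plateau (1 * s + - 2^-1).

Lemma cap_radial p s x : 0 < s -> sqd p x <= s ^+ 2 -> radial cap p (2 * s) x = 1.
Proof.
move=> s0 xs; rewrite /radial /cap mul1r plateau1//.
have -> : 1 - sqd p x / (2 * s) ^+ 2 - 2^-1 = (2 - sqd p x / s ^+ 2) / 4 by field; rewrite gt_eqF.
have : sqd p x / s ^+ 2 <= 1 by rewrite ler_pdivrMr ?exprn_gt0// mul1r.
lra.
Qed.

Lemma tf_cap p s (B : set E) : 0 < s -> (forall x, sqd p x <= s ^+ 2 -> B x) -> test_function B (radial cap p s).
Proof.
move=> s0; apply: tf_radial => //.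
  exact: (@smooth1_comp_affine R plateau 1 (- 2^-1) (@smooth1_plateau R)).
by move=> v v0; rewrite /cap plateau0//; lra.
Qed.

Section touching.
Variables (p : E) (P : E -> R) (kap d : R).
Hypotheses (p0 : 0 <= xn p) (pz : ball z r p) (kap0 : 0 < kap) (d0 : 0 < d) (sP : smooth P)
  (lapP : forall x, \sum_i partial i (partial i P) x = - kap)
  (nP : forall y : 'rV[R]_m, partial nn P (emb y) = lp)
  (uP : forall x, hp x -> `|x - p| < d -> u x <= P x) (up : u p = P p) (u0 : xn p = 0 -> 0 < u p).

Let cont_uP : {for p, continuous (fun x => P x - u x)}.
Proof.
have c1 : {for p, continuous P} by exact: smooth_continuous.
have c2 := lmin_cont hu pz.
by apply: continuousB; [exact: c1|exact: c2].
Qed.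

Lemma touching_radius : exists2 s, 0 < s < d & (forall x, sqd p x <= s ^+ 2 -> ball z r x) /\
  ((xn p = 0 /\ forall x, sqd p x <= s ^+ 2 -> 0 < u x) \/ s < xn p).
Proof.
have near A : nbhs p A -> exists2 s, 0 < s & forall s' x, 0 < s' <= s -> sqd p x <= s' ^+ 2 -> A x.
  move=> /nbhs_ballP[q /= q0 hq]; exists (q / 2); first exact: divr_gt0.
  move=> s' x /andP[s0 sq] xs; apply: hq; rewrite ballEC.
  by have := sqd_norm (ltW s0) xs; lra.
have bo : open (ball z r) by apply: ball_open; exact: lmin_r hu.
have [s1 s10 h1] := near _ (open_nbhs_nbhs (conj bo pz)).
have [pE|pE] := eqVneq (xn p) 0.
  have [s2 s20 h2] := near _ (cvgr_gt _ (lmin_cont hu pz) _ (u0 pE)).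
  pose s := Num.min (Num.min s1 s2) (d / 2).
  have s0 : 0 < s by rewrite !lt_min s10 s20 divr_gt0.
  have le1 : s <= Num.min s1 s2 by rewrite ge_min lexx.
  have le2 : s <= d / 2 by rewrite ge_min lexx orbT.
  exists s; first by rewrite s0; lra.
  split; first by move=> x; apply: h1; rewrite s0 (le_trans le1)// ge_min lexx.
  by left; split => // x; apply: h2; rewrite s0 (le_trans le1)// ge_min lexx orbT.
have pp : 0 < xn p by rewrite lt_def pE.
pose s := Num.min (Num.min s1 (xn p / 2)) (d / 2).
have s0 : 0 < s by rewrite !lt_min s10 !divr_gt0.
have le1 : s <= Num.min s1 (xn p / 2) by rewrite ge_min lexx.
have le2 : s <= d / 2 by rewrite ge_min lexx orbT.
have le3 : s <= xn p / 2 by rewrite (le_trans le1)// ge_min lexx orbT.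
exists s; first by rewrite s0; lra.
split; first by move=> x; apply: h1; rewrite s0 (le_trans le1)// ge_min lexx.
by right; lra.
Qed.

(* [Sf] of [P - u >= 0] strictly decreases in the radius, but vanishes at radius [0]. *)
Lemma no_touching : False.
Proof.
have [s1 /andP[s10 s1d] [inb alt]] := touching_radius.
have gc s : s <= s1 -> good_center 0 p s by move=> ss; case: alt => [[pE _]|sp]; [left|right; split => //; lra].
pose chi := radial cap p (2 * s1); pose f x := P x * chi x - u x.
have s20 : 0 < 2 * s1 by [].
have tc : test_function setT chi by exact: tf_cap.
have bf : bmfun f by apply: bmfunB (lmin_bm hu); exact: tf_bmfun (tfM tc sP).
have fE x : sqd p x <= s1 ^+ 2 -> f x = P x - u x by move=> xs; rewrite /f /chi cap_radial// mulr1.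
have mono s x : 0 < s <= s1 -> sqd p x <= s ^+ 2 -> sqd p x <= s1 ^+ 2.
  move=> /andP[s0 ss] xs; apply: le_trans xs _.
  by rewrite ler_sqr ?nnegrE ?(ltW s0) ?(ltW s10).
have f0 s x : 0 < s <= s1 -> hp x -> sqd p x <= s ^+ 2 -> 0 <= f x.
  move=> ss hx xs; rewrite fE; last exact: mono xs.
  by rewrite subr_ge0 uP//; apply: le_lt_trans s1d; apply: sqd_norm (ltW s10) _; exact: mono xs.
have [c c0 Hc] := @mass_lb R m 0 (lexx 0); have [K K0 HK] := @mass_ub R m 0 (lexx 0).
have [C C0 HC] := @psi_ub R m.
(* If [p] is flat, the boundary term of [P] with slope lp cancels the flux of [u], which is exact
   because u > 0 there; if [p] is interior both boundary terms vanish. Only the term with the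
   Laplacian - kap of [P] is left. *)
have der s : 0 < s <= s1 -> \I_0[x] f x * Lop 0 (bump p s) x <= - (kap * (expR (- 2) * c * s ^+ (m + 1))).
  move=> ss; have /andP[s0 sle] := ss.
  have tb : test_function (ball z r) (bump p s) by apply: tf_bump => // x /(mono _ _ ss)/inb.
  have tbT : test_function setT (bump p s) by exact: tf_bump.
  have wb := wint_bmfun hw (tf_bmfun tb).
  have lL : l2 (@wt R m 0) (Lop 0 (bump p s)).
    apply: (l2_sum hw) => i; apply: (l2_dvg (lexx 0) (tf_partial i tbT)).
    by apply: okn_bump => //; exact: gc.
  have -> : \I_0[x] f x * Lop 0 (bump p s) x =
      \I_0[x] P x * Lop 0 (bump p s) x - \I_0[x] u x * Lop 0 (bump p s) x.
    have LE x : P x * Lop 0 (bump p s) x = P x * chi x * Lop 0 (bump p s) x.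
      have [xs|xs] := leP (sqd p x) (s ^+ 2); first by rewrite /chi cap_radial ?mulr1//; exact: mono xs.
      rewrite Lop0E big1 ?mulr0// => i; rewrite (@partial_sqd_out _ _ _ p (s ^+ 2))// => y ys.
      by apply: (@partial_sqd_out _ _ _ p (s ^+ 2)) ys => w ws; rewrite bump_out// ltW.
    rewrite (wI_ext _ LE) -wIB; first by apply: wI_ext => x; rewrite mulrBl.
      exact: (wint_mul hw (l2_bmfun hw (tf_bmfun (tfM tc sP)))).
    exact: (wint_mul hw (l2_bmfun hw (lmin_bm hu))).
  have bn (y : 'rV[R]_m) : partial nn (bump p s) (emb y) = 0 by apply: partial_bump_flat => //; exact: gc.
  rewrite (green sP tbT bn) wI_Lop//; last by move=> i; apply: okn_bump => //; exact: gc.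
  rewrite opprK; have -> : flatI (fun x => bump p s x * partial nn P x) = lp * flatI (bump p s).
    rewrite /flatI -wIZ; first by apply: wI_ext => y; rewrite nP mulrC.
    by apply: wint_one_bmfun; apply: bmfun_emb; exact: tf_bmfun tb.
  have -> : L (bump p s) = - lp * flatI (bump p s).
    case: alt => [[pE upos]|sp].
      by apply: (ell_pos hu); apply: tf_bump => // x /(mono _ _ ss) xs; split => [|_]; [exact: inb|exact: upos].
    have b0 (y : 'rV[R]_m) : bump p s (emb y) = 0.
      rewrite bump_out//; apply: le_trans (sqd_coord p (emb y) nn).
      rewrite -[_ ord0 nn]/(xn (emb y)) xn_emb -[p ord0 nn]/(xn p) sub0r sqrrN.
      by rewrite ler_sqr ?nnegrE ?(ltW s0)//; lra.
    have F0 : flatI (bump p s) = 0 by rewrite /flatI -[RHS](wI0 (@one R m)); apply: wI_ext => y; exact: b0.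
    by rewrite (ell_trace0 hu tb b0) F0 mulr0.
  have -> : \I_0[x] bump p s x * \sum_i partial i (partial i P) x = - (kap * wI (wt 0) (bump p s)) by rewrite -mulNr -wIZ//; apply: wI_ext => x; rewrite lapP mulrC.
  have : expR (- 2) * c * s ^+ (m + 1) <= wI (wt 0) (bump p s).
    rewrite -powR_Nw0//; apply: (Hc p) => //.
    by move=> x _; exact: bump_lb.
  move=> h; have := ler_wpM2l (ltW kap0) h; lra.
pose F := Sf 0 f p.
have FD s : 0 < s <= s1 -> is_derive s 1 F (s `^ (1 - Nw m 0) * \I_0[x] f x * Lop 0 (bump p s) x) by move=> /andP[s0 ss]; apply: (Sf_derive (lexx 0) bf s0); exact: gc.
pose q := kap * (expR (- 2) * c); have q0 : 0 < q by rewrite !mulr_gt0 ?expR_gt0.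
have slope s : 0 < s <= s1 -> q * s <= - (s `^ (1 - Nw m 0) * \I_0[x] f x * Lop 0 (bump p s) x).
  move=> ss; have /andP[s0 _] := ss; have := der s ss; set W := wI _ _ => hW.
  have -> : q * s = s `^ (1 - Nw m 0) * (kap * (expR (- 2) * c * s ^+ (m + 1))).
    have -> : s `^ (1 - Nw m 0) = s / s ^+ (m + 1) by rewrite powRD ?powRr1 ?(ltW s0) ?powRN ?powR_Nw0// (gt_eqF s0) implybT.
    by rewrite /q; field; rewrite gt_eqF// exprn_gt0.
  by rewrite -mulrN ler_wpM2l ?powR_ge0// lerNr.
have dec s t : 0 < s -> s <= t -> t <= s1 -> (t - s) * (q * s) <= F s - F t.
  move=> s0 st ts; have := growth_slope (F := fun v => - F v) (dF := fun v => - (v `^ (1 - Nw m 0) * \I_0[x] f x * Lop 0 (bump p v) x)) (c := q * s) st.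
  have -> : F s - F t = - F t - - F s by rewrite opprK addrC.
  move=> h; apply: h => v /andP[sv vt].
    by apply: is_deriveN; apply: FD; rewrite (lt_le_trans s0 sv) (le_trans vt).
  apply: le_trans (slope v _); last by rewrite (lt_le_trans s0 sv) (le_trans vt).
  by rewrite ler_pM2l.
have Fge s : 0 < s <= s1 -> 0 <= F s.
  move=> ss; rewrite mulr_ge0 ?powR_ge0//; have /andP[s0 _] := ss.
  have w := wint_psi (lexx 0) p bf s0.
  rewrite /wI /Rintegral fine_ge0//; apply: integral_ge0 => x _; rewrite lee_fin.
  have [hx|hx] := pselect (hp x); last by rewrite wt_out// mulr0.
  rewrite mulr_ge0 ?(ltW (wt_gt0 0 hx))//; have [xs|xs] := leP (sqd p x) (s ^+ 2).
    by rewrite mulr_ge0 ?psi_ge0//; exact: f0 xs.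
  by rewrite psi_out ?mulr0// ltW.
pose h := s1 / 2; have h0 : 0 < h by exact: divr_gt0.
pose D := h * (q * h); have D0 : 0 < D by rewrite mulr_gt0.
have FD0 s : 0 < s <= h -> D <= F s.
  move=> /andP[s0 sh]; have hs1 : h <= s1 by rewrite /h; lra.
  have h1 := dec h s1 h0 hs1 (lexx s1); have hh : s1 - h = h by rewrite /h; lra.
  rewrite hh -/D in h1; have h2 := dec s h s0 sh hs1.
  have h3 : 0 <= (h - s) * (q * s) by [].
  have s11 : 0 < s1 <= s1 by rewrite s10 lexx.
  exact: drop_arith h1 h3 h2 (Fge s1 s11).
(* By continuity P - u is below e near [p], where the two functions agree, and this e makes the mean
   at small radii at most D / 2, against its lower bound D. *)
pose e := D / (2 * (C * K)); have CK : 0 < C * K by [].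
have e0 : 0 < e by rewrite mulr_gt0.
have ue : P p - u p < e by rewrite up subrr.
have /nbhs_ballP[b /= b0 Hb] : \forall x \near p, P x - u x < e by exact: (cvgr_lt _ cont_uP).
pose s := Num.min h (b / 2); have s0 : 0 < s by rewrite lt_min h0 divr_gt0.
have sh : 0 < s <= h by rewrite s0 ge_min lexx.
have sb : s < b.
  have : s <= b / 2 by rewrite ge_min lexx orbT.
  lra.
have ss : 0 < s <= s1 by have /andP[_ sh'] := sh; rewrite /h in sh'; lra.
have Fle : F s <= e * C * K.
  rewrite /F /Sf powRN ler_pdivrMl ?powR_gt0// mulrC.
  apply: (HK p) => //; [by right|exact: wint_psi| |].
  - move=> x hx xs; apply: ler_pM; [exact: f0 xs|exact: psi_ge0| |exact: HC].
    rewrite fE; last exact: mono xs.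
    apply: ltW; apply: Hb; rewrite ballEC; apply: le_lt_trans sb.
    exact: sqd_norm (ltW s0) xs.
  - by move=> x xs; rewrite psi_out ?mulr0// ltW.
have := FD0 s sh; have : e * C * K = D / 2 by rewrite /e; field; rewrite !gt_eqF.
lra.
Qed.

End touching.
End maximum_principle.

Lemma barrier_arith (R : realFieldType) (V uy lp t q T D c0 E : R) : 0 < V ->
  V = uy - lp * t - q * (T - D) -> uy <= (lp - c0 / 2) * t + E -> q * D <= c0 / 8 * t ->
  3 / 8 * (c0 * t) + q * T < E.
Proof. by move=> V0 E1; rewrite E1 in V0; lra. Qed.

Lemma flux_arith (R : realFieldType) (l0 l1 C1 C2 X F lp c0 : R) : l0 - l1 <= C2 * X -> - l0 <= (lp - c0) * F ->
  (C1 + C2) * X <= c0 / 2 * F -> - l1 + C1 * X <= (lp - c0 / 2) * F.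
Proof. lra. Qed.

Lemma flux_absurd (R : realFieldType) (lp F X c : R) : lp * F + X <= (lp - c) * F -> 0 <= X -> 0 < c * F -> False.
Proof. lra. Qed.

Lemma above_arith (R : realFieldType) (uy ux M s t l : R) : uy - ux - 2 * ((M + 1) * s) <= t * l -> ux <= M * s ->
  uy <= l * t + (3 * M + 2) * s.
Proof. lra. Qed.

(** * The barrier argument for a = 0 *)

Section unweighted_contradiction.
Context {R : realType} {m : nat}.
Local Notation E := 'rV[R]_(m + 1).
Local Notation en := ('e_nn : E).
Local Notation dim := ((m + 1)%:R : R).
Implicit Types (p x y : E) (s e S : R) (i : 'I_(m + 1)) (k : 'rV[R]_m).

(** The coefficient dim + 1 gives the quadratic part, before multiplication by e, the Laplacian 2
    dim - 2 (dim + 1) = -2 in every dimension. For p on the flat part, the quadratic part has no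
    normal derivative at x_n = 0 and grows there like the squared distance to p. *)
Definition barrier l e c p y : R := l * xn y + (e * (sqd p y - (dim + 1) * xn y ^+ 2) + c).

Lemma smooth_barrier l e c p : smooth (barrier l e c p).
Proof.
apply: smoothD; first by apply: smoothZ; exact: smooth_xn.
apply: smoothD; last exact: smooth_cst.
apply: smoothZ; apply: smoothB; first exact: smooth_sqd.
by apply: smoothZ; apply: smoothX; exact: smooth_xn.
Qed.

Lemma partial_barrier l e c p i y : partial i (barrier l e c p) y =
  l * (i == nn)%:R + e * (2 * (y ord0 i - p ord0 i) - (dim + 1) * (2 * xn y * (i == nn)%:R)).
Proof.
have dx : differentiable xn y by [].
have dq : differentiable (sqd p) y by [].
have sx2 : smooth (fun y : E => xn y ^+ 2) by [].
have dx2 := smooth_differentiable y sx2.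
have s3 : smooth (fun y : E => (dim + 1) * xn y ^+ 2) by [].
have s4 : smooth (fun y : E => sqd p y - (dim + 1) * xn y ^+ 2) by [].
have s5 : smooth (fun y : E => e * (sqd p y - (dim + 1) * xn y ^+ 2)) by [].
have s6 : smooth (fun y : E => e * (sqd p y - (dim + 1) * xn y ^+ 2) + c) by [].
have s7 : smooth (fun y : E => l * xn y) by [].
rewrite /barrier (partialD _ (smooth_differentiable y s7) (smooth_differentiable y s6)) partialZ// partial_xn.
rewrite (partialD _ (smooth_differentiable y s5) (smooth_differentiable y (smooth_cst c))) partial_cst addr0.
rewrite partialZ; last exact: smooth_differentiable.
rewrite (partialB _ dq (smooth_differentiable y s3)) partial_sqd partialZ//.
by rewrite (partial_sqr _ dx) partial_xn.
Qed.

Lemma partial2_barrier l e c p i y : partial i (partial i (barrier l e c p)) y =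
  e * (2 - (dim + 1) * (2 * (i == nn)%:R)).
Proof.
have -> : partial i (barrier l e c p) = (fun y => l * (i == nn)%:R +
    e * (2 * (y ord0 i - p ord0 i) - (dim + 1) * (2 * xn y * (i == nn)%:R))).
  by apply/funext => x; rewrite partial_barrier.
set b := (i == nn)%:R.
have -> : (fun y : E => l * b + e * (2 * (y ord0 i - p ord0 i) - (dim + 1) * (2 * xn y * b))) =
    (fun y => 2 * e * y ord0 i + (- (e * (dim + 1) * 2 * b) * xn y + (l * b - 2 * e * p ord0 i))).
  by apply/funext => x; ring.
have s1 : smooth (fun y : E => 2 * e * y ord0 i) by [].
have s2 : smooth (fun y : E => - (e * (dim + 1) * 2 * b) * xn y) by [].
have s3 : smooth (fun y : E => - (e * (dim + 1) * 2 * b) * xn y + (l * b - 2 * e * p ord0 i)) by apply: smoothD => //; exact: smooth_cst.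
rewrite (partialD _ (smooth_differentiable y s1) (smooth_differentiable y s3)).
rewrite (partialD _ (smooth_differentiable y s2) (smooth_differentiable y (smooth_cst _))) partial_cst addr0.
rewrite partialZ; last exact: smooth_differentiable (smooth_coord i).
rewrite partialZ; last exact: smooth_differentiable smooth_xn.
rewrite partial_coord partial_xn eqxx -/b mulr1.
have : b * b = b by rewrite /b; case: (i == nn); rewrite ?mulr1 ?mulr0.
move=> bb; rewrite mulNr -[X in _ - X]mulrA bb; ring.
Qed.

Lemma laplacian_barrier l e c p y : \sum_i partial i (partial i (barrier l e c p)) y = - (2 * e).
Proof.
rewrite (eq_bigr _ (fun i _ => partial2_barrier l e c p i y)) -mulr_sumr sumrB sumr_const card_ord.
rewrite (eq_bigr (fun i : 'I__ => if i == nn then (dim + 1) * 2 else 0)).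
  by rewrite -big_mkcond big_pred1_eq -[_ *+ _]mulr_natl; ring.
by move=> i _; case: (i == nn); rewrite ?mulr1 ?mulr0.
Qed.

Lemma flatten_addn y : flatten y + xn y *: en = y.
Proof. by rewrite /flatten subrK. Qed.

Lemma flat_diff x y : xn x = 0 -> xn y = 0 -> exists2 k : 'rV[R]_m, y = x + emb k & `|k| <= `|y - x|.
Proof.
move=> x0 y0; have E1 (w v : E) l : (w + v) ord0 l = w ord0 l + v ord0 l by rewrite mxE.
have E2 (w v : E) l : (w - v) ord0 l = w ord0 l - v ord0 l by rewrite !mxE.
exists (\row_j (y ord0 (lshift 1 j) - x ord0 (lshift 1 j))).
  apply/rowP => i; rewrite E1; case: (split_ordP i) => j ->.
    by rewrite embE rV_rconsl mxE addrC subrK.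
  rewrite ord1 -/(xn y) -/(xn x) -/(xn _).
  by rewrite x0 y0 xn_emb addr0.
by apply: rV_norm_le => // j; rewrite mxE -E2; exact: rV_norm_coord.
Qed.

Context `(hu : @local_min R m 0 lp lm z r u G).
Local Notation L := (ell 0 G).
Let z0 := lmin_z hu.

(* If the mean flux at a good scale stays below [lp], then [u] lies below a linear function of slope
   less than [lp] up to a small error, and a strictly superharmonic barrier
   touching [u] from above rules out positive values on the flat part. *)
Lemma no_positive_values : exists2 th0, 0 < th0 & forall th, 0 < th <= th0 -> exists2 e0, 0 < e0 &
  forall S e, scale_ok z r G S e -> e <= e0 ->
  - L (bump z (th * S)) <= (lp - lm) / 2 * flatI (bump z (th * S)) ->
  (forall d, 0 < d -> exists2 k : 'rV[R]_m, `|k| <= d & 0 < u (z + emb k)) -> False.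
Proof.
have [M M0 HM] := tangential_lipschitz hu.
have [C1 C10 H1] := hat_estimate hu HM M0.
have [cF cF0 HF] := @flatI_bump_lb R m.
have lp0 := lmin_p hu; have lm0 := lmin_m hu; have r0 := lmin_r hu.
(* Half of the total jump: the assumed bound (lp - lm) / 2 on the mean flux is lp - c0. *)
pose c0 := (lp + lm) / 2; have c00 : 0 < c0 by rewrite divr_gt0// addr_gt0.
have d1 := @dim_ge1 R m; have dp : 0 < dim by exact: lt_le_trans d1.
(* With w = S / (8 dim), [th1] makes the error (3 M + 2) sg smaller than c0 w^2 / (4 S), the growth
   of the barrier at tangential distance w / 2. The bound [th2] gives sg <= w / 2. *)
pose th1 := c0 / (256 * dim ^+ 2 * (3 * M + 3)).
have M3 : 0 < 3 * M + 3 by [].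
have th10 : 0 < th1 by apply: divr_gt0 => //; apply: mulr_gt0 => //; apply: mulr_gt0 => //; exact: exprn_gt0.
pose th2 := (16 * dim)^-1; have th20 : 0 < th2 by rewrite invr_gt0 mulr_gt0.
exists (Num.min th1 th2); first by rewrite lt_min th10 th20.
move=> th /andP[t0]; rewrite le_min => /andP[tt1 tt2].
have th01 : 0 < th <= 1 by rewrite t0 (le_trans tt2)// invf_le1 ?mulr_gt0//; lra.
have [C2 C20 H2] := flux_nearly_constant hu th01.
have den : 0 < C1 + C2 + 1 by [].
have thm : 0 < th ^+ m by [].
exists (c0 / 2 * (cF * th ^+ m) / (C1 + C2 + 1)).
  by apply: divr_gt0 => //; apply: mulr_gt0.
move=> S e sok ee fl Hpos.
have [/andP[S0 S1] e0 _] := sok.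
pose sg := th * S; have sg0 : 0 < sg by exact: mulr_gt0.
set F0 := flatI (bump z sg) in fl.
have F0lb : cF * th ^+ m * S ^+ m <= F0 by have := HF z sg z0 sg0; rewrite /sg exprMn mulrA.
have Sm : 0 < S ^+ m by [].
have F00 : 0 < F0 by apply: lt_le_trans F0lb; rewrite mulr_gt0.
have err : (C1 + C2) * (e * S ^+ m) <= c0 / 2 * F0.
  have h1 : e * (C1 + C2 + 1) <= c0 / 2 * (cF * th ^+ m) by rewrite -ler_pdivlMr.
  apply: (@le_trans _ _ (e * (C1 + C2 + 1) * S ^+ m)).
    have : 0 <= e * S ^+ m by rewrite mulr_ge0// ltW.
    lra.
  apply: le_trans (ler_wpM2r (ltW Sm) h1) _; rewrite [leLHS](_ : _ = c0 / 2 * (cF * th ^+ m * S ^+ m)); last by ring.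
  by rewrite ler_pM2l// divr_gt0.
pose b := inner_radius m S.
have bE : b = 8 * (S * th2) by rewrite /b /inner_radius /th2; field; rewrite gt_eqF.
pose w := S * th2 * 2; have w0 : 0 < w by rewrite mulr_gt0.
have sgw : sg <= w / 2 by rewrite /sg mulrC -mulrA divff// mulr1 ler_pM2l.
have bw : b = 4 * w by rewrite bE /w; ring.
have br : b <= r / 16 by have := @half_le R m _ (ltW S0); rewrite -/b; lra.
clear ee F0lb thm den th01 bE th10.
have FE x : xn x = 0 -> flatI (bump x sg) = F0.
  move=> x0; have [k -> _] := flat_diff z0 x0; rewrite /F0.
  have mb : mbfun (bump (z + emb k) sg) by apply: (tf_bmfun _).1; exact: tf_bump.
  rewrite -(flatI_translate k mb); apply: wI_ext => y.
  by rewrite -bump_translate addrK.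
have flux x : xn x = 0 -> `|x - z| <= 2 * w -> - L (bump x sg) + C1 * (e * S ^+ m) <= (lp - c0 / 2) * F0.
  move=> x0 xz; have [k xE kx] := flat_diff z0 x0; rewrite xE.
  have hk : `|k| + th * S <= inner_radius m S by rewrite -/sg -/b; lra.
  have fl' : - L (bump z sg) <= (lp - c0) * F0 by move: fl; rewrite (_ : (lp - lm) / 2 = lp - c0)//; rewrite /c0; field.
  exact: flux_arith (H2 S e k sok hk) fl' err.
(* If u(x) > M sg, the Lipschitz bound keeps u positive on the flat disk of radius sg around [x];
   the flux there would then be exactly lp, above the bound lp - c0 / 2. *)
have flatu x : xn x = 0 -> `|x - z| <= 2 * w -> u x <= M * sg.
  move=> x0 xz; rewrite leNgt; apply/negP => ux.
  have tb : test_function [set y | ball z r y /\ (xn y = 0 -> 0 < u y)] (bump x sg).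
    apply: tf_bump => // y /(sqd_norm (ltW sg0)) xy; split.
      rewrite ballEC; have := ler_normD (y - x) (x - z).
      by rewrite addrA subrK; lra.
    move=> y0; have [k yE ky] := flat_diff x0 y0.
    have x2 : 0 <= xn x <= r / 8 / 2 by rewrite x0 lexx ltW.
    have xz8 : `|x - z| <= r / 8 by lra.
    have k8 : `|k| <= r / 8 by lra.
    have := HM x k x2 xz8 k8; rewrite -yE ler_norml => /andP[h _].
    have : M * `|k| <= M * sg by rewrite ler_wpM2l// (le_trans ky).
    lra.
  have h := flux x x0 xz; rewrite (ell_pos hu tb) FE// mulNr opprK in h.
  have h1 : 0 <= C1 * (e * S ^+ m) by [].
  have h2 : 0 < c0 / 2 * F0 by [].
  exact: flux_absurd h h1 h2.
(* [hat_estimate] raises the flux bound from the projection of [y] to [y]. The error is 2 (M + 1) sg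
   from averaging over the cylinder and M sg from the value on the flat part. *)
have above y : 0 <= xn y <= w -> `|y - z| <= 2 * w -> u y <= (lp - c0 / 2) * xn y + (3 * M + 2) * sg.
  move=> /andP[y0 yw] yz; have [ye|yn] := eqVneq (xn y) 0.
    rewrite ye mulr0 add0r; apply: le_trans (flatu y ye yz) _.
    by rewrite ler_pM2r//; lra.
  have yp : 0 < xn y by rewrite lt_def yn.
  have x0 := xn_flatten y; have xz := flatten_near hu yz.
  have hc : `|flatten y - z| + sg + xn y < inner_radius m S by rewrite -/b; lra.
  have := H1 S e _ _ sg sok x0 yp sg0 hc; rewrite flatten_addn FE// => h.
  have h2 := ler_wpM2l y0 (flux _ x0 xz); have h3 := le_trans h h2.
  rewrite [leRHS]mulrA (ler_pM2r F00) in h3; exact: above_arith h3 (flatu _ x0 xz).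
clear err flux C10 C20 e0 sgw Sm F00.
have [k kw pu] := Hpos w w0; pose p := z + emb k.
have p0 : xn p = 0 by rewrite xnD xn_emb addr0.
have pz : `|p - z| <= w by rewrite addrAC subrr add0r (le_trans (norm_emb k)).
pose P c := barrier lp (c0 / S) c p.
have PE c y : P c y = P 0 y + c by rewrite /P /barrier; ring.
pose K := [set y : E | 0 <= xn y] `&` [set y : E | `|y - p| <= w].
have inb y : `|y - p| <= w -> ball z r y.
  move=> h; rewrite ballEC; have := ler_normD (y - p) (p - z).
  by rewrite addrA subrK; lra.
have cK : compact K.
  apply: bounded_closed_compact.
    exists (`|p| + w); split; first exact: num_real.
    by move=> q hq y [_ /= h]; have := ler_normD (y - p) p; rewrite subrK; lra.
  apply: closedI.
    by apply: (@preimage_closed _ _ (@xn R m) [set s | 0 <= s]); [move=> y _; exact: continuous_xn|exact: closed_ge].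
  apply: (@preimage_closed _ _ (fun y => `|y - p|) [set s | s <= w]); last exact: closed_le.
  move=> y _; apply: (@continuous_comp _ _ _ (fun y : E => y + - p) (fun y : E => `|y|)); [exact: continuous_addv|exact: norm_continuous].
have K0 : K !=set0 by exists p; split; rewrite /= ?p0// subrr normr0 ltW.
have cV : {within K, continuous (fun y => u y - P 0 y)}.
  apply: continuous_in_subspaceT => y /set_mem[_ /= /inb by_].
  have c1 := lmin_cont hu by_.
  have c2 : {for y, continuous (P 0)} by exact: (smooth_continuous (smooth_barrier lp _ 0 p)).
  by apply: continuousB; [exact: c1|exact: c2].
(* Raised by the maximum V of u - P 0 over the half cube, the barrier touches u from above at y. *)
have [y /set_mem[/= y0 yp] ymax] := EVT_max_rV K0 cK cV.
set V := u y - P 0 y in ymax.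
have V0 : 0 < V.
  have pK : p \in K by apply/mem_set; split; rewrite /= ?p0// subrr normr0 ltW.
  apply: lt_le_trans (ymax p pK); rewrite /P /barrier p0 sqdxx expr0n /= !mulr0 subr0 mulr0 !addr0 subr0.
  exact: pu.
have yz : `|y - z| <= 2 * w by have := ler_normD (y - p) (p - z); rewrite addrA subrK; lra.
have yn1 : xn y <= w.
  have := rV_norm_coord (y - p) nn; have := ler_norm ((y - p) ord0 nn).
  by rewrite -[(y - p) ord0 nn]/(xn (y - p)) xnD xnN p0 subr0; lra.
have yw : 0 <= xn y <= w by rewrite y0.
have ub := above y yw yz.
pose T := tsq p y; have T0 : 0 <= T by apply: sumr_ge0 => j _; pos.
have small : (3 * M + 2) * sg < c0 / S * (w ^+ 2 / 4).
  have -> : c0 / S * (w ^+ 2 / 4) = (3 * M + 3) * (th1 * S) by rewrite /th1 /w /th2; field; rewrite !gt_eqF.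
  apply: (@lt_le_trans _ _ ((3 * M + 3) * sg)); first by rewrite ltr_pM2r//; lra.
  by rewrite ler_pM2l// /sg ler_pM2r.
have VE : V = u y - lp * xn y - c0 / S * (T - dim * xn y ^+ 2) by rewrite /V /P /barrier sqd_tsq -/T p0 subr0; ring.
have c0S : 0 < c0 / S by [].
have quad : c0 / S * (dim * xn y ^+ 2) <= c0 / 8 * xn y.
  have -> : c0 / 8 * xn y = c0 / S * (dim * (w * xn y)) by rewrite /w /th2; field; rewrite !gt_eqF.
  by apply: (ler_wpM2l (ltW c0S)); apply: (ler_wpM2l (ltW dp)); rewrite expr2; apply: ler_wpM2r.
(* V > 0 and the upper bound on u(y) confine the maximum point: its tangential distance from [p] and
   its height are at most w / 2. The touching therefore takes place away from the rest of the
   boundary of the half cube. *)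
have main : 3 / 8 * (c0 * xn y) + c0 / S * T < c0 / S * (w ^+ 2 / 4).
  apply: lt_trans small; exact: (barrier_arith V0 VE ub quad).
have Tw : T <= (w / 2) ^+ 2.
  have h : c0 / S * T < c0 / S * (w ^+ 2 / 4) by apply: le_lt_trans main; rewrite lerDr mulr_ge0// mulr_ge0// ltW.
  by move: h; rewrite ltr_pM2l// => h; rewrite exprMn exprVn; apply: ltW; lra.
have nw : xn y <= w / 2.
  have h : 3 / 8 * (c0 * xn y) <= 3 / 8 * (c0 * (w / 2)).
    apply: ltW; apply: le_lt_trans (lt_le_trans main _); first by rewrite lerDl mulr_ge0// ltW.
    have -> : c0 / S * (w ^+ 2 / 4) = c0 * w / (32 * dim) by rewrite /w /th2; field; rewrite !gt_eqF.
    have -> : 3 / 8 * (c0 * (w / 2)) = c0 * w * (3 / 16) by field.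
    apply: ler_wpM2l => //.
    have d32 : 0 < 32 * dim by [].
    by rewrite -div1r ler_pdivrMr//; lra.
  by move: h; rewrite ler_pM2l// ler_pM2l.
have yp2 : `|y - p| <= w / 2.
  have w20 : 0 <= w / 2 by [].
  have E1 (x1 x2 : E) l : (x1 - x2) ord0 l = x1 ord0 l - x2 ord0 l by rewrite !mxE.
  apply: rV_norm_le => // i; case: (split_ordP i) => j ->; last first.
    by rewrite [j]ord1 -[_ ord0 nn]/(xn (y - p)) xnD xnN p0 subr0 ger0_norm.
  rewrite E1 -ler_sqr ?nnegrE// sqr_normr; apply: le_trans Tw.
  by rewrite /T /tsq (bigD1 j)//= lerDl; apply: sumr_ge0 => l _; exact: sqr_ge0.
have kap0 : 0 < 2 * (c0 / S) by [].
have w20 : 0 < w / 2 by [].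
have by_ : ball z r y by exact: inb.
have PV : u y = P V y by rewrite PE addrC subrK.
apply: (@no_touching R m lp lm z r u G hu y (P V) (2 * (c0 / S)) (w / 2)) => //.
- exact: smooth_barrier.
- exact: laplacian_barrier.
- move=> v; rewrite partial_barrier eqxx -/(xn _) xn_emb -/(xn p) p0.
  by rewrite !(mulr1, subrr, mulr0, mul0r, subr0, addr0).
- move=> x hx xy; have xK : x \in K.
    apply/mem_set; split; rewrite /=; first exact: ltW.
    by have := ler_normD (x - y) (y - p); rewrite addrA subrK; lra.
  by rewrite PE; have := ymax x xK; lra.
- move=> ye; rewrite PV /P /barrier ye expr0n !mulr0 subr0 add0r.
  by rewrite ltr_wpDl// mulr_ge0 ?sqd_ge0// ltW.
Qed.

End unweighted_contradiction.

(** The midpoint (lp - lm) / 2 changes sign under u -> -u, as the flux does. On whichever side of it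
    the flux lies, [no_positive_values] applies to [u] or to [- u]; one good scale serves both,
    because the energy of the increments is even in [G]. *)
Lemma no_touch_unweighted (R : realType) (m : nat) (lp lm r : R) (z : 'rV[R]_(m + 1)) u G :
  local_min 0 lp lm z r u G ->
  (forall e, 0 < e -> exists2 k : 'rV[R]_m, `|k| <= e & 0 < u (z + emb k)) ->
  (forall e, 0 < e -> exists2 k : 'rV[R]_m, `|k| <= e & u (z + emb k) < 0) -> False.
Proof.
move=> hu Hp Hn; have huN := local_minN hu.
have [t1 t10 A1] := no_positive_values hu; have [t2 t20 A2] := no_positive_values huN.
pose th := Num.min t1 t2; have th0 : 0 < th by rewrite lt_min t10.
have th1 : 0 < th <= t1 by rewrite th0 ge_min lexx.
have th2 : 0 < th <= t2 by rewrite th0 ge_min lexx orbT.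
have [e1 e10 B1] := A1 th th1; have [e2 e20 B2] := A2 th th2.
pose e := Num.min e1 e2; have e0 : 0 < e by rewrite lt_min e10.
have r0 := lmin_r hu; have r8 : 0 < r / 8 by [].
have e20' : 0 < e ^+ 2 by [].
have [S [hs [S1 _ hs0 hsc HB]]] := good_scale hu e20' r8.
have sok : scale_ok z r G S e by split => //; exists hs.
have sokN : scale_ok z r (fun i x => - G i x) S e.
  split => //; exists hs; split => // q j; apply: le_trans (HB q j).
  apply: eqW; apply: wI_ext => x; congr (_ _).
  by apply: eq_bigr => i; rewrite /DG -opprD sqrrN.
have le1 : e <= e1 by rewrite ge_min lexx.
have le2 : e <= e2 by rewrite ge_min lexx orbT.
set F0 := flatI (bump z (th * S)) in B1 B2.
have [h|h] := leP (- ell 0 G (bump z (th * S))) ((lp - lm) / 2 * F0).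
  exact: B1 S e sok le1 h Hp.
apply: (B2 S e sokN le2) => [|d /Hn[k kd ku]]; last by exists k => //; rewrite oppr_gt0.
have tb : test_function setT (bump z (th * S)) by apply: tf_bump => //; rewrite mulr_gt0; have /andP[] := S1.
have hw := @weight_wt R m 0 (lexx 0).
rewrite ellN; last by apply: (wint_dot hu (lmin_l2 hu)) => i; exact: (l2_partial hu i tb).
by move: h; rewrite opprK -[lm - lp]opprB !mulNr ltrNr => /ltW.
Qed.

(** * Traces as limits of means, and weak derivatives up to null sets *)

Section mean_values.
Context {R : realType} {n : nat}.
Local Notation E := 'rV[R]_n.
Local Notation I1 := (wI (@one R n)).
Implicit Types (U A : set E) (f g v w psi : E -> R) (x y : E) (r d e : R) (i : 'I_n).

Lemma enormB_sqr x y : \sum_i (x ord0 i - y ord0 i) ^+ 2 = enorm (x - y) ^+ 2.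
Proof.
rewrite /enorm sqr_sqrtr; last by apply: sumr_ge0 => i _; exact: sqr_ge0.
by apply: eq_bigr => i; rewrite !mxE.
Qed.

Lemma norm_le_enorm x : `|x| <= enorm x.
Proof.
apply: rV_norm_le => [|i]; first exact: sqrtr_ge0.
rewrite -ler_sqr ?nnegrE ?sqrtr_ge0// sqr_normr sqr_sqrtr//.
by rewrite (bigD1 i)//= lerDl; apply: sumr_ge0 => j _; exact: sqr_ge0.
Qed.

Lemma enorm_le_norm x : enorm x <= n%:R * `|x|.
Proof.
rewrite -ler_sqr ?nnegrE ?sqrtr_ge0 ?mulr_ge0// sqr_sqrtr; last by apply: sumr_ge0 => j _; exact: sqr_ge0.
apply: (@le_trans _ _ (\sum_(i < n) `|x| ^+ 2)).
  apply: ler_sum => i _; rewrite -sqr_normr ler_sqr ?nnegrE//; exact: rV_norm_coord.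
rewrite sumr_const card_ord -[_ n]mulr_natl exprMn; apply: ler_wpM2r => //.
by rewrite -natrX ler_nat; case: n => // k; rewrite expnS expn1 leq_pmull.
Qed.

Lemma continuous_sqdist y : continuous (fun x : E => \sum_i (x ord0 i - y ord0 i) ^+ 2).
Proof.
apply: smooth_continuous; apply: smooth_sum => i; apply: smoothX.
by apply: smoothB; [exact: smooth_coord|exact: smooth_cst].
Qed.

Lemma open_eball y r : open (eball y r).
Proof.
have [r0|r0] := ltP 0 r; last first.
  rewrite (_ : eball y r = set0); first exact: open0.
  by apply/seteqP; split => x //; rewrite /eball /= ltNge (le_trans r0) ?sqrtr_ge0.
rewrite (_ : eball y r = (fun x : E => \sum_i (x ord0 i - y ord0 i) ^+ 2) @^-1` [set s| s < r ^+ 2]).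
  by apply: open_comp; [move=> x _; exact: continuous_sqdist|exact: open_lt].
apply/seteqP; split => x; rewrite /= enormB_sqr ltr_sqr ?nnegrE ?sqrtr_ge0 ?_//.
Qed.

Lemma eball_sub_ball y r x : eball y r x -> ball y r x.
Proof. by rewrite /eball /= ballEC => h; apply: le_lt_trans h; exact: norm_le_enorm. Qed.

Lemma leb_open_gt0 U : open U -> U !=set0 -> (0 < leb n U)%E.
Proof.
move=> oU [x Ux]; have /nbhs_ballP[e /= e0 eU] := open_nbhs_nbhs (conj oU Ux).
apply: (@lt_le_trans _ _ (leb n (ball x e))).
  by rewrite leb_ball// lte_fin exprn_gt0// mulrn_wgt0.
apply: le_measure; rewrite ?inE//; exact: measurable_open.
Qed.

Lemma trace_value U v y : open U -> measurable_fun U v -> (forall r, 0 < r -> (U `&` eball y r) !=set0) ->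
  (forall e, 0 < e -> exists2 d, 0 < d & forall x, U x -> `|x - y| < d -> `|v x - v y| <= e) ->
  trace U v y = v y.
Proof.
move=> oU mv ne cv; apply: cvg_lim => //.
apply/cvgrPdist_le => e e0; have [d d0 Hd] := cv e e0.
near=> r; have r0 : 0 < r by [].
have rd : r < d by near: r; exact: nbhs_right_lt.
pose A := U `&` eball y r.
have oA : open A by apply: openI => //; exact: open_eball.
have mA : measurable A by exact: measurable_open.
have A0 : (0 < leb n A)%E by apply: leb_open_gt0 => //; exact: ne.
have Ar : A `<=` ball y r by move=> x [_ /eball_sub_ball].
have Aoo : (leb n A < +oo)%E.
  apply: (@le_lt_trans _ _ (leb n (ball y r))); last by rewrite leb_ball// ltry.
  by apply: le_measure; rewrite ?inE//; exact: measurable_ball_rV.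
have Af : leb n A \is a fin_num by rewrite ge0_fin_numE.
have mu0 : 0 < fine (leb n A) by rewrite -lte_fin fineK.
have vA x : A x -> v y - e <= v x <= v y + e.
  move=> [Ux /eball_sub_ball xy]; rewrite -ler_distlC distrC; apply: Hd => //.
   move: xy; rewrite ballEC => h; exact: lt_trans rd.
have ic c : (leb n).-integrable A (EFin \o cst c).
  apply/integrableP; split; first exact/measurable_EFinP.
  rewrite (eq_integral (cst (`|c|%:E))); last by [].
  by rewrite integral_cst// lte_mul_pinfty// ?lee_fin.
have iv : (leb n).-integrable A (EFin \o v).
  apply: (@le_integrable _ _ _ _ _ mA _ (EFin \o cst (`|v y| + e))) => //.
    by apply/measurable_EFinP; apply: measurable_funS mv => //; [exact: measurable_open|move=> x []].
  move=> x /vA /andP[h1 h2]; rewrite /= lee_fin (@ger0_norm _ (`|v y| + e)) ?_//.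
  by rewrite ler_norml; have := ler_norm (v y); have := ler_norm (- v y); rewrite normrN; lra.
have lo : (v y - e) * fine (leb n A) <= \int[leb n]_(x in A) v x by rewrite -Rintegral_cst//; apply: (le_Rintegral mA (ic _) iv) => x /vA /andP[].
have hi : \int[leb n]_(x in A) v x <= (v y + e) * fine (leb n A) by rewrite -Rintegral_cst//; apply: (le_Rintegral mA iv (ic _)) => x /vA /andP[].
rewrite /mean_near -/A ler_distlC; apply/andP; split.
  by rewrite ler_pdivlMl// mulrC.
by rewrite ler_pdivrMl// mulrC.
Unshelve. all: by end_near. Qed.

Lemma trace_near U v w y d : 0 < d -> (forall x, U x -> `|x - y| < d -> v x = w x) -> trace U v y = trace U w y.
Proof.
move=> d0 vw; rewrite /trace; congr lim; apply/seteqP.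
have H : \forall r \near (0 : R)^'+, mean_near U v y r = mean_near U w y r.
  near=> r; have rd : r < d by near: r; exact: nbhs_right_lt.
  congr (_ * _); apply: eq_Rintegral => x /set_mem[Ux /eball_sub_ball].
  by rewrite ballEC => h; apply: vw => //; exact: lt_trans rd.
split; apply: near_eq_cvg => //; apply: filterS H => r //.
Unshelve. all: by end_near. Qed.

Lemma hausdorff0 s : hausdorff s (set0 : set E) = 0%E.
Proof.
have H delta : ereal_inf [set e : \bar R| exists K C (r : nat -> R),
 hausdorff_cover delta (set0 : set E) K C r /\ e = \esum_(k in K) (r k ^+ s)%:E] = 0%E.
  apply/eqP; rewrite eq_le; apply/andP; split.
    apply: ereal_inf_lbound; exists set0, (fun=> set0), (fun=> 0); split; first by split.
    by rewrite esum_set0.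
  apply: le_ereal_inf_tmp => _ [K [C [r [[_ hr] ->]]]]; apply: esum_ge0 => k Kk.
  by have [/andP[r0]] := hr k Kk; rewrite lee_fin exprn_ge0.
rewrite -[RHS]ereal_sup1; congr ereal_sup; apply/seteqP; split => x /=.
  by move=> [delta _ <-]; rewrite H.
by move=> ->; exists 1 => //=.
Qed.

Lemma loc_int_tf U f psi : open U -> loc_integrable U f -> test_function U psi -> wint (@one R n) (fun x => f x * psi x).
Proof.
move=> oU [mf lf] tp; have [_ [K [cK KU K0]]] := tp; have [mp [C [_ [_ hC _]]]] := tf_bmfun tp.
have mK : measurable K by apply: measurable_closed; exact: compact_closedE.
have iK := (integrable_mkcond _ mK).1 (lf K cK KU).
apply: (wint_ext (f := fun x => (f \_ K) x * psi x)).
  move=> x; rewrite /patch; case: (boolP (x \in K)) => // /negP h.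
  by rewrite K0 ?mulr0// => /mem_set.
have w1 : wint (@one R n) (f \_ K).
  apply: integrable_wint; apply: eq_integrable iK => // x _ /=.
  by rewrite /patch; case: ifP.
apply: (@wint_le _ _ _ weight_one _ (fun x => C * `|(f \_ K) x|)).
- apply: mbfunM => //; apply: (measurable_restrictT _ mK).1.
  by apply: measurable_funS mf => //; exact: measurable_open.
- by move=> x; rewrite normrM mulrC ler_wpM2r.
- exact: wintZ _ (wint_abs weight_one w1).
Qed.

Lemma integral_tf U f : (forall x, ~ U x -> f x = 0) -> (\int[leb n]_(x in U) (f x)%:E = \int[leb n]_x (f x)%:E)%E.
Proof.
move=> f0; rewrite integral_mkcond; apply: eq_integral => x _; rewrite /patch; case: (boolP (x \in U)) => // /negP h.
by rewrite f0// => /mem_set.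
Qed.

Lemma tf_out U psi x : test_function U psi -> ~ U x -> psi x = 0.
Proof. by move=> [_ [K [_ KU K0]]] Ux; apply: K0 => /KU. Qed.

Lemma weak_deriv_I1 U i f g psi : is_weak_deriv U i f g -> test_function U psi ->
  \I[x] f x * partial i psi x = - \I[x] g x * psi x.
Proof.
move=> [_ _ H] tp; have := H _ tp.
have h1 x : ~ U x -> f x * partial i psi x = 0 by move=> Ux; rewrite (tf_out (tf_partial i tp) Ux) mulr0.
have h2 x : ~ U x -> g x * psi x = 0 by move=> Ux; rewrite (tf_out tp Ux) mulr0.
rewrite (integral_tf h1) (integral_tf h2) => h.
rewrite /wI /Rintegral -fineN; under eq_integral do rewrite mulr1.
by rewrite h; congr (fine (- _)); apply: eq_integral => x; rewrite /one mulr1.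
Qed.

Lemma I1_weak_deriv U i f g : open U -> loc_integrable U f -> loc_integrable U g ->
  (forall psi, test_function U psi -> \I[x] f x * partial i psi x = - \I[x] g x * psi x) ->
  is_weak_deriv U i f g.
Proof.
move=> oU lf lg; split => // psi tp; have w1 := loc_int_tf oU lf (tf_partial i tp); have w2 := loc_int_tf oU lg tp.
have h1 x : ~ U x -> f x * partial i psi x = 0 by move=> Ux; rewrite (tf_out (tf_partial i tp) Ux) mulr0.
have h2 x : ~ U x -> g x * psi x = 0 by move=> Ux; rewrite (tf_out tp Ux) mulr0.
rewrite (integral_tf h1) (integral_tf h2).
have EI h : wint one h -> (\int[leb n]_x (h x)%:E)%E = (I1 h)%:E.
  move=> wh; rewrite /wI /Rintegral fineK; first by apply: eq_integral => x _; rewrite /one mulr1.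
  exact: integrable_fin_num.
by rewrite !EI// H.
Qed.

Lemma loc_integrableD U f g c : open U -> loc_integrable U f -> loc_integrable U g ->
  loc_integrable U (fun x => f x + c * g x).
Proof.
move=> oU [mf lf] [mg lg]; split.
  by apply: measurable_funD => //; apply: measurable_funM.
move=> K cK KU; have mK : measurable K by apply: measurable_closed; exact: compact_closedE.
have := integrableD mK (lf K cK KU) (integrableZl mK c (lg K cK KU)).
by apply: eq_integrable.
Qed.

(** [weak_deriv] is a chosen representative, so an explicitly computed derivative can replace it
    only almost everywhere. *)
Lemma weak_deriv_unique U i f g h : open U -> is_weak_deriv U i f g -> is_weak_deriv U i f h ->
  {ae leb n, forall x, U x -> g x = h x}.
Proof.
move=> oU Hg Hh; have [_ lg _] := Hg; have [_ lh _] := Hh.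
have := fundamental_lemma oU (loc_integrableD (-1) oU lg lh) _.
move=> H; apply: filterS (H _) => [x h1 Ux|psi tp].
  by apply/eqP; rewrite -subr_eq0 -mulN1r; apply/eqP; exact: h1.
have w1 := loc_int_tf oU lg tp; have w2 := loc_int_tf oU lh tp.
have e1 := weak_deriv_I1 Hg tp; rewrite (weak_deriv_I1 Hh tp) in e1.
have h1 x : ~ U x -> (g x + -1 * h x) * psi x = 0 by move=> Ux; rewrite (tf_out tp Ux) mulr0.
rewrite /Rintegral (integral_tf h1).
have : \I[x] (g x * psi x - h x * psi x) = 0.
  rewrite (wIB w1 w2); apply/eqP; by rewrite subr_eq0 -eqr_opp e1.
move=> h0; rewrite -[RHS]h0 /wI /Rintegral; congr fine; apply: eq_integral => x _.
by rewrite /one mulr1 mulN1r mulrBl.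
Qed.

End mean_values.

(** * Reflection into the upper half space *)

Section even_reflection.
Context {R : realType} {m : nat}.
Local Notation E := 'rV[R]_(m + 1).
Implicit Types (c x y : E).

Lemma compact_closed_ball c (s : R) : compact [set x : E | `|x - c| <= s].
Proof.
apply: bounded_closed_compact.
  exists (`|c| + s); split; first exact: num_real.
  by move=> M hM y /= h; have := ler_normD (y - c) c; rewrite subrK; lra.
apply: (@preimage_closed _ _ (fun y : E => `|y - c|) [set s| s <= _]) => //.
by move=> y _; apply: (@continuous_comp _ _ _ (fun y : E => y + - c) (fun y : E => `|y|)); [exact: continuous_addv|exact: norm_continuous].
Qed.

Definition reflect_up x : E := x + (`|xn x| - xn x) *: 'e_nn.

Lemma xn_reflect_up x : xn (reflect_up x) = `|xn x|.
Proof. by rewrite xn_addn addrC subrK. Qed.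

Lemma reflect_up_id x : 0 <= xn x -> reflect_up x = x.
Proof. by move=> x0; rewrite /reflect_up ger0_norm// subrr scale0r addr0. Qed.

Lemma reflect_up_dist x y : `|reflect_up x - reflect_up y| <= `|x - y|.
Proof.
have sub (v w : E) l : (v - w) ord0 l = v ord0 l - w ord0 l by rewrite !mxE.
apply: rV_norm_le => // i; rewrite sub; case: (split_ordP i) => j ->.
  by rewrite /reflect_up !coord_addn; have := rV_norm_coord (x - y) (lshift 1 j); rewrite sub.
rewrite [j]ord1 -!/(xn _) !xn_reflect_up; apply: le_trans (ler_dist_dist _ _) _.
by have := rV_norm_coord (x - y) nn; rewrite sub.
Qed.

End even_reflection.

Lemma wint_penalty (R : realType) (m : nat) (lp lm t : R) (f phi : 'rV[R]_(m + 1) -> R) : 0 < lp -> 0 < lm ->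
  bmfun f -> bmfun phi ->
  wint (@one R m) (fun y : 'rV[R]_m => jd lp lm (f (emb y) + t * phi (emb y)) - jd lp lm (f (emb y))).
Proof.
move=> lp0 lm0 bf bphi.
have bp : bmfun (fun x => t * phi x) by apply: bmfunM => //; exact: mbfun_cst.
have bpe := bmfun_emb bp; have mfe := mbfun_emb bf.1.
apply: (wint_le weight_one _ _ (wintZ (lp + lm) (wint_abs weight_one (wint_one_bmfun bpe)))) => [|y].
  by apply: mbfunB; apply: mbfun_jd => //; apply: mbfunD => //; case: bpe.
exact: jd_lip.
Qed.

Lemma variation_arith (R : realType) (t A J Q F E P : R) : F <= t * J ->
  E + 2 * (P + 0) <= E + (2 * t * A + t ^+ 2 * Q) + 2 * (P + F) -> 0 <= t * (A + J + t * (Q / 2)).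
Proof.
move=> h1 h2; have -> : t * (A + J + t * (Q / 2)) = (2 * t * A + t ^+ 2 * Q) / 2 + t * J by field.
lra.
Qed.

(** * From the minimizer of the energy to the local first-order condition *)

Section minimizer_local.
Context {R : realType} {m : nat}.
Local Notation E := 'rV[R]_(m + 1).
Implicit Types (f g psi v w : E -> R) (x y : E) (r s t d e : R) (i : 'I_(m + 1)).
Variables (a lp lm : R) (D : set E) (u : E -> R).
Hypotheses (a01 : 0 <= a < 1) (lp0 : 0 < lp) (lm0 : 0 < lm) (oD : open D)
  (umin : minimizer a lp lm D u) (ucont : {within upper D `|` flat D, continuous u}).
Local Notation U := (upper D).
Let a0 : 0 <= a. Proof. by case/andP: a01. Qed.
Let hw := weight_wt m a0.

Lemma continuous_emb : continuous (@emb R m).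
Proof.
move=> y; apply/(@cvgrPdist_lt _ _ _ (nbhs y)) => e e0; apply/nbhs_ballP; exists e => //= k; rewrite ballE.
by rewrite -embB; apply: le_lt_trans; exact: norm_emb.
Qed.

Lemma open_upper : open U.
Proof. by apply: openI => //; exact: open_hp. Qed.

Lemma u_within y e : D y -> 0 <= xn y -> 0 < e ->
  exists2 d, 0 < d & forall x, `|x - y| < d -> 0 <= xn x -> D x /\ `|u x - u y| <= e.
Proof.
move=> Dy y0 e0; have mem x : D x -> 0 <= xn x -> (U `|` flat D) x.
  by move=> Dx; rewrite le_eqVlt => /orP[/eqP/esym x0|x0]; [right|left].
have /cvgrPdist_le/(_ _ e0) := @ucont y.
move=> h0; have : within (U `|` flat D) (nbhs y) (fun x => `|u y - u x| <= e).
  by rewrite (nbhs_subspace_in (mem _ Dy y0)).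
move=> /nbhs_ballP[d1 /= d10 h1]; have /nbhs_ballP[d2 /= d20 h2] := open_nbhs_nbhs (conj oD Dy).
exists (Num.min d1 d2) => [|x]; first by rewrite lt_min d10.
rewrite lt_min => /andP[x1 x2] x0; have Dx : D x by apply: h2; rewrite ballEC.
split => //; rewrite distrC; apply: h1; last exact: mem.
by rewrite ballEC.
Qed.

Lemma upper_near y r : D y -> xn y = 0 -> 0 < r -> (U `&` eball y r) !=set0.
Proof.
move=> Dy y0 r0; have /nbhs_ballP[d /= d0 hd] := open_nbhs_nbhs (conj oD Dy).
have c1 : 0 < (m + 1)%:R :> R by [].
pose t := Num.min (d / 2) (r / (2 * (m + 1)%:R)).
have t0 : 0 < t by rewrite lt_min divr_gt0// mulr_gt0.
have td : t <= d / 2 by rewrite ge_min lexx.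
have tr : t <= r / (2 * (m + 1)%:R) by rewrite ge_min lexx orbT.
have nt : `|t *: 'e_nn : E| <= t by exact/norm_scale_delta/ltW.
have yt : y + t *: 'e_nn - y = t *: 'e_nn by rewrite addrAC subrr add0r.
exists (y + t *: 'e_nn); split; first split.
- by apply: hd; rewrite ballEC yt; lra.
- by rewrite /= xn_addn y0 add0r.
- rewrite /eball /= yt; apply: le_lt_trans (enorm_le_norm _) _.
  apply: (@le_lt_trans _ _ ((m + 1)%:R * t)); first by rewrite ler_wpM2l.
  apply: (@le_lt_trans _ _ (r / 2)); last by lra.
  by rewrite mulrC -ler_pdivlMr// -mulrA -invfM.
Qed.

Lemma trace_flat (v : E -> R) y : measurable_fun U v -> D y -> xn y = 0 ->
  (forall e, 0 < e -> exists2 d, 0 < d & forall x, U x -> `|x - y| < d -> `|v x - v y| <= e) ->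
  trace U v y = v y.
Proof. by move=> mv Dy y0; apply: trace_value mv _ => [|r r0]; [exact: open_upper|exact: upper_near]. Qed.

Lemma trace_u y : D y -> xn y = 0 -> trace U u y = u y.
Proof.
move=> Dy y0; have [[mu _ _] _] := umin; apply: trace_flat => // e e0.
have y00 : 0 <= xn y by rewrite y0.
have [d d0 H] := u_within Dy y00 e0; exists d => // x [Dx /= x0] xy.
by have [|_] := H x xy; first exact: ltW.
Qed.

Let wd i := weak_deriv U i u.
Definition wd0 i : E -> R := wd i \_ U.

Let Hwd i : is_weak_deriv U i u (wd i).
Proof. by have [[_ _ /(_ i)[]]] := umin. Qed.

Lemma l2_patch (f : E -> R) : measurable_fun U f -> (\int[leb (m + 1)]_(x in U) (f x ^+ 2 * xn x `^ a)%:E < +oo)%E ->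
  l2 (wt a) (f \_ U).
Proof.
move=> mf foo; have mU := measurable_open open_upper.
have mfU : mbfun (f \_ U) by apply: (measurable_restrictT _ mU).1.
split => //; have H x : ((f \_ U) x ^+ 2 * wt a x)%:E = ((fun x => (f x ^+ 2 * xn x `^ a)%:E) \_ U) x.
  rewrite /patch; case: (boolP (x \in U)) => [/set_mem[_ hx]|_]; first by rewrite wtE.
  by rewrite -[X in X ^+ 2]/(0 : R) expr0n mul0r.
apply/integrableP; split; first by apply/measurable_EFinP; apply: mbfunM; [exact: mbfunX|exact: mbfun_wt].
rewrite (eq_integral ((fun x => (f x ^+ 2 * xn x `^ a)%:E) \_ U)); last first.
  by move=> x _; rewrite -H gee0_abs// lee_fin mulr_ge0 ?sqr_ge0// (weight_ge0 hw).
by rewrite -integral_mkcond.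
Qed.

Lemma l2_wd0 i : l2 (wt a) (wd0 i).
Proof.
apply: l2_patch; first by have [_ []] := Hwd i.
by have [[_ _ /(_ i)[]]] := umin.
Qed.

Lemma integral_patch (f : E -> R) : (\int[leb (m + 1)]_(x in U) (f x * xn x `^ a)%:E = \int[leb (m + 1)]_x ((f \_ U) x * wt a x)%:E)%E.
Proof.
rewrite integral_mkcond; apply: eq_integral => x _; rewrite /patch.
case: (boolP (x \in U)) => [/set_mem[_ hx]|_]; first by rewrite wtE.
by rewrite -[X in X * _]/(0 : R) mul0r.
Qed.

Section competitor.
Variables (z : E) (r : R) (phi : E -> R) (Gam : 'I_(m + 1) -> E -> R).
Hypotheses (zD : ball z r `<=` D) (adm : admissible a (ball z r) phi Gam).
Variable t : R.
Let w x := u x + t * phi x.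

Let cphi : continuous phi. Proof. by case: adm. Qed.
Let lGam i : l2 (wt a) (Gam i). Proof. by case: adm. Qed.
Let mphi : mbfun phi. Proof. exact: mbfun_continuous. Qed.
Let bphi : bmfun phi.
Proof. by case: adm => c [K [cK _ K0]] _ _; exact: (bmfun_compact c cK (fun x Kx => (K0 x Kx).1)). Qed.

Lemma loc_int_l2 g : l2 (wt a) g -> loc_integrable U g.
Proof.
move=> [mg lg]; split; first exact: measurable_funS mg.
move=> K cK KU; have mK : measurable K by apply: measurable_closed; exact: compact_closedE.
have [c c0 Hc] : exists2 c, 0 < c & forall x, K x -> c <= xn x by apply: compact_hp => // x /KU[].
have ca : 0 < c `^ a by [].
have i1 : (leb _).-integrable K (EFin \o (fun x => (c `^ a)^-1 * (g x ^+ 2 * wt a x) + 1)).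
  have iA := integrableZl mK (c `^ a)^-1 (integrableS measurableT mK (@subsetT _ _) lg).
  have i2 : (leb _).-integrable K (EFin \o cst (1 : R)).
    have [b b0 hb] := compact_ball cK; apply/integrableP; split; first exact/measurable_EFinP.
    rewrite (eq_integral (cst 1%E)); last by move=> x _ /=; rewrite normr1.
    rewrite integral_cst// mul1e; apply: (@le_lt_trans _ _ (leb (m + 1) (ball 0 b))); last by rewrite leb_ball// ltry.
    by apply: le_measure; rewrite ?inE//; exact: measurable_ball_rV.
  by have := integrableD mK iA i2; apply: eq_integrable.
apply: (le_integrable mK _ _ i1); first by apply/measurable_EFinP; exact: measurable_funS mg.
move=> x Kx; rewrite lee_fin [X in _ <= X]ger0_norm; last first.
  by rewrite addr_ge0// mulr_ge0 ?invr_ge0 ?powR_ge0// mulr_ge0 ?sqr_ge0// (weight_ge0 hw).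
have [_ hx] := KU x Kx; rewrite wtE//.
have h : c `^ a <= xn x `^ a by apply: ge0_ler_powR; rewrite ?nnegrE ?_//; exact: Hc.
apply: (@le_trans _ _ (g x ^+ 2 + 1)).
  have := sqr_ge0 (`|g x| - 1); rewrite sqrrB1 sqr_normr mulr2n.
  by have := sqr_ge0 (g x); lra.
rewrite lerD2r ler_pdivlMl// mulrC ler_wpM2l ?sqr_ge0//.
Qed.

Lemma competitor_deriv i : is_weak_deriv U i w (fun x => wd i x + t * Gam i x).
Proof.
have lphi := loc_int_l2 (l2_bmfun hw bphi); have lG := loc_int_l2 (lGam i).
have [lu lwd _] := Hwd i; have oU := open_upper.
apply: I1_weak_deriv => //; [exact: loc_integrableD|exact: loc_integrableD|].
move=> psi tp; have w1 := loc_int_tf oU lu (tf_partial i tp); have w2 := loc_int_tf oU lwd tp.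
have w3 := loc_int_tf oU lphi (tf_partial i tp); have w4 := loc_int_tf oU lG tp.
have tph : test_function hp psi by apply: tf_sub tp => x [].
have [_ _ _ dg] := adm; have e2 := dg i psi tph; have e1 := weak_deriv_I1 (Hwd i) tp.
transitivity (wI one (fun x => u x * partial i psi x) + t * wI one (fun x => phi x * partial i psi x)).
  rewrite -wIZ// -wID//; last exact: wintZ.
  by apply: wI_ext => x; rewrite /w mulrDl mulrA.
rewrite e1 e2 mulrN -opprD; congr (- _); rewrite -wIZ// -wID//; last exact: wintZ.
by apply: wI_ext => x; rewrite mulrDl mulrA.
Qed.

Lemma is_weak_deriv_w i : is_weak_deriv U i w (weak_deriv U i w).
Proof. by rewrite /weak_deriv; case: xgetP => [g _ //|/(_ _ (competitor_deriv i))]. Qed.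

Lemma competitor_wd i : {ae leb (m + 1), forall x, U x -> weak_deriv U i w x = wd i x + t * Gam i x}.
Proof. exact: (weak_deriv_unique open_upper (is_weak_deriv_w i) (competitor_deriv i)). Qed.

(** Exchanges the chosen weak derivatives of the competitor for the explicit ones under an integral.
    [P] is a single square for the Sobolev norm and the sum of squares for the energy. *)
Lemma integral_wd_w (P : ('I_(m + 1) -> R) -> R) :
  (forall g : 'I_(m + 1) -> E -> R, (forall i, measurable_fun U (g i)) -> measurable_fun U (fun x => P (g ^~ x))) ->
  (\int[leb (m + 1)]_(x in U) (P (fun i => weak_deriv U i w x) * xn x `^ a)%:E =
   \int[leb (m + 1)]_(x in U) (P (fun i => wd i x + t * Gam i x) * xn x `^ a)%:E)%E.
Proof.
move=> mP; have mx : measurable_fun U (fun x : E => xn x `^ a).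
  by apply: measurable_funS (measurableT_comp (measurable_powR a) mbfun_xn).
have mm (g : 'I_(m + 1) -> E -> R) : (forall i, measurable_fun U (g i)) -> measurable_fun U (fun x => (P (g ^~ x) * xn x `^ a)%:E) by move=> mg; apply/measurable_EFinP; apply: measurable_funM => //; exact: mP.
apply: ae_eq_integral; first exact: measurable_open open_upper.
- by apply: mm => i; have [_ []] := is_weak_deriv_w i.
- by apply: (mm (fun i x => wd i x + t * Gam i x)) => i; have [_ []] := competitor_deriv i.
- apply: filterS (filter_forall _ competitor_wd) => x h Ux; congr (P _ * _)%:E.
  by apply/funext => i; rewrite h.
Qed.

Lemma competitor_W12 : W12 a U w.
Proof.
have mU := measurable_open open_upper; have [[mu uoo _] _] := umin.
have l2oo f : mbfun f -> l2 (wt a) f -> forall g, (forall x, U x -> g x = f x) ->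
 (\int[leb _]_(x in U) (g x ^+ 2 * xn x `^ a)%:E < +oo)%E.
  move=> mf [_ lf] g gf.
  have := integral_fune_lt_pinfty mU (integrableS measurableT mU (@subsetT _ _) lf).
  by congr (_ < _)%E; apply: eq_integral => x /set_mem Ux; rewrite /= gf// wtE//; case: Ux.
have lu := l2_patch mu uoo.
have lw : l2 (wt a) (fun x => (u \_ U) x + t * phi x) by apply: (l2D hw lu); apply: l2Z; exact: (l2_bmfun hw bphi).
split.
- by apply: measurable_funD => //; apply: measurable_funM => //; exact: measurable_funS mphi.
- by apply: (l2oo _ lw.1 lw) => x Ux; rewrite /w /patch mem_set.
- move=> i; split; first exact: is_weak_deriv_w.
  rewrite (integral_wd_w (P := fun h => h i ^+ 2)); last by move=> g mg; exact: measurable_funX.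
  have lg : l2 (wt a) (fun x => wd0 i x + t * Gam i x) by apply: (l2D hw (l2_wd0 i)); exact: l2Z.
  by apply: (l2oo _ lg.1 lg) => x Ux; rewrite /wd0 /patch mem_set.
Qed.

Lemma competitor_trace y : D y -> xn y = 0 -> trace U w y = w y.
Proof.
move=> Dy y0; have [[mu _ _] _] := umin; apply: trace_flat => //.
  by apply: measurable_funD => //; apply: measurable_funM => //; exact: measurable_funS mphi.
move=> e e0; have e2 : 0 < e / 2 by [].
have y00 : 0 <= xn y by rewrite y0.
have [d d0 H] := u_within Dy y00 e2.
have T0 : 0 < e / 2 / (`|t| + 1) by [].
have /cvgrPdist_le/(_ _ T0)/nbhs_ballP[d1 /= d10 h1] := @cphi y.
exists (Num.min d d1) => [|x [Dx /= x0]]; first by rewrite lt_min d0.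
rewrite lt_min => /andP[xd xd1]; have [_ hu] := H x xd (ltW x0).
have hp' : `|phi y - phi x| <= e / 2 / (`|t| + 1) by apply: h1; rewrite ballEC.
have -> : w x - w y = (u x - u y) - t * (phi y - phi x) by rewrite /w; ring.
apply: le_trans (ler_normB _ _) _; rewrite normrM.
have : `|t| * `|phi y - phi x| <= e / 2.
  apply: (@le_trans _ _ ((`|t| + 1) * (e / 2 / (`|t| + 1)))); last by rewrite mulrC divfK// gt_eqF// ltr_wpDl.
  by apply: ler_pM => //; rewrite lerDl.
lra.
Qed.

(** The variation has compact support in a ball inside the open set [D], so the competitor equals
    [u] near every boundary point and the exceptional set is empty. *)
Lemma competitor_bd : same_boundary_values D w u.
Proof.
rewrite /same_boundary_values (_ : _ `&` _ = set0) ?hausdorff0//; apply/seteqP; split => y //.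
move=> [[[_ nDi] _] /=]; apply.
have Dy : ~ D y by move=> Dy; apply: nDi; exact: open_nbhs_nbhs.
have [_ [K [cK KB K0]] _ _] := adm.
have Ky : (~` K) y by move=> /KB/zD.
have /nbhs_ballP[d /= d0 hd] := open_nbhs_nbhs (conj (closed_openC (compact_closedE cK)) Ky).
apply: (trace_near d0) => x _ xy; rewrite /w (K0 x _).1 ?mulr0 ?addr0//.
by apply: hd; rewrite ballEC.
Qed.

Lemma interior_energy : (\int[leb (m + 1)]_(x in U) (grad_sq U w x * xn x `^ a)%:E =
  (\I_a[x] \sum_i (wd0 i x + t * Gam i x) ^+ 2)%:E)%E.
Proof.
rewrite (integral_wd_w (P := fun h => \sum_i h i ^+ 2)); last first.
  by move=> g mg; apply: measurable_sum => i; exact: measurable_funX.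
rewrite (integral_patch (fun x => \sum_i _ ^+ 2)) fineK; last first.
  have iw : wint (wt a) (fun x => \sum_i (wd0 i x + t * Gam i x) ^+ 2).
    apply: wint_sum => i; have [] // : l2 (wt a) (fun x => wd0 i x + t * Gam i x).
    by apply: (l2D hw (l2_wd0 i)); exact: l2Z.
  exact: integrable_fin_num iw.
apply: eq_integral => x _; congr (_)%:E; rewrite /wd0 /patch; case: (boolP (x \in U)) => // /negP xU.
have [h|h] := boolP (0 < xn x); last by rewrite /wt (negbTE h) !mulr0.
have [_ [K [_ KB K0]]] := adm; rewrite big1 ?mul0r// => i _.
rewrite -[X in X + _]/(0 : R) add0r (K0 x _).2 ?mulr0 ?expr0n// => /KB/zD Dx; apply: xU; exact: mem_set.
Qed.

Variable f : E -> R.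
Hypotheses (bf : bmfun f) (fu : forall y : 'rV[R]_m, ball z r (emb y) -> f (emb y) = u (emb y)).
Hypothesis hflat : (leb m).-integrable (flat' D) (fun y : 'rV[R]_m => (u (emb y))%:E).

Lemma open_flat' : open (flat' D).
Proof. by apply: open_comp => // y _; exact: continuous_emb. Qed.

(** [f] is a bounded function with bounded support that agrees with [u] on the flat part of the
    ball, so the change of penalty is an integral over all of R^m. Integrability of [u] on the flat
    part allows the penalty of [u] to be split off. *)
Lemma flat_energy : (\int[leb m]_(y in flat' D) (lp * Num.max (trace U w (emb y)) 0 + lm * Num.max (- trace U w (emb y)) 0)%:E =
  (\int[leb m]_(y in flat' D) jd lp lm (u (emb y)) + flatI (fun x => jd lp lm (f x + t * phi x) - jd lp lm (f x)))%:E)%E.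
Proof.
have mD := measurable_open open_flat'; have [_ [K [_ KB K0]] _ _] := adm.
pose q (y : 'rV[R]_m) := jd lp lm (f (emb y) + t * phi (emb y)) - jd lp lm (f (emb y)).
have iq := wint_penalty t lp0 lm0 bf bphi; rewrite -/q in iq.
have q0 (y : 'rV[R]_m) : ~ flat' D y -> q y = 0 by move=> Dy; rewrite /q (K0 _ _).1 ?mulr0 ?addr0 ?subrr// => /KB/zD.
have iqD : (leb m).-integrable (flat' D) (EFin \o q).
  have := integrableS measurableT mD (@subsetT _ _) iq; apply: eq_integrable => // y _ /=.
  by rewrite /one mulr1.
have iu : (leb m).-integrable (flat' D) (EFin \o (fun y : 'rV[R]_m => jd lp lm (u (emb y)))).
  have mu : measurable_fun (flat' D) (fun y : 'rV[R]_m => u (emb y)) by apply/measurable_EFinP; case/integrableP: hflat.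
  apply: (le_integrable mD _ _ (integrableZl mD (lp + lm) (integrable_abse hflat))).
    by apply/measurable_EFinP; apply: measurable_funD; apply: measurable_funM => //; apply: measurable_maxr => //; exact: measurableT_comp mu.
  by move=> y _; rewrite /= lee_fin normrM normr_id (ger0_norm (addr_ge0 (ltW lp0) (ltW lm0))); exact: jd_norm.
rewrite (eq_integral (fun y : 'rV[R]_m => (jd lp lm (u (emb y)) + q y)%:E)); last first.
  move=> y /set_mem Dy; rewrite (competitor_trace Dy (xn_emb _)); congr EFin; rewrite /q /w -/(jd lp lm _).
  have [yB|yB] := pselect (ball z r (emb y)); first by rewrite fu//; ring.
  by rewrite (K0 (emb y) _).1 ?mulr0 ?addr0 ?subrr ?addr0// => /KB.
rewrite integralD_EFin// EFinD fineK; last exact: integrable_fin_num.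
congr (_ _)%E; rewrite integral_tf// fineK; last exact: integrable_fin_num.
by apply: eq_integral => y _; rewrite /one mulr1.
Qed.

Lemma energy_w : energy a lp lm D w =
  (\I_a[x] \sum_i (wd0 i x + t * Gam i x) ^+ 2 +
   2 * (\int[leb m]_(y in flat' D) jd lp lm (u (emb y)) + flatI (fun x => jd lp lm (f x + t * phi x) - jd lp lm (f x))))%:E.
Proof. by rewrite /energy interior_energy flat_energy. Qed.

End competitor.

(** Compare with u + t phi: the Dirichlet part is quadratic in t, and by convexity the penalty grows
    by at most t times its full increment. Dividing by t and letting t decrease to 0 gives the
    inequality. *)
Lemma minimizer_EL z r phi Gam f : ball z r `<=` D -> admissible a (ball z r) phi Gam -> bmfun f ->
  (forall y : 'rV[R]_m, ball z r (emb y) -> f (emb y) = u (emb y)) ->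
  (leb m).-integrable (flat' D) (fun y : 'rV[R]_m => (u (emb y))%:E) ->
  0 <= \I_a[x] \sum_i wd0 i x * Gam i x + flatI (fun x => jd lp lm (f x + phi x) - jd lp lm (f x)).
Proof.
move=> zD adm bf fu hflat; have [_ _ lG _] := adm.
have w1 : wint (wt a) (fun x => \sum_i wd0 i x * Gam i x) by apply: wint_sum => i; exact: (wint_mul hw (l2_wd0 i)).
have w2 : wint (wt a) (fun x => \sum_i Gam i x * Gam i x) by apply: wint_sum => i; exact: wint_mul.
have w3 : wint (wt a) (fun x => \sum_i wd0 i x * wd0 i x) by apply: wint_sum => i; exact: (wint_mul hw (l2_wd0 i) (l2_wd0 i)).
set A := wI _ _; set J := flatI _; set Q := \I_a[x] \sum_i Gam i x * Gam i x.
have Et t : \I_a[x] \sum_i (wd0 i x + t * Gam i x) ^+ 2 = \I_a[x] \sum_i wd0 i x * wd0 i x + (2 * t * A + t ^+ 2 * Q).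
  rewrite -wIZ// -wIZ// -wID; [|exact: wintZ|exact: wintZ].
  rewrite -wID//; last by apply: wintD => //; exact: wintZ.
  apply: wI_ext => x; rewrite !mulr_sumr -!big_split; apply: eq_bigr => i _ /=; ring.
have Jt t : 0 < t <= 1 -> flatI (fun x => jd lp lm (f x + t * phi x) - jd lp lm (f x)) <= t * J.
  move=> /andP[t0 t1]; have tt : 0 <= t <= 1 by rewrite (ltW t0).
  have pt s : wint (@one R m) (fun y : 'rV[R]_m => jd lp lm (f (emb y) + s * phi (emb y)) - jd lp lm (f (emb y))) by case: adm => cphi [K [cK _ K0]] _ _; exact: wint_penalty lp0 lm0 bf (bmfun_compact cphi cK (fun x Kx => (K0 x Kx).1)).
  have p1 : wint (@one R m) (fun y : 'rV[R]_m => jd lp lm (f (emb y) + phi (emb y)) - jd lp lm (f (emb y))) by move: (pt 1); apply: wint_ext => y; rewrite mul1r.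
  rewrite /J -wIZ//; apply: (wI_le weight_one) => [||y] //; first exact: wintZ.
  have := jd_convex lp0 lm0 (f (emb y)) (f (emb y) + phi (emb y)) tt.
  by rewrite [f _ + phi _ - _]addrAC subrr add0r; lra.
have key t : 0 < t <= 1 -> 0 <= A + J + t * (Q / 2).
  move=> tt; have /andP[t0 _] := tt; have [_ umin'] := umin.
  have := umin' _ (competitor_W12 adm t) (competitor_bd zD adm t).
  rewrite (energy_w zD adm t bf fu hflat).
  have := energy_w zD adm 0 bf fu hflat; rewrite (_ : (fun x => u x + 0 * phi x) = u); last first.
    by apply/funext => x; rewrite mul0r addr0.
  move=> ->; rewrite lee_fin !Et mulr0 mul0r expr0n !mul0r !addr0.
  have -> : flatI (fun x => jd lp lm (f x + 0 * phi x) - jd lp lm (f x)) = 0 by rewrite -[RHS](wI0 (@one R m)); apply: wI_ext => y; rewrite mul0r addr0 subrr.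
  by move=> h2; rewrite -(pmulr_rge0 _ t0); exact: variation_arith (Jt t tt) h2.
have [//|h] := leP; have Q0 : 0 <= Q.
  by apply: (wI_ge0 hw) => x; apply: sumr_ge0 => i _; rewrite -expr2 sqr_ge0.
pose t := Num.min 1 (- (A + J) / (Q + 1)).
have Q1 : 0 < Q + 1 by [].
have t0 : 0 < t by rewrite lt_min ltr01 divr_gt0// oppr_gt0.
have t1 : t <= 1 by rewrite ge_min lexx.
have := key t; rewrite t0 t1 => /(_ isT); have : t * (Q + 1) <= - (A + J) by rewrite -ler_pdivlMr// ge_min lexx orbT.
rewrite mulrDr mulr1 mulrA; lra.
Qed.

(** The even reflection supplies values below the flat part and makes [f] continuous on the full
    ball, which is the form of continuity in [local_min]; above the flat part [f] is [u]. *)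
Lemma reflected_patch z r : 0 < r -> (forall x, `|x - z| < 2 * r -> D (reflect_up x)) ->
  exists f G, [/\ bmfun f, forall x, ball z r x -> {for x, continuous f} /\ f x = u (reflect_up x),
    forall i, l2 (wt a) (G i), forall i x, (ball z r x -> G i x = wd0 i x) /\ (~ ball z r x -> G i x = 0) &
    dgrad (hp `&` ball z r) f G].
Proof.
move=> rp refD; have cu x : `|x - z| < 2 * r -> {for x, continuous (u \o reflect_up)}.
  move=> xr; apply/(@cvgrPdist_le _ _ _ (nbhs x)) => e e0.
  have x0 : 0 <= xn (reflect_up x) by rewrite xn_reflect_up.
  have [d d0 H] := u_within (refD _ xr) x0 e0; apply/nbhs_ballP; exists d => // x1; rewrite ballE => x1d.
  have [||] := H (reflect_up x1); last by rewrite distrC.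
  - by apply: le_lt_trans (reflect_up_dist _ _) _; rewrite distrC.
  - by rewrite xn_reflect_up.
pose B : set E := ball z r; pose f x := if x \in B then u (reflect_up x) else 0.
have fE x : ball z r x -> f x = u (reflect_up x) by move=> xB; rewrite /f mem_set.
have BE x : ball z r x -> `|x - z| < r by rewrite ballEC.
have inr x : `|x - z| <= r -> `|x - z| < 2 * r by lra.
have [C HC] : exists C : R, forall x, ball z r x -> `|u (reflect_up x)| <= C.
  have K0 : [set x | `|x - z| <= r] !=set0 by exists z; rewrite /= subrr normr0 ltW.
  have cV : {within [set x | `|x - z| <= r], continuous (fun x => `|u (reflect_up x)|)}.
    apply: continuous_in_subspaceT => x /set_mem/inr/cu c1.
    by apply: (@continuous_comp _ _ _ (u \o @reflect_up R m) (fun s : R => `|s|)) => //; exact: norm_continuous.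
  have [c _ Hc] := EVT_max_rV K0 (@compact_closed_ball R m z r) cV.
  by exists `|u (reflect_up c)| => x /BE/ltW xB; apply: Hc; exact: mem_set.
have mB := measurable_ball_rV z r.
exists f, (fun i x => if x \in B then wd0 i x else 0); split.
- split.
    apply: (measurable_restrictT (u \o @reflect_up R m) mB).1.
    by apply: measurable_fun_continuous => [|x /BE/ltW/inr]; [exact: ball_open|exact: cu].
  exists (Num.max C 0), (`|z| + r + 1); split => [|x|x xb]; first by have := normr_ge0 z; lra.
    by rewrite /f; case: ifP => [/set_mem/HC h|_]; rewrite ?normr0 le_max ?h ?lexx ?orbT.
  rewrite /f; case: ifP => // /set_mem/BE xB; exfalso; apply: xb; rewrite ballE sub0r normrN.
  by have := ler_normD (x - z) z; rewrite subrK; lra.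
- move=> x xB; split; last exact: fE.
  have nB : \forall y \near x, ball z r y by apply: open_nbhs_nbhs; split => //; exact: ball_open.
  apply/(@cvgrPdist_le _ _ _ (nbhs x)) => e e0.
  have /cvgrPdist_le/(_ _ e0) h := cu x (inr x (ltW (BE x xB))).
  by apply: filterS2 nB h => x1 /fE ->; rewrite fE.
- move=> i; have [mw lw] := l2_wd0 i; split; first exact: mbfun_if.
  apply: (wint_le hw _ _ lw); first by apply: mbfunX; exact: mbfun_if.
  by move=> x; rewrite ger0_norm ?sqr_ge0//; case: ifP => // _; rewrite expr0n sqr_ge0.
- by move=> i x; split => xB; [rewrite mem_set|rewrite memNset].
- have BD x : 0 < xn x -> ball z r x -> U x by move=> x0 /BE/ltW/inr/refD; rewrite reflect_up_id// ltW.
  move=> i psi tp; have tU : test_function U psi by apply: tf_sub tp => x [x0 /(BD _ x0)].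
  have e1 := weak_deriv_I1 (Hwd i) tU.
  have outs x (g : R) : ~ (hp `&` ball z r) x -> g * partial i psi x = 0 /\ g * psi x = 0 by move=> xB; rewrite (tf_out tp xB) (tf_out (tf_partial i tp) xB) !mulr0.
  rewrite (@wI_ext _ _ _ _ (fun x => u x * partial i psi x)); last first.
    move=> x; have [[x0 xB]|xB] := pselect ((hp `&` ball z r) x); last by rewrite !(outs x _ xB).1.
    by rewrite fE// reflect_up_id// ltW.
  rewrite e1; congr (- _); apply: wI_ext => x; have [[x0 xB]|xB] := pselect ((hp `&` ball z r) x); last by rewrite !(outs x _ xB).2.
  by rewrite mem_set// /wd0 /patch mem_set//; exact: BD.
Qed.

Lemma minimizer_local_min (y : 'rV[R]_m) : flat' D y ->
  (leb m).-integrable (flat' D) (fun y : 'rV[R]_m => (u (emb y))%:E) ->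
  exists r f G, local_min a lp lm (emb y) r f G /\
    forall k : 'rV[R]_m, `|k| < r -> flat' D (y + k) /\ f (emb y + emb k) = u (emb (y + k)).
Proof.
move=> Dy hflat; set z : E := emb y; have z0 : xn z = 0 by exact: xn_emb.
have /nbhs_ballP[r0 /= r00 h0] := open_nbhs_nbhs (conj oD Dy : open_nbhs z D).
pose r := r0 / 2; have rp : 0 < r by rewrite divr_gt0.
have r2 : 2 * r = r0 by rewrite /r; field.
have zD : ball z r `<=` D by apply: subset_trans h0; apply: le_ball; lra.
have zz : reflect_up z = z by rewrite reflect_up_id// z0.
have refD x : `|x - z| < 2 * r -> D (reflect_up x) by rewrite r2 => xr; apply: h0; rewrite ballEC; apply: le_lt_trans xr; rewrite -{1}zz; exact: reflect_up_dist.
have [f [G [bf fE lG GE dG]]] := reflected_patch rp refD.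
have ball_flat (y1 : 'rV[R]_m) : ball z r (emb y1) -> f (emb y1) = u (emb y1) by move=> /fE[_ ->]; rewrite reflect_up_id// xn_emb.
exists r, f, G; split; last first.
  move=> k kr; have zk : ball z r (z + emb k).
    by rewrite ballE opprD addNKr normrN; apply: le_lt_trans (norm_emb _) kr.
  by rewrite /flat' /= embD; split; [exact: zD|rewrite -embD ball_flat embD].
split => //; first by move=> x /fE[].
  by move=> i x /(GE i x).2.
move=> phi Gam adm; have := minimizer_EL zD adm bf ball_flat hflat.
congr (_ <= _ + _); apply: wI_ext => x; apply: eq_bigr => i _.
have [xB|xB] := pselect (ball z r x); first by rewrite (GE i x).1.
by have [_ [K [_ KB K0]]] := adm; rewrite (K0 x _).2 ?mulr0// => /KB.
Qed.

End minimizer_local.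

(** * Connectedness of the unit interval *)

Section real_intervals.
Context {R : realType}.
Implicit Types (t s d : R) (P : R -> Prop).

Lemma open_locally_true (A : set R) P : open [set t | exists2 d, 0 < d & forall s, A s -> `|s - t| < d -> P s].
Proof.
rewrite openE => t [d d0 H]; have d2 : 0 < d / 2 by [].
apply/nbhs_ballP; exists (d / 2) => // t' tt'; exists (d / 2) => // s sA st; apply: H => //.
have {}tt' : `|t - t'| < d / 2 by [].
by have := ler_distD t' s t; rewrite [`|t' - t|]distrC; lra.
Qed.

Lemma unit_interval_locally_constant P : P 0 ->
  (forall t, 0 <= t <= 1 -> exists2 d, 0 < d & forall s, 0 <= s <= 1 -> `|s - t| < d -> (P s <-> P t)) -> P 1.
Proof.
move=> P0 H; pose A : set R := [set t | 0 <= t <= 1].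
have cA : connected A by rewrite (_ : A = `[0, 1]%classic); [exact: segment_connected|apply/seteqP; split => t; rewrite /= in_itv].
have A0 : A 0 by rewrite /A /= lexx ler01.
have self Q t : A t -> (exists2 d, 0 < d & forall s, A s -> `|s - t| < d -> Q s) -> Q t by move=> At [d d0]; apply => //; rewrite subrr normr0.
have E : A `&` P = A.
  apply: cA; first by exists 0.
    exists [set t | exists2 d, 0 < d & forall s, A s -> `|s - t| < d -> P s]; first exact: open_locally_true.
    apply/seteqP; split => t [At Pt]; split => //; last exact: self Pt.
    by have [d d0 Hd] := H t At; exists d => // s sA st; apply/(Hd s sA st).
  exists (~` [set t | exists2 d, 0 < d & forall s, A s -> `|s - t| < d -> ~ P s]).
    by apply: open_closedC; exact: (@open_locally_true A (fun s => ~ P s)).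
  apply/seteqP; split => t [At Pt]; split => //; first by move=> /(self (fun s => ~ P s) t At).
  apply: contrapT => nP; apply: Pt; have [d d0 Hd] := H t At; exists d => // s sA st.
  by move/(Hd s sA st).
by have : (A `&` P) 1; [rewrite E /A /= ler01 lexx|case].
Qed.

End real_intervals.

(** * Bi-Lipschitz charts and chains of balls descending to the flat part *)

Section half_ball_charts.
Context {R : realType} {m : nat}.
Local Notation E := 'rV[R]_(m + 1).
Local Notation dim := ((m + 1)%:R : R).
Local Notation B1 := (eball (0 : E) 1).
Implicit Types (q w x y c : E) (r s t d rho sg : R) (i : 'I_(m + 1)).

Lemma eball_sqd q : B1 q <-> sqd 0 q < 1.
Proof.
have -> : sqd 0 q = enorm (q - 0) ^+ 2 by exact: enormB_sqr.
by rewrite /eball /= -[X in _ ^+ 2 < X](expr1n _ 2) ltr_sqr// nnegrE ?sqrtr_ge0.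
Qed.

Lemma eball_convex q w t : B1 q -> B1 w -> 0 <= t <= 1 -> B1 (q + t *: (w - q)).
Proof.
move=> /eball_sqd h1 /eball_sqd h2 /andP[t0 t1]; apply/eball_sqd.
apply: (@le_lt_trans _ _ ((1 - t) * sqd 0 q + t * sqd 0 w)).
  rewrite /sqd !mulr_sumr -big_split /=; apply: ler_sum => i _; rewrite !mxE !subr0.
  set a := q _ _; set b := w _ _; rewrite -subr_ge0.
  rewrite [leRHS](_ : _ = t * ((1 - t) * (a - b) ^+ 2)); last by ring.
  by rewrite mulr_ge0// mulr_ge0 ?sqr_ge0// subr_ge0.
have [-> |t2] := eqVneq t 1; first by lra.
have t3 : 0 < 1 - t by rewrite subr_gt0 lt_neqAle t2.
have := ltr_pM2l t3 (sqd 0 q) 1; rewrite h1 => h3; have := ler_wpM2l t0 (ltW h2); lra.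
Qed.

(** The chart maps the flat part to the flat part but may send the upper part of [D] to either half
    of the ball; the sign [sg] records which half is used. *)
Definition half_ball sg : set E := [set q | B1 q /\ 0 < sg * xn q].
Definition half_center sg : E := (sg / 2) *: 'e_nn.

Lemma half_center_near sg w : `|sg| = 1 -> `|w - half_center sg| <= (4 * dim)^-1 -> half_ball sg w.
Proof.
move=> s1 wc; have d1 : 1 <= dim := @dim_ge1 R m; have dp : 0 < dim by [].
have wi i : `|w ord0 i - half_center sg ord0 i| <= (4 * dim)^-1.
  have := rV_norm_coord (w - half_center sg) i; rewrite !mxE => h; exact: le_trans wc.
have q0 : (4 * dim)^-1 <= 4^-1 by rewrite lef_pV2 ?posrE; lra.
have cn i : half_center sg ord0 i = (i == nn)%:R * (sg / 2) by rewrite !mxE eqxx /= mulrC.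
have sg2 : sg ^+ 2 = 1 by rewrite -sqr_normr s1 expr1n.
split; last first.
  have := wi nn; rewrite cn eqxx mul1r -/(xn w) => h.
  have : `|sg * (xn w - sg / 2)| <= 4^-1 by rewrite normrM s1 mul1r; exact: le_trans q0.
  have -> : sg * (xn w - sg / 2) = sg * xn w - sg ^+ 2 / 2 by field.
  by rewrite sg2 ler_norml => /andP[]; lra.
apply/eball_sqd; apply: (@le_lt_trans _ _ (\sum_i (2 * half_center sg ord0 i ^+ 2 + 2 * (4 * dim)^-1 ^+ 2))).
  apply: ler_sum => i _; rewrite mxE subr0; have : `|w ord0 i - half_center sg ord0 i| ^+ 2 <= (4 * dim)^-1 ^+ 2.
    by apply: lerXn2r => //; rewrite nnegrE// invr_ge0 mulr_ge0.
  rewrite sqr_normr.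
  set A := w _ _; set B := half_center _ _ _; have := sqr_ge0 (A - B - B); rewrite !sqrrB !mulr2n; lra.
rewrite big_split sumr_const card_ord (bigD1 nn)//= big1 => [|i ni]; last by rewrite cn (negbTE ni) mul0r expr0n mulr0.
rewrite cn eqxx mul1r addr0 -[X in _ + X]mulr_natl.
have -> : dim * (2 * (4 * dim)^-1 ^+ 2) = (4 * dim)^-1 / 2 by field; rewrite gt_eqF.
have -> : 2 * (sg / 2) ^+ 2 = sg ^+ 2 / 2 by field.
by rewrite sg2; lra.
Qed.


(** The half ball contains a ball around [half_center sg]. By convexity it also contains the cone
    over that ball with vertex q, whose cross-section at parameter rho has a radius proportional to
    rho. *)
Lemma half_ball_cone sg q rho y : `|sg| = 1 -> B1 q -> xn q = 0 -> 0 < rho <= 1 ->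
  `|y - (q + rho *: (half_center sg - q))| <= rho / (4 * dim) -> half_ball sg y.
Proof.
move=> s1 qB q0 /andP[r0 r1] yr; pose w := q + rho^-1 *: (y - q).
have yE : y = q + rho *: (w - q) by rewrite addrAC subrr add0r scalerA divff ?gt_eqF// scale1r addrC subrK.
have [wB w0] : half_ball sg w.
  apply: half_center_near => //.
  have -> : w - half_center sg = rho^-1 *: (y - (q + rho *: (half_center sg - q))).
    apply: (scalerI (lt0r_neq0 r0)); rewrite scalerA divff ?gt_eqF// scale1r {1}yE opprD addrACA subrr add0r.
    by rewrite -scalerBr opprB addrA subrK.
  by rewrite normrZ gtr0_norm ?invr_gt0// mulrC ler_pdivrMr// mulrC.
split; first by rewrite yE; apply: eball_convex; rewrite ?(ltW r0).
have : xn y = rho * xn w by rewrite {1}yE xnD xnZ xnD xnN q0 subr0 add0r.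
by move=> ->; rewrite mulrCA mulr_gt0.
Qed.

Variables (D : set E) (Phi : E -> E) (L : R).
Hypotheses (oD : open D) (L0 : 0 < L)
  (PhiL : {in D &, forall x y, L^-1 * enorm (x - y) <= enorm (Phi x - Phi y) <= L * enorm (x - y)})
  (PhiD : Phi @` D = B1) (Phiflat : Phi @` flat D = flat B1).
Let M := L * dim.

Let M0 : 0 < M. Proof. by rewrite mulr_gt0// ltr0n addn1. Qed.

Let Phi_lip x y : D x -> D y -> `|Phi x - Phi y| <= M * `|x - y|.
Proof.
move=> Dx Dy; apply: le_trans (norm_le_enorm _) _.
have /andP[_ h] := PhiL (mem_set Dx) (mem_set Dy); apply: le_trans h _.
by rewrite /M -mulrA; apply: (ler_wpM2l (ltW L0)); exact: enorm_le_norm.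
Qed.

Let Phi_inv x y : D x -> D y -> `|x - y| <= M * `|Phi x - Phi y|.
Proof.
move=> Dx Dy; apply: le_trans (norm_le_enorm _) _.
have /andP[h _] := PhiL (mem_set Dx) (mem_set Dy).
move: h; rewrite ler_pdivrMl// => h; apply: le_trans h _.
by rewrite /M -mulrA; apply: (ler_wpM2l (ltW L0)); exact: enorm_le_norm.
Qed.

Let Phi_in x : D x -> B1 (Phi x). Proof. by move=> Dx; rewrite -PhiD; exists x. Qed.

Let Psi : {Psi : E -> E | forall q, B1 q -> D (Psi q) /\ Phi (Psi q) = q}.
Proof.
have H q : exists x, B1 q -> D x /\ Phi x = q.
  have [qB|qB] := pselect (B1 q); last by exists 0.
  by move: (qB); rewrite -PhiD => -[x Dx <-]; exists x.
by have [f Hf] := choice H; exists f.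
Qed.

Let P : E -> E := sval Psi.
Let PD q : B1 q -> D (P q). Proof. by move=> /(svalP Psi)[]. Qed.
Let PK q : B1 q -> Phi (P q) = q. Proof. by move=> /(svalP Psi)[]. Qed.

Let P_lip q w : B1 q -> B1 w -> `|P q - P w| <= M * `|q - w|.
Proof. by move=> qB wB; have := Phi_inv (PD qB) (PD wB); rewrite !PK. Qed.

Let PPhi x : D x -> P (Phi x) = x.
Proof.
move=> Dx; have Bx := Phi_in Dx; have := Phi_inv (PD Bx) Dx; rewrite PK// subrr normr0 mulr0.
by rewrite normr_le0 subr_eq0 => /eqP.
Qed.

Let P_continuous q : B1 q -> {for q, continuous P}.
Proof.
move=> qB; apply/(@cvgrPdist_le _ _ _ (nbhs q)) => e e0.
have nB : \forall w \near q, B1 w by apply: open_nbhs_nbhs; split => //; exact: open_eball.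
have nd : \forall w \near q, `|q - w| < e / M by apply/nbhs_ballP; exists (e / M); [exact: divr_gt0|move=> w; rewrite -ball_normE].
apply: filterS2 nB nd => w wB qw; apply: le_trans (P_lip qB wB) _.
by rewrite mulrC -ler_pdivlMr// ltW.
Qed.

Let P_xn q : B1 q -> xn q != 0 -> xn (P q) != 0.
Proof.
move=> qB; apply: contraNneq => x0.
have : (Phi @` flat D) q by exists (P q); [split => //; exact: PD|exact: PK].
by rewrite Phiflat => -[_ /= ->].
Qed.

(** x_n composed with the inverse chart does not vanish on an open half ball, since the flat parts
    correspond. Along segments its sign is constant, and the right half is the one that contains the
    image of a point just above [p]. *)
Lemma half_ball_preimage (p : 'rV[R]_m) : flat' D p ->
  exists sg, `|sg| = 1 /\ forall q, half_ball sg q -> 0 < xn (P q).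
Proof.
move=> Dp; have /nbhs_ballP[d /= d0 hd] := open_nbhs_nbhs (conj oD Dp).
pose x := emb p + (d / 2) *: 'e_nn : E.
have x0 : xn x = d / 2 by rewrite xn_addn xn_emb add0r.
have d2 : 0 < d / 2 by [].
have Dx : D x.
  apply: hd; rewrite ballE /x opprD addNKr normrN.
  by apply: (@le_lt_trans _ _ (d / 2)); [exact/norm_scale_delta/ltW|lra].
have q0 : xn (Phi x) != 0.
  apply/eqP => q0; have : (Phi @` flat D) (Phi x) by rewrite Phiflat; split => //; exact: Phi_in.
  move=> [y [Dy /= y0] yx]; have := PPhi Dx; rewrite -yx PPhi// => yx'.
  by move: d2; rewrite -x0 -yx' y0 ltxx.
exists (Num.sg (xn (Phi x))); split; first by rewrite normr_sg q0.
have qx : half_ball (Num.sg (xn (Phi x))) (Phi x) by split; [exact: Phi_in|rewrite -normrEsg normr_gt0].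
move=> q [qB qs]; pose l t : E := Phi x + t *: (q - Phi x).
have lB t : 0 <= t <= 1 -> half_ball (Num.sg (xn (Phi x))) (l t).
  move=> /andP[t0 t1]; split; first by apply: eball_convex; rewrite ?t0//; exact: Phi_in.
  have [_ h1] := qx; rewrite xnD xnZ xnD xnN; set sg := Num.sg _ in qs h1 *.
  have -> : sg * (xn (Phi x) + t * (xn q - xn (Phi x))) = (1 - t) * (sg * xn (Phi x)) + t * (sg * xn q) by ring.
  have [->|t2] := eqVneq t 0; first by rewrite subr0 mul1r mul0r addr0.
  rewrite ltr_wpDl//; first by rewrite mulr_ge0 ?subr_ge0// ltW.
  by rewrite mulr_gt0// lt_neqAle eq_sym t2.
have := @unit_interval_locally_constant R (fun t => 0 < xn (P (l t))).
rewrite {1 4}/l scale0r addr0 scale1r addrC subrK; apply; first by rewrite PPhi// x0.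
move=> t t01; have [lB1 ls] := lB t t01.
have n0 : xn (P (l t)) != 0 by apply: P_xn => //; apply: contraTneq ls => ->; rewrite mulr0 ltxx.
have K0 : 0 < M * (`|q - Phi x| + 1) by [].
exists (`|xn (P (l t))| / (M * (`|q - Phi x| + 1))) => [|s s01 st]; first by rewrite divr_gt0// normr_gt0.
have h : `|xn (P (l s)) - xn (P (l t))| < `|xn (P (l t))|.
  apply: (@le_lt_trans _ _ `|P (l s) - P (l t)|).
    exact: xn_dist.
  have [lBs _] := lB s s01; apply: le_lt_trans (P_lip lBs lB1) _.
  have -> : l s - l t = (s - t) *: (q - Phi x) by rewrite opprD addrACA subrr add0r -scalerBl.
  rewrite normrZ; apply: (@le_lt_trans _ _ (M * (`|q - Phi x| + 1) * `|s - t|)).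
    by rewrite [`|s - t| * _]mulrC mulrA; apply: ler_wpM2r => //; apply: (ler_wpM2l (ltW M0)); rewrite lerDl.
  by rewrite mulrC -ltr_pdivlMr.
move: h; rewrite /l; set A := xn _; set B := xn _; move: n0; rewrite -/B.
by rewrite neq_lt => /orP[B0|B0]; rewrite ?(gtr0_norm B0) ?(ltr0_norm B0) ltr_norml => /andP[h1 h2]; split; lra.
Qed.

Let kap := (M * (4 * dim))^-1.

Let kap0 : 0 < kap.
Proof. by rewrite invr_gt0 mulr_gt0// mulr_gt0// ltr0n addn1. Qed.

(* Points of [D] in the ball are images of a compact part of the half ball, so
   [D] is relatively closed in the ball. *)
Lemma chart_ball sg q rho : `|sg| = 1 -> (forall q, half_ball sg q -> 0 < xn (P q)) ->
  B1 q -> xn q = 0 -> 0 < rho <= 1 ->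
  ball (P (q + rho *: (half_center sg - q))) (kap * rho) `<=` upper D.
Proof.
move=> s1 HP qB q0 rr; have /andP[r0 _] := rr; set qr := q + _; set c := P qr.
pose K : set E := [set y | `|y - qr| <= rho / (4 * dim)].
have d0 : 0 < 4 * dim by [].
have KH : K `<=` half_ball sg by move=> y; exact: half_ball_cone.
have Kqr : K qr by rewrite /K /= subrr normr0 ltW.
have qrB : B1 qr by have [] := KH _ Kqr.
have cT : closed (P @` K).
  apply: compact_closedE; apply: continuous_compact; last exact: compact_closed_ball.
  by apply: continuous_in_subspaceT => y /set_mem/KH[yB _]; exact: P_continuous.
move=> x; rewrite ballEC => xc.
pose l t : E := c + t *: (x - c).
have lT t : 0 <= t <= 1 -> D (l t) -> (P @` K) (l t).
  move=> /andP[t0 t1] Dl; exists (Phi (l t)); last exact: PPhi.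
  rewrite /K -(PK qrB); apply: le_trans (Phi_lip Dl (PD qrB)) _.
  rewrite /l addrAC subrr add0r normrZ ger0_norm//.
  apply: (@le_trans _ _ (M * (kap * rho))); last by rewrite /kap invfM !mulrA divff ?gt_eqF// mul1r mulrC.
  by apply: (ler_wpM2l (ltW M0)); rewrite -[leRHS]mul1r; apply: ler_pM => //; exact: ltW.
have Dx : D x.
  have := @unit_interval_locally_constant R (fun t => D (l t)).
  rewrite {1 4}/l scale0r addr0 scale1r [c + _]addrC subrK; apply; first exact: PD.
  move=> t t01; have [V [oV Vl HV]] : exists V : set E, [/\ open V, V (l t) & forall s, 0 <= s <= 1 -> V (l s) -> (D (l s) <-> D (l t))].
    have [|Dt] := pselect (D (l t)); first by exists D; split.
    exists (~` (P @` K)); split; first exact: closed_openC.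
      by move=> [y yK yl]; apply: Dt; rewrite -yl; apply: PD; have [] := KH _ yK.
    by move=> s s01 Ts; split => // /(lT s s01).
  have /nbhs_ballP[d /= d1 hd] := open_nbhs_nbhs (conj oV Vl).
  have x1 : 0 < `|x - c| + 1 by [].
  exists (d / (`|x - c| + 1)) => [|s s01 st]; first exact: divr_gt0.
  apply: HV => //; apply: hd; rewrite ballEC /l opprD addrACA subrr add0r -scalerBl normrZ.
  apply: (@le_lt_trans _ _ (`|s - t| * (`|x - c| + 1))); first by rewrite ler_wpM2l// lerDl.
  by rewrite -ltr_pdivlMr.
split => //; have := @lT 1; rewrite ler01 lexx /l scale1r addrC subrK => /(_ isT Dx)[y /KH yH <-].
exact: HP.
Qed.

(** In the chart the centers run along the segment from [half_center sg] to the image of [p], at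
    parameters eta^k. The chains for all [p] start at the same center [c0], so the first average
    along them is a single constant. *)
Lemma whitney_chain (p0 : 'rV[R]_m) : flat' D p0 ->
  exists r0 eta C c0, [/\ 0 < r0, 2^-1 <= eta < 1, 0 <= C & forall p, flat' D p ->
    exists g : nat -> E, g 0%N = c0 /\ forall k : nat, let r := r0 * eta ^+ k in
      [/\ ball (g k) (8 * r) `<=` upper D, `|g k.+1 - g k| <= r & `|g k - emb p| <= C * r]].
Proof.
move=> Dp0; have [sg [s1 HP]] := half_ball_preimage Dp0.
have d0 : 0 < 4 * dim by [].
(* The ratio 1 - dl is so close to 1 that consecutive centers, at distance at most 2 M dl eta^k, lie
   within one radius (kap / 8) eta^k; dl <= 1/2 keeps consecutive radii comparable. *)
pose dl := Num.min 2^-1 (kap / (16 * M)).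
have dl0 : 0 < dl by rewrite lt_min invr_gt0 ltr0n mulr_gt0.
have dl2 : dl <= 2^-1 by rewrite ge_min lexx.
have dlk : dl * (16 * M) <= kap by rewrite -ler_pdivlMr ?mulr_gt0// ge_min lexx orbT.
pose eta := 1 - dl; have e1 : 2^-1 <= eta < 1 by rewrite /eta; lra.
have hcB : B1 (half_center sg) by have [] // : half_ball sg (half_center sg); apply: half_center_near => //; rewrite subrr normr0 invr_ge0 ltW.
have nB q : B1 q -> `|q| <= 1 by move=> /ltW h; apply: le_trans (norm_le_enorm _) _; move: h; rewrite subr0.
exists (kap / 8), eta, (16 * M / kap), (P (half_center sg)); split => //.
move=> p Dp; pose q := Phi (emb p); have qB : B1 q by exact: Phi_in.
have q0 : xn q = 0.
  have : (Phi @` flat D) q by exists (emb p) => //; split => //; exact: xn_emb.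
  by rewrite Phiflat => -[].
pose qr rho := q + rho *: (half_center sg - q).
have qrB rho : 0 <= rho <= 1 -> B1 (qr rho) by exact: eball_convex.
have hq : `|half_center sg - q| <= 2 by apply: le_trans (ler_normB _ _) _; have := nB _ qB; have := nB _ hcB; lra.
have ek k : 0 < eta ^+ k <= 1.
  have /andP[h1 h2] := e1; have h0 : 0 < eta by apply: lt_le_trans h1; rewrite invr_gt0.
  by rewrite exprn_gt0// exprn_ile1// ltW.
exists (fun k => P (qr (eta ^+ k))); split; first by rewrite expr0 /qr scale1r addrC subrK.
move=> k r; have /andP[e0 e2] := ek k; have eE : eta ^+ k.+1 = eta ^+ k - dl * eta ^+ k by rewrite exprS /eta; ring.
have kr : 8 * r = kap * eta ^+ k by rewrite /r; field.
have [f1 f2] : 0 <= eta ^+ k <= 1 /\ 0 <= eta ^+ k.+1 <= 1 by have /andP[h1 h2] := ek k.+1; rewrite (ltW e0) (ltW h1).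
split.
- by rewrite kr; exact: chart_ball.
- apply: le_trans (P_lip (qrB _ f2) (qrB _ f1)) _.
  have -> : qr (eta ^+ k.+1) - qr (eta ^+ k) = - (dl * eta ^+ k) *: (half_center sg - q) by rewrite /qr opprD addrACA subrr add0r -scalerBl eE addrAC subrr add0r.
  rewrite normrZ normrN ger0_norm; last by rewrite mulr_ge0// ltW.
  apply: (@le_trans _ _ (M * (dl * eta ^+ k * 2))).
    by apply: (ler_wpM2l (ltW M0)); apply: ler_wpM2l => //; rewrite mulr_ge0// ltW.
  rewrite (_ : M * _ = dl * (16 * M) * (eta ^+ k / 8)); last by field.
  rewrite (_ : r = kap * (eta ^+ k / 8)); last by rewrite /r; field.
  by apply: ler_wpM2r => //; rewrite divr_ge0// ltW.
- rewrite -(PPhi Dp) -/q; have -> : q = qr 0 by rewrite /qr scale0r addr0.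
  have f0 : 0 <= (0 : R) <= 1 by rewrite lexx ler01.
  apply: le_trans (P_lip (qrB _ f1) (qrB _ f0)) _.
  have -> : qr (eta ^+ k) - qr 0 = eta ^+ k *: (half_center sg - q) by rewrite /qr opprD addrACA subrr add0r -scalerBl subr0.
  rewrite normrZ ger0_norm ?(ltW e0)//.
  rewrite (_ : 16 * M / kap * r = M * (eta ^+ k * 2)); last by rewrite /r; field; rewrite gt_eqF.
  by apply: (ler_wpM2l (ltW M0)); apply: (ler_wpM2l (ltW e0)).
Qed.

End half_ball_charts.

Lemma derive_bounded_dist (R : realType) (F dF : R -> R) s t A : s <= t ->
  (forall v : R, s <= v <= t -> is_derive v 1 F (dF v)) -> (forall v, s <= v <= t -> `|dF v| <= A) ->
  `|F t - F s| <= (t - s) * A.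
Proof.
move=> st D Dle; have e1 := growth_slope (c := - A) st D.
have e2 := growth_slope (c := - A) st (fun v hv => is_deriveN (D v hv)).
have {}e1 : (t - s) * - A <= F t - F s by apply: e1 => v /Dle; rewrite ler_norml => /andP[].
have {}e2 : (t - s) * - A <= - F t - - F s by apply: e2 => v /Dle; rewrite ler_norml lerN2 => /andP[].
by rewrite ler_norml; move: e1 e2; rewrite !mulrN; set X := (t - s) * A; lra.
Qed.

(** * Oscillation of means between neighboring balls *)

Section kernel_averages.
Context {R : realType} {m : nat}.
Local Notation E := 'rV[R]_(m + 1).
Implicit Types (f : E -> R) (c x p : E) (r s : R) (i : 'I_(m + 1)).
Let hw := @weight_wt R m 0 (lexx 0).

Lemma psi_translate p r v x : psi p r (x - v) = psi (p + v) r x.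
Proof.
congr (2 * fe' (1 - _ / _)).
by apply: eq_bigr => i _; rewrite !mxE; congr (_ ^+ 2); ring.
Qed.

Lemma dot_le (w : E -> R) (F H : 'I_(m + 1) -> E -> R) K : weight w -> (forall i, wint w (F i)) ->
  wint w (fun x => \sum_i F i x * H i x) -> 0 <= K -> (forall i x, `|H i x| <= K) ->
  `|wI w (fun x => \sum_i F i x * H i x)| <= K * wI w (fun x => \sum_i `|F i x|).
Proof.
move=> ww wF wFH K0 HK; apply: le_trans (wI_abs ww wFH) _.
have wS : wint w (fun x => \sum_i `|F i x|) by apply: wint_sum => i; exact: wint_abs.
rewrite -wIZ//; apply: (wI_le ww (wint_abs ww wFH) (wintZ _ wS)) => x.
apply: le_trans (ler_norm_sum _ _ _) _; rewrite mulr_sumr; apply: ler_sum => i _.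
by rewrite normrM mulrC; apply: ler_wpM2r.
Qed.

Lemma osc_arith (K S : R) r n : 0 < r -> (r / 2)^-1 ^+ n * ((K / (r / 2)) * S) * (r / 2) = 2 ^+ n * K * (r ^- n * S).
Proof. by move=> r0; rewrite exprVn expr_div_n; field; rewrite !expf_neq0 ?gt_eqF. Qed.

Lemma Sf_oscillation : exists2 C, 0 <= C & forall f (G : 'I_(m + 1) -> E -> R) c c' r r', 0 < r -> 4 * r <= xn c ->
  bmfun f -> dgrad (hp `&` ball c (4 * r)) f G -> (forall i, l2 (wt 0) (G i)) ->
  (forall i x, ~ ball c (4 * r) x -> G i x = 0) -> `|c' - c| <= r -> r / 2 <= r' <= r ->
  `|Sf 0 f c' r' - Sf 0 f c r| <= C * (r ^- m * \I_0[x] (\sum_i `|G i x|)).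
Proof.
have [K K0 HK] := @partial_bump_le R m; have [K1 K10 HK1] := @psi_ub R m.
exists (2 ^+ m * K + K1) => [|f G c c' r r' r0 cr bf dG lG G0 cc /andP[r1 r2]].
  by rewrite addr_ge0 ?mulr_ge0 ?(ltW K0) ?(ltW K10).
have n0 : 0 <= r ^- m / r by [].
have rK : 0 <= r * K1 by [].
have KE s : K1 * (r ^- m * s) = r ^- m / r * (r * K1 * s) by field; rewrite ?expf_neq0 ?gt_eqF.
set B := ball c (4 * r); set S := wI _ _.
have Bhp x : B x -> hp x.
  move=> xB; have : `|xn c - xn x| < 4 * r; last by rewrite ltr_norml => /andP[]; rewrite /hp /=; lra.
  have : `|c - x| < 4 * r by move: xB; rewrite /B -ball_normE.
  by apply: le_lt_trans; exact: xn_dist.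
have Bin p s x : `|p - c| <= r -> 0 < s <= r -> sqd p x <= s ^+ 2 -> B x.
  move=> pc /andP[s0 sr] /(sqd_norm (ltW s0)) xp; rewrite /B ballEC.
  by have := ler_distD p x c; lra.
have xc' : r < xn c'.
  have := le_trans (xn_dist c' c) cc.
  by rewrite ler_norml => /andP[]; lra.
have lB : l2 (wt 0) (\1_B : E -> R) by apply: (l2_bmfun hw); apply: bmfun_indic_ball; rewrite mulr_gt0.
have wG i : wint (wt 0) (G i).
  apply: wint_ext (wint_mul hw (lG i) lB) => x; rewrite indicE.
  by have [xB|xB] := pselect (B x); [rewrite mem_set// mulr1|rewrite G0// mul0r].
have S0 : 0 <= S by apply: (wI_ge0 hw) => x; pos.
have lf := l2_bmfun hw bf.
have dil : `|Sf 0 f c' r - Sf 0 f c' r'| <= 2 ^+ m * K * (r ^- m * S).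
  pose dF v := v `^ (1 - Nw m 0) * \I_0[x] f x * Lop 0 (bump c' v) x.
  have D v : r' <= v <= r -> is_derive v 1 (Sf 0 f c') (dF v).
    move=> /andP[v1 v2]; apply: (Sf_derive (lexx 0) bf); first by apply: lt_le_trans v1; lra.
    by right; split => //; exact: le_lt_trans xc'.
  have Dle v : r' <= v <= r -> `|dF v| <= (r / 2)^-1 ^+ m * ((K / (r / 2)) * S).
    move=> /andP[v1 v2]; have v0 : 0 < v by lra.
    have gc : good_center 0 c' v by right; split => //; exact: le_lt_trans xc'.
    have tb : test_function B (bump c' v) by apply: tf_bump => // x; apply: Bin => //; rewrite v0.
    have -> : dF v = v ^- m * \I_0[x] f x * Lop 0 (bump c' v) x.
      rewrite /dF (_ : 1 - Nw m 0 = - m%:R); last by rewrite /Nw natrD; ring.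
      by rewrite powRN powR_mulrn// ltW.
    have -> : \I_0[x] f x * Lop 0 (bump c' v) x = - \I_0[x] \sum_i G i x * partial i (bump c' v) x.
      have wp i : wint (wt 0) (fun x => G i x * partial i (bump c' v) x) by apply: (wint_mul hw (lG i)); exact: (l2_bmfun hw (tf_bmfun (tf_partial i tb))).
      rewrite wI_sum// -sumrN.
      transitivity (\sum_i \I_0[x] f x * dvg 0 i (partial i (bump c' v)) x).
        rewrite -wI_sum; first by apply: wI_ext => x; rewrite mulr_sumr.
        by move=> i; apply: (wint_mul hw lf); apply: (l2_dvg (lexx 0) (tf_partial i tb)); exact: okn_bump gc.
      apply: eq_bigr => i _; apply: (dgrad_ibp (lexx 0) dG lf (lG i) (tf_partial i tb)); exact: okn_bump gc.
    have rv : r / 2 <= v by exact: le_trans v1.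
    have h2 : 0 < r / 2 by [].
    rewrite normrM normrN ger0_norm; last by rewrite invr_ge0 exprn_ge0// ltW.
    apply: ler_pM => //.
      by rewrite exprVn lef_pV2 ?posrE ?exprn_gt0//; apply: lerXn2r => //; rewrite nnegrE ltW.
    apply: dot_le => //.
    - by apply: wint_sum => i; apply: (wint_mul hw (lG i)); exact: (l2_bmfun hw (tf_bmfun (tf_partial i tb))).
    - by move=> i x; apply: le_trans (HK _ _ _ _ v0) _; apply: (ler_wpM2l (ltW K0)); rewrite lef_pV2 ?posrE.
  rewrite -osc_arith//; set A := _ * _ in Dle *.
  have A0 : 0 <= A by have := Dle r; rewrite r2 lexx => /(_ isT); exact: le_trans.
  apply: le_trans (derive_bounded_dist r2 D Dle) _.
  by rewrite mulrC; apply: (ler_wpM2l A0); lra.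
have tra : `|Sf 0 f c' r - Sf 0 f c r| <= K1 * (r ^- m * S).
  pose v := c' - c; have Nr : r `^ (- Nw m 0) = r ^- m / r.
    by rewrite powRN powR_Nw0// exprD expr1 invfM.
  have psiE x : psi c r (x - v) = psi c' r x by rewrite psi_translate /v addrC subrK.
  have tp s : 0 <= s <= 1 -> test_function (hp `&` B) (fun x => psi c r (x - s *: v)).
    move=> /andP[s0 s1]; rewrite (_ : (fun => _) = psi (c + s *: v) r); last by apply/funext; exact: psi_translate.
    apply: tf_psi => // x; move=> /Bin xB; have {}xB : B x.
      apply: xB; last by rewrite r0 lexx.
      by rewrite addrC addKr normrZ ger0_norm//; apply: le_trans cc; rewrite ler_piMl.
    by split => //; exact: Bhp.
  have I10 F : (forall x, ~ B x -> F x = 0) -> wI one F = wI (wt 0) F by move=> F0; apply: wI_one_hp => x nx; apply: F0 => /Bhp.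
  have w1 : wint one f by exact: wint_one_bmfun.
  have w1G i : wint one (G i).
    move: (wG i); congr (_.-integrable _ _); apply/funext => x; congr EFin.
    have [xB|xB] := pselect (B x); last by rewrite G0// !mul0r.
    by rewrite wt0_hp ?mulr1//; exact: Bhp.
  have [s s01 E1] := dgrad_line_mvt bf.1 w1 (fun i => l2_mfun (lG i)) w1G dG tp.
  have tp0 : test_function (hp `&` B) (psi c r).
    have := tp 0; rewrite lexx ler01 => /(_ isT); by under eq_fun do rewrite scale0r subr0.
  have tp1 : test_function (hp `&` B) (psi c' r).
    have := tp 1; rewrite lexx ler01 => /(_ isT); by under eq_fun do rewrite scale1r psiE.
  have wf0 := wint1_tf bf.1 w1 tp0; have wf1 := wint1_tf bf.1 w1 tp1.
  have [wt1 It1] := wI_translate (v := v) wf1 (fun=> erefl).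
  have psiE' x : psi c' r (x + v) = psi c r x by rewrite -psiE addrK.
  have E2 : wI (@one R (m + 1)) (fun x => (f (x + v) - f x) * psi c r x) =
      \I_0[x] f x * psi c' r x - \I_0[x] f x * psi c r x.
    have J q : test_function (hp `&` B) (psi q r) -> \I_0[x] f x * psi q r x = wI one (fun x => f x * psi q r x).
      move=> tq; symmetry; apply: I10 => x xB; rewrite (tf_out tq); last by case.
      exact: mulr0.
    rewrite (J _ tp1) (J _ tp0).
    rewrite -It1 -(wIB wt1 wf0).
    by apply: wI_ext => x; rewrite psiE' mulrBl.
  pose H i x := v ord0 i * psi c r (x - s *: v).
  have E3 : wI (@one R _) (fun x => gdir v G x * psi c r (x - s *: v)) = \I_0[x] \sum_i G i x * H i x.
    have HE x : gdir v G x * psi c r (x - s *: v) = \sum_i G i x * H i x by rewrite /gdir mulr_suml; apply: eq_bigr => i _; rewrite /H [v ord0 i * G i x]mulrC mulrA.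
    rewrite (wI_ext _ HE); apply: (I10) => x xB.
    by apply: big1 => i _; rewrite (G0 i x xB); exact: mul0r.
  have E4 : Sf 0 f c' r - Sf 0 f c r = r ^- m / r * \I_0[x] \sum_i G i x * H i x by rewrite /Sf Nr -E3 -E1 E2 mulrBr.
  rewrite E4 normrM (ger0_norm n0).
  rewrite KE; apply: (ler_wpM2l n0); apply: (dot_le hw wG _ rK).
  - by apply: wint_sum => i; apply: (wint_mul hw (lG i)); apply: (l2Z _); exact: (l2_bmfun hw (tf_bmfun (tp s s01))).
  - move=> i x; rewrite normrM (ger0_norm (psi_ge0 _ _ _)).
    exact: (ler_pM (normr_ge0 _) (psi_ge0 _ _ _) (le_trans (rV_norm_coord _ _) cc) (HK1 _ _ _)).
apply: le_trans (ler_distD (Sf 0 f c' r) _ _) _.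
rewrite mulrDl; apply: lerD tra; rewrite distrC; exact: dil.
Qed.

End kernel_averages.

(** * Integrals over vertical cylinders *)

Section cylinders.
Context {R : realType} {m : nat}.
Local Notation E := 'rV[R]_(m + 1).
Implicit Types (F : E -> R) (x : E) (p : 'rV[R]_m) (rho : R).

(** For F >= 0 this dominates the integral over any set whose projection lies in the cube around
    [p]. It makes an energy near a chain descending to [p] into a measurable function of [p] whose
    integral Tonelli computes. *)
Definition cylinder_integral F rho p : \bar R :=
  (\int[leb (m + 1)]_x (F x * \1_(ball (lsubmx x) rho) p)%:E)%E.

Lemma cylinder_tonelli F rho : mbfun F -> (forall x, 0 <= F x) -> 0 < rho ->
  [/\ forall p, measurable_fun [set: E] (fun x => (F x * \1_(ball (lsubmx x) rho) p)%:E),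
    measurable_fun [set: 'rV[R]_m] (cylinder_integral F rho) &
    (\int[leb m]_p cylinder_integral F rho p = ((rho *+ 2) ^+ m)%:E * \int[leb (m + 1)]_x (F x)%:E)%E].
Proof.
move=> mF F0 r0; pose H (q : 'rV[R]_m * E) : \bar R := (F q.2 * \1_(ball (lsubmx q.2) rho) q.1)%:E.
have ml : measurable_fun [set: 'rV[R]_m * E] (fun q => lsubmx q.2 - q.1).
  apply: measurable_fun_coordP => i; rewrite (_ : (fun _ => _) = fun q : 'rV[R]_m * E => q.2 ord0 (lshift 1 i) - q.1 ord0 i).
    apply: measurable_funB; first exact: measurableT_comp (@measurable_coord R _ _) measurable_snd.
    exact: measurableT_comp (@measurable_coord R _ _) measurable_fst.
  by apply/funext => q; rewrite !mxE.
have H0 q : (0 <= H q)%E by rewrite lee_fin mulr_ge0// indicE.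
have mH : measurable_fun [set: 'rV[R]_m * E] H.
  apply/measurable_EFinP; apply: measurable_funM; first exact: measurableT_comp mF measurable_snd.
  rewrite (_ : (fun _ => _) = \1_((fun q : 'rV[R]_m * E => lsubmx q.2 - q.1) @^-1` ball 0 rho)).
    by apply: measurable_indic; rewrite -[X in measurable X]setTI; apply: ml => //; exact: measurable_ball_rV.
  apply/funext => q; rewrite !indicE; congr (nat_of_bool _)%:R.
  have e : ball (lsubmx q.2) rho q.1 <-> ball 0 rho (lsubmx q.2 - q.1) by rewrite !ballE sub0r normrN.
  by apply/idP/idP => /set_mem/e h; exact: mem_set.
pose m1 : {sigma_finite_measure set 'rV[R]_m -> \bar R} := @leb R m.
pose m2 : {sigma_finite_measure set E -> \bar R} := @leb R (m + 1).
split; [by move=> p; exact: (measurableT_comp mH (measurable_pair1 p))|exact: (@measurable_fun_fubini_tonelli_F _ _ _ _ R m2 H mH H0)|].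
rewrite (@fubini_tonelli _ _ _ _ R m1 m2 H mH H0) -ge0_integralZl//; last 3 first.
- exact/measurable_EFinP.
- by move=> x _; rewrite lee_fin.
- by rewrite lee_fin exprn_ge0// mulrn_wge0// ltW.
apply: eq_integral => x _; rewrite /H /=.
under eq_integral do rewrite EFinM.
rewrite ge0_integralZl//; last 2 first.
- by apply/measurable_EFinP; apply: measurable_indic; exact: measurable_ball_rV.
- by rewrite lee_fin.
have mB := measurable_ball_rV (lsubmx x) rho.
rewrite integral_indic// setIT [X in (_ * X)%E](_ : _ = ((rho *+ 2) ^+ m)%:E); last exact: leb_ball.
by rewrite muleC.
Qed.

End cylinders.

(** * Integrability of the trace from finite energy *)

Section flat_trace.
Context {R : realType} {m : nat}.
Local Notation E := 'rV[R]_(m + 1).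
Local Notation dim := ((m + 1)%:R : R).
Implicit Types (c x y : E) (r t d : R) (i : 'I_(m + 1)).
Variables (a lp lm : R) (D : set E) (u : E -> R).
Hypotheses (a01 : 0 <= a < 1) (oD : open D)
  (umin : minimizer a lp lm D u) (ucont : {within upper D `|` flat D, continuous u}).
Local Notation U := (upper D).
Let a0 : 0 <= a. Proof. by case/andP: a01. Qed.
Let hw := weight_wt m a0.
Let hw0 := @weight_wt R m 0 (lexx 0).

(** Young's inequality with weight r^(s+a) produces the powers r^s and r^(1-a-s); this exponent
    makes them equal. It is positive since a < 1, so the powers are summable over geometrically
    decreasing radii. *)
Let s : R := (1 - a) / 2.
Let s0 : 0 < s. Proof. by rewrite divr_gt0// subr_gt0; case/andP: a01. Qed.

Definition energy_density x : R := (\sum_i wd0 D u i x ^+ 2) * wt a x.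

Lemma wint_energy : wint (wt a) (fun x => \sum_i wd0 D u i x ^+ 2).
Proof. by apply: wint_sum => i; exact: (l2_wd0 a01 oD umin i).2. Qed.

Lemma amgm_weight r (x : E) q : 0 < r -> r <= xn x ->
  `|q| <= r `^ s * (q ^+ 2 * wt a x) + r `^ (- s - a).
Proof.
move=> r0 rx; have x0 : 0 < xn x by exact: lt_le_trans rx.
have h : r `^ a <= wt a x by rewrite wtE//; apply: ge0_ler_powR; rewrite ?nnegrE ?_.
pose A := r `^ (s + a); have A0 : 0 < A by rewrite powR_gt0.
have -> : r `^ (- s - a) = A^-1 by rewrite -opprD powRN.
apply: (@le_trans _ _ (A * q ^+ 2 + A^-1)).
  rewrite -(ler_pM2l A0) mulrDr divff ?gt_eqF//.
  by have := sqr_ge0 (A * `|q| - 1); rewrite sqrrB1 exprMn sqr_normr mulr2n; have := mulr_ge0 (ltW A0) (normr_ge0 q); lra.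
rewrite lerD2r /A powRD ?gt_eqF ?implybT// -mulrA ler_wpM2l ?powR_ge0// mulrC.
by apply: ler_wpM2l => //; exact: sqr_ge0.
Qed.

Lemma interior_patch c r : 0 < r -> ball c (8 * r) `<=` U ->
  exists f G, [/\ bmfun f, forall x, ball c (4 * r) x -> f x = u x, 6 * r < xn c & forall x, ball c (4 * r) x -> r <= xn x] /\
    [/\ forall i, l2 (wt a) (G i), forall i x, (ball c (4 * r) x -> G i x = wd0 D u i x) /\ (~ ball c (4 * r) x -> G i x = 0) &
    dgrad (hp `&` ball c (4 * r)) f G].
Proof.
move=> r0 cU; have r4 : 0 < 4 * r by [].
have upU x : `|x - c| < 2 * (4 * r) -> U x by rewrite (_ : 2 * (4 * r) = 8 * r) => [h|]; [apply: cU; rewrite ballEC|ring].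
have refl x : `|x - c| < 2 * (4 * r) -> D (reflect_up x) by move=> /upU[Dx x0]; rewrite reflect_up_id// ltW.
have [f [G [bf fE lG GE dG]]] := reflected_patch a01 oD umin ucont r4 refl.
have x6 : 6 * r < xn c.
  have [|_ /=] := upU (c - (6 * r) *: 'e_nn).
    rewrite addrAC subrr add0r normrN.
    by apply: (@le_lt_trans _ _ (6 * r)); [apply: norm_scale_delta|]; lra.
  by rewrite xnD xnN xnZ xn_delta; lra.
have Bx x : ball c (4 * r) x -> `|x - c| < 2 * (4 * r) by rewrite ballEC; lra.
exists f, G; split; split => //.
- by move=> x xB; rewrite (fE x xB).2 reflect_up_id//; have [_ /ltW] := upU _ (Bx _ xB).
- move=> x; rewrite ballE => xc; have := le_lt_trans (xn_dist c x) xc.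
  by rewrite ltr_norml => /andP[]; lra.
Qed.

Let u0 : E -> R := u \_ U.

Lemma patch_psi c r f q t x : (forall x, ball c (4 * r) x -> f x = u x) -> ball c (8 * r) `<=` U ->
  `|q - c| <= r -> 0 < t <= r -> f x * psi q t x = u0 x * psi q t x.
Proof.
move=> fE cU qc /andP[t0 tr]; have [xt|/ltW xt] := leP (sqd q x) (t ^+ 2); last by rewrite psi_out// !mulr0.
have xc : `|c - x| < 4 * r by rewrite distrC; have := sqd_norm _ xt; have := ler_distD q x c; lra.
rewrite fE; last by rewrite -ball_normE.
by rewrite /u0 /patch mem_set//; apply: cU; rewrite ballE; lra.
Qed.

Let S x := \sum_i wd0 D u i x ^+ 2.

Let wtM f : wint (wt a) f -> wint (wt 0) (fun x => f x * wt a x) /\ \I_0[x] f x * wt a x = wI (wt a) f.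
Proof.
have E0 x : f x * wt a x * wt 0 x = f x * wt a x by have [hx|hx] := pselect (hp x); [rewrite wt0_hp// mulr1|rewrite !wt_out// !mulr0].
move=> wf; split; last by apply: eq_Rintegral => x _.
by move: wf; congr (_.-integrable _ _); apply/funext => x; rewrite E0.
Qed.

Lemma wint_energy_ball c r : 0 < r -> wint (wt a) (fun x => S x * \1_(ball c r) x).
Proof.
move=> r0; apply: (wint_le hw _ _ wint_energy) => [|x].
  apply: mbfunM; last by apply: measurable_indic; exact: measurable_ball_rV.
  by apply: mbfun_sum => i; apply: mbfunX; exact: l2_mfun (l2_wd0 a01 oD umin i).
have S0 : 0 <= S x by apply: sumr_ge0 => i _; pos.
by rewrite normrM ger0_norm// indicE; case: (x \in _); rewrite ?normr1 ?mulr1// normr0 mulr0.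
Qed.

(** Young's inequality turns the L^1 bound of [Sf_oscillation] into the weighted energy of the ball,
    on which x_n >= r. The summand 1 is the contribution of the volume of the ball. *)
Lemma oscillation_energy : exists2 C, 0 <= C & forall c c' r r', 0 < r -> ball c (8 * r) `<=` U ->
  `|c' - c| <= r -> r / 2 <= r' <= r -> `|Sf 0 u0 c' r' - Sf 0 u0 c r| <=
  C * (r `^ s * (r ^- m * \I_a[x] S x * \1_(ball c (4 * r)) x + 1)).
Proof.
have [C C0 HC] := @Sf_oscillation R m; pose K := dim * 8 ^+ (m + 1); have K1 : 1 <= K.
  by rewrite /K -[leLHS]mulr1; apply: ler_pM => //; [rewrite ler1n addn1|apply: exprn_ege1; lra].
exists (C * K) => [|c c' r r' r0 cU cc rr]; first by rewrite mulr_ge0//; lra.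
have [f [G [[bf fE c6 xB] [lG GE dG]]]] := interior_patch r0 cU.
set B : set E := ball c (4 * r); have r4 : 0 < 4 * r by rewrite mulr_gt0.
have SfE q t : `|q - c| <= r -> 0 < t <= r -> Sf 0 u0 q t = Sf 0 f q t by move=> qc tr; congr (_ * _); apply: wI_ext => x; apply/esym/(patch_psi _ fE).
have /andP[r1 r2] := rr; have cr : 4 * r <= xn c by lra.
rewrite !SfE ?subrr ?normr0 ?lexx ?(ltW r0) ?r0 ?andbT//; last by lra.
have lG0 i : l2 (wt 0) (G i).
  split; first exact: l2_mfun (lG i).
  have [w1 _] := wtM (lG i).2; apply: (wint_le hw0 _ _ (wintZ (r `^ (- a)) w1)) => [|x].
    exact: mbfunX (l2_mfun (lG i)).
  rewrite ger0_norm ?sqr_ge0//; have [xb|xb] := pselect (B x); last by rewrite (GE i x).2// expr0n/= mul0r mulr0.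
  have x0 : 0 < xn x by apply: lt_le_trans (xB _ xb).
  rewrite mulrCA -[leLHS]mulr1; apply: (ler_wpM2l (sqr_ge0 _)).
  rewrite wtE// powRN mulrC ler_pdivlMr ?powR_gt0// mul1r.
  by apply: ge0_ler_powR; rewrite ?nnegrE ?(ltW r0) ?(ltW x0) ?xB.
apply: le_trans (HC _ _ _ _ _ _ r0 cr bf dG lG0 (fun i x xb => (GE i x).2 xb) cc rr) _.
rewrite -mulrA; apply: (ler_wpM2l C0).
have wS := wint_energy_ball c r4; have [w1 wE] := wtM wS.
have b1 := bmfun_indic_ball c r4; have w2 := wint_bmfun hw0 b1.
have rm : 0 <= r ^- m by rewrite invr_ge0 exprn_ge0// ltW.
set J := wI (wt a) _ in wE *; set X := r `^ s.
have J0 : 0 <= J by apply: (wI_ge0 hw) => x; rewrite mulr_ge0// sumr_ge0// => i _; exact: sqr_ge0.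
have H : \I_0[x] (\sum_i `|G i x|) <= X * J + dim * r `^ (- s - a) * wI (wt 0) \1_B.
  rewrite -wE -!wIZ// -wID; [|exact: wintZ|exact: wintZ].
  apply: wI_le => //; [|by apply: wintD => //; exact: wintZ|move=> x].
    apply: wint_sum => i; apply: wint_abs => //.
    apply: wint_ext (wint_mul hw0 (lG0 i) (l2_bmfun hw0 b1)) => x; rewrite indicE.
    by have [xb|xb] := pselect (B x); [rewrite mem_set// mulr1|rewrite (GE i x).2// mul0r].
  rewrite indicE; have [xb|xb] := pselect (B x); last first.
    by rewrite memNset// !mulr0 mul0r mulr0 addr0 big1// => i _; rewrite (GE i x).2// normr0.
  rewrite mem_set// !mulr1; apply: (@le_trans _ _ (\sum_i (X * (G i x ^+ 2 * wt a x) + r `^ (- s - a)))).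
    by apply: ler_sum => i _; apply: amgm_weight => //; exact: xB.
  rewrite big_split /= -mulr_sumr -mulr_suml sumr_const card_ord mulr_natl lerD2r.
  rewrite (_ : \sum_i _ = S x)//; apply: eq_bigr => i _; by rewrite (GE i x).1.
have HB : wI (wt 0) \1_B = (8 * r) ^+ (m + 1).
  rewrite -wI_one_hp; last by move=> x hx; rewrite indicE memNset// => /xB; move: hx; rewrite /hp /=; lra.
  by rewrite wI_ball//; congr (_ ^+ _); ring.
have XE : r ^- m * (r `^ (- s - a) * (8 * r) ^+ (m + 1)) = 8 ^+ (m + 1) * X.
  have -> : X = r `^ (- s - a) * r.
    rewrite -[X in _ * X](powRr1 (ltW r0)) -powRD ?(gt_eqF r0) ?implybT//; congr (_ `^ _).
    by rewrite /s; field.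
  by rewrite exprMn [r ^+ (m + 1)]exprD expr1; field; rewrite expf_neq0// gt_eqF.
apply: le_trans (ler_wpM2l rm H) _; rewrite HB mulrDr.
rewrite (_ : r ^- m * (dim * _ * _) = K * X); last by rewrite /K -[RHS]mulrA -XE; ring.
have X0 : 0 <= X by exact: powR_ge0.
rewrite [leRHS](_ : _ = K * (r ^- m * (X * J)) + K * X); last by ring.
by rewrite lerD2r; apply: ler_peMl K1; do 2 apply: mulr_ge0 => //; exact: powR_ge0.
Qed.

(** By continuity at the flat point [u] has the sign of u(p) and at least half its size on a ball
    far enough down the chain, so the mean over that ball already bounds |u(p)|; no limit of means
    is taken. *)
Lemma trace_le_average : exists2 K, 0 <= K & forall p C (g : nat -> E) (r : nat -> R), flat' D p ->
  (forall k, 0 < r k) -> r @ \oo --> (0 : R) -> 0 <= C ->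
  (forall k, ball (g k) (8 * r k) `<=` U /\ `|g k - emb p| <= C * r k) ->
  exists k, `|u (emb p)| <= K * `|Sf 0 u0 (g k) (r k)|.
Proof.
have [c c0 Hc] := @mass_lb R m 0 (lexx 0); set e2 := expR (- 2) : R.
have e20 : 0 < e2 by exact: expR_gt0.
exists (2 / (e2 * c)) => [|p C g r Dp r0 rl C0 H]; first by rewrite divr_ge0// mulr_ge0// ltW.
have [up|up] := eqVneq (u (emb p)) 0.
  by exists 0%N; rewrite up normr0 mulr_ge0// divr_ge0// mulr_ge0// ltW.
pose e := `|u (emb p)| / 2; have e0 : 0 < e by rewrite divr_gt0// normr_gt0.
have ep : 0 <= xn (emb p : E) by rewrite xn_emb.
have [d d0 Hd] := u_within oD ucont Dp ep e0.
have C1 : 0 < C + 1 by [].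
have /cvgrPdist_lt/(_ _ (divr_gt0 d0 C1))[k _ /(_ k (leqnn k))] := rl.
rewrite sub0r normrN gtr0_norm// ltr_pdivlMr// => kd; exists k.
move: (r k) (g k) (r0 k) (H k) kd => {r g r0 rl H} r g r0 [gU gp] kd.
have [f [G [[bf fE g6 _] _]]] := interior_patch r0 gU.
have rr : 0 < r <= r by rewrite r0 lexx.
have gg : `|g - g| <= r by rewrite subrr normr0 ltW.
pose sg := Num.sg (u (emb p)).
have sgu : sg * u (emb p) = `|u (emb p)| by rewrite -normrEsg.
have sg1 : `|sg| = 1 by rewrite normr_sg up.
have near x : sqd g x <= r ^+ 2 -> e <= sg * u0 x.
  move=> /(sqd_norm (ltW r0)) xg; have Ux : U x.
    by apply: gU; rewrite ballEC; lra.
  have [||_ xu] := Hd x; last 2 first.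
  - by case: Ux => _ /ltW.
  - rewrite /u0 /patch mem_set//; move: xu.
    rewrite -[`|u x - _|]mul1r -sg1 -normrM mulrBr sgu ler_norml => /andP[+ _].
    by rewrite /e; lra.
  by have := ler_distD g x (emb p); lra.
have wP : wint (wt 0) (fun x => u0 x * psi g r x) by apply: wint_ext (wint_psi (lexx 0) g bf r0) => x; exact: (patch_psi x fE gU gg rr).
have M0 : e * e2 * c * r `^ (Nw m 0) <= \I_0[x] sg * (u0 x * psi g r x).
  apply: (Hc) => //; first lra.
  - exact: wintZ.
  - move=> x; have [/near h|/ltW h] := leP (sqd g x) (r ^+ 2); last by rewrite psi_out// !mulr0.
    by rewrite mulrA mulr_ge0 ?psi_ge0//; lra.
  - move=> x _ h; rewrite mulrA; apply: ler_pM; rewrite ?(ltW e0) ?(ltW e20) ?psi_lb//.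
    by apply: near; apply: le_trans h _; have := sqr_ge0 r; lra.
have Nr := powR_gt0 (Nw m 0) r0.
rewrite wIZ// in M0.
have : e * e2 * c <= `|Sf 0 u0 g r|.
  rewrite -(ler_pM2r Nr); apply: le_trans M0 _; rewrite /Sf normrM powRN ger0_norm//.
  rewrite mulrAC mulVf ?gt_eqF// mul1r; apply: le_trans (ler_norm _) _.
  by rewrite normrM sg1 mul1r.
move=> h; have ec : 0 < e2 * c by [].
by rewrite mulrAC ler_pdivlMr//; move: h; rewrite /e; lra.
Qed.

(** |u(p)| is at most a constant plus the telescoped oscillations along the chain to [p]. The k-th
    oscillation is bounded by r_k^s times one plus the normalized energy in a cylinder over [p];
    integration over [p] by Tonelli leaves a geometric series times the total energy. *)
Lemma flat_trace_integrable : bounded_set D -> bilipschitz_to_ball D ->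
  (leb m).-integrable (flat' D) (fun y : 'rV[R]_m => (u (emb y))%:E).
Proof.
move=> bD [Phi [L [L0 PhiL PhiD Phif]]]; have oF := open_flat' oD; have mF := measurable_open oF.
have [[p0 Dp0]|F0] := pselect (flat' D !=set0); last first.
  by rewrite (_ : flat' D = set0); [exact: integrable_set0|rewrite -subset0 => p Dp; apply: F0; exists p].
have [r0 [eta [C [c0 [r00 /andP[e1 e2] C0 chain]]]]] := whitney_chain oD L0 PhiL PhiD Phif Dp0.
have [K K0 HK] := trace_le_average; have [C1 C10 HC1] := oscillation_energy.
have et0 : 0 < eta by lra.
pose r (k : nat) := r0 * eta ^+ k; have rp k : 0 < r k by rewrite mulr_gt0 ?exprn_gt0.
have rl : r @ \oo --> (0 : R) by rewrite -[X in _ --> X](mulr0 r0); apply: cvgMr; apply: cvg_expr; rewrite ger0_norm// ltW.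
have q1 : eta `^ s < 1.
  have p1 : 1 `^ s = 1 :> R by rewrite powR1.
  by rewrite -[ltRHS]p1 gt0_ltr_powR// ?nnegrE// ltW.
pose q := eta `^ s; have q0 : 0 <= q by exact: powR_ge0.
have bE k : r k `^ s = r0 `^ s * q ^+ k.
  rewrite (powRM _ (ltW r00) (exprn_ge0 k (ltW et0))); congr (_ _).
  by rewrite -(powR_mulrn k (ltW et0)) -(powR_mulrn k q0) -!powRrM mulrC.
pose S0 := r0 `^ s / (1 - q).
have q1' : 0 < 1 - q by rewrite subr_gt0.
have bS n : \sum_(0 <= k < n) r k `^ s <= S0.
  under eq_bigr do rewrite bE.
  have := geometric_seriesE (r0 `^ s) (negbT (lt_eqF q1)); rewrite /series /= => /(congr1 (fun h => h n)) /= ->.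
  rewrite ler_wpM2r// -[leRHS]mulr1; apply: ler_wpM2l => //.
  by rewrite gerBl exprn_ge0.
pose rho k := (C + 4) * r k; have rh k : 0 < rho k by rewrite mulr_gt0//; lra.
have mS := wint_energy; pose F := energy_density.
have mEF : mbfun F.
  apply: mbfunM => //.
  by apply: mbfun_sum => i; apply: mbfunX; exact: l2_mfun (l2_wd0 a01 oD umin i).
have F00 x : 0 <= F x.
  rewrite mulr_ge0; by case: hw.
pose h k p := ((r k `^ s * r k ^- m)%:E * cylinder_integral F (rho k) p)%E.
have h0 k p : (0 <= h k p)%E.
  rewrite mule_ge0 ?lee_fin ?mulr_ge0 ?invr_ge0 ?exprn_ge0 ?(ltW (rp k))//.
  by apply: integral_ge0 => x _; rewrite lee_fin mulr_ge0// indicE.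
pose A := K * (`|Sf 0 u0 c0 r0| + C1 * S0); have S00 : 0 <= S0 by rewrite divr_ge0 ?powR_ge0// ltW.
have A0 : 0 <= A by rewrite mulr_ge0// addr_ge0 mulr_ge0.
have ub p : flat' D p -> (`|u (emb p)|%:E <= A%:E + (K * C1)%:E * \sum_(k <oo) h k p)%E.
  move=> Dp; have [g [g0 gP]] := chain p Dp.
  have [|k Hk] := HK p C g r Dp rp rl C0; first by move=> k; have [] := gP k.
  have step j : (`|Sf 0 u0 (g j.+1) (r j.+1) - Sf 0 u0 (g j) (r j)|%:E <= C1%:E * (h j p + (r j `^ s)%:E))%E.
    have [gU gg gp] := gP j.
    have rj : r j / 2 <= r j.+1 <= r j.
      rewrite /r exprS; have := exprn_gt0 j et0; move: (eta ^+ j) => t t0.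
      have := mulr_gt0 r00 t0; set v := r0 * t => v0; rewrite (_ : r0 * (eta * t) = eta * v); last by rewrite /v; ring.
      by apply/andP; split; nra.
    have := HC1 _ _ _ _ (rp j) gU gg rj; rewrite -lee_fin => /le_trans; apply.
    rewrite EFinM lee_wpmul2l ?lee_fin// mulrDr mulr1 EFinD leeD2r// mulrA EFinM.
    rewrite lee_wpmul2l ?lee_fin ?mulr_ge0 ?invr_ge0 ?exprn_ge0 ?(ltW (rp j))//.
    have w := wint_energy_ball (g j) (mulr_gt0 (ltr0Sn R 3) (rp j)).
    rewrite fineK; last exact: integrable_fin_num w.
    have [mc _ _] := cylinder_tonelli mEF F00 (rh j).
    apply: ge0_le_integral => //; [|by case/integrableP: w|move=> x _].
      move=> x; rewrite lee_fin !mulr_ge0 ?indicE//; last by case: hw.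
      by apply: sumr_ge0 => i _; exact: sqr_ge0.
    rewrite mulrAC; apply: ler_wpM2l; first exact: F00.
    rewrite !indicE; case: (boolP (x \in _)) => //= /set_mem xb; rewrite mem_set//.
    move: xb; rewrite !ballE => xb.
    have : `|x - emb p| < rho j.
      rewrite distrC in xb; have := ler_distD (g j) x (emb p); rewrite /rho mulrDl; move: gp; rewrite -/(r j); lra.
    apply: le_lt_trans; apply: rV_norm_le => // i.
    have -> : (lsubmx x - p) ord0 i = (x - emb p) ord0 (lshift 1 i) by rewrite !mxE (unsplitK (inl i)).
    exact: rV_norm_coord.
  have tel n : (`|Sf 0 u0 (g n) (r n)|%:E <= `|Sf 0 u0 c0 r0|%:E + C1%:E * (\sum_(0 <= j < n) h j p + (\sum_(0 <= j < n) r j `^ s)%:E))%E.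
    elim: n => [|n IH].
      by rewrite !big_geq// adde0 mule0 adde0 g0 /r expr0 mulr1.
    rewrite !big_nat_recr//= EFinD addeACA ge0_muleDr; last 2 first.
    - by rewrite adde_ge0 ?sume_ge0 ?lee_fin ?sumr_ge0// => j _; exact: powR_ge0.
    - by rewrite adde_ge0 ?lee_fin ?powR_ge0.
    rewrite addeA; apply: le_trans (leeD IH (step n)); rewrite -EFinD lee_fin.
    by rewrite -lerBlDl; apply: lerB_dist.
  apply: (@le_trans _ _ (K%:E * `|Sf 0 u0 (g k) (r k)|%:E)%E) => //.
  rewrite EFinM EFinM -muleA -ge0_muleDr ?lee_fin; last 2 first.
  - by rewrite addr_ge0// mulr_ge0.
  - by rewrite mule_ge0 ?lee_fin//; exact: nneseries_ge0.
  rewrite lee_wpmul2l ?lee_fin//; apply: le_trans (tel k) _.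
  rewrite EFinD -addeA leeD2l// EFinM -ge0_muleDr ?lee_fin//; last exact: nneseries_ge0.
  rewrite lee_wpmul2l ?lee_fin// addeC leeD ?lee_fin//.
  by apply: nneseries_lim_ge => j _.
have mh k : measurable_fun [set: 'rV[R]_m] (h k) by have [_ mc _] := cylinder_tonelli mEF F00 (rh k); apply: emeasurable_funM => //; exact: measurable_cst.
pose IF := wI (wt a) S.
have sum_fin : (\int[leb m]_p (\sum_(k <oo) h k p) < +oo)%E.
  rewrite integral_nneseries//.
  have IFE : (\int[leb _]_x (F x)%:E)%E = IF%:E by rewrite /IF /wI /Rintegral fineK//; exact: integrable_fin_num mS.
  have e k : (\int[leb m]_p h k p)%E = (r k `^ s * ((2 * (C + 4)) ^+ m * IF))%:E.
    have [_ mc ec] := cylinder_tonelli mEF F00 (rh k).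
    rewrite ge0_integralZl//; last 2 first.
    - by move=> p _; apply: integral_ge0 => x _; rewrite lee_fin mulr_ge0// indicE.
    - by rewrite lee_fin mulr_ge0 ?powR_ge0// invr_ge0 exprn_ge0// ltW.
    rewrite ec IFE -!EFinM; congr EFin.
    rewrite (_ : rho k *+ 2 = 2 * (C + 4) * r k); last by rewrite /rho mulr2n; ring.
    have := expf_neq0 m (lt0r_neq0 (rp k)); rewrite (exprMn m (2 * _)).
    by move: (r k `^ s) (k ^+ m) (_ ^+ m) => x y z y0; field.
  under eq_eseriesr do rewrite e.
  have IF0 : 0 <= (2 * (C + 4)) ^+ m * IF.
    rewrite mulr_ge0 ?exprn_ge0//.
    by apply: (wI_ge0 hw) => x; apply: sumr_ge0 => i _; exact: sqr_ge0.
  apply: (@le_lt_trans _ _ (S0 * ((2 * (C + 4)) ^+ m * IF))%:E); last exact: ltry.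
  apply: lime_le; first by apply: is_cvg_nneseries => k _ _; rewrite lee_fin mulr_ge0 ?powR_ge0.
  by apply: nearW => n; rewrite sumEFin lee_fin -mulr_suml ler_wpM2r.
have finF : (leb m (flat' D) < +oo)%E.
  have [M [_ HM]] := bD; pose N := Num.max M 0 + 1.
  have MN : M < N by rewrite ltr_pwDr// le_max lexx.
  have N0 : 0 < N by rewrite ltr_pwDr// le_max lexx orbT.
  apply: (@le_lt_trans _ _ (leb m (ball (0 : 'rV[R]_m) (N + 1)))).
    apply: le_measure; rewrite ?inE//.
    move=> p /(HM _ MN) pN; rewrite ballE sub0r normrN.
    apply: (@le_lt_trans _ _ N); last by rewrite ltrDl.
    apply: rV_norm_le => //.
    by move=> i; apply: le_trans pN; have := rV_norm_coord (emb p : E) (lshift 1 i); rewrite row_mxEl.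
  by rewrite [X in (X < _)%E](_ : _ = (((N + 1) *+ 2) ^+ m)%:E); [exact: ltry|apply: leb_ball; lra].
have mu0 : measurable_fun (flat' D) (fun y : 'rV[R]_m => u (emb y)).
  apply: measurable_fun_continuous => // y Dy; apply/(@cvgrPdist_le _ _ _ (nbhs y)) => e e0.
  have y0 : 0 <= xn (emb y : E) by rewrite xn_emb.
  have [d d0 Hd] := u_within oD ucont Dy y0 e0.
  apply/nbhs_ballP; exists d => //= k; rewrite ballEC => ky.
  have [||] := Hd (emb k); rewrite ?xn_emb 1?distrC//.
  by rewrite -embB; apply: le_lt_trans (norm_emb _) _; rewrite distrC.
apply/integrableP; split; first exact/measurable_EFinP.
have msum : measurable_fun [set: 'rV[R]_m] (fun p => \sum_(k <oo) h k p)%E by apply: ge0_emeasurable_sum => // k p _ _.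
apply: (@le_lt_trans _ _ (\int[leb m]_(p in flat' D) (A%:E + (K * C1)%:E * \sum_(k <oo) h k p))%E).
  apply: ge0_le_integral => //.
  - by apply: measurableT_comp => //; exact/measurable_EFinP.
  - apply: emeasurable_funD => //.
    by apply: emeasurable_funM; [exact: measurable_cst|exact: measurable_funS msum].
have KC : 0 <= K * C1 by [].
have s00 p : (0 <= \sum_(k <oo) h k p)%E by exact: nneseries_ge0.
rewrite ge0_integralD//; last 2 first.
- by move=> p; rewrite mule_ge0 ?lee_fin.
- by apply: emeasurable_funM; [exact: measurable_cst|exact: measurable_funS msum].
rewrite integral_cst// lte_add_pinfty//; first by rewrite lte_mul_pinfty ?lee_fin.
rewrite ge0_integralZl ?lee_fin//; last exact: measurable_funS msum.
rewrite lte_mul_pinfty ?lee_fin//; apply: le_lt_trans sum_fin.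
by apply: ge0_subset_integral.
Qed.

End flat_trace.

Theorem theorem1p3 (R : realType) (m : nat) (a lp lm : R)
  (D : set 'rV[R]_(m + 1)) (u : 'rV[R]_(m + 1) -> R)
  (a_range : -1 < a < 1) (lp_gt0 : 0 < lp) (lm_gt0 : 0 < lm)
  (D_domain : bounded_domain D) (D_regular : regular a D)
  (a_ge0 : 0 <= a)
  (u_min : minimizer a lp lm D u)
  (u_cont : {within upper D `|` flat D, continuous u}) :
  Gamma_pos D u `&` Gamma_neg D u = set0.
Proof.
have a01 : 0 <= a < 1 by rewrite a_ge0; case/andP: a_range.
have [oD _ _ bD] := D_domain.
(* If traces are assumed to exist, their integrability is part of the assumption and [trace_u]
   identifies them with the continuous values; in the other alternative the chart provides it. *)
have hflat : (leb m).-integrable (flat' D) (fun y => (u (emb y))%:E).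
  case: D_regular => [T|B]; last exact: (flat_trace_integrable a01 oD u_min u_cont bD B).
  have [_ int _] := T u u_min.1; apply: eq_integrable int => [|y /set_mem Dy].
    exact: measurable_open (open_flat' oD).
  by rewrite (trace_u oD u_min u_cont Dy) ?xn_emb.
rewrite -subset0 => y [[[yP _] yD] [[yN _] _]].
have [r [f [G [hf fE]]]] := minimizer_local_min a01 lp_gt0 lm_gt0 oD u_min u_cont yD hflat.
have near (P : R -> Prop) : closure [set x' | flat' D x' /\ P (u (emb x'))] y ->
    forall e, 0 < e -> exists2 k, `|k| <= e & P (f (emb y + emb k)).
  move=> cl e e0; have er : 0 < Num.min e r by rewrite lt_min e0 (lmin_r hf).
  have [x [[Dx Px]]] := cl _ (nbhsx_ballx y _ er).
  rewrite ballEC lt_min => /andP[xe xr].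
  by exists (x - y); [exact: ltW|rewrite (fE _ xr).2 addrC subrK].
have [p n] := (near (fun t => 0 < t) yP, near (fun t => t < 0) yN).
move: a_ge0; rewrite le_eqVlt => /orP[/eqP a0|a0]; last exact: no_touch_weighted hf a0 p n.
by rewrite -a0 in hf; exact: no_touch_unweighted hf p n.
Qed.
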